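(* Let $\varepsilon>0$ and $h_{\mathrm{ex}}>0$. Given any configuration $(\mathbf{u},\mathbf{A})\in H^1(\Omega,\mathbb{C})\times H^1(\Omega,\mathbb{R}^2)$, let $(u,A)$ be defined through the relation $(\mathbf{u},\mathbf{A})=(\rho_\varepsilon u,\;A+h_{\mathrm{ex}}A_\varepsilon^0)$. Then $$GL_\varepsilon(\mathbf{u},\mathbf{A})=GL_\varepsilon(\rho_\varepsilon,h_{\mathrm{ex}}A_\varepsilon^0)+F_{\varepsilon,\rho_\varepsilon}(u,A)-h_{\mathrm{ex}}\int_\Omega \mu(u,A)\,\xi_\varepsilon+R_0,$$ where $$R_0=\frac{h_{\mathrm{ex}}^2}{2}\int_\Omega\frac{|\nabla\xi_\varepsilon|^2}{\rho_\varepsilon^2}\left(|u|^2-1\right).$$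
   Context: $\Omega\subset\mathbb{R}^2$ is a smooth, bounded, simply connected domain; $b\in(0,1)$ is a constant independent of $\varepsilon$; for each $\varepsilon>0$, $a_\varepsilon\in L^\infty(\Omega)$ takes values in $[b,1]$; $h_{\mathrm{ex}}>0$ is a constant (the applied field). Notation: $\nabla_A u=\nabla u-iAu$; $\operatorname{curl}A=\partial_{x_1}A_2-\partial_{x_2}A_1$; $\nabla^\perp f=(-\partial_{x_2}f,\partial_{x_1}f)$; $\langle z,w\rangle=\frac{z\overline w+\overline z w}{2}$ is the real scalar product on $\mathbb{C}\cong\mathbb{R}^2$. Energies: with $h=\operatorname{curl}A$, $$GL_\varepsilon(u,A)=\frac12\int_\Omega|\nabla_Au|^2+\frac{(a_\varepsilon-|u|^2)^2}{2\varepsilon^2}+|h-h_{\mathrm{ex}}|^2,$$ and, for a weight $\eta_\varepsilon:\Omega\to\mathbb{R}$, $$F_{\varepsilon,\eta_\varepsilon}(u,A)=\frac12\int_\Omega\eta_\varepsilon^2|\nabla_Au|^2+\eta_\varepsilon^4\frac{(1-|u|^2)^2}{2\varepsilon^2}+|\operatorname{curl}A|^2.$$ Vorticity: $\mu(u,A)=\operatorname{curl}\langle iu,\nabla_Au\rangle+\operatorname{curl}A$, understood as a distribution acting on Lipschitz functions $\varphi$ vanishing on $\partial\Omega$ by $\int_\Omega\mu(u,A)\varphi=-\int_\Omega(\langle iu,\nabla_Au\rangle+A)\cdot\nabla^\perp\varphi$. $\rho_\varepsilon$ is the unique positive real-valued minimizer in $H^1(\Omega,\mathbb{C})$ of $E_\varepsilon(u)=\frac12\int_\Omega|\nabla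 u|^2+\frac{(a_\varepsilon-|u|^2)^2}{2\varepsilon^2}$; it satisfies $\sqrt b\le\rho_\varepsilon\le1$. $\xi_\varepsilon$ is the unique solution in $H^1_0(\Omega)$ of $-\operatorname{div}\left(\frac{\nabla\xi_\varepsilon}{\rho_\varepsilon^2}\right)+\xi_\varepsilon=1$ in $\Omega$, $\xi_\varepsilon=0$ on $\partial\Omega$. $A_\varepsilon^0=-\dfrac{\nabla^\perp\xi_\varepsilon}{\rho_\varepsilon^2}$. *)

(* Defs.v *)
From HB Require Import structures.
From mathcomp Require Import all_boot all_order all_algebra.
From mathcomp Require Import all_classical all_reals all_analysis.
From mathcomp Require Import complex.

Set Implicit Arguments.
Unset Strict Implicit.
Unset Printing Implicit Defensive.

Import Order.TTheory GRing.Theory Num.Theory.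
Import numFieldNormedType.Exports.

Local Open Scope classical_set_scope.
Local Open Scope ring_scope.
Local Open Scope complex_scope.

Section PlaneDomains.
Context {R : realType}.
Local Notation plane := (R * R)%type.
Implicit Types Omega : set plane.

Definition lebesgue2 :
    {measure set (measurableTypeR R * measurableTypeR R)%type -> \bar R} :=
  (@lebesgue_measure R \x @lebesgue_measure R)%E.

(* C^oo: all iterated directional derivatives exist and are continuous. *)
Definition smooth {V : normedModType R} (f : V -> R) : Prop :=
  forall vs : seq V,
    let g := foldr (fun v k => 'D_v k) f vs in
    continuous g /\ forall x v, derivable g x v.

(* [axis_coords s n x] is the point x after the relabeling (s) and
   reorientation (n) of the axes: a pair (tangential, normal) coordinate. *)
Definition axis_coords (s n : bool) (x : plane) : plane :=
  let y := if s then (x.2, x.1) else x in (y.1, (-1) ^+ n * y.2).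

(* The boundary is locally the graph of a smooth function, with Omega on one
   side of it, up to relabeling and reorienting the coordinate axes. *)
Definition smooth_boundary Omega : Prop :=
  forall p, closure Omega p -> ~ Omega p ->
  exists (r : R) (gamma : R -> R) (s n : bool),
    [/\ 0 < r, smooth gamma &
        forall x, ball p r x ->
          (Omega x <->
           gamma (axis_coords s n x).1 < (axis_coords s n x).2)].

Definition simply_connected Omega : Prop :=
  connected Omega /\
  forall gamma : R -> plane,
    {within `[0, 1]%classic, continuous gamma} ->
    gamma @` `[0, 1]%classic `<=` Omega -> gamma 0 = gamma 1 ->
    exists H : plane -> plane,
      [/\ {within `[0, 1]%classic `*` `[0, 1]%classic, continuous H},
          H @` (`[0, 1]%classic `*` `[0, 1]%classic) `<=` Omega,
          forall s, `[0, 1]%classic s -> H (s, 0) = gamma s,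
          forall t, `[0, 1]%classic t -> H (0, t) = H (1, t) &
          forall s, `[0, 1]%classic s -> H (s, 1) = H (0, 1)].

Definition smooth_bounded_simply_connected_domain Omega : Prop :=
  [/\ open Omega, Omega !=set0, bounded_set Omega,
      smooth_boundary Omega & simply_connected Omega].

End PlaneDomains.

(* Elements of Lebesgue and Sobolev spaces over Omega are represented by total
   functions on the plane, whose values outside Omega are irrelevant. *)
Section Sobolev.
Context {R : realType}.
Local Notation plane := (R * R)%type.
Local Notation mu := (@lebesgue2 R).
Implicit Types (Omega : set plane) (f g : plane -> R).

Definition test_function Omega (phi : plane -> R) : Prop :=
  smooth phi /\
  exists K : set plane,
    [/\ compact K, K `<=` Omega & forall x, ~ K x -> phi x = 0].

Definition loc_integrable Omega f : Prop :=
  measurable_fun Omega f /\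
  forall K : set plane, compact K -> K `<=` Omega ->
    mu.-integrable K (EFin \o f).

Definition L2 Omega f : Prop :=
  measurable_fun Omega f /\
  mu.-integrable Omega (fun x => (f x ^+ 2)%:E).

Definition weak_derivative Omega (v : plane) f g : Prop :=
  [/\ loc_integrable Omega f, loc_integrable Omega g &
      forall phi, test_function Omega phi ->
        (\int[mu]_(x in Omega) (f x * 'D_v phi x) =
         - \int[mu]_(x in Omega) (g x * phi x))%R].

(* A chosen weak derivative (unique almost everywhere when it exists). *)
Definition weakD Omega (v : plane) f : plane -> R :=
  xget (cst 0) [set g | weak_derivative Omega v f g].

Definition e1 : plane := (1, 0).
Definition e2 : plane := (0, 1).

Definition dot (v w : plane) : R := v.1 * w.1 + v.2 * w.2.
Definition perp (v : plane) : plane := (- v.2, v.1).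

Definition wgrad Omega f (x : plane) : plane :=
  (weakD Omega e1 f x, weakD Omega e2 f x).

Definition H1 Omega f : Prop :=
  L2 Omega f /\
  forall v, v = e1 \/ v = e2 ->
    exists2 g, weak_derivative Omega v f g & L2 Omega g.

Definition H1_sqnorm Omega f : \bar R :=
  (\int[mu]_(x in Omega)
     (f x ^+ 2 + dot (wgrad Omega f x) (wgrad Omega f x))%:E)%E.

Definition H10 Omega f : Prop :=
  H1 Omega f /\
  exists phi : nat -> plane -> R,
    (forall n, test_function Omega (phi n)) /\
    H1_sqnorm Omega (fun x => phi n x - f x) @[n --> \oo] --> 0%E.

Definition H1C Omega (u : plane -> R[i]) : Prop :=
  H1 Omega (fun x => complex.Re (u x)) /\ H1 Omega (fun x => complex.Im (u x)).

Definition H1V Omega (A : plane -> plane) : Prop :=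
  H1 Omega (fun x => (A x).1) /\ H1 Omega (fun x => (A x).2).

(* h is the distributional curl d_1 A_2 - d_2 A_1: moving both derivatives onto
   phi turns it into - A . perp (grad phi). *)
Definition weak_curl Omega (A : plane -> plane) (h : plane -> R) : Prop :=
  [/\ loc_integrable Omega (fun x => (A x).1),
      loc_integrable Omega (fun x => (A x).2),
      loc_integrable Omega h &
      forall phi, test_function Omega phi ->
        (\int[mu]_(x in Omega) dot (A x) (perp ('D_e1 phi x, 'D_e2 phi x)) =
         - \int[mu]_(x in Omega) (h x * phi x))%R].

Definition curl Omega (A : plane -> plane) : plane -> R :=
  xget (cst 0) [set h | weak_curl Omega A h].

End Sobolev.

Section GinzburgLandau.
Context {R : realType}.
Local Notation plane := (R * R)%type.
Local Notation mu := (@lebesgue2 R).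
Implicit Types (Omega : set plane) (u : plane -> R[i]) (A : plane -> plane).

Local Notation "`| z |_C" := (ComplexField.Normc.normc z)
  (at level 0, format "`| z |_C").

Definition cdot (z w : R[i]) : R := complex.Re ((z * w^*%C + z^*%C * w) / 2%:R).

Definition weakDC Omega (v : plane) u (x : plane) : R[i] :=
  weakD Omega v (fun y => complex.Re (u y)) x +i*
  weakD Omega v (fun y => complex.Im (u y)) x.

Definition covgrad Omega A u (x : plane) : R[i] * R[i] :=
  (weakDC Omega e1 u x - 'i%C * (A x).1%:C * u x,
   weakDC Omega e2 u x - 'i%C * (A x).2%:C * u x).

Definition sqnorm_covgrad Omega A u (x : plane) : R :=
  `|(covgrad Omega A u x).1|_C ^+ 2 + `|(covgrad Omega A u x).2|_C ^+ 2.

Definition GL Omega (eps hex : R) (a : plane -> R) u A : \bar R :=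
  ((2^-1)%:E * \int[mu]_(x in Omega)
     (sqnorm_covgrad Omega A u x
      + (a x - `|u x|_C ^+ 2) ^+ 2 / (2 * eps ^+ 2)
      + `|curl Omega A x - hex| ^+ 2)%:E)%E.

Definition F Omega (eps : R) (eta : plane -> R) u A : \bar R :=
  ((2^-1)%:E * \int[mu]_(x in Omega)
     (eta x ^+ 2 * sqnorm_covgrad Omega A u x
      + eta x ^+ 4 * ((1 - `|u x|_C ^+ 2) ^+ 2 / (2 * eps ^+ 2))
      + `|curl Omega A x| ^+ 2)%:E)%E.

Definition E Omega (eps : R) (a : plane -> R) u : \bar R :=
  ((2^-1)%:E * \int[mu]_(x in Omega)
     (`|weakDC Omega e1 u x|_C ^+ 2 + `|weakDC Omega e2 u x|_C ^+ 2
      + (a x - `|u x|_C ^+ 2) ^+ 2 / (2 * eps ^+ 2))%:E)%E.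

Definition supercurrent Omega u A (x : plane) : plane :=
  (cdot ('i%C * u x) (covgrad Omega A u x).1,
   cdot ('i%C * u x) (covgrad Omega A u x).2).

(* mu(u, A) = curl (<iu, nabla_A u> + A), a distribution, tested against phi. *)
Definition vorticity Omega u A (phi : plane -> R) : \bar R :=
  (- \int[mu]_(x in Omega)
       (dot (supercurrent Omega u A x + A x) (perp (wgrad Omega phi x)))%:E)%E.

Definition positive_minimizer Omega (eps : R) (a rho : plane -> R) : Prop :=
  [/\ H1C Omega (fun x => (rho x)%:C),
      {ae mu, forall x, Omega x -> 0 < rho x} &
      forall v, H1C Omega v ->
        (E Omega eps a (fun x => (rho x)%:C) <= E Omega eps a v)%E].

(* Weak form of - div (grad xi / rho^2) + xi = 1 in Omega; the boundary
   condition is membership in H^1_0. *)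
Definition xi_solution Omega (rho xi : plane -> R) : Prop :=
  H10 Omega xi /\
  forall phi, test_function Omega phi ->
    (\int[mu]_(x in Omega)
       (dot (wgrad Omega xi x) ('D_e1 phi x, 'D_e2 phi x) / rho x ^+ 2
        + xi x * phi x) =
     \int[mu]_(x in Omega) phi x)%R.

Definition A0 Omega (rho xi : plane -> R) (x : plane) : plane :=
  - ((rho x ^+ 2)^-1 *: perp (wgrad Omega xi x)).

Definition R0 Omega (hex : R) (rho xi : plane -> R) u : \bar R :=
  ((hex ^+ 2 / 2)%:E * \int[mu]_(x in Omega)
     (dot (wgrad Omega xi x) (wgrad Omega xi x) / rho x ^+ 2
      * (`|u x|_C ^+ 2 - 1))%:E)%E.

End GinzburgLandau.

(* Main.v *)
(** Write u = v1 + i v2 and A' for A_eps^0 = (q2, - q1), q = grad xi / rho^2.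
    Expanding the squares, the density of the left-hand side minus that of the
    right-hand side is, almost everywhere, the Euler-Lagrange density of rho
    tested with rho (|u|^2 - 1), minus 2 hex (xi curl A + A . perp (grad xi)),
    since curl A' = 1 - xi. The second part integrates to zero because xi
    belongs to H^1_0. The first one does because rho is a minimizer, but only
    bounded test functions are immediately available: u is truncated and the
    truncation removed by dominated convergence.

    All integrals converge, and u is in H^1, without any elliptic regularity:
    H^1 embeds into L^4 (a Gagliardo inequality along two directions pointing
    into the domain), and the Caccioppoli inequalities for rho and xi give
    f |grad rho| and f |grad xi| in L^2 for every f in H^1. *)

From HB Require Import structures.
Require Import Defs.
From mathcomp Require Import all_boot all_order all_algebra.
From mathcomp Require Import all_classical all_reals all_analysis.
From mathcomp Require Import complex.
From mathcomp Require Import measurable_realfun ring lra.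

Set Implicit Arguments.
Unset Strict Implicit.
Unset Printing Implicit Defensive.

Import Order.TTheory GRing.Theory Num.Theory.
Import numFieldNormedType.Exports.

Local Open Scope classical_set_scope.
Local Open Scope ring_scope.

(** * Continuity of translations in L^1 *)

(** The difficulty is the low regularity of the data. The functions rho and xi are only in H^1 and
    [A0] only in L^2, so [A] has a curl merely as a distribution, and u = bu / rho is not obviously
    in H^1, its gradient containing u grad rho. Testing the equation of rho with rho psi^2 bounds
    the integral of psi^2 |grad rho|^2 by the H^1 norm of psi, which is what the division needs. The
    exponent 4 comes from the quartic potential and from the product of a vector potential in H^1
    with u.

    The two cancellations treat the boundary differently. The variations of rho are free there, so
    rho (|u|^2 - 1) is admissible without zero trace. In the curl term it is xi that has zero trace,
    so no boundary value of [A] appears.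

    Products, truncations, inverses and comparison functions in H^1 are all built from explicit
    piecewise quadratic functions of one variable. Real-valued integrals carry information only for
    integrable functions, hence every identity is preceded by the integrability of its terms. *)

Lemma cvge0_exists_le (R : realType) (u : nat -> \bar R) (e : R) :
  u n @[n --> \oo] --> 0%E -> 0 < e -> exists n, (u n <= e%:E)%E.
Proof.
move=> /fine_cvgP[fn /cvgrPdist_le/= H1] e0.
have [N _ HN] := filterI fn (H1 _ e0).
have /= [fin le] := HN N (leqnn N).
exists N; rewrite -(fineK fin) lee_fin.
by apply: le_trans le; rewrite sub0r normrN ler_norm.
Qed.

Section L1Norm.
Context d (T : measurableType d) (R : realType).
Variable mu : {measure set T -> \bar R}.
Implicit Types f g : T -> R.
Local Open Scope ereal_scope.

(** Extended-valued, so that the triangle inequality needs measurability only. *)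
Definition L1norm f : \bar R := \int[mu]_x `|f x|%:E.

Lemma L1norm_ge0 f : 0 <= L1norm f.
Proof. by apply: integral_ge0 => x _; rewrite lee_fin. Qed.

Lemma L1normD f g : measurable_fun setT f -> measurable_fun setT g ->
  L1norm (f \+ g)%R <= L1norm f + L1norm g.
Proof.
move=> mf mg; rewrite /L1norm -ge0_integralD//; last 2 first.
- by apply/measurable_EFinP; exact: measurableT_comp.
- by apply/measurable_EFinP; exact: measurableT_comp.
apply: ge0_le_integral => //.
- by apply/measurable_EFinP; apply: measurableT_comp => //; exact: measurable_funD.
- by apply: emeasurable_funD; apply/measurable_EFinP; exact: measurableT_comp.
- by move=> x _; rewrite -EFinD lee_fin ler_normD.
Qed.

Lemma L1normZ f (k : R) : measurable_fun setT f -> L1norm (fun x => k * f x)%R = `|k|%:E * L1norm f.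
Proof.
move=> mf; rewrite /L1norm -ge0_integralZl//; last first.
  by apply/measurable_EFinP; exact: measurableT_comp.
by apply: eq_integral => x _; rewrite normrM EFinM.
Qed.

End L1Norm.

Section TranslCont.
Context d (T : measurableType d) (R : realType).
Variable mu : {measure set T -> \bar R}.
Context (H : Type) (F : set_system H) {FF : Filter F} (tau : H -> T -> T).
Hypothesis mtau : forall h, measurable_fun setT (tau h).
Hypothesis tauE : forall h A, measurable A -> mu (tau h @^-1` A) = mu A.
Implicit Types f g : T -> R.
Local Open Scope ereal_scope.

(** The maps [tau h] form an abstract measure-preserving family, so that one argument serves the
    translations of the line and those of the plane. *)
Definition transl_cont f := forall e : R, (0 < e)%R ->
  \forall h \near F, L1norm mu (fun x => f (tau h x) - f x)%R <= e%:E.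

Lemma L1norm_comp f h : measurable_fun setT f -> L1norm mu (f \o tau h) = L1norm mu f.
Proof.
move=> mf; rewrite /L1norm.
have -> : \int[mu]_x `|(f \o tau h) x|%:E =
    \int[mu]_(x in tau h @^-1` setT) (((fun y => `|f y|%:E) \o tau h) x).
  by rewrite preimage_setT.
rewrite -ge0_integral_pushforward//; last first.
  by apply/measurable_EFinP; exact: measurableT_comp.
by apply: eq_measure_integral => A mA _; exact: tauE.
Qed.

(** The three-epsilon argument: (f - g) composed with [tau h] has the same norm as f - g, because
    [tau h] preserves the measure. *)
Lemma transl_cont_lim f : measurable_fun setT f ->
  (forall e : R, (0 < e)%R -> exists g, [/\ measurable_fun setT g, transl_cont g &
    L1norm mu (f \- g)%R <= e%:E]) -> transl_cont f.
Proof.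
move=> mf fg e e0.
have e3 : (0 < e / 3)%R by rewrite divr_gt0.
have [g [mg tg Nfg]] := fg _ e3.
have := tg _ e3; apply: filterS => h Hh.
have mft : measurable_fun setT (f \o tau h) by exact: measurableT_comp.
have mgt : measurable_fun setT (g \o tau h) by exact: measurableT_comp.
have -> : (fun x => f (tau h x) - f x)%R =
  ((((f \- g) \o tau h) \+ (fun x => g (tau h x) - g x)) \+ (g \- f))%R.
  by apply/funext => x /=; ring.
have mgf : measurable_fun setT (g \- f)%R by exact: measurable_funB.
have mfg : measurable_fun setT (f \- g)%R by exact: measurable_funB.
have mgg : measurable_fun setT (fun x => g (tau h x) - g x)%R by exact: measurable_funB.
apply: le_trans (L1normD _ _ _) _ => //.
  by apply: measurable_funD => //; exact: measurableT_comp.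
apply: (le_trans (leeD2r _ (L1normD _ _ _))) => //; first exact: measurableT_comp.
rewrite L1norm_comp//.
have -> : L1norm mu (g \- f)%R = L1norm mu (f \- g)%R.
  by apply: eq_integral => x _; rewrite distrC.
rewrite (_ : e = e/3 + e/3 + e/3)%R; last by field.
by rewrite !EFinD; apply: leeD => //; apply: leeD.
Qed.

Lemma transl_contD f g : measurable_fun setT f -> measurable_fun setT g ->
  transl_cont f -> transl_cont g -> transl_cont (f \+ g)%R.
Proof.
move=> mf mg tf tg e e0.
have e2 : (0 < e / 2)%R by rewrite divr_gt0.
near=> h.
have -> : (fun x => (f \+ g) (tau h x) - (f \+ g) x)%R =
  ((fun x => f (tau h x) - f x) \+ (fun x => g (tau h x) - g x))%R.
  by apply/funext => x /=; ring.
apply: le_trans (L1normD _ _ _) _ => //.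
- by apply: measurable_funB => //; exact: (measurableT_comp mf (mtau h)).
- by apply: measurable_funB => //; exact: (measurableT_comp mg (mtau h)).
by rewrite [e]splitr EFinD; apply: leeD; near: h; [exact: tf|exact: tg].
Unshelve. all: by end_near. Qed.

Lemma transl_contZ f (k : R) : measurable_fun setT f -> transl_cont f -> transl_cont (fun x => k * f x)%R.
Proof.
move=> mf tf e e0.
have e2 : (0 < e / (`|k| + 1))%R by rewrite divr_gt0// ltr_wpDl.
have := tf _ e2; apply: filterS => h Hh.
have -> : (fun x => k * f (tau h x) - k * f x)%R =
  (fun x => k * (f (tau h x) - f x))%R.
  by apply/funext => x /=; ring.
rewrite L1normZ//; last first.
  by apply: measurable_funB => //; exact: (measurableT_comp mf (mtau h)).
apply: (le_trans (lee_wpmul2l _ Hh)); first by rewrite lee_fin.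
rewrite -EFinM lee_fin mulrA ler_pdivrMr ?ltr_wpDl//.
by rewrite mulrC ler_wpM2l ?lerDl// ltW.
Qed.

Lemma transl_cont0 : transl_cont (fun _ => 0)%R.
Proof.
move=> e e0; near=> h; rewrite /L1norm.
under eq_integral do rewrite subrr normr0.
by rewrite integral0 lee_fin ltW.
Unshelve. all: by end_near. Qed.

Variables (G : set (set T)) (Q : set T).
Hypothesis GE : @measurable _ T = <<s G >>.
Hypothesis GI : setI_closed G.
Hypothesis mQ : measurable Q.
Hypothesis Qfin : mu Q < +oo.
Hypothesis TCQ : transl_cont (\1_Q : T -> R).
Hypothesis TCG : forall S, G S -> transl_cont (\1_(S `&` Q) : T -> R).

(** Dynkin's pi-lambda theorem: the good sets form a lambda-system containing the pi-system [G].
    Intersecting with [Q], of finite measure, provides the dominating function [\1_Q] for countable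
    disjoint unions. *)
Lemma transl_cont_indic S : measurable S -> transl_cont (\1_(S `&` Q) : T -> R).
Proof.
rewrite GE; move: S.
apply: (@dynkin_induction _ _ G (fun S => transl_cont (\1_(S `&` Q) : T -> R)) GE GI); rewrite ?setTI//.
- move=> {}S mS tS.
  have -> : \1_(~` S `&` Q) = (\1_Q \+ (fun x => (-1) * \1_(S `&` Q) x))%R :> (T -> R).
    apply/funext => x /=; rewrite !indicI/= !indicE in_setC.
    by case: (x \in S); case: (x \in Q) => /=; ring.
  apply: transl_contD => //; last first.
    by apply: transl_contZ => //; apply: measurable_indic; exact: measurableI.
  by apply: measurable_funM => //; apply: measurable_indic; exact: measurableI.
- move=> B mB tB TB.
  have mU n : measurable (\bigcup_(k < n) B k).
    by apply: bigcup_measurable => k _.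
  have TU n : transl_cont (\1_((\bigcup_(k < n) B k) `&` Q) : T -> R).
    elim: n => [|n IH].
      rewrite (_ : \1_ _ = fun=> 0%R); first exact: transl_cont0.
      by rewrite bigcup_mkord big_ord0 set0I; apply/funext => x; rewrite indicE in_set0.
    have -> : \1_((\bigcup_(k < n.+1) B k) `&` Q) =
       (\1_((\bigcup_(k < n) B k) `&` Q) \+ \1_(B n `&` Q))%R :> (T -> R).
      apply/funext => x /=; rewrite !indicI/= !indicE.
      rewrite !bigcup_mkord big_ord_recr/= -bigcup_mkord in_setU.
      have : ~ (x \in \bigcup_(k < n) B k /\ x \in B n).
        rewrite !inE => -[[k /= kn Bk] Bn].
        have kn' : k = n by apply: (tB k n) => //; exists x.
        by rewrite kn' ltnn in kn.
      case: (x \in \bigcup_(k < n) B k); case: (x \in B n); case: (x \in Q) => //= H0; try (by exfalso; apply: H0); ring.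
    by apply: transl_contD => //; apply: measurable_indic; exact: measurableI.
  have mUB : measurable (\bigcup_k B k) by exact: bigcup_measurable.
  apply: transl_cont_lim => [|e e0]; first by apply: measurable_indic; exact: measurableI.
  have [] := @dominated_convergence _ _ _ mu setT measurableT
    (fun n x => (\1_((\bigcup_(k < n) B k) `&` Q) x : R)%:E)
    (fun x => (\1_((\bigcup_k B k) `&` Q) x : R)%:E) (fun x => (\1_Q x : R)%:E).
  + by move=> n; apply/measurable_EFinP; apply: measurable_indic; exact: measurableI.
  + by apply/measurable_EFinP; apply: measurable_indic; exact: measurableI.
  + apply: aeW => x _.
    have [[k _ Bkx]|nB] := pselect ((\bigcup_k B k) x).
      apply: (@cvg_near_cst) => //; exists k.+1 => // n /= kn.
      congr EFin; rewrite !indicI/= !indicE; congr (_%:R * _)%R.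
      by rewrite !mem_set//; exists k.
    have -> : (fun n => (\1_((\bigcup_(k < n) B k) `&` Q) x : R)%:E) = fun=> (\1_((\bigcup_k B k) `&` Q) x)%:E.
      apply/funext => n; congr EFin; rewrite !indicI/= !indicE; congr (_%:R * _)%R.
      by rewrite !memNset//; apply: contra_not nB => -[k _ ?]; exists k.
    exact: cvg_cst.
  + by apply/integrableP; split; [exact/measurable_EFinP|rewrite (eq_integral (fun x => (\1_Q x)%:E)) ?integral_indic ?setIT// => x _; rewrite gee0_abs// lee_fin].
  + apply: aeW => x n _; rewrite lee_fin !indicI/= !indicE.
    by case: (_ \in _); case: (_ \in _) => /=; rewrite ?(mul0r,mulr0,mulr1,normr0,normr1).
  move=> _ /= /cvge0_exists_le/(_ e0)[N le] _.
  exists (\1_((\bigcup_(k < N) B k) `&` Q)); split => //.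
    by apply: measurable_indic; exact: measurableI.
  apply: le_trans le; apply: ge0_le_integral => //.
  + apply/measurable_EFinP; apply: measurableT_comp => //.
    by apply: measurable_funB; apply: measurable_indic; exact: measurableI.
  + apply/measurable_EFinP; apply: measurableT_comp => //.
    by apply: (@measurable_funB _ _ _ _ (\1_((\bigcup_(k < N) B k) `&` Q)) (\1_((\bigcup_k B k) `&` Q)));
      apply: measurable_indic; exact: measurableI.
  + by move=> x _; rewrite lee_fin distrC.
Qed.

Import HBSimple.

Lemma transl_cont_sfun (f : {sfun T >-> R}) : transl_cont (fun x => f x * \1_Q x)%R.
Proof.
have -> : (fun x => f x * \1_Q x)%R =
  (fun x => \sum_(r <- finmap.enum_fset (fset_set (range f))) (r * \1_((f @^-1` [set r]) `&` Q) x))%R.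
  apply/funext => x; rewrite {1}fimfunE fsbig_finite//= mulr_suml.
  by apply: eq_bigr => r _; rewrite indicI/= mulrA.
elim: (finmap.enum_fset _) => [|r s IH].
  by under eq_fun do rewrite big_nil; exact: transl_cont0.
under eq_fun do rewrite big_cons.
have mi : measurable_fun setT (\1_((f @^-1` [set r]) `&` Q) : T -> R).
  by apply: measurable_indic; apply: measurableI.
apply: transl_contD => //.
- exact: measurable_funM.
- apply: measurable_sum => i; apply: measurable_funM => //.
  by apply: measurable_indic; apply: measurableI.
- by apply: transl_contZ => //; apply: transl_cont_indic.
Qed.

End TranslCont.

Section TranslContIntegrable.
Context d (T : measurableType d) (R : realType).
Variable mu : {measure set T -> \bar R}.
Context (H : Type) (F : set_system H) {FF : Filter F} (tau : H -> T -> T).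
Hypothesis mtau : forall h, measurable_fun setT (tau h).
Hypothesis tauE : forall h A, measurable A -> mu (tau h @^-1` A) = mu A.
Variables (G : set (set T)) (Q : nat -> set T).
Hypothesis GE : @measurable _ T = <<s G >>.
Hypothesis GI : setI_closed G.
Hypothesis mQ : forall n, measurable (Q n).
Hypothesis Qfin : forall n, (mu (Q n) < +oo)%E.
Hypothesis QT : forall x, \forall n \near \oo, Q n x.
Hypothesis TCQ : forall n, transl_cont mu F tau (\1_(Q n) : T -> R).
Hypothesis TCG : forall n S, G S -> transl_cont mu F tau (\1_(S `&` Q n) : T -> R).

Import HBSimple.

(** Two nested L^1 approximations: [f] by its restrictions to the exhausting sets [Q n], then each
    restriction by simple functions, whose level sets fall under [transl_cont_indic]. *)
Lemma transl_cont_integrable (f : T -> R) : mu.-integrable setT (EFin \o f) -> transl_cont mu F tau f.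
Proof.
move=> intf.
have mf : measurable_fun setT f by apply/measurable_EFinP; exact: (measurable_int mu).
have mi n : measurable_fun setT (\1_(Q n) : T -> R) by exact: measurable_indic.
have mfi n : measurable_fun setT (fun x => f x * \1_(Q n) x) by exact: measurable_funM.
apply: transl_cont_lim => // e e0.
have [] := @dominated_convergence _ _ _ mu setT measurableT
    (fun n x => (f x * \1_(Q n) x)%:E) (EFin \o f) (fun x => `|f x|%:E).
- by move=> n; exact/measurable_EFinP.
- exact/measurable_EFinP.
- apply: aeW => x _; apply: (@cvg_near_cst).
  by have := QT x; apply: filterS => n Qx; rewrite indicE mem_set// mulr1.
- exact: integrable_norm.
- apply: aeW => x n _; rewrite lee_fin normrM indicE.
  by case: (_ \in _); rewrite ?(normr1,mulr1,normr0,mulr0).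
move=> _ /= /cvge0_exists_le/(_ e0)[n le] _.
exists (fun x => f x * \1_(Q n) x); split => //; last first.
  apply: le_trans le; apply: ge0_le_integral => //.
  - by apply/measurable_EFinP; apply: measurableT_comp => //; exact: measurable_funB.
  - by apply/measurable_EFinP; apply: measurableT_comp => //; exact: measurable_funB.
  - by move=> x _; rewrite lee_fin distrC.
apply: transl_cont_lim => // r r0.
have [g_ [ig _ /cvge0_exists_le/(_ r0)[k le']]] := approximation_sfun_integrable measurableT intf.
exists (fun x => g_ k x * \1_(Q n) x); split => //.
- exact: measurable_funM.
- apply: (@transl_cont_sfun _ _ _ _ _ _ _ _ mtau _ _ _ GE GI (mQ n) _ _ _ (g_ k)).
  + exact: tauE.
  + exact: Qfin.
  + exact: TCQ.
  + exact: TCG.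
- apply: le_trans le'; apply: ge0_le_integral => //.
  + by apply/measurable_EFinP; apply: measurableT_comp => //; apply: measurable_funB => //; exact: measurable_funM.
  + by apply: measurableT_comp => //; apply/measurable_EFinP; exact: measurable_funB.
  + move=> x _; rewrite lee_fin /= -mulrBl normrM indicE.
    by case: (_ \in _); rewrite ?(normr1,mulr1,normr0,mulr0).
Qed.

End TranslContIntegrable.

Section Translation.
Context {R : realType}.
Local Notation plane := (R * R)%type.
Local Notation mu2 := (@lebesgue2 R).
Local Notation leb := (@lebesgue_measure R).

Lemma lebesgue_measure_shift (h : R) (A : set R) : measurable A ->
  leb ((fun x : measurableTypeR R => (x + h : measurableTypeR R)) @^-1` A) = leb A.
Proof.
have mh : measurable_fun [set: measurableTypeR R]
    (fun x : measurableTypeR R => (x + h : measurableTypeR R)).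
  exact: measurable_funD.
move=> mA.
have lu := @lebesgue_measure_unique R (pushforward leb (fun x : measurableTypeR R => (x + h : measurableTypeR R))).
apply/esym; apply: (lu mh) => // X [[a b]] _ <-.
transitivity (leb `]a - h, b - h]%classic); last first.
  rewrite /pushforward; congr (leb _).
  by apply/seteqP; split => x /=; rewrite !in_itv/= ltrBlDr lerBrDr.
rewrite !lebesgue_measure_itv/= !lte_fin ltrD2r; case: ifP => // _.
by rewrite -!EFinB; congr EFin; ring.
Qed.

Lemma leb_itvcc (a b : R) : a <= b -> leb `[a, b]%classic = (b - a)%:E.
Proof.
move=> ab; rewrite lebesgue_measure_itv/= lte_fin.
by case: ltgtP ab => // -> _; rewrite subrr.
Qed.

Lemma leb_itvoc (a b : R) : a <= b -> leb `]a, b]%classic = (b - a)%:E.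
Proof.
move=> ab; rewrite lebesgue_measure_itv/= lte_fin.
by case: ltgtP ab => // -> _; rewrite subrr.
Qed.

Lemma lebesgue2_rect (A B : set (measurableTypeR R)) : measurable A -> measurable B ->
  mu2 (A `*` B) = (leb A * leb B)%E.
Proof. by move=> mA mB; exact: product_measure1E. Qed.

Lemma measurable_fun_shift (h : plane) :
  measurable_fun [set: plane] (fun x : plane => x + h).
Proof.
apply/measurable_fun_pairP; split.
- exact: (@measurable_funD _ _ _ _ (fst : plane -> R) (cst h.1)).
- exact: (@measurable_funD _ _ _ _ (snd : plane -> R) (cst h.2)).
Qed.

Lemma lebesgue2_shift (h : plane) (A : set plane) : measurable A ->
  mu2 ((fun x : plane => x + h) @^-1` A) = mu2 A.
Proof.
move=> mA.
rewrite -[LHS]/(pushforward mu2 (fun x : plane => x + h) A).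
apply/esym; have mh : measurable_fun [set: measurableTypeR R * measurableTypeR R]
  (fun x : measurableTypeR R * measurableTypeR R => (x.1 + h.1, x.2 + h.2) : measurableTypeR R * measurableTypeR R).
  exact: (measurable_fun_shift h).
have lu := @product_measure_unique _ _ _ _ R leb leb
  (pushforward mu2 (fun x : measurableTypeR R * measurableTypeR R => (x.1 + h.1, x.2 + h.2) : measurableTypeR R * measurableTypeR R)).
apply: (lu mh) => // B C mB mC; 
transitivity (mu2 (((fun x : measurableTypeR R => (x + h.1 : measurableTypeR R)) @^-1` B) `*`
    ((fun x : measurableTypeR R => (x + h.2 : measurableTypeR R)) @^-1` C))).
  by congr (mu2 _); apply/seteqP; split => -[x y] /=.
rewrite lebesgue2_rect ?lebesgue_measure_shift//.
- rewrite -[X in measurable X]setTI.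
  have mh1 : measurable_fun [set: measurableTypeR R] (fun x : measurableTypeR R => (x + h.1 : measurableTypeR R)).
    exact: measurable_funD.
  exact: mh1.
- rewrite -[X in measurable X]setTI.
  have mh1 : measurable_fun [set: measurableTypeR R] (fun x : measurableTypeR R => (x + h.2 : measurableTypeR R)).
    exact: measurable_funD.
  exact: mh1.
Qed.

Lemma lebesgue2_swap (A : set plane) : measurable A ->
  mu2 ((fun x : plane => (x.2, x.1)) @^-1` A) = mu2 A.
Proof.
move=> mA; apply/esym.
have mh : measurable_fun [set: measurableTypeR R * measurableTypeR R]
  (fun x : measurableTypeR R * measurableTypeR R => (x.2, x.1) : measurableTypeR R * measurableTypeR R).
  exact: measurable_swap.
have lu := @product_measure_unique _ _ _ _ R leb leb
  (pushforward mu2 (fun x : measurableTypeR R * measurableTypeR R => (x.2, x.1) : measurableTypeR R * measurableTypeR R)).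
apply: (lu mh) => // B C mB mC; 
transitivity (mu2 (C `*` B)).
  by congr (mu2 _); apply/seteqP; split => -[x y] /= [].
by rewrite lebesgue2_rect// muleC.
Qed.

(** A point farther than |h| from both ends lies on the same side of each of them as its
    translate. *)
Lemma itvoc_shift_le (a b h x : R) :
  (`|(a < x + h <= b)%R%:R - (a < x <= b)%R%:R| <=
   (a - `|h| <= x <= a + `|h|)%R%:R + (b - `|h| <= x <= b + `|h|)%R%:R :> R)%R.
Proof.
have hn : (- h <= `|h|)%R by rewrite -normrN ler_norm.
have hp := ler_norm h.
have d1 (u v : bool) : (`|u%:R - v%:R| <= 1 :> R)%R.
  by case: u v => -[]; rewrite ?subrr ?subr0 ?sub0r ?normrN ?normr0 ?normr1.
have [_|/negP na] := boolP (a - `|h| <= x <= a + `|h|)%R.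
  by apply: (le_trans (d1 _ _)); rewrite lerDl ler0n.
have [_|/negP nb] := boolP (b - `|h| <= x <= b + `|h|)%R.
  by apply: (le_trans (d1 _ _)); rewrite lerDr ler0n.
have -> : (a < x + h)%R = (a < x)%R.
  by apply/idP/idP => ?; rewrite ltNge; apply/negP => ?; apply: na; apply/andP; split; lra.
have -> : (x + h <= b)%R = (x <= b)%R.
  by apply/idP/idP => ?; rewrite leNgt; apply/negP => ?; apply: nb; apply/andP; split; lra.
by rewrite subrr normr0 addr0.
Qed.

Lemma itvoc_setI (a b c e : R) :
  `]a, b]%classic `&` `]c, e]%classic = `](Num.max a c), (Num.min b e)]%classic.
Proof.
apply/seteqP; split => x /=; rewrite !in_itv/= gt_max le_min.
  by move=> [/andP[-> ->] /andP[-> ->]].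
by move=> /andP[/andP[-> ->] /andP[-> ->]].
Qed.

Local Open Scope ereal_scope.

Lemma transl_cont_dominated d (T : measurableType d) (mu : {measure set T -> \bar R})
   (H : Type) (F : set_system H) {FF : Filter F} (tau : H -> T -> T)
   (f : T -> R) (k : R) (nrm : H -> R) :
   (forall e, (0 < e)%R -> \forall h \near F, (0 <= nrm h < e)%R) ->
   (\forall h \near F, L1norm mu (fun x => f (tau h x) - f x)%R <= (k * nrm h)%:E) -> transl_cont mu F tau f.
Proof.
move=> nrm0 Hf e e0.
have e1 : (0 < e / (`|k| + 1))%R by rewrite divr_gt0// ltr_wpDl.
near=> h.
have le : L1norm mu (fun x => f (tau h x) - f x)%R <= (k * nrm h)%:E by near: h.
have /andP[n0 n1] : (0 <= nrm h < e / (`|k| + 1))%R by near: h; exact: nrm0.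
apply: (le_trans le); rewrite lee_fin.
have k1 : (0 < `|k| + 1)%R by rewrite ltr_wpDl.
move: n1; rewrite ltr_pdivlMr// => n1; apply: le_trans (ltW n1).
rewrite mulrC; apply: ler_wpM2l => //.
by apply: le_trans (ler_norm k) _; rewrite lerDl.
Unshelve. all: by end_near. Qed.

(** The constant 4 is the total length, in units of |h|, of the two intervals of radius |h| around
    the end points. *)
Lemma L1norm_itv_shift (a b h : R) : (`|h| <= 1)%R ->
  L1norm leb (fun x : R => \1_(`]a, b]%classic) (x + h)%R - \1_(`]a, b]%classic) x)%R
   <= (4 * `|h|)%:E.
Proof.
move=> h1.
pose I1 := `[(a - `|h|)%R, (a + `|h|)%R]%classic.
pose I2 := `[(b - `|h|)%R, (b + `|h|)%R]%classic.
have h0 : (0 <= `|h|)%R by [].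
apply: (@le_trans _ _ (\int[leb]_x ((\1_I1 x)%:E + (\1_I2 x)%:E))).
  apply: ge0_le_integral => //=.
  - apply/measurable_EFinP; apply: measurableT_comp => //; apply: measurable_funB => //.
    have mh : measurable_fun [set: measurableTypeR R] (fun x : measurableTypeR R => (x + h : measurableTypeR R)%R).
      exact: measurable_funD.
    have mi : measurable_fun [set: measurableTypeR R] (\1_(`]a, b]%classic) : R -> R).
      exact: measurable_indic.
    exact: (measurableT_comp mi mh).
  - by apply: emeasurable_funD; apply/measurable_EFinP; apply: measurable_indic; exact: measurable_itv.
  - move=> x _; rewrite -EFinD lee_fin !indicE /I1 /I2.
    rewrite !mem_setE !in_itv/=; exact: itvoc_shift_le.
rewrite ge0_integralD//=; last 2 first.
- by apply/measurable_EFinP; apply: measurable_indic; exact: measurable_itv.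
- by apply/measurable_EFinP; apply: measurable_indic; exact: measurable_itv.
have E (c e : R) : (c <= e)%R -> \int[leb]_x (\1_(`[c, e]%classic) x)%:E = (e - c)%:E.
  move=> ce; etransitivity; first by apply: integral_indic => //; exact: measurable_itv.
  transitivity (leb `[c, e]%classic); last exact: leb_itvcc.
  by congr (_ _); exact: setIT.
rewrite /I1 /I2 !E; [|lra|lra].
by rewrite -EFinD lee_fin; lra.
Qed.

Lemma transl_cont_indic1 (S : set R) (M : R) : measurable S ->
  transl_cont leb (nbhs (0:R)%R) (fun h x : R => (x + h)%R : R) (\1_(S `&` `](- M)%R, M]%classic) : R -> R).
Proof.
have TCab (a b : R) : transl_cont leb (nbhs (0:R)%R) (fun h x : R => (x + h)%R : R) (\1_(`]a, b]%classic) : R -> R).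
  apply: (@transl_cont_dominated _ _ _ _ _ _ _ _ 4 (fun h => `|h|%R)).
  - move=> e e0; have := @nbhs0_lt R R e e0; apply: filterS => h; rewrite normr_ge0.
    by move=> ->.
  - by have := @nbhs0_le R R 1%R ltr01; apply: filterS => h; exact: L1norm_itv_shift.
move=> mS; apply: (@transl_cont_indic _ _ _ _ _ _ _ (fun h (x : measurableTypeR R) => (x + h)%R : measurableTypeR R) _ _ (@ocitv R)) => //.
- by move=> h; exact: measurable_funD.
- by move=> h A mA0; exact: lebesgue_measure_shift.
- by move=> A B [[a b]] _ <- [[c e]] _ <-; rewrite itvoc_setI; exists (Num.max a c, Num.min b e).
- have [M0|M0] := leP 0%R M; first by rewrite [X in (X < _)%E](leb_itvoc _) ?ltry//; lra.
  rewrite (_ : `]_, _]%classic = set0) ?measure0//.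
  by apply/seteqP; split => x //=; rewrite in_itv/= => /andP[? ?]; lra.
- by move=> _ [[a b]] _ <-; rewrite /= itvoc_setI.
Qed.

Lemma L1norm_tensor (p q : R -> R) :
  measurable_fun [set: measurableTypeR R] (p : measurableTypeR R -> R) ->
  measurable_fun [set: measurableTypeR R] (q : measurableTypeR R -> R) ->
  L1norm mu2 (fun x => p x.1 * q x.2)%R = L1norm leb p * L1norm leb q.
Proof.
move=> mp mq; rewrite /L1norm /lebesgue2 fubini_tonelli1//=; last first.
  apply/measurable_EFinP; apply: measurableT_comp => //; apply: measurable_funM.
    exact: (measurableT_comp mp measurable_fst).
  exact: (measurableT_comp mq measurable_snd).
rewrite /fubini_F /=.
transitivity (\int[leb]_x (`|p x|%:E * \int[leb]_y `|q y|%:E)).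
  apply: eq_integral => x _; rewrite -ge0_integralZl//.
  - by apply: eq_integral => y _; rewrite normrM EFinM.
  - by apply/measurable_EFinP; exact: measurableT_comp.
rewrite ge0_integralZr//.
- by apply/measurable_EFinP; exact: measurableT_comp.
- by apply: integral_ge0 => y _; rewrite lee_fin.
Qed.

Lemma L1norm_indic (S : set (measurableTypeR R)) : measurable S ->
  L1norm leb (\1_S : R -> R) = leb S.
Proof.
move=> mS; rewrite /L1norm.
under eq_integral do rewrite ger0_norm ?indic_ge0//.
by rewrite integral_indic// setIT.
Qed.

(** The pi-system is that of measurable rectangles, for which the one-dimensional case applies in
    each coordinate; the squares [I n] exhaust the plane. *)
Lemma transl_cont_plane (f : plane -> R) : mu2.-integrable setT (EFin \o f) ->
  transl_cont mu2 (nbhs (0:plane)%R) (fun h x : plane => (x + h)%R) f.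
Proof.
pose I (n : nat) : set (measurableTypeR R) := `](- n%:R)%R, (n%:R : R)]%classic.
have mI n : measurable (I n) by exact: measurable_itv.
have finI n (A : set (measurableTypeR R)) : measurable A -> leb (A `&` I n) <= (2 * n%:R)%:E.
  move=> mA; apply: (@le_trans _ _ (leb (I n))).
    by apply: le_measure; rewrite ?inE//; exact: measurableI.
  by rewrite /I leb_itvoc ?lee_fin; have := ler0n R n; lra.
have TCr n (A B : set (measurableTypeR R)) : measurable A -> measurable B ->
   transl_cont mu2 (nbhs (0:plane)%R) (fun h x : plane => (x + h)%R)
     (\1_((A `*` B) `&` (I n `*` I n)) : plane -> R).
  move=> mA mB e e0.
  pose p : R -> R := \1_(A `&` I n); pose q : R -> R := \1_(B `&` I n).
  have mAI : measurable (A `&` I n) by exact: measurableI.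
  have mBI : measurable (B `&` I n) by exact: measurableI.
  have mp : measurable_fun [set: measurableTypeR R] (p : measurableTypeR R -> R) by exact: measurable_indic.
  have mq : measurable_fun [set: measurableTypeR R] (q : measurableTypeR R -> R) by exact: measurable_indic.
  have pqE : (\1_((A `*` B) `&` (I n `*` I n)) : plane -> R) = fun x => (p x.1 * q x.2)%R.
    by apply/funext => -[x y]; rewrite -setXI /p /q !indicE/= in_setX -natrM mulnb.
  (* The length 2n of [I n] bounds the norms of [p] and [q]; adding 1 keeps the bound positive when
     n = 0. *)
  pose k := (2 * n%:R + 1 : R)%R.
  have k0 : (0 < k)%R by rewrite /k ltr_wpDl// mulr_ge0.
  have e1 : (0 < e / 2 / k)%R by rewrite !divr_gt0.
  have ms (c : R) : measurable_fun [set: measurableTypeR R] (fun x : measurableTypeR R => (x + c)%R : measurableTypeR R).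
    exact: measurable_funD.
  have TCp := transl_cont_indic1 n%:R mA e1.
  have TCq := transl_cont_indic1 n%:R mB e1.
  have : \forall h \near nbhs (0 : plane)%R,
      L1norm leb (fun x : R => p (x + h.1) - p x)%R <= (e / 2 / k)%:E.
    exact: (@cvg_fst _ _ (nbhs (0:R)%R) (nbhs (0:R)%R) _ _ TCp).
  have : \forall h \near nbhs (0 : plane)%R,
      L1norm leb (fun x : R => q (x + h.2) - q x)%R <= (e / 2 / k)%:E.
    exact: (@cvg_snd _ _ (nbhs (0:R)%R) (nbhs (0:R)%R) _ _ TCq).
  apply: filterS2 => h Hq Hp.
  rewrite pqE /=.
  have mph : measurable_fun [set: measurableTypeR R] (fun x : measurableTypeR R => p (x + h.1) - p x)%R.
    by apply: measurable_funB => //; exact: (measurableT_comp mp (ms h.1)).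
  have mqt : measurable_fun [set: measurableTypeR R] (fun x : measurableTypeR R => q (x + h.2))%R.
    exact: (measurableT_comp mq (ms h.2)).
  have mqh : measurable_fun [set: measurableTypeR R] (fun x : measurableTypeR R => q (x + h.2) - q x)%R.
    by apply: measurable_funB.
  have mt (p1 q1 : R -> R) :
    measurable_fun [set: measurableTypeR R] (p1 : measurableTypeR R -> R) ->
    measurable_fun [set: measurableTypeR R] (q1 : measurableTypeR R -> R) ->
    measurable_fun [set: plane] (fun x : plane => p1 x.1 * q1 x.2)%R.
    move=> mp1 mq1; apply: measurable_funM.
      exact: (measurableT_comp mp1 measurable_fst).
    exact: (measurableT_comp mq1 measurable_snd).
  (* One coordinate is moved at a time, so that both terms are tensor products, whose norms
     factor. *)
  have -> : (fun x : plane => p (x.1 + h.1) * q (x.2 + h.2) - p x.1 * q x.2)%R =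
     ((fun x : plane => (p (x.1 + h.1) - p x.1) * q (x.2 + h.2)) \+
      (fun x : plane => p x.1 * (q (x.2 + h.2) - q x.2)))%R.
    by apply/funext => x /=; ring.
  apply: (@le_trans _ _ (L1norm mu2 (fun x : plane => (p (x.1 + h.1) - p x.1) * q (x.2 + h.2))%R +
      L1norm mu2 (fun x : plane => p x.1 * (q (x.2 + h.2) - q x.2))%R)).
    by apply: L1normD; [exact: (mt _ _ mph mqt)|exact: (mt _ _ mp mqh)].
  rewrite (L1norm_tensor mph mqt) (L1norm_tensor mp mqh).
  have Nq : L1norm leb (fun x : R => q (x + h.2))%R <= k%:E.
    have -> : L1norm leb (fun x : R => q (x + h.2))%R = L1norm leb q.
      apply: (@L1norm_comp _ _ _ leb _ (fun h (x : measurableTypeR R) => (x + h)%R : measurableTypeR R) _ _ q h.2) => //.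
      by move=> c S mS; exact: lebesgue_measure_shift.
    rewrite L1norm_indic//; apply: (le_trans (finI _ _ mB)).
    by rewrite lee_fin /k lerDl.
  have Np : L1norm leb p <= k%:E.
    rewrite L1norm_indic//; apply: (le_trans (finI _ _ mA)).
    by rewrite lee_fin /k lerDl.
  have -> : e%:E = (e / 2 / k)%:E * k%:E + k%:E * (e / 2 / k)%:E.
    by rewrite -!EFinM -EFinD; congr EFin; field; rewrite gt_eqF.
  by apply: leeD; apply: lee_pmul => //; exact: L1norm_ge0.
move=> intf.
apply: (@transl_cont_integrable _ _ _ mu2 _ _ _ (fun h x : plane => (x + h)%R) _ _
  [set A `*` B | A in measurable & B in measurable] (fun n => I n `*` I n)) => //.
- by move=> h; exact: measurable_fun_shift.
- by move=> h A mA; exact: lebesgue2_shift.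
- exact: measurable_prod_measurableType.
- move=> _ _ [A mA [B mB <-]] [C mC [D mD <-]].
  exists (A `&` C); first exact: measurableI.
  by exists (B `&` D); [exact: measurableI|rewrite setXI].
- by move=> n; exact: measurableX.
- move=> n; rewrite lebesgue2_rect//.
  have := finI n setT measurableT; rewrite setTI => h.
  by apply: lte_mul_pinfty; rewrite ?ge0_fin_numE// (le_lt_trans h) ?ltry.
- move=> [x y]; near=> n.
  have xn : (`|x| < n%:R)%R by near: n; exact: nbhs_infty_gtr.
  have yn : (`|y| < n%:R)%R by near: n; exact: nbhs_infty_gtr.
  by split; rewrite /I/= in_itv/=; apply/andP; move: xn yn; rewrite !ltr_norml => /andP[? ?] /andP[? ?]; split => //; exact: ltW.
- by move=> n; have := TCr n setT setT measurableT measurableT; rewrite setXTT setTI.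
- by move=> n _ [A mA [B mB <-]]; exact: TCr.
Unshelve. all: by end_near. Qed.

End Translation.

(** * Measure and integration on the plane *)

Section PlaneTopology.
Context {R : realType}.
Local Notation plane := (R * R)%type.
Local Notation mu2 := (@lebesgue2 R).

(** The plane carries the product sigma-algebra, so an open set has to be exhibited as a countable
    union of rational squares. Squares not contained in [U] are replaced by the empty set, which
    lets the union range over all rationals. *)
Lemma open_measurable2 (U : set plane) : open U -> measurable U.
Proof.
move=> oU.
pose B (q1 q2 r : rat) : set plane :=
  (ball (ratr q1 : R) (ratr r) : set (measurableTypeR R)) `*`
  (ball (ratr q2 : R) (ratr r) : set (measurableTypeR R)).
pose C (q1 q2 r : rat) : set plane := if `[< B q1 q2 r `<=` U >] then B q1 q2 r else set0.
have -> : U = \bigcup_q1 \bigcup_q2 \bigcup_r C q1 q2 r.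
  apply/seteqP; split => [[x y] Uxy|x]; last first.
    by move=> [q1 _ [q2 _ [r _]]]; rewrite /C; case: asboolP => // BU /BU.
  have /nbhs_ballP[e /= e0 eU] : nbhs (x, y) U by apply: open_nbhs_nbhs.
  (* Half the radius, because the rational centre is itself only within r of the point. *)
  have e2 : 0 < e / 2 by rewrite divr_gt0.
  have [r] := rat_in_itvoo e2; rewrite in_itv/= => /andP[r0 re].
  have [q1] : exists q, ratr q \in `](x - ratr r), (x + ratr r)[ by apply: rat_in_itvoo; lra.
  have [q2] : exists q, ratr q \in `](y - ratr r), (y + ratr r)[ by apply: rat_in_itvoo; lra.
  rewrite !in_itv/= => /andP[q21 q22] /andP[q11 q12].
  exists q1 => //; exists q2 => //; exists r => //; rewrite /C.
  case: asboolP => [_|nBU].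
    by split => /=; rewrite /ball/= ltr_norml; apply/andP; split; lra.
  exfalso; apply: nBU => -[a b] [] /=.
  rewrite /ball/= !ltr_norml => /andP[? ?] /andP[? ?].
  by apply: eU; split; rewrite /= /ball/= ltr_norml; apply/andP; split; lra.
apply: bigcupT_measurable_rat => q1; apply: bigcupT_measurable_rat => q2.
apply: bigcupT_measurable_rat => r; rewrite /C; case: asboolP => // _.
by apply: measurableX; exact: measurable_ball.
Qed.

Lemma closed_measurable2 (F : set plane) : closed F -> measurable F.
Proof. by rewrite -openC => /open_measurable2 mF; rewrite -(setCK F); exact: measurableC. Qed.

Lemma plane_hausdorff : hausdorff_space plane.
Proof. exact: norm_hausdorff. Qed.

Lemma compact_closed2 (K : set plane) : compact K -> closed K.
Proof. by apply: compact_closed; exact: plane_hausdorff. Qed.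

Lemma compact_measurable2 (K : set plane) : compact K -> measurable K.
Proof. by move=> /compact_closed2/closed_measurable2. Qed.

Lemma continuous_measurable2 (f : plane -> R) : continuous f -> measurable_fun setT f.
Proof.
move=> /continuousP cf; apply: (measurability _ (RGenOpens.measurableE R)).
move=> _ [_ [a [b ->] <-]]; rewrite setTI; apply: open_measurable2.
exact/cf/interval_open.
Qed.

Definition box (n : R) : set plane := `[(- n), n]%classic `*` `[(- n), n]%classic.

Lemma box_compact n : compact (box n).
Proof. by apply: compact_setX; exact: segment_compact. Qed.

Lemma measurable_box n : measurable (box n).
Proof. by apply: compact_measurable2; exact: box_compact. Qed.

Lemma box_fin n : (mu2 (box n) < +oo)%E.
Proof.
have [n0|n0] := leP 0 n; last first.
  rewrite (_ : box n = set0) ?measure0//.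
  by apply/seteqP; split => -[x y] //= [/=]; rewrite !in_itv/= => /andP[? ?]; lra.
rewrite lebesgue2_rect; [|exact: measurable_itv..].
by rewrite !leb_itvcc -?EFinM ?ltry//; lra.
Qed.

Lemma bounded_box (A : set plane) : bounded_set A -> exists2 n, 0 < n & A `<=` box n.
Proof.
move=> [M [_ HM]]; exists (`|M| + 1) => [|[x y] Axy]; first by rewrite ltr_wpDl.
have := HM (`|M| + 1); rewrite ltr_pwDr// ?ler_norm// => /(_ isT _ Axy).
rewrite /= prod_normE ge_max /= !ler_norml => /andP[/andP[? ?] /andP[? ?]].
by split; rewrite /= in_itv/=; apply/andP.
Qed.

Lemma bounded_fin (A : set plane) : measurable A -> bounded_set A -> (mu2 A < +oo)%E.
Proof.
move=> mA /bounded_box[n _ An]; apply: le_lt_trans (box_fin n).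
by apply: le_measure; rewrite ?inE//; exact: measurable_box.
Qed.

Lemma compact_fin (K : set plane) : compact K -> (mu2 K < +oo)%E.
Proof.
by move=> cK; apply: bounded_fin; [exact: compact_measurable2|exact: compact_bounded].
Qed.

End PlaneTopology.

Section SigmaFinite.
Context {R : realType}.
(** A copy of [lebesgue2] on which the sigma-finite structure is declared, as required by
    Fubini-Tonelli on a product of two planes. *)
Definition lebesgue2f : set (measurableTypeR R * measurableTypeR R)%type -> \bar R := @lebesgue2 R.
HB.instance Definition _ := Measure.copy lebesgue2f (@lebesgue2 R).
Lemma lebesgue2f_sigma_finite : sigma_finite setT lebesgue2f.
Proof.
exists (fun n => box n%:R).
  apply/esym; rewrite -subTset => -[x y] _.
  near \oo => n; exists n => //.
  have xn : `|x| < n%:R by near: n; exact: nbhs_infty_gtr.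
  have yn : `|y| < n%:R by near: n; exact: nbhs_infty_gtr.
  by split; rewrite /= in_itv/=; apply/andP; move: xn yn; rewrite !ltr_norml => /andP[? ?] /andP[? ?]; split; exact: ltW.
by move=> n; split; [exact: measurable_box|exact: box_fin].
Unshelve. all: by end_near. Qed.
HB.instance Definition _ := @Measure_isSigmaFinite.Build _ _ _ lebesgue2f lebesgue2f_sigma_finite.
Definition lebesgue2s : {sigma_finite_measure set (measurableTypeR R * measurableTypeR R)%type -> \bar R} := lebesgue2f.
End SigmaFinite.

(** * Real-valued integrals of integrable functions *)

Section Rintegral_toolkit.
Context d (T : measurableType d) (R : realType).
Variable mu : {measure set T -> \bar R}.
Variable D : set T.
Hypothesis mD : measurable D.
Implicit Types f g : T -> R.
Local Notation intg f := (mu.-integrable D (EFin \o f)).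
Local Notation I f := (\int[mu]_(x in D) f x).

Lemma intgP f : intg f <-> measurable_fun D f /\ (\int[mu]_(x in D) `|f x|%:E < +oo)%E.
Proof.
split => [/integrableP[mf fi]|[mf fi]]; first by split; [exact/measurable_EFinP|].
by apply/integrableP; split; [exact/measurable_EFinP|].
Qed.

Lemma intg_meas f : intg f -> measurable_fun D f.
Proof. by move=> /intgP[]. Qed.

Lemma eq_intg f g : {in D, f =1 g} -> intg f -> intg g.
Proof. by move=> fg; apply: eq_integrable => // x xD; rewrite /= fg. Qed.

Lemma intgD f g : intg f -> intg g -> intg (fun x => f x + g x).
Proof. by move=> fi gi; have := integrableD mD fi gi; apply: eq_integrable. Qed.

Lemma intgB f g : intg f -> intg g -> intg (fun x => f x - g x).
Proof. by move=> fi gi; have := integrableB mD fi gi; apply: eq_integrable. Qed.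

Lemma intgZ (k : R) f : intg f -> intg (fun x => k * f x).
Proof. by move=> fi; have := integrableZl mD k fi; apply: eq_integrable. Qed.

Lemma intgN f : intg f -> intg (fun x => - f x).
Proof. by move=> fi; have := integrableN fi; apply: eq_integrable. Qed.

Lemma intg_norm f : intg f -> intg (fun x => `|f x|).
Proof. exact: integrable_norm. Qed.

Lemma intg_le f g : measurable_fun D f -> {ae mu, forall x, D x -> `|f x| <= g x} ->
  intg g -> intg f.
Proof.
move=> mf fg gi; apply/intgP; split => //.
have /intgP[mg gfin] := gi.
apply: le_lt_trans gfin; apply: ae_ge0_le_integral => //.
- by apply/measurable_EFinP; exact: measurableT_comp.
- by apply/measurable_EFinP; exact: measurableT_comp.
- by apply: filterS fg => x fg Dx; rewrite lee_fin (le_trans (fg Dx))// ler_norm.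
Qed.

Lemma intg_cst (k : R) : (mu D < +oo)%E -> intg (fun=> k).
Proof.
move=> Dfin; apply/intgP; split => //.
rewrite integral_cst//; apply: lte_mul_pinfty => //.
Qed.

Lemma intg_ae f g : measurable_fun D g -> {ae mu, forall x, D x -> f x = g x} -> intg f -> intg g.
Proof.
move=> mg fg fi; apply: (intg_le mg) (intg_norm fi).
by apply: filterS fg => x fg Dx; rewrite fg.
Qed.

Lemma Rint_ae f g : measurable_fun D f -> measurable_fun D g ->
  {ae mu, forall x, D x -> f x = g x} -> I f = I g.
Proof.
move=> mf mg fg; congr fine; apply: ae_eq_integral => //; try exact/measurable_EFinP.
by apply: filterS fg => x fg Dx; rewrite fg.
Qed.

Lemma RintD f g : intg f -> intg g -> I (fun x => f x + g x) = I f + I g.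
Proof. exact: RintegralD. Qed.

Lemma RintB f g : intg f -> intg g -> I (fun x => f x - g x) = I f - I g.
Proof. exact: RintegralB. Qed.

Lemma RintZ (k : R) f : intg f -> I (fun x => k * f x) = k * I f.
Proof. exact: RintegralZl. Qed.

Lemma RintN f : intg f -> I (fun x => - f x) = - I f.
Proof.
move=> fi; rewrite -mulN1r -RintZ//; congr fine; apply: eq_integral => x _.
by rewrite mulN1r.
Qed.

Lemma Rint_EFin f : intg f -> (\int[mu]_(x in D) (f x)%:E)%E = (I f)%:E.
Proof. by move=> fi; rewrite /Rintegral fineK//; exact: integrable_fin_num. Qed.

(** The pointwise comparison is applied to min(f, g), which equals [f] almost everywhere. *)
Lemma Rint_le_ae f g : intg f -> intg g -> {ae mu, forall x, D x -> f x <= g x} -> I f <= I g.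
Proof.
move=> fi gi fg.
have h : I (fun x => Num.min (f x) (g x)) = I f.
  apply: Rint_ae; [|exact: intg_meas|].
    by apply: measurable_minr; exact: intg_meas.
  by apply: filterS fg => x fg Dx; rewrite min_l// fg.
rewrite -h; apply: le_Rintegral => //; last by move=> x _; rewrite ge_min lexx orbT.
apply: (@intg_le _ (fun x => `|f x| + `|g x|)).
- by apply: measurable_minr; exact: intg_meas.
- apply: aeW => x _; rewrite minEle; case: ifP => _; rewrite ?lerDl ?lerDr//.
- by apply: intgD; exact: intg_norm.
Qed.

Lemma Rint_ge0_ae f : intg f -> {ae mu, forall x, D x -> 0 <= f x} -> 0 <= I f.
Proof.
move=> fi f0; have := @Rint_le_ae (fun=> 0) f _ fi f0.
have -> : I (fun=> 0) = 0 by rewrite /Rintegral integral0.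
by apply; apply: (@intg_le _ f) => //; apply: filterS f0 => x f0 Dx; rewrite normr0 f0.
Qed.

Lemma Rint_norm_le f : intg f -> `|I f| <= I (fun x => `|f x|).
Proof. exact: le_normr_Rintegral. Qed.

Lemma Rint_dct (f_ : nat -> T -> R) f g : (forall n, measurable_fun D (f_ n)) ->
  measurable_fun D f ->
  {ae mu, forall x, D x -> f_ n x @[n --> \oo] --> f x} ->
  intg g -> {ae mu, forall x, D x -> forall n, `|f_ n x| <= g x} ->
  intg f /\ (I (f_ n) @[n --> \oo] --> I f).
Proof.
move=> mf_ mf cf gi fg.
have mf_E n : measurable_fun D (fun x => (f_ n x)%:E) by exact/measurable_EFinP.
have mfE : measurable_fun D (EFin \o f) by exact/measurable_EFinP.
have cfE : {ae mu, forall x, D x -> (f_ n x)%:E @[n --> \oo] --> (EFin \o f) x}.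
  apply: filterS cf => x cf Dx; apply: cvg_EFin; first exact: nearW.
  exact: cf.
have fgE : {ae mu, forall x n, D x -> (`|(f_ n x)%:E| <= (EFin \o g) x)%E}.
  by apply: filterS fg => x fg n Dx; rewrite lee_fin fg.
have [fi _ cI] := @dominated_convergence _ _ _ mu D mD _ _ _ mf_E mfE cfE gi fgE.
split => //; rewrite /Rintegral; apply: fine_cvg.
by rewrite -[X in _ --> X]/(I f)%:E -(Rint_EFin fi).
Qed.

Lemma intg_sqrM f g : measurable_fun D f -> measurable_fun D g ->
  intg (fun x => f x ^+ 2) -> intg (fun x => g x ^+ 2) -> intg (fun x => f x * g x).
Proof.
move=> mf mg fi gi; apply: (@intg_le _ (fun x => f x ^+ 2 + g x ^+ 2)).
- exact: measurable_funM.
- apply: aeW => x _; rewrite normrM -(real_normK (num_real (f x))) -(real_normK (num_real (g x))).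
  by have := sqr_ge0 (`|f x| - `|g x|); have := sqr_ge0 (`|f x| + `|g x|); nra.
- exact: intgD.
Qed.

Lemma intg_bndM f g (M : R) : measurable_fun D f -> {ae mu, forall x, D x -> `|f x| <= M} ->
  intg g -> intg (fun x => f x * g x).
Proof.
move=> mf fM gi; apply: (@intg_le _ (fun x => M * `|g x|)).
- by apply: measurable_funM => //; exact: intg_meas.
- by apply: filterS fM => x fM Dx; rewrite normrM ler_wpM2r// fM.
- by apply: intgZ; exact: intg_norm.
Qed.

End Rintegral_toolkit.

(** * Smooth functions and mollification *)

Section Smooth.
Context {R : realType} {V : normedModType R}.
Implicit Types f g : V -> R.

(** Iterated derivatives never leave a class stable under ['D_v], so continuity and derivability
    have to be checked only once, on the class. *)
Lemma smooth_ind (P : (V -> R) -> Prop) :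
  (forall f, P f -> continuous f) ->
  (forall f x v, P f -> derivable f x v) ->
  (forall f v, P f -> P ('D_v f)) ->
  forall f, P f -> smooth f.
Proof.
move=> Pc Pd PD f Pf vs /=.
have : P (foldr (fun v k => 'D_v k) f vs) by elim: vs => //= v vs; exact: PD.
by move=> Pg; split; [exact: Pc|move=> x v; exact: Pd].
Qed.

Lemma smooth_continuous f : smooth f -> continuous f.
Proof. by move=> /(_ [::])[]. Qed.

Lemma smooth_derivable f x v : smooth f -> derivable f x v.
Proof. by move=> /(_ [::])[_]; apply. Qed.

Lemma smooth_D f v : smooth f -> smooth ('D_v f).
Proof.
move=> sf vs; have := sf (vs ++ [:: v]).
by rewrite foldr_cat.
Qed.

(* [smooth] quantifies over iterated derivatives, so products are handled by
   proving that a class containing them is stable under differentiation. *)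
Inductive smooth_closure : (V -> R) -> Prop :=
| scl_s f : smooth f -> smooth_closure f
| scl_D f g : smooth_closure f -> smooth_closure g -> smooth_closure (f + g)
| scl_M f g : smooth_closure f -> smooth_closure g -> smooth_closure (f * g)
| scl_c k : smooth_closure (cst k).

Lemma smooth_closure_props f : smooth_closure f ->
  [/\ continuous f, forall x v, derivable f x v & forall v, smooth_closure ('D_v f)].
Proof.
elim=> {f} [f sf|f g _ [cf df sf] _ [cg dg sg]|f g hf [cf df sf] hg [cg dg sg]|k].
- split; [exact: smooth_continuous|by move=> x v; exact: smooth_derivable|].
  by move=> v; apply: scl_s; exact: smooth_D.
- split.
  + by move=> x; apply: continuousD; [exact: cf|exact: cg].
  + by move=> x v; exact: derivableD.
  + move=> v; rewrite (_ : 'D_v (f + g) = 'D_v f + 'D_v g); first exact: scl_D.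
    by apply/funext => x; rewrite deriveD.
- split.
  + by move=> x; apply: continuousM; [exact: cf|exact: cg].
  + by move=> x v; exact: derivableM.
  + move=> v; rewrite (_ : 'D_v (f * g) = f * 'D_v g + g * 'D_v f).
      by apply: scl_D; exact: scl_M.
    by apply/funext => x; rewrite deriveM.
- split.
  + by move=> x; exact: cst_continuous.
  + by move=> x v; exact: derivable_cst.
  + move=> v; rewrite (_ : 'D_v (cst k) = cst 0); first exact: scl_c.
    by apply/funext => x; rewrite derive_cst.
Qed.

Lemma smooth_closure_smooth f : smooth_closure f -> smooth f.
Proof.
apply: smooth_ind => {f}.
- by move=> f /smooth_closure_props[].
- by move=> f x v /smooth_closure_props[].
- by move=> f v /smooth_closure_props[].
Qed.

Lemma smoothMf f g : smooth f -> smooth g -> smooth (fun x => f x * g x).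
Proof. by move=> sf sg; apply: smooth_closure_smooth; apply: (@scl_M f g); exact: scl_s. Qed.

Lemma smooth_cst k : smooth (fun _ : V => k : R).
Proof. by apply: smooth_closure_smooth; exact: scl_c. Qed.

Lemma smoothZf k f : smooth f -> smooth (fun x => k * f x).
Proof. by move=> sf; exact: (smoothMf (smooth_cst k) sf). Qed.

End Smooth.

Section SmoothComp.
Context {R : realType} {V W : normedModType R}.

Section one.
Variables (A : V -> W) (L : V -> W).
Hypothesis AL : forall h x v, A (h *: v + x) = h *: L v + A x.

(** By [AL] the map [A] is affine with linear part [L]: the difference quotients of [f \o A] along v
    are literally those of [f] along [L v]. *)
Lemma derivable_affine (f : W -> R) x v : derivable f (A x) (L v) -> derivable (f \o A) x v.
Proof. by move=> df; rewrite /derivable /=; under eq_fun do rewrite AL. Qed.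

Lemma derive_affine (f : W -> R) x v : 'D_v (f \o A) x = 'D_(L v) f (A x).
Proof. by rewrite /derive /=; under eq_fun do rewrite AL. Qed.

Lemma smooth_affine (f : W -> R) : continuous A -> smooth f -> smooth (f \o A).
Proof.
move=> cA sf; apply: (@smooth_ind _ _ (fun g => exists2 f, smooth f & g = f \o A)); last by exists f.
- move=> _ [{sf}f sf ->] x; apply: continuous_comp; [exact: cA|exact: (smooth_continuous sf)].
- by move=> _ x v [{sf}f sf ->]; apply: derivable_affine; exact: smooth_derivable.
- move=> _ v [{sf}f sf ->]; exists ('D_(L v) f); first exact: smooth_D.
  by apply/funext => x; rewrite derive_affine.
Qed.
End one.

End SmoothComp.

(** Serves for [flat] at the origin and for the class [c11], where what is known is a quadratic
    bound on the Taylor remainder. *)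
Lemma is_derive_quad (R : realType) (f : R -> R) (x a C r : R) : 0 < r ->
  (forall h, `|h| <= r -> `|f (x + h) - f x - a * h| <= C * h ^+ 2) -> is_derive x 1 f a.
Proof.
move=> r0 H.
have cv : h^-1 *: (f (h *: (1:R) + x) - f x) @[h --> (0:R)^'] --> a.
  apply/cvgrPdist_le => e e0.
  have C1 : 0 < `|C| + 1 by rewrite ltr_wpDl.
  near=> h.
  have hn0 : h != 0 by near: h; exact: nbhs_dnbhs_neq.
  have hr : `|h| <= r by near: h; exact: dnbhs0_le.
  have he : `|h| <= e / (`|C| + 1) by near: h; apply: dnbhs0_le; rewrite divr_gt0.
  have -> : a - h^-1 *: (f (h *: (1:R) + x) - f x) = - h^-1 * (f (x + h) - f x - a * h).
    by rewrite /GRing.scale/= mulr1 (addrC h); field.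
  rewrite normrM normrN normfV ler_pdivrMl ?normr_gt0//.
  apply: (le_trans (H _ hr)).
  rewrite -(real_normK (num_real h)) expr2 mulrCA.
  apply: ler_wpM2l => //.
  apply: (@le_trans _ _ ((`|C| + 1) * `|h|)).
    by rewrite ler_wpM2r// (le_trans (ler_norm _))// lerDl.
  by rewrite mulrC -ler_pdivlMr.
apply: DeriveDef; first by apply/cvg_ex; exists a.
exact: (cvg_lim (@norm_hausdorff _ _) cv).
Unshelve. all: by end_near. Qed.

Section Flat.
Context {R : realType}.
Implicit Types (p : {poly R}) (t : R).

(* Every derivative of [flat p] is of the form [flat q], whence smoothness. *)
Definition flat p t := if 0 < t then p.[t^-1] * expR (- t^-1) else 0.

Lemma poly_bound p : exists C n, 0 <= C /\ forall s, 1 <= s -> `|p.[s]| <= C * s ^+ n.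
Proof.
elim/poly_ind: p => [|p c [C [n [C0 H]]]].
  by exists 0, 0%N; split => // s _; rewrite horner0 normr0 mul0r.
exists (C + `|c|), n.+1; split=> [|s s1]; first by rewrite addr_ge0.
rewrite hornerD hornerM hornerX hornerC (le_trans (ler_normD _ _))// mulrDl lerD//.
  rewrite normrM exprS mulrCA [leLHS]mulrC ger0_norm ?(le_trans ler01)//.
  by rewrite ler_wpM2l ?(le_trans ler01)// H.
by rewrite ler_peMr// exprn_ege1.
Qed.

(** With s = 1/t, one term of the exponential series gives exp(-s) <= (n+2)! s^-(n+2). This absorbs
    the growth s^n of the polynomial and leaves t^2. *)
Lemma flat_bound p : exists2 C, 0 < C & forall t, `|t| <= 1 -> `|flat p t| <= C * t ^+ 2.
Proof.
have [C [n [C0 H]]] := poly_bound p.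
exists (C * (n.+2)`!%:R + 1); first by rewrite ltr_wpDl// mulr_ge0.
move=> t t1; rewrite /flat; case: ifPn => [t0|_]; last first.
  by rewrite normr0 mulr_ge0 ?sqr_ge0// addr_ge0// mulr_ge0.
have ti1 : 1 <= t^-1 by rewrite invr_ge1// ?inE ?unitf_gt0//; move: t1; rewrite gtr0_norm.
rewrite normrM (gtr0_norm (expR_gt0 _)).
apply: (@le_trans _ _ (C * t^-1 ^+ n * ((n.+2)`!%:R * t ^+ n.+2))).
  apply: ler_pM; [by []|exact: expR_ge0|exact: H|].
  have tn : 0 < (n.+2)`!%:R * t ^+ n.+2 by rewrite mulr_gt0 ?ltr0n ?fact_gt0 ?exprn_gt0.
  rewrite expRN invf_ple ?posrE ?expR_gt0//.
  rewrite invfM mulrC -exprVn.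
  apply: le_trans (expR_ge1Dxn n.+1 _); last by rewrite invr_ge0 ltW.
  by rewrite lerDr.
have -> : C * t^-1 ^+ n * ((n.+2)`!%:R * t ^+ n.+2) = C * (n.+2)`!%:R * t ^+ 2.
  rewrite -addn2 exprD exprVn; field.
  by rewrite expf_neq0// gt_eqF.
by rewrite ler_wpM2r ?sqr_ge0// lerDl.
Qed.

(** In the variable s = 1/t the derivative is - s^2 d/ds, and it sends p(s) exp(-s) to s^2 (p -
    p')(s) exp(-s). At the origin the quadratic bound gives derivative 0. *)
Lemma is_derive_flat p t : is_derive t 1 (flat p) (flat ('X^2 * (p - p^`())) t).
Proof.
have [t0|t0|->] := ltgtP t 0.
- have -> : flat ('X^2 * (p - p^`())) t = 0 by rewrite /flat ltNge (ltW t0).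
  have dc : is_derive t 1 (fun _ : R => 0 : R) (0:R) by exact: is_derive_cst.
  apply: (near_eq_is_derive _ dc).
  near=> s; rewrite /flat ltNge (_ : s <= 0)//.
  by apply/ltW; near: s; exact: lt_nbhsl.
- have tn0 : t != 0 by rewrite gt_eqF.
  have -> : flat ('X^2 * (p - p^`())) t =
     p.[t^-1] * (expR (- t^-1) * t^-1 ^+ 2) + expR (- t^-1) * (p^`().[t^-1] * (- t ^- 2)).
    by rewrite /flat t0 !hornerE/=; field.
  have d1 : is_derive t 1 (fun s : R => s^-1) (- t ^- 2).
    have := @is_deriveV R id t 1 1 tn0 (is_derive_id _ _).
    by rewrite /GRing.scale/= mulr1.
  have d2 : is_derive t 1 (fun s : R => p.[s^-1]) (p^`().[t^-1] * (- t ^- 2)).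
    exact: (@is_derive1_comp _ (horner p) _ _ _ _ (is_derive_poly p _) d1).
  have d3 : is_derive t 1 (fun s : R => expR (- s^-1)) (expR (- t^-1) * t^-1 ^+ 2).
    have d1N := is_deriveN d1; rewrite opprK -exprVn in d1N.
    exact: (@is_derive1_comp _ expR _ _ _ _ (is_derive_expR _) d1N).
  have d4 : is_derive t 1 (fun s : R => p.[s^-1] * expR (- s^-1))
      (p.[t^-1] * (expR (- t^-1) * t^-1 ^+ 2) + expR (- t^-1) * (p^`().[t^-1] * (- t ^- 2))).
    exact: (is_deriveM d2 d3).
  apply: (near_eq_is_derive _ d4).
  near=> s; rewrite /flat ifT//.
  by near: s; exact: lt_nbhsr.
- have -> : flat ('X^2 * (p - p^`())) 0 = 0 by rewrite /flat ltxx.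
  have [C C0 H] := flat_bound p.
  apply: (@is_derive_quad _ _ _ _ C 1) => // h h1.
  by rewrite add0r mul0r subr0 [flat p 0]/flat ltxx subr0; exact: H.
Unshelve. all: by end_near. Qed.

Lemma continuous_flat p : continuous (flat p).
Proof.
move=> t; apply: differentiable_continuous; apply/derivable1_diffP.
by have [] := is_derive_flat p t.
Qed.

Lemma derive_scale (f : R -> R) (df x v : R) : is_derive x 1 f df -> is_derive x v f (v * df).
Proof.
move=> [/derivable1_diffP df1 Dfx]; apply: DeriveDef; first exact: diff_derivable.
rewrite deriveE// -[v in 'd f x v]mulr1 -[v * 1]/(v *: 1) linearZ/=.
by rewrite -deriveE// Dfx.
Qed.

Lemma derive_homog (V : normedModType R) (f : V -> R) (x v : V) (c : R) : derivable f x v ->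
  derivable f x (c *: v) /\ 'D_(c *: v) f x = c * 'D_v f x.
Proof.
move=> df.
pose A (s : R) := s *: v + x.
have AL (h t s : R) : A (h *: s + t) = h *: (s *: v) + A t.
  by rewrite /A scalerDl addrA scalerA.
have A0 : A 0 = x by rewrite /A scale0r add0r.
have d1 : derivable (f \o A) 0 1.
  have := @derivable_affine R R V A (fun s => s *: v) AL f 0 1.
  by rewrite A0 scale1r; apply.
have D1 : 'D_1 (f \o A) 0 = 'D_v f x by rewrite (derive_affine AL) A0 scale1r.
have [d2 D2] : is_derive (0:R) c (f \o A) (c * 'D_v f x).
  by apply: derive_scale; rewrite -D1; exact: derivableP.
rewrite (derive_affine AL) A0 in D2; split => //.
move: d2; rewrite /derivable /=; under eq_fun do rewrite AL A0.
by [].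
Qed.

Lemma smooth_flat p : smooth (flat p).
Proof.
(* The class carries a factor c because a derivative along a direction v of the line brings out the
   factor v. *)
apply: (@smooth_ind _ _ (fun g => exists c p, g = fun t => c * flat p t)).
- move=> _ [c [q ->]] x; apply: continuousM; first exact: cst_continuous.
  exact: continuous_flat.
- move=> _ x v [c [q ->]].
  have d := derive_scale v (is_derive_flat q x).
  by apply: (@derivableM _ _ (cst c) (flat q)); [exact: derivable_cst|case: d].
- move=> _ v [c [q ->]]; exists (c * v), ('X^2 * (q - q^`())); apply/funext => x.
  have d := derive_scale v (is_derive_flat q x).
  have [dq Dq] := d.
  rewrite (@deriveM _ _ (cst c) (flat q) x v (derivable_cst _ _ _) dq).
  by rewrite derive_cst scaler0 addr0 Dq /GRing.scale/= mulrA.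
- by exists 1, p; apply/funext => t; rewrite mul1r.
Qed.

Lemma flat1_gt0 t : (0 < flat 1 t) = (0 < t).
Proof.
rewrite /flat; case: ifPn => [t0|]; last by rewrite ltxx.
by rewrite hornerE mul1r expR_gt0.
Qed.

Lemma flat1_ge0 t : 0 <= flat 1 t.
Proof. by rewrite /flat; case: ifPn => // t0; rewrite hornerE mul1r expR_ge0. Qed.

Lemma flat1_le s t : s <= t -> flat 1 s <= flat 1 t.
Proof.
move=> st; rewrite {1}/flat; case: ifPn => [s0|_]; last exact: flat1_ge0.
have t0 : 0 < t by exact: lt_le_trans st.
by rewrite /flat t0 !hornerE ?mul1r ler_expR lerN2 lef_pV2.
Qed.

Lemma flat1_0 t : t <= 0 -> flat 1 t = 0.
Proof. by rewrite /flat ltNge => ->. Qed.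

End Flat.

(** * Bump functions and mollifying kernels *)

Section Kernel.
Context {R : realType}.
Local Notation plane := (R * R)%type.
Local Notation mu2 := (@lebesgue2 R).
Implicit Types (f g k w : plane -> R).

Definition csupp f := exists n : R, forall x, ~ box n x -> f x = 0.

Lemma csupp_bounded f : continuous f -> csupp f -> exists2 M, 0 < M & forall x, `|f x| <= M.
Proof.
move=> cf [n fn].
have cbox : compact (f @` box n).
  apply: continuous_compact; last exact: box_compact.
  exact: continuous_subspaceT.
have [M [_ HM]] := compact_bounded cbox.
exists (`|M| + 1) => [|x]; first by rewrite ltr_wpDl.
have [bx|nbx] := pselect (box n x); last by rewrite fn// normr0 addr_ge0.
by apply: HM; [rewrite ltr_pwDr// ler_norm|exists x].
Qed.

Lemma csupp_integrable f : continuous f -> csupp f -> mu2.-integrable setT (EFin \o f).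
Proof.
move=> cf fn; have [M M0 HM] := csupp_bounded cf fn; case: fn => n fn.
apply: (@intg_le _ _ _ mu2 setT measurableT f (fun x => M * \1_(box n) x)).
- exact: continuous_measurable2.
- apply: aeW => x _; rewrite indicE; have [bx|nbx] := pselect (box n x).
    by rewrite mem_set// mulr1.
  by rewrite fn// normr0 mulr_ge0// ltW.
apply: intgZ => //; apply/intgP; split.
  by apply: measurable_indic; exact: measurable_box.
under eq_integral do rewrite ger0_norm ?indic_ge0//.
by rewrite integral_indic ?setIT//; [exact: box_fin|exact: measurable_box].
Qed.

Lemma derive_near0 f x v : (\forall y \near x, f y = 0) -> 'D_v f x = 0.
Proof.
move=> f0; rewrite (@near_eq_derive _ _ _ f (cst 0)) ?derive_cst//.
Qed.

Lemma csupp_D f v : csupp f -> csupp ('D_v f).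
Proof.
move=> [n fn]; exists n => x nbx; apply: derive_near0.
have oC : open (~` box n) by rewrite openC; apply: compact_closed2; exact: box_compact.
by apply: filterS (open_nbhs_nbhs (conj oC nbx)) => y; exact: fn.
Qed.

Definition bump r t : R := flat 1 (r - t) * flat 1 (r + t).

(** A product of one-dimensional bumps fits the balls of the product norm, which are squares. *)
Definition bump2 (c : plane) (r : R) (x : plane) : R :=
  bump r (x.1 - c.1) * bump r (x.2 - c.2).

Lemma bump_ge0 r t : 0 <= bump r t.
Proof. by rewrite mulr_ge0// flat1_ge0. Qed.

Lemma bump_0 r t : r <= `|t| -> bump r t = 0.
Proof.
rewrite /bump; have [t0|t0] := leP 0 t => rt.
  by rewrite (@flat1_0 _ (r - t)) ?mul0r// subr_le0; move: rt; rewrite ger0_norm.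
by rewrite (@flat1_0 _ (r + t)) ?mulr0//; move: rt; rewrite ltr0_norm//; lra.
Qed.

Lemma bump_ge r t : `|t| <= r / 2 -> flat 1 (r / 2) ^+ 2 <= bump r t.
Proof.
rewrite ler_norml => /andP[? ?]; rewrite expr2 /bump.
by apply: ler_pM; rewrite ?flat1_ge0//; apply: flat1_le; lra.
Qed.

Lemma smooth_coord (g : R -> R) (a b c : R) : smooth g ->
  smooth (fun x : plane => g (a * x.1 + b * x.2 + c)).
Proof.
move=> sg.
apply: (@smooth_affine _ _ _ (fun x : plane => a * x.1 + b * x.2 + c : R) (fun v : plane => a * v.1 + b * v.2)) sg.
- by move=> h v x /=; rewrite /GRing.scale/=; ring.
- move=> x; apply: cvgD; last exact: cvg_cst.
  apply: cvgD; apply: cvgM; [exact: cvg_cst|exact: cvg_fst|exact: cvg_cst|exact: cvg_snd].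
Qed.

Lemma smooth_bump2 c r : smooth (bump2 c r).
Proof.
have -> : bump2 c r = fun x => (flat 1 ((-1) * x.1 + 0 * x.2 + (r + c.1)) * flat 1 (1 * x.1 + 0 * x.2 + (r - c.1)))
   * (flat 1 (0 * x.1 + (-1) * x.2 + (r + c.2)) * flat 1 (0 * x.1 + 1 * x.2 + (r - c.2))).
  apply/funext => x; rewrite /bump2 /bump; congr (_ * _ * (_ * _)); congr (flat 1 _); ring.
have sf := @smooth_flat R 1.
exact: (smoothMf (smoothMf (smooth_coord _ _ _ sf) (smooth_coord _ _ _ sf)) (smoothMf (smooth_coord _ _ _ sf) (smooth_coord _ _ _ sf))).
Qed.

Lemma bump2_ge0 c r x : 0 <= bump2 c r x.
Proof. by rewrite mulr_ge0// bump_ge0. Qed.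

Lemma bump2_0 c r x : ~ ball c r x -> bump2 c r x = 0.
Proof.
move=> nb; rewrite /bump2; have [r1|r1] := leP r `|x.1 - c.1|; first by rewrite bump_0// mul0r.
have [r2|r2] := leP r `|x.2 - c.2|; first by rewrite (bump_0 r2) mulr0.
by exfalso; apply: nb; split; rewrite /ball/= distrC.
Qed.

Lemma bump2_ge c r x : ball c (r / 2) x -> flat 1 (r / 2) ^+ 4 <= bump2 c r x.
Proof.
move=> [/= b1 b2]; rewrite /ball/= in b1 b2.
rewrite (exprM _ 2 2) expr2 /bump2; apply: ler_pM; rewrite ?sqr_ge0//; apply: bump_ge; rewrite distrC ltW//.
Qed.

(** The centre is free: near the boundary, kernels placed off the origin look only into the
    domain. *)
Definition is_kernel (c : plane) (r : R) k :=
  [/\ smooth k, forall x, 0 <= k x, forall x, ~ ball c r x -> k x = 0 & \int[mu2]_x k x = 1].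

Lemma csupp_ball c r f : (forall x, ~ ball c r x -> f x = 0) -> csupp f.
Proof.
move=> H; exists (`|c.1| + `|c.2| + `|r|) => x nb; apply: H; apply: contra_not nb => -[/= b1 b2].
rewrite /ball/= in b1 b2; have := ler_norm r => rr.
have := normr_ge0 c.1; have := normr_ge0 c.2 => c20 c10.
have := ler_norm c.1; have := ler_norm c.2; have := ler_norm (- c.1); have := ler_norm (- c.2).
rewrite !normrN => ? ? ? ?.
move: b1 b2; rewrite !ltr_norml => /andP[? ?] /andP[? ?].
by split; rewrite /= in_itv/=; apply/andP; split; lra.
Qed.

Lemma exists_kernel c r : 0 < r -> exists k, is_kernel c r k.
Proof.
move=> r0; have cb : continuous (bump2 c r) by apply: smooth_continuous; exact: smooth_bump2.
have sb : csupp (bump2 c r) by apply: csupp_ball; exact: bump2_0.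
have ib := csupp_integrable cb sb.
pose Z := \int[mu2]_x bump2 c r x.
have Z0 : 0 < Z.
  pose B := ball c.1 (r / 2) `*` ball c.2 (r / 2) : set (measurableTypeR R * measurableTypeR R).
  have mB : measurable B by apply: measurableX; exact: measurable_ball.
  have muB : mu2 B = (r * r)%:E.
    rewrite lebesgue2_rect; [|exact: measurable_ball..].
    have E d : lebesgue_measure (ball d (r / 2)) = r%:E :> \bar R.
      by rewrite lebesgue_measure_ball ?divr_ge0// ?ltW//; congr EFin; field.
    by rewrite [X in (X * _)%E]E [X in (_ * X)%E]E.
  pose m := flat 1 (r / 2) ^+ 4.
  have m0 : 0 < m by rewrite exprn_gt0// flat1_gt0 divr_gt0.
  have i1 : mu2.-integrable setT (EFin \o (fun x => m * \1_B x)).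
    apply: intgZ => //; apply/intgP; split; first exact: measurable_indic.
    under eq_integral do rewrite ger0_norm ?indic_ge0//.
    by rewrite integral_indic ?setIT//= muB ltry.
  have : \int[mu2]_x (m * \1_B x) <= Z.
    apply: le_Rintegral => // x _; rewrite indicE; have [bx|nbx] := pselect (B x).
      by rewrite mem_set// mulr1; apply: bump2_ge.
    by rewrite memNset// mulr0 bump2_ge0.
  apply: lt_le_trans.
  rewrite RintZ//; last first.
    apply/intgP; split; first exact: measurable_indic.
    under eq_integral do rewrite ger0_norm ?indic_ge0//.
    by rewrite integral_indic ?setIT//= muB ltry.
  rewrite /Rintegral integral_indic// setIT [mu2 _]muB /=.
  by apply: mulr_gt0 => //; exact: mulr_gt0.
exists (fun x => Z^-1 * bump2 c r x); split.
- by apply: smoothZf; exact: smooth_bump2.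
- by move=> x; rewrite mulr_ge0 ?bump2_ge0// invr_ge0 ltW.
- by move=> x nb; rewrite bump2_0// mulr0.
- by rewrite RintZ// mulVf// gt_eqF.
Qed.

End Kernel.

(** * Mollification of integrable functions *)

Section Mollify.
Context {R : realType}.
Local Notation plane := (R * R)%type.
Local Notation mplane := (measurableTypeR R * measurableTypeR R)%type.
Local Notation mu2 := (@lebesgue2 R).
Implicit Types (f g k w : plane -> R).
Local Notation intT f := (mu2.-integrable [set: mplane] (EFin \o f)).

(** A correlation rather than a convolution: the value at x averages w(x + z) with weight k(z), so a
    kernel supported in a cone uses [w] only in the cone with apex x. *)
Definition moll k w (x : plane) : R := \int[mu2]_z (w z * k (z - x)).

Lemma meas_shift f (h : plane) : measurable_fun [set: mplane] f ->
  measurable_fun [set: mplane] (fun x => f (x + h)).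
Proof. by move=> mf; exact: (measurableT_comp mf (measurable_fun_shift h)). Qed.

Lemma intT_shift f (h : plane) : intT f -> intT (fun x => f (x + h)).
Proof.
move=> fi; have mf := intg_meas fi.
apply/intgP; split; first exact: meas_shift.
have /intgP[_] := fi.
have := @L1norm_comp _ _ _ mu2 _ (fun (h x : plane) => (x + h)) measurable_fun_shift lebesgue2_shift f h mf.
by rewrite /L1norm /= => ->.
Qed.

Lemma int_shift f (h : plane) : intT f -> \int[mu2]_x f (x + h) = \int[mu2]_x f x.
Proof.
move=> fi; congr fine.
have mf : measurable_fun [set: mplane] (EFin \o f) by apply/measurable_EFinP; exact: (intg_meas fi).
have := @integral_pushforward _ _ mplane mplane R (fun x : mplane => (x + h : mplane)) (measurable_fun_shift h) mu2 setT
  (EFin \o f) mf _ measurableT.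
rewrite preimage_setT => /(_ (intT_shift h fi)) <-.
apply: eq_measure_integral => [|pf A mA _]; first exact: (measurable_fun_shift h).
exact: (lebesgue2_shift h mA).
Qed.

Lemma csupp_smooth_bounded k : smooth k -> csupp k -> exists2 M, 0 < M & forall x, `|k x| <= M.
Proof. by move=> /smooth_continuous; exact: csupp_bounded. Qed.

Lemma smooth_measurable k : smooth k -> measurable_fun [set: mplane] k.
Proof. by move=> /smooth_continuous; exact: continuous_measurable2. Qed.

Lemma moll_int k w x : smooth k -> csupp k -> intT w -> intT (fun z => w z * k (z - x)).
Proof.
move=> sk ck wi; have [M M0 HM] := csupp_smooth_bounded sk ck.
have mk : measurable_fun [set: mplane] (fun z => k (z - x)) by apply: meas_shift; exact: smooth_measurable.
have := @intg_bndM _ _ _ mu2 setT measurableT _ _ M mk (aeW _ (fun z _ => HM _)) wi.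
by apply: eq_integrable => // z _; rewrite /= mulrC.
Qed.

Lemma mollE k w x : smooth k -> csupp k -> intT w ->
  moll k w x = \int[mu2]_z (w (z + x) * k z).
Proof.
move=> sk ck wi; rewrite /moll -(int_shift x (moll_int x sk ck wi)).
by congr fine; apply: eq_integral => z _; rewrite addrK.
Qed.

(** The kernel being bounded by M, two values differ by at most M times the L^1 distance between two
    translates of [w]. *)
Lemma moll_continuous k w : smooth k -> csupp k -> intT w -> continuous (moll k w).
Proof.
move=> sk ck wi x; have [M M0 HM] := csupp_smooth_bounded sk ck.
have mw := intg_meas wi.
have mk := smooth_measurable sk.
apply/cvgrPdist_le => e e0.
have e1 : 0 < e / M by rewrite divr_gt0.
have cx : (y - x : plane) @[y --> x] --> (0 : plane).
  by rewrite -[X in _ --> X](subrr x); apply: cvgB; [exact: cvg_id|exact: cvg_cst].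
near=> y.
have H : (L1norm mu2 (fun x0 : plane => w (x0 + (y - x)) - w x0)%R <= (e / M)%:E)%E.
  by near: y; exact: (cx _ (transl_cont_plane wi e1)).
rewrite !mollE//.
have i1 (y0 : plane) : intT (fun z => w (z + y0) * k z).
  have := @intg_bndM _ _ _ mu2 setT measurableT _ _ M mk (aeW _ (fun z _ => HM _)) (intT_shift y0 wi).
  by apply: eq_integrable => // z _; rewrite /= mulrC.
rewrite distrC -RintB//.
have i2 : intT (fun z => w (z + y) - w (z + x)) by apply: intgB => //; exact: intT_shift.
apply: (le_trans (Rint_norm_le _ (intgB _ (i1 y) (i1 x)))) => //.
apply: (@le_trans _ _ (\int[mu2]_z (M * `|w (z + y) - w (z + x)|))).
  apply: le_Rintegral => //.
  - by apply: intg_norm => //; exact: intgB.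
  - by apply: intgZ => //; exact: intg_norm.
  - by move=> z _; rewrite -mulrBl normrM mulrC ler_wpM2r.
rewrite RintZ//; last exact: intg_norm.
rewrite mulrC -ler_pdivlMr// -lee_fin -Rint_EFin//; last exact: intg_norm.
apply: le_trans H; rewrite /L1norm.
have mi : measurable_fun [set: mplane] (fun x0 : plane => w (x0 + (y - x)) - w x0).
  by apply: measurable_funB => //; exact: meas_shift.
have := @L1norm_comp _ _ _ mu2 _ (fun (h x : plane) => (x + h)) measurable_fun_shift lebesgue2_shift _ x mi.
rewrite /L1norm => <- /=.
have E z : z + x + (y - x) = z + y by rewrite -addrA [x + _]addrC subrK.
by under [X in (_ <= X)%E]eq_integral do rewrite E.
Unshelve. all: by end_near. Qed.

Lemma plane_affine (z v x : plane) (h s t : R) :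
  z - ((h * s + t) *: v + x) = h *: (s *: - v) + (z - (t *: v + x)).
Proof.
rewrite !scalerDl scalerN -scalerA scalerN; move: (h *: (s *: v)) (t *: v) => a b.
by rewrite -[a + b + x]addrA opprD addrCA.
Qed.

(** Differentiation under the integral sign: x occurs only in the kernel, and |w| times a bound of
    ['D_v k] dominates. *)
Lemma moll_is_derive k w (x v : plane) : smooth k -> csupp k -> intT w ->
  derivable (moll k w) x v /\ 'D_v (moll k w) x = moll (fun z => - 'D_v k z) w x.
Proof.
move=> sk ck wi.
pose f (t : R) (z : mplane) := w z * k (z - (t *: v + x)).
have dk (t : R) (z : plane) : is_derive t 1 (fun t => k (z - (t *: v + x))) (- 'D_v k (z - (t *: v + x))).
  pose A (s : R) : plane := z - (s *: v + x).
  have AL (h t0 s : R) : A (h *: s + t0) = h *: (s *: (- v)) + A t0.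
    exact: plane_affine.
  have [d1 D1] := derive_homog (-1) (@smooth_derivable _ _ k (A t) v sk).
  rewrite scaleN1r mulN1r in d1 D1.
  apply: DeriveDef.
    by apply: (derivable_affine AL); rewrite scale1r.
  by rewrite -[LHS]/('D_1 (k \o A) t) (derive_affine AL) scale1r.
have df (t : R) (z : mplane) : is_derive t 1 (f ^~ z) (w z * - 'D_v k (z - (t *: v + x))).
  have dw : is_derive t 1 (fun _ : R => w z) (0 : R) by exact: is_derive_cst.
  have := is_deriveM dw (dk t z).
  by rewrite scaler0 addr0 => dd; exact: dd.
have pf t z : partial1of2 f t z = w z * - 'D_v k (z - (t *: v + x)).
  by rewrite partial1of2E; have [] := df t z.
have sDk := smooth_D v sk; have cDk := csupp_D v ck.
have [M M0 HM] := csupp_smooth_bounded sDk cDk.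
have i1 (t : R) : intT (f t) by exact: moll_int.
have d1 (t : R) (z : mplane) : derivable (f ^~ z) t 1 by have [] := df t z.
have I0 : `](-1), 1[%classic (0:R) by rewrite /= in_itv/= ltr01 ltrN10.
have iG : intT (fun z => `|w z| * M).
  by under eq_fun do rewrite mulrC; apply: intgZ => //; exact: intg_norm.
have Gub (t : R) (z : mplane) : `|partial1of2 f t z| <= `|w z| * M.
  by rewrite pf normrM ler_wpM2l// normrN.
have cv := @cvg_differentiation_under_integral R _ mplane mu2 f setT measurableT 0 (-1) 1 I0
   (fun t _ => i1 t) (fun t z _ _ => d1 t z) _
   (fun z => mulr_ge0 (normr_ge0 _) (ltW M0)) iG (fun t z _ _ => Gub t z).
have {}cv : h^-1 *: (moll k w (h *: v + x) - moll k w x) @[h --> (0:R)^'] --> moll (fun z => - 'D_v k z) w x.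
  have E : moll (fun z => - 'D_v k z) w x = \int[mu2]_y partial1of2 f 0 y.
    by apply: eq_Rintegral => z _; rewrite pf scale0r add0r.
  rewrite E; apply: cvg_trans cv; apply: near_eq_cvg; near=> h.
  by rewrite addr0 /f scale0r add0r.
split; first by apply/cvg_ex; exists (moll (fun z => - 'D_v k z) w x).
exact: (cvg_lim (@norm_hausdorff _ _) cv).
Unshelve. all: by end_near. Qed.

Lemma moll_smooth k w : smooth k -> csupp k -> intT w -> smooth (moll k w).
Proof.
move=> sk ck wi.
apply: (@smooth_ind _ _ (fun g => exists k, [/\ smooth k, csupp k & g = moll k w])).
- by move=> _ [q [sq cq ->]]; exact: moll_continuous.
- by move=> _ x v [q [sq cq ->]]; have [] := moll_is_derive x v sq cq wi.
- move=> _ v [q [sq cq ->]]; exists (fun z => - 'D_v q z); split.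
  + rewrite (_ : (fun z => _) = fun z => -1 * 'D_v q z); last by apply/funext => z; rewrite mulN1r.
    by apply: smoothZf; exact: smooth_D.
  + by have [n Hn] := csupp_D v cq; exists n => z /Hn ->; rewrite oppr0.
  + by apply/funext => x; have [] := moll_is_derive x v sq cq wi.
- by exists k.
Qed.

End Mollify.

Section Jensen.
Context {R : realType}.
Local Notation plane := (R * R)%type.
Local Notation mplane := (measurableTypeR R * measurableTypeR R)%type.
Local Notation mu2 := (@lebesgue2 R).
Implicit Types (f g k w : plane -> R).
Local Notation intT f := (mu2.-integrable [set: mplane] (EFin \o f)).
Variables (Phi : R -> R) (s : R -> R).
Hypothesis Phi0 : forall t, 0 <= Phi t.
Hypothesis mPhi : measurable_fun [set: measurableTypeR R] (Phi : measurableTypeR R -> R).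
Hypothesis Phis : forall m t, Phi m + s m * (t - m) <= Phi t.

(** The supporting line of [Phi] at the mean is integrated against the probability density [k]. If
    the right-hand side is infinite there is nothing to prove. *)
Lemma jensen_kernel c r k (p : plane -> R) : is_kernel c r k -> measurable_fun [set: mplane] p ->
  intT (fun z => p z * k z) ->
  ((Phi (\int[mu2]_z (p z * k z)))%:E <= \int[mu2]_z (Phi (p z) * k z)%:E)%E.
Proof.
move=> [sk k0 kb k1] mp ip.
have mk := smooth_measurable sk.
have ck := csupp_ball kb.
have ik := csupp_integrable (smooth_continuous sk) ck.
have mPp : measurable_fun [set: mplane] (fun z => Phi (p z) * k z).
  by apply: measurable_funM => //; exact: (measurableT_comp mPhi mp).
have Pk0 z : 0 <= Phi (p z) * k z by exact: mulr_ge0.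
have := leey (\int[mu2]_z (Phi (p z) * k z)%:E)%E.
rewrite le_eqVlt => /orP[/eqP ->|fin]; first by rewrite leey.
have iP : intT (fun z => Phi (p z) * k z).
  apply/intgP; split => //.
  by under eq_integral do rewrite ger0_norm//.
rewrite (Rint_EFin measurableT iP) lee_fin.
set m := (\int[mu2]_z (p z * k z)).
have i2 : intT (fun z => s m * (p z * k z)) by exact: intgZ.
have i3 : intT (fun z => (Phi m - s m * m) * k z) by exact: intgZ.
have -> : Phi m = \int[mu2]_z ((Phi m - s m * m) * k z + s m * (p z * k z)).
  by rewrite RintD// !RintZ// k1 -/m; ring.
apply: le_Rintegral => //; first exact: intgD.
move=> z _; rewrite mulrA -mulrDl; apply: ler_wpM2r => //.
by apply: le_trans (Phis m (p z)); rewrite mulrBr; lra.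
Qed.

(** Jensen for each x, then Tonelli: the bound [B] is averaged against [k], so it is required only
    for z in the ball carrying the kernel. *)
Lemma jensen_moll c r k (p : plane -> plane -> R) (B : \bar R) : is_kernel c r k -> (0 <= B)%E ->
  measurable_fun [set: mplane] (fun x => \int[mu2]_z (p x z * k z)) ->
  measurable_fun [set: mplane * mplane] (fun xz : mplane * mplane => p xz.1 xz.2) ->
  (forall x, intT (fun z => p x z * k z)) ->
  (forall z, ball c r z -> (\int[mu2]_x (Phi (p x z))%:E <= B)%E) ->
  (\int[mu2]_x (Phi (\int[mu2]_z (p x z * k z)))%:E <= B)%E.
Proof.
pose ms := @lebesgue2s R.
move=> kk B0 mI mp ip HB; have [sk k0 kb k1] := kk.
have mk := smooth_measurable sk.
have ck := csupp_ball kb.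
have ik := csupp_integrable (smooth_continuous sk) ck.
have mp1 x : measurable_fun [set: mplane] (p x).
  exact: (@measurable_fun_pair2 _ _ _ mplane mplane _ (fun xz : mplane * mplane => p xz.1 xz.2) x mp).
have mp2 z : measurable_fun [set: mplane] (p ^~ z).
  exact: (@measurable_fun_pair1 _ _ _ mplane mplane _ (fun xz : mplane * mplane => p xz.1 xz.2) z mp).
have mG : measurable_fun [set: mplane * mplane] (fun xz : mplane * mplane => (Phi (p xz.1 xz.2) * k xz.2)%:E).
  apply/measurable_EFinP; apply: measurable_funM; first exact: (measurableT_comp mPhi mp).
  exact: (measurableT_comp mk measurable_snd).
have mpk : measurable_fun [set: mplane * mplane] (fun xz : mplane * mplane => p xz.1 xz.2 * k xz.2).
  by apply: measurable_funM => //; exact: (measurableT_comp mk measurable_snd).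
apply: (@le_trans _ _ (\int[mu2]_x \int[mu2]_z (Phi (p x z) * k z)%:E)%E).
  apply: ge0_le_integral => //.
  - by move=> x _; rewrite lee_fin.
  - by apply/measurable_EFinP; exact: (measurableT_comp mPhi).
  - apply: (@measurable_fun_fubini_tonelli_F _ _ mplane mplane R ms _ mG).
    by move=> xz; rewrite lee_fin mulr_ge0.
  - by move=> x _; exact: (jensen_kernel kk).
have pos (xz : mplane * mplane) : (0 <= (Phi (p xz.1 xz.2) * k xz.2)%:E)%E.
  by rewrite lee_fin mulr_ge0.
have := @fubini_tonelli _ _ mplane mplane R ms ms _ mG pos.
move=> /= ->.
have mkE : measurable_fun [set: mplane] (fun z => (k z)%:E) by exact/measurable_EFinP.
apply: (@le_trans _ _ (\int[mu2]_z ((k z)%:E * B))%E).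
  apply: ge0_le_integral => //.
  - by move=> z _; apply: integral_ge0 => x _; rewrite lee_fin mulr_ge0.
  - apply: (@measurable_fun_fubini_tonelli_G _ _ mplane mplane R ms _ mG).
    by move=> xz; rewrite lee_fin mulr_ge0.
  - by apply: emeasurable_funM.
  - move=> z _.
    have mPz : measurable_fun [set: mplane] (fun x => (Phi (p x z))%:E).
      by apply/measurable_EFinP; exact: (measurableT_comp mPhi (mp2 z)).
    have -> : (\int[ms]_x (Phi (p x z) * k z)%:E = (k z)%:E * \int[mu2]_x (Phi (p x z))%:E)%E.
      under [LHS]eq_integral do rewrite EFinM muleC.
      by apply: (@ge0_integralZl _ mplane R mu2 setT measurableT _ mPz) => // [x _|]; rewrite lee_fin.
    have [bz|nbz] := pselect (ball c r z); last by rewrite kb// !mul0e.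
    by apply: lee_wpmul2l; [rewrite lee_fin|exact: HB].
rewrite ge0_integralZr//; last by move=> z _; rewrite lee_fin.
by rewrite (Rint_EFin measurableT ik) k1 mul1e.
Qed.

End Jensen.

Section MollCvg.
Context {R : realType}.
Local Notation plane := (R * R)%type.
Local Notation mplane := (measurableTypeR R * measurableTypeR R)%type.
Local Notation mu2 := (@lebesgue2 R).
Implicit Types (f g k w : plane -> R).
Local Notation intT f := (mu2.-integrable [set: mplane] (EFin \o f)).

Lemma measurable_plane_add : measurable_fun [set: mplane * mplane]
  (fun xz : mplane * mplane => (xz.2 + xz.1 : plane) : mplane).
Proof.
have m1 (T1 T2 : measurableType _) : measurable_fun [set: T1 * T2] (@fst T1 T2) by exact: measurable_fst.
apply/measurable_fun_pairP; split.
- apply: (@measurable_funD _ _ _ _ (fun xz : mplane * mplane => xz.2.1 : R) (fun xz : mplane * mplane => xz.1.1 : R)).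
    exact: (measurableT_comp measurable_fst measurable_snd).
  exact: (measurableT_comp measurable_fst measurable_fst).
- apply: (@measurable_funD _ _ _ _ (fun xz : mplane * mplane => xz.2.2 : R) (fun xz : mplane * mplane => xz.1.2 : R)).
    exact: (measurableT_comp measurable_snd measurable_snd).
  exact: (measurableT_comp measurable_snd measurable_fst).
Qed.

Lemma moll_subE c r k w x : is_kernel c r k -> intT w ->
  intT (fun z => (w (z + x) - w x) * k z) /\
  moll k w x - w x = \int[mu2]_z ((w (z + x) - w x) * k z).
Proof.
move=> [sk k0 kb k1] wi; have ck := csupp_ball kb.
have ik := csupp_integrable (smooth_continuous sk) ck.
have [M M0 HM] := csupp_smooth_bounded sk ck.
have mk := smooth_measurable sk.
have i1 : intT (fun z => w (z + x) * k z).
  have := @intg_bndM _ _ _ mu2 setT measurableT _ _ M mk (aeW _ (fun z _ => HM _)) (intT_shift x wi).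
  by apply: eq_integrable => // z _; rewrite /= mulrC.
have i2 : intT (fun z => w x * k z) by apply: (@intgZ _ _ _ mu2 setT measurableT).
split.
  have := @intgB _ _ _ mu2 setT measurableT _ _ i1 i2.
  by apply: eq_integrable => // z _; rewrite /= mulrBl.
rewrite (mollE x sk ck wi) -[X in _ - X]mulr1 -k1 -(@RintZ _ _ _ mu2 setT measurableT _ _ ik).
rewrite -(@RintB _ _ _ mu2 setT measurableT _ _ i1 i2).
by congr fine; apply: eq_integral => z _; rewrite mulrBl.
Qed.

(* The supporting lines of the convex function Phi, with slopes s, stand for
   Jensen's inequality: Phi = |.| gives the L^1 bound and Phi = (.)^2 the L^2
   one. *)
Lemma moll_convex_le (Phi s : R -> R) (e : R) c r k w : (forall t, 0 <= Phi t) ->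
  continuous Phi -> (forall m t, Phi m + s m * (t - m) <= Phi t) ->
  is_kernel c r k -> intT w -> 0 <= e ->
  (forall z, ball c r z -> (\int[mu2]_x (Phi (w (x + z) - w x))%:E <= e%:E)%E) ->
  (\int[mu2]_x (Phi (moll k w x - w x))%:E <= e%:E)%E.
Proof.
move=> P0 cP Ps kk wi e0 He.
have mP : measurable_fun [set: measurableTypeR R] (Phi : measurableTypeR R -> R).
  exact: continuous_measurable_fun.
have [sk k0 kb k1] := kk; have ck := csupp_ball kb.
have mw := intg_meas wi.
have mm : measurable_fun [set: mplane] (moll k w).
  by apply: continuous_measurable2; exact: moll_continuous.
under eq_integral => x _ do rewrite (moll_subE x kk wi).2.
apply: (@jensen_moll _ Phi s P0 mP Ps c r k (fun x z => w (z + x) - w x)) => //.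
- by under eq_fun do rewrite -(moll_subE _ kk wi).2; exact: measurable_funB.
- apply: measurable_funB; first exact: (measurableT_comp mw measurable_plane_add).
  exact: (measurableT_comp mw measurable_fst).
- by move=> x; have [] := moll_subE x kk wi.
- move=> z bz; apply: le_trans (He z bz).
  rewrite (eq_integral (fun x : mplane => (Phi (w (x + z) - w x))%:E))// => x _.
  by congr (Phi (w _ - w x))%:E; exact: addrC.
Qed.

Lemma norm_support (m t : R) : `|m| + Num.sg m * (t - m) <= `|t|.
Proof.
rewrite mulrBr -normrEsg addrC subrK; apply: (le_trans (ler_norm _)).
by rewrite normrM normr_sg; case: (m != 0); rewrite ?mul1r ?mul0r.
Qed.

Lemma moll_L1norm c r k w : is_kernel c r k -> intT w -> (L1norm mu2 (moll k w) <= L1norm mu2 w)%E.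
Proof.
move=> kk wi; have [sk k0 kb k1] := kk; have ck := csupp_ball kb.
have mw := intg_meas wi.
have [M M0 HM] := csupp_smooth_bounded sk ck.
have mk := smooth_measurable sk.
have mn : measurable_fun [set: measurableTypeR R] (fun t : measurableTypeR R => `|t| : R).
  exact: normr_measurable.
have i1 x : intT (fun z => w (z + x) * k z).
  have := @intg_bndM _ _ _ mu2 setT measurableT _ _ M mk (aeW _ (fun z _ => HM _)) (intT_shift x wi).
  by apply: eq_integrable => // z _; rewrite /= mulrC.
rewrite {1}/L1norm; under eq_integral do rewrite (mollE _ sk ck wi).
apply: (@jensen_moll _ (fun t => `|t|) Num.sg _ mn _ c r k (fun x z => w (z + x))) => //.
- exact: norm_support.
- exact: L1norm_ge0.
- under eq_fun do rewrite -(mollE _ sk ck wi).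
  by apply: continuous_measurable2; exact: moll_continuous.
- exact: (measurableT_comp mw measurable_plane_add).
- move=> z _.
  have := @L1norm_comp _ _ _ mu2 _ (fun (h x : plane) => (x + h)) measurable_fun_shift lebesgue2_shift _ z mw.
  rewrite /L1norm /= => <-.
  by rewrite (eq_integral (fun x : mplane => `|w (x + z)|%:E))// => x _; congr (`|w _|)%:E; exact: addrC.
Qed.

Lemma moll_intT c r k w : is_kernel c r k -> intT w -> intT (moll k w).
Proof.
move=> kk wi; have [sk k0 kb k1] := kk; have ck := csupp_ball kb.
apply/intgP; split; first by apply: continuous_measurable2; exact: moll_continuous.
by apply: le_lt_trans (moll_L1norm kk wi) _; have /intgP[] := wi.
Qed.

(** The kernels may sit off the origin; convergence only requires that their supports shrink to
    it. *)
Definition kseq (k_ : nat -> plane -> R) := forall n,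
  exists c r, is_kernel c r (k_ n) /\ ball c r `<=` ball (0 : plane) (n.+1%:R^-1 : R).

Lemma moll_cvg1 (k_ : nat -> plane -> R) w : kseq k_ -> intT w ->
  \int[mu2]_x `|moll (k_ n) w x - w x| @[n --> \oo] --> 0.
Proof.
move=> kk wi; apply/cvgrPdist_le => e e0.
have /nbhs_ballP[d /= d0 Hd] := transl_cont_plane wi e0.
near=> n.
have [c [r [kn sub]]] := kk n.
have dn : n.+1%:R^-1 <= d by apply: ltW; near: n; exact: (near_infty_natSinv_lt (PosNum d0)).
have im := moll_intT kn wi.
have ii : intT (fun x => `|moll (k_ n) w x - w x|).
  by apply: (@intg_norm _ _ _ mu2 setT); exact: (@intgB _ _ _ mu2 setT measurableT).
rewrite sub0r normrN ger0_norm; last by apply: Rintegral_ge0.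
rewrite -lee_fin -(@Rint_EFin _ _ _ mu2 setT measurableT _ ii).
apply: (@moll_convex_le (fun t => `|t|) Num.sg e c r) => //.
- exact: norm_continuous.
- exact: norm_support.
- exact: ltW.
- move=> z bz; apply: Hd; apply: le_ball dn _ _; exact: sub.
Unshelve. all: by end_near. Qed.

(* Reduces continuity of translations in L^2 to that in L^1 of w |w|. *)
Lemma sqr_dist_le (a b : R) : (a - b) ^+ 2 <= 2 * `|a * `|a| - b * `|b| |.
Proof.
have [a0|a0] := leP 0 a; have [b0|b0] := leP 0 b;
 rewrite ?(ger0_norm a0) ?(ger0_norm b0) ?(ltr0_norm a0) ?(ltr0_norm b0).
- by case: (leP b a) => ab; [rewrite ger0_norm|rewrite ler0_norm]; nra.
- by have h := sqr_ge0 (a + b); rewrite mulrN opprK ger0_norm ?addr_ge0 -?expr2 ?sqr_ge0//; nra.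
- have h := sqr_ge0 (a + b); rewrite mulrN -opprD normrN.
  by rewrite ger0_norm ?addr_ge0 -?expr2 ?sqr_ge0//; nra.
- by case: (leP b a) => ab; [rewrite ger0_norm|rewrite ler0_norm]; nra.
Qed.

Lemma moll_cvg2 (k_ : nat -> plane -> R) w : kseq k_ -> intT w -> intT (fun x => w x ^+ 2) ->
  (forall n, intT (fun x => (moll (k_ n) w x - w x) ^+ 2)) /\
  \int[mu2]_x (moll (k_ n) w x - w x) ^+ 2 @[n --> \oo] --> 0.
Proof.
move=> kk wi w2i.
have mw := intg_meas wi.
have wwi : intT (fun x => w x * `|w x|).
  apply: (@intg_le _ _ _ mu2 setT measurableT _ _ _ _ w2i).
    by apply: measurable_funM => //; exact: measurableT_comp.
  by apply: aeW => x _; rewrite normrM normr_id -expr2 real_normK ?num_real.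
have H z (e : R) : (L1norm mu2 (fun x => w (x + z)%R * `|w (x + z)%R| - w x * `|w x|)%R <= e%:E ->
   \int[mu2]_x ((w (x + z) - w x) ^+ 2)%:E <= (2 * e)%:E)%E.
  move=> HN; apply: (@le_trans _ _ (2%:E * L1norm mu2 (fun x => w (x + z)%R * `|w (x + z)%R| - w x * `|w x|)%R)%E).
    have mD : measurable_fun [set: mplane] (fun x : mplane => w (x + z) * `|w (x + z)| - w x * `|w x|).
      apply: measurable_funB; last exact: (intg_meas wwi).
      exact: (meas_shift z (intg_meas wwi)).
    rewrite /L1norm -ge0_integralZl//; last first.
      by apply/measurable_EFinP; exact: measurableT_comp.
    apply: ge0_le_integral => //.
    - by move=> x _; rewrite lee_fin sqr_ge0.
    - apply/measurable_EFinP; apply: measurable_funX; apply: measurable_funB => //; exact: meas_shift.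
    - apply/measurable_EFinP; apply: measurable_funM => //; exact: measurableT_comp.
    - by move=> x _; rewrite -EFinM lee_fin sqr_dist_le.
  by rewrite EFinM; apply: lee_wpmul2l => //; rewrite lee_fin.
have c2 : continuous (fun t : R => t ^+ 2) by exact: exprn_continuous.
have s2 (m t : R) : m ^+ 2 + (2 * m) * (t - m) <= t ^+ 2.
  by have := sqr_ge0 (t - m); rewrite !expr2; lra.
have mm n : measurable_fun [set: mplane] (fun x => (moll (k_ n) w x - w x) ^+ 2).
  have [c [r [kn sub]]] := kk n; have [sk k0 kb k1] := kn; have ck := csupp_ball kb.
  apply: measurable_funX; apply: measurable_funB => //.
  by apply: continuous_measurable2; exact: moll_continuous.
have i2 n : intT (fun x => (moll (k_ n) w x - w x) ^+ 2).
  have [c [r [kn sub]]] := kk n.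
  have fin : (L1norm mu2 (fun x => w x * `|w x|)%R < +oo)%E by have /intgP[] := wwi.
  apply/intgP; split => //.
  under eq_integral do rewrite ger0_norm ?sqr_ge0//.
  pose B := fine (L1norm mu2 (fun x => w x * `|w x|)%R).
  have BE : L1norm mu2 (fun x => w x * `|w x|)%R = B%:E.
    by rewrite /B fineK// ge0_fin_numE// L1norm_ge0.
  have B0 : 0 <= B by rewrite -lee_fin -BE L1norm_ge0.
  apply: (@le_lt_trans _ _ (2 * (B + B))%:E); last exact: ltry.
  apply: (@moll_convex_le (fun t => t ^+ 2) (fun m => 2 * m) _ c r) => //.
  - by move=> t; exact: sqr_ge0.
  - by rewrite mulr_ge0// addr_ge0.
  move=> z _; apply: H.
  have mww := intg_meas wwi.
  have mwz := meas_shift z mww.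
  rewrite EFinD -BE; apply: le_trans.
    apply: (@le_trans _ _ (L1norm mu2 ((fun x => w (x + z) * `|w (x + z)|) \+ (fun x => - (w x * `|w x|))))).
      by [].
    by apply: L1normD => //; exact: measurable_funN.
  apply: leeD.
    have := @L1norm_comp _ _ _ mu2 _ (fun (h x : plane) => (x + h)) measurable_fun_shift lebesgue2_shift _ z mww.
    by rewrite /= => <-.
  by rewrite /L1norm; under eq_integral do rewrite normrN.
split => //.
apply/cvgrPdist_le => e e0.
have e2 : 0 < e / 2 by rewrite divr_gt0.
have /nbhs_ballP[d /= d0 Hd] := transl_cont_plane wwi e2.
near=> n.
have [c [r [kn sub]]] := kk n.
have dn : n.+1%:R^-1 <= d by apply: ltW; near: n; exact: (near_infty_natSinv_lt (PosNum d0)).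
rewrite sub0r normrN ger0_norm; last by apply: Rintegral_ge0 => x _; exact: sqr_ge0.
rewrite -lee_fin -(@Rint_EFin _ _ _ mu2 setT measurableT _ (i2 n)).
apply: (@moll_convex_le (fun t => t ^+ 2) (fun m => 2 * m) e c r) => //.
- by move=> t; exact: sqr_ge0.
- exact: ltW.
- move=> z bz; rewrite (_ : e = 2 * (e / 2)); last by field.
  by apply: H; apply: Hd; apply: le_ball dn _ _; exact: sub.
Unshelve. all: by end_near. Qed.

Lemma exists_kseq : exists k_ : nat -> plane -> R, kseq k_ /\ forall n, is_kernel 0 (n.+1%:R^-1) (k_ n).
Proof.
have H n : exists k : plane -> R, is_kernel 0 (n.+1%:R^-1) k by apply: exists_kernel.
have [k_ Hk] := choice H; exists k_; split => // n.
by exists 0, (n.+1%:R^-1); split; [exact: Hk|].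
Qed.

End MollCvg.

(** * Integration by parts on the plane *)

Section IBP.
Context {R : realType}.
Local Notation plane := (R * R)%type.
Local Notation mplane := (measurableTypeR R * measurableTypeR R)%type.
Local Notation mu2 := (@lebesgue2 R).
Local Notation leb := (@lebesgue_measure R).

Lemma continuous_plane (T : topologicalType) (f g : T -> R) :
  continuous f -> continuous g -> continuous (fun t => (f t, g t) : plane).
Proof.
by move=> cf cg x; apply: (@cvg_pair _ _ _ _ (nbhs (f x)) (nbhs (g x))); [exact: cf|exact: cg].
Qed.

Lemma planeP (a b : plane) : a.1 = b.1 -> a.2 = b.2 -> a = b.
Proof. by case: a b => a1 a2 [b1 b2] /= -> ->. Qed.

Lemma fstD (a b : plane) : (a + b).1 = a.1 + b.1. Proof. by []. Qed.
Lemma sndD (a b : plane) : (a + b).2 = a.2 + b.2. Proof. by []. Qed.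
Lemma fstZ (k : R) (a : plane) : (k *: a).1 = k * a.1. Proof. by []. Qed.
Lemma sndZ (k : R) (a : plane) : (k *: a).2 = k * a.2. Proof. by []. Qed.

Lemma FTC_Rint (F dF : R -> R) (a b : R) : a < b -> continuous dF ->
  (forall t : R, is_derive t 1 F (dF t)) -> \int[leb]_(t in `[a, b]) dF t = F b - F a.
Proof.
move=> ab cdF dFF.
have cF : continuous F.
  by move=> t; apply: differentiable_continuous; apply/derivable1_diffP; have [] := dFF t.
rewrite /Rintegral (@continuous_FTC2 _ dF F a b ab)//.
- exact: continuous_subspaceT.
- split; first by move=> t _; have [] := dFF t.
  + by apply: cvg_at_right_filter; exact: cF.
  + by apply: cvg_at_left_filter; exact: cF.
- by move=> t _; rewrite derive1E; have [] := dFF t.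
Qed.

Lemma cont_int_itv (dF : R -> R) (a b : R) : continuous dF -> leb.-integrable `[a, b] (EFin \o dF).
Proof.
move=> c; apply: continuous_compact_integrable; first exact: segment_compact.
exact: continuous_subspaceT.
Qed.

Lemma supp_int (dF : R -> R) (n : R) : continuous dF -> (forall t : R, n < `|t| -> dF t = 0) ->
  leb.-integrable setT (EFin \o dF) /\
  \int[leb]_t dF t = \int[leb]_(t in `[(- n), n]) dF t.
Proof.
move=> c dF0.
have E : dF \_ `[(- n), n]%classic = dF.
  apply/funext => t; rewrite patchE; case: ifPn => // /negP.
  rewrite inE/= in_itv/= => /negP; rewrite -ler_norml -ltNge => h.
  by rewrite dF0.
split.
  have := cont_int_itv (- n) n c.
  move=> /(proj1 (@integrable_mkcond _ _ R leb `[(- n), n]%classic (EFin \o dF) (measurable_itv _))).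
  by rewrite restrict_EFin E.
by rewrite [RHS]Rintegral_mkcond E.
Qed.

Lemma FTC_supp (F dF : R -> R) (n : R) : continuous dF ->
  (forall t : R, is_derive t 1 F (dF t)) -> (forall t : R, n < `|t| -> F t = 0) ->
  (forall t : R, n < `|t| -> dF t = 0) -> \int[leb]_t dF t = 0.
Proof.
move=> c dFF F0 dF0.
pose m := `|n| + 1.
have nm : n < m by rewrite /m ltr_pwDr// ler_norm.
have m0 : 0 < m by rewrite /m ltr_wpDl.
have dF0' t : m < `|t| -> dF t = 0 by move=> mt; apply: dF0; exact: lt_trans mt.
have [_ ->] := supp_int c dF0'.
rewrite (FTC_Rint _ c dFF); last by lra.
by rewrite !F0 ?subrr// ?normrN gtr0_norm.
Qed.

(** Fubini with the inner integral along v, and the fundamental theorem of calculus on each line,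
    where the function vanishes near both ends. *)
Lemma Rint_derive0 (H : plane -> R) (v : plane) : (v = e1 \/ v = e2) ->
  (forall x, derivable H x v) -> continuous ('D_v H) -> csupp H ->
  \int[mu2]_x 'D_v H x = 0.
Proof.
move=> ve dH cD sH.
have sD := csupp_D v sH.
have iD := csupp_integrable cD sD.
have [n Hn] := sH.
have Dn x : ~ box n x -> 'D_v H x = 0.
  move=> nbx; apply: derive_near0.
  have oC : open (~` box n) by rewrite openC; apply: compact_closed2; exact: box_compact.
  by apply: filterS (open_nbhs_nbhs (conj oC nbx)) => y; exact: Hn.
have nb1 (x y : R) : n < `|x| -> ~ box n (x, y).
  by move=> nx -[]; rewrite /= in_itv/= -ler_norml leNgt nx.
have nb2 (x y : R) : n < `|y| -> ~ box n (x, y).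
  by move=> nx -[_]; rewrite /= in_itv/= -ler_norml leNgt nx.
case: ve => ve; subst v.
- have A (y h x s : R) : (h *: s + x, y) = h *: (s *: (e1 : plane)) + (x, y) :> plane.
    by apply: planeP; rewrite !(fstD, fstZ, sndD, sndZ) /= -?[h *: s]/(h * s); ring.
  rewrite /Rintegral -(@integral21_prod_meas1 _ _ _ _ R leb leb _ iD).
  rewrite /fubini_G integral0_eq// => y _.
  have := @FTC_supp (fun t => H (t, y)) (fun t => 'D_e1 H (t, y)) n.
  rewrite /Rintegral => E.
  have cc : continuous (fun t : R => 'D_e1 H (t, y)).
    move=> t; apply: (@continuous_comp _ _ _ (fun t : R => (t, y)) ('D_e1 H)); last exact: cD.
    apply: (@continuous_plane R (fun t => t) (fun=> y)) => ?; [exact: cvg_id|exact: cvg_cst].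
  have [i1 _] := @supp_int _ n cc (fun t nt => Dn _ (nb1 t y nt)).
  have dd (t : R) : is_derive t 1 (fun t => H (t, y)) ('D_e1 H (t, y)).
    apply: DeriveDef.
      have := @derivable_affine R R _ (fun t : R => (t, y) : plane) _ (A y) H t 1.
      by rewrite scale1r; apply.
    by rewrite -[LHS]/('D_1 (H \o (fun t : R => (t, y) : plane)) t) (derive_affine (A y)) scale1r.
  have E0 := E cc dd (fun t nt => Hn _ (nb1 t y nt)) (fun t nt => Dn _ (nb1 t y nt)).
  etransitivity; first exact/esym/(fineK (integrable_fin_num measurableT i1)).
  by congr EFin.
- have A (x h y s : R) : (x, h *: s + y) = h *: (s *: (e2 : plane)) + (x, y) :> plane.
    by apply: planeP; rewrite !(fstD, fstZ, sndD, sndZ) /= -?[h *: s]/(h * s); ring.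
  rewrite /Rintegral -(@integral12_prod_meas1 _ _ _ _ R leb leb _ iD).
  rewrite /fubini_F integral0_eq// => x _.
  have := @FTC_supp (fun t => H (x, t)) (fun t => 'D_e2 H (x, t)) n.
  rewrite /Rintegral => E.
  have cc : continuous (fun t : R => 'D_e2 H (x, t)).
    move=> t; apply: (@continuous_comp _ _ _ (fun t : R => (x, t)) ('D_e2 H)); last exact: cD.
    apply: (@continuous_plane R (fun=> x) (fun t => t)) => ?; [exact: cvg_cst|exact: cvg_id].
  have [i1 _] := @supp_int _ n cc (fun t nt => Dn _ (nb2 x t nt)).
  have dd (t : R) : is_derive t 1 (fun t => H (x, t)) ('D_e2 H (x, t)).
    apply: DeriveDef.
      have := @derivable_affine R R _ (fun t : R => (x, t) : plane) _ (A x) H t 1.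
      by rewrite scale1r; apply.
    by rewrite -[LHS]/('D_1 (H \o (fun t : R => (x, t) : plane)) t) (derive_affine (A x)) scale1r.
  have E0 := E cc dd (fun t nt => Hn _ (nb2 x t nt)) (fun t nt => Dn _ (nb2 x t nt)).
  etransitivity; first exact/esym/(fineK (integrable_fin_num measurableT i1)).
  by congr EFin.
Qed.

End IBP.

(** * Weak derivatives *)

Section C11.
Context {R : realType}.
Implicit Types (F f : R -> R) (C : R).

(* With a Taylor bound uniform over the line, the chain rule passes to L^1 limits
   of mollified functions without smoothing F. *)
Definition c11 F f C := [/\ 0 <= C, forall x y, `|F y - F x - f x * (y - x)| <= C * (y - x) ^+ 2,
  forall x, `|f x| <= C & forall x y, `|f y - f x| <= C * `|y - x|].

Lemma c11_is_derive F f C (x : R) : c11 F f C -> is_derive x 1 F (f x).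
Proof.
move=> [C0 T _ _]; apply: (@is_derive_quad _ _ _ _ C 1) => // h _.
by have := T x (x + h); rewrite (_ : x + h - x = h)//; ring.
Qed.

Lemma c11_lip F f C : c11 F f C -> forall x y, `|F y - F x| <= C * `|y - x|.
Proof.
move=> c x y; wlog xy : x y / x < y => [H|].
  have [|yx|->] := ltgtP x y; [exact: H| |by rewrite !subrr normr0 mulr0].
  by rewrite distrC [`|y - x|]distrC; exact: H.
have cF : continuous F.
  move=> t; apply: differentiable_continuous; apply/derivable1_diffP.
  by have [] := c11_is_derive t c.
have [z _ ->] := MVT xy (fun t _ => c11_is_derive t c) (continuous_subspaceT cF).
by rewrite normrM ler_wpM2r//; case: c.
Qed.

Lemma c11_continuous F f C : c11 F f C -> continuous F.
Proof.
move=> c t; apply: differentiable_continuous; apply/derivable1_diffP.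
by have [] := c11_is_derive t c.
Qed.

Lemma c11_continuous_d F f C : c11 F f C -> continuous f.
Proof.
move=> [C0 _ _ L] x; apply/cvgrPdist_le => e e0.
near=> y.
rewrite distrC (le_trans (L x y))//.
have : `|y - x| <= e / (C + 1).
  rewrite distrC; near: y; apply: cvgr_dist_le; first exact: cvg_id.
  by rewrite divr_gt0// ltr_wpDl.
rewrite ler_pdivlMr ?ltr_wpDl// => h; apply: le_trans h.
by rewrite mulrC ler_wpM2l// lerDl.
Unshelve. all: by end_near. Qed.

Lemma c11_id : c11 id (fun=> 1) 1.
Proof.
split=> // [x y|x|x y]; rewrite ?normr1//; last by rewrite subrr normr0 mulr_ge0.
by rewrite mul1r subrr normr0 mul1r sqr_ge0.
Qed.

Lemma c11_cst k : c11 (fun=> k) (fun=> 0) 0.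
Proof.
by split=> // [x y|x|x y]; rewrite ?mul0r ?subrr ?sub0r ?oppr0 ?normr0.
Qed.

Lemma c11_D F f C G g D : c11 F f C -> c11 G g D ->
  c11 (fun x => F x + G x) (fun x => f x + g x) (C + D).
Proof.
move=> [C0 T1 B1 L1] [D0 T2 B2 L2]; split; first exact: addr_ge0.
- move=> x y; rewrite (_ : _ - _ = (F y - F x - f x * (y - x)) + (G y - G x - g x * (y - x))); last by ring.
  by rewrite (le_trans (ler_normD _ _))// mulrDl lerD.
- by move=> x; rewrite (le_trans (ler_normD _ _))// lerD.
- move=> x y; rewrite (_ : _ - _ = (f y - f x) + (g y - g x)); last by ring.
  by rewrite (le_trans (ler_normD _ _))// mulrDl lerD.
Qed.

Lemma c11_Z (a : R) F f C : c11 F f C -> c11 (fun x => a * F x) (fun x => a * f x) (`|a| * C).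
Proof.
move=> [C0 T1 B1 L1]; split; first exact: mulr_ge0.
- move=> x y; rewrite (_ : _ - _ = a * (F y - F x - f x * (y - x))); last by ring.
  by rewrite normrM -mulrA ler_wpM2l.
- by move=> x; rewrite normrM ler_wpM2l.
- move=> x y; rewrite (_ : _ - _ = a * (f y - f x)); last by ring.
  by rewrite normrM -mulrA ler_wpM2l.
Qed.

Lemma c11_refl F f C : c11 F f C -> c11 (fun x => F (- x)) (fun x => - f (- x)) C.
Proof.
move=> [C0 T1 B1 L1]; split => //.
- move=> x y; have := T1 (- x) (- y).
  rewrite (_ : - y - - x = - (y - x)); last by ring.
  by rewrite sqrrN mulrN mulNr.
- by move=> x; rewrite normrN.
- move=> x y; have := L1 (- x) (- y).
  rewrite (_ : - y - - x = - (y - x)); last by ring.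
  by rewrite normrN -opprD normrN.
Qed.

Definition pos (t : R) := Num.max t 0.
(** A primitive of [ramp a w], which is 0 up to a, climbs with slope 1 and stays at w from a + w on.
    The truncations and comparison functions below are combinations of such primitives. *)
Definition ramp_prim (a w t : R) := (pos (t - a) ^+ 2 - pos (t - a - w) ^+ 2) / 2.
Definition ramp (a w t : R) := pos (t - a) - pos (t - a - w).

Lemma posE t : pos t = if 0 <= t then t else 0.
Proof. by rewrite /pos maxEle; case: (ltgtP 0 t) => [h|h|<-] //; rewrite ?(ltW h)// leNgt h. Qed.

(** The square of [pos] is convex and its derivative 2 [pos] is 2-Lipschitz. *)
Lemma pos_taylor x y : 0 <= pos y ^+ 2 - pos x ^+ 2 - 2 * pos x * (y - x) <= (y - x) ^+ 2.
Proof.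
have h := sqr_ge0 (y - x); have hy := sqr_ge0 y; have hx := sqr_ge0 x.
rewrite !posE; have [x0|x0] := leP 0 x; have [y0|y0] := leP 0 y.
- by apply/andP; split; lra.
- by have hxy : 0 <= x * - y; [apply: mulr_ge0; lra|apply/andP; split; lra].
- by have hxy : 0 <= y * - x; [apply: mulr_ge0; lra|apply/andP; split; lra].
- by apply/andP; split; lra.
Qed.

Lemma pos_lip x y : `|pos y - pos x| <= `|y - x|.
Proof.
rewrite !posE; have [x0|x0] := leP 0 x; have [y0|y0] := leP 0 y => //.
- by rewrite ler0_norm ?ler0_norm; lra.
- by rewrite ger0_norm ?ger0_norm; lra.
- by rewrite subrr normr0.
Qed.

(** A single constant has to serve all the bounds of [c11]: w bounds the size of [ramp], and 2 its
    Lipschitz constant. *)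
Lemma c11_ramp (a w : R) : 0 <= w -> c11 (ramp_prim a w) (ramp a w) (w + 2).
Proof.
move=> w0; split; first exact: addr_ge0.
- move=> x y; rewrite /ramp_prim /ramp.
  have /andP[h1 h2] := pos_taylor (x - a) (y - a).
  have /andP[h3 h4] := pos_taylor (x - a - w) (y - a - w).
  rewrite (_ : y - a - w - (x - a - w) = y - x) in h3 h4; last by ring.
  rewrite (_ : y - a - (x - a) = y - x) in h1 h2; last by ring.
  have h5 := sqr_ge0 (y - x); have h6 : 0 <= w * (y - x) ^+ 2 by exact: mulr_ge0.
  by rewrite ler_norml; apply/andP; split; lra.
- move=> x; rewrite /ramp !posE; have [x0|x0] := leP 0 (x - a); have [y0|y0] := leP 0 (x - a - w);
    rewrite ler_norml; apply/andP; split; lra.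
- move=> x y; rewrite /ramp.
  have h1 := pos_lip (x - a) (y - a); have h2 := pos_lip (x - a - w) (y - a - w).
  rewrite (_ : y - a - w - (x - a - w) = y - x) in h2; last by ring.
  rewrite (_ : y - a - (x - a) = y - x) in h1; last by ring.
  rewrite (_ : _ - _ = (pos (y - a) - pos (x - a)) - (pos (y - a - w) - pos (x - a - w))); last by ring.
  apply: (le_trans (ler_normB _ _)).
  by have h3 : 0 <= w * `|y - x| by [rewrite mulr_ge0]; lra.
Qed.

Lemma c11_inv F f C m : 0 < m -> (forall x, m <= F x) -> c11 F f C ->
  exists D, c11 (fun x => (F x)^-1) (fun x => - (f x / F x ^+ 2)) D.
Proof.
move=> m0 Fm c; have [C0 T B L] := c; have lip := c11_lip c.
have F0 x : 0 < F x by exact: lt_le_trans (Fm x).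
have Fn0 x : F x != 0 by rewrite gt_eqF.
have iF x : (F x)^-1 <= m^-1 by rewrite lef_pV2 ?posrE.
have iF0 x : 0 <= (F x)^-1 by rewrite invr_ge0 ltW.
have i0 : 0 <= m^-1 by rewrite invr_ge0 ltW.
(* [D1] bounds the Taylor remainder and [D2] the variation of the derivative, term by term in the
   two field identities below. *)
pose D1 := C ^+ 2 * m^-1 ^+ 3 + C * m^-1 ^+ 2.
pose D2 := C * m^-1 ^+ 2 + 2 * C ^+ 2 * m^-1 ^+ 3.
have D10 : 0 <= D1 by rewrite addr_ge0// mulr_ge0 ?exprn_ge0.
have D20 : 0 <= D2 by rewrite addr_ge0// ?mulr_ge0 ?exprn_ge0.
have i2 x : (F x)^-1 ^+ 2 <= m^-1 ^+ 2 by rewrite lerXn2r ?nnegrE.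
exists (D1 + D2); split; first exact: addr_ge0.
- move=> x y.
  have -> : (F y)^-1 - (F x)^-1 - - (f x / F x ^+ 2) * (y - x) =
     (F y - F x) ^+ 2 * ((F x)^-1 ^+ 2 * (F y)^-1) - (F y - F x - f x * (y - x)) * (F x)^-1 ^+ 2.
    by field; rewrite !Fn0.
  apply: (@le_trans _ _ (D1 * (y - x) ^+ 2)); last by rewrite ler_wpM2r ?sqr_ge0// lerDl.
  apply: (le_trans (ler_normB _ _)); rewrite /D1 [leRHS]mulrDl; apply: lerD.
    have g1 : (F y - F x) ^+ 2 <= C ^+ 2 * (y - x) ^+ 2.
      rewrite -(real_normK (num_real (F y - F x))) -(real_normK (num_real (y - x))) -exprMn.
      by rewrite lerXn2r ?nnegrE ?mulr_ge0.
    have g2 : (F x)^-1 ^+ 2 * (F y)^-1 <= m^-1 ^+ 3.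
      by rewrite [m^-1 ^+ 3]exprSr; apply: ler_pM; rewrite ?sqr_ge0.
    have g3 : 0 <= (F x)^-1 ^+ 2 * (F y)^-1 by rewrite mulr_ge0 ?sqr_ge0.
    rewrite normrM [X in X * _]ger0_norm ?sqr_ge0// [X in _ * X]ger0_norm//.
    by rewrite [leRHS]mulrAC; apply: ler_pM; rewrite ?sqr_ge0.
  rewrite normrM [`|(F x)^-1 ^+ 2|]ger0_norm ?sqr_ge0// mulrAC.
  by apply: ler_pM; rewrite ?sqr_ge0.
- move=> x; rewrite normrN normrM -exprVn [`|_ ^+ 2|]ger0_norm ?sqr_ge0//.
  apply: (@le_trans _ _ (C * m^-1 ^+ 2)); first by apply: ler_pM; rewrite ?sqr_ge0.
  by rewrite /D1 /D2; have : 0 <= C ^+ 2 * m^-1 ^+ 3; [rewrite mulr_ge0 ?exprn_ge0|have : 0 <= C * m^-1 ^+ 2; [rewrite mulr_ge0 ?exprn_ge0|lra]].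
- move=> x y.
  have -> : - (f y / F y ^+ 2) - - (f x / F x ^+ 2) =
     - ((f y - f x) * (F y)^-1 ^+ 2) + f x * (F y - F x) * ((F x)^-1 * (F y)^-1 * ((F x)^-1 + (F y)^-1)).
    by field; rewrite !Fn0.
  apply: (@le_trans _ _ (D2 * `|y - x|)); last by rewrite ler_wpM2r// lerDr.
  apply: (le_trans (ler_normD _ _)); rewrite /D2 [leRHS]mulrDl; apply: lerD.
    rewrite normrN normrM [`|(F y)^-1 ^+ 2|]ger0_norm ?sqr_ge0// mulrAC.
    by apply: ler_pM; rewrite ?sqr_ge0.
  have h : 0 <= (F x)^-1 * (F y)^-1 * ((F x)^-1 + (F y)^-1) <= 2 * m^-1 ^+ 3.
    apply/andP; split; first by rewrite !mulr_ge0 ?addr_ge0.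
    rewrite (_ : 2 * m^-1 ^+ 3 = m^-1 * m^-1 * (m^-1 + m^-1)); last by ring.
    by apply: ler_pM; rewrite ?mulr_ge0 ?addr_ge0// ?lerD//; apply: ler_pM.
  have /andP[h1 h2] := h.
  rewrite normrM [X in _ * X]ger0_norm// normrM.
  rewrite (_ : 2 * C ^+ 2 * m^-1 ^+ 3 * `|y - x| = C * (C * `|y - x|) * (2 * m^-1 ^+ 3)); last by ring.
  by apply: ler_pM => //; rewrite ?mulr_ge0//; apply: ler_pM.
Qed.

Lemma c11_eq F f G g C : F =1 G -> f =1 g -> c11 F f C -> c11 G g C.
Proof. by move=> /funext -> /funext ->. Qed.

(** For M >= 0 this is odd, the identity on [-M, M], and constant of modulus M + 1/2 beyond M + 1;
    its derivative falls linearly from 1 to 0 in between. *)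
Definition trunc (M t : R) := t - ramp_prim M 1 t + ramp_prim M 1 (- t).
Definition trunc' (M t : R) := 1 - ramp M 1 t - ramp M 1 (- t).

Lemma c11_trunc M : exists C, c11 (trunc M) (trunc' M) C.
Proof.
have h := c11_ramp M ler01.
exists (1 + `|-1| * (1 + 2) + (1 + 2)).
apply: c11_eq (c11_D (c11_D c11_id (c11_Z (-1) h)) (c11_refl h)) => x.
  by rewrite /trunc; ring.
by rewrite /trunc'; ring.
Qed.

Lemma trunc_id M t : `|t| <= M -> trunc M t = t /\ trunc' M t = 1.
Proof.
rewrite ler_norml => /andP[h1 h2]; rewrite /trunc /trunc' /ramp_prim /ramp !posE.
have [a1|a1] := leP 0 (t - M); have [a2|a2] := leP 0 (t - M - 1);
have [a3|a3] := leP 0 (- t - M); have [a4|a4] := leP 0 (- t - M - 1); split; try lra; nra.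
Qed.

Lemma trunc_opp M t : trunc M (- t) = - trunc M t /\ trunc' M (- t) = trunc' M t.
Proof. by rewrite /trunc /trunc' opprK; split; ring. Qed.

Lemma trunc_ge0 M t : 0 <= M -> 0 <= t ->
  [/\ 0 <= trunc M t <= t, trunc M t <= M + 1 & 0 <= trunc' M t <= 1].
Proof.
move=> M0 t0; rewrite /trunc /trunc' /ramp_prim /ramp !posE.
rewrite (_ : (if 0 <= - t - M then _ else 0) = 0); last by case: ifP => // ?; lra.
rewrite (_ : (if 0 <= - t - M - 1 then _ else 0) = 0); last by case: ifP => // ?; lra.
have [a1|a1] := leP 0 (t - M); have [a2|a2] := leP 0 (t - M - 1); split;
  try (apply/andP; split); try lra; nra.
Qed.

Lemma trunc_le M t : 0 <= M -> [/\ `|trunc M t| <= `|t|, `|trunc M t| <= M + 1 & 0 <= trunc' M t <= 1].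
Proof.
move=> M0; wlog t0 : t / 0 <= t => [H|].
  have [|t0] := leP 0 t; first exact: H.
  have [h1 h2 h3] := H (- t) (ltac:(lra)); have [e1 e2] := trunc_opp M t.
  by rewrite e1 !normrN in h1 h2; rewrite e2 in h3.
have [/andP[h1 h2] h3 h4] := trunc_ge0 M0 t0.
by rewrite !ger0_norm.
Qed.

Lemma c11_scale F f C a : c11 F f C -> c11 (fun x => F (a * x)) (fun x => a * f (a * x)) (C * (`|a| + a ^+ 2)).
Proof.
move=> [C0 T1 B1 L1]; split.
- by rewrite mulr_ge0// addr_ge0// sqr_ge0.
- move=> x y; have := T1 (a * x) (a * y).
  rewrite (_ : f (a * x) * (a * y - a * x) = a * f (a * x) * (y - x)); last by ring.
  move=> h; apply: (le_trans h).
  rewrite -mulrBr exprMn mulrA; apply: ler_wpM2r; first exact: sqr_ge0.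
  by apply: ler_wpM2l => //; rewrite lerDr.
- move=> x; rewrite normrM mulrC; apply: ler_pM => //.
  by rewrite lerDl sqr_ge0.
- move=> x y; rewrite -mulrBr normrM.
  apply: (@le_trans _ _ (`|a| * (C * `|a * y - a * x|))); first by rewrite ler_wpM2l.
  have -> : `|a| * (C * `|a * y - a * x|) = C * (`|a| ^+ 2) * `|y - x|.
    by rewrite -mulrBr normrM; ring.
  rewrite real_normK ?num_real//; apply: ler_wpM2r => //; apply: ler_wpM2l => //.
  by rewrite lerDr.
Qed.

(* [lower b] is a C^{1,1} substitute for t |-> max t b: it is the identity
   above b, raises positive values below b, and is at least b / 2. *)
Definition lower1 (t : R) := t + ramp_prim (- 1) 1 (- t).
Definition lower1' (t : R) := 1 - ramp (- 1) 1 (- t).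
Definition lower (b t : R) := b * lower1 (b^-1 * t).
Definition lower' (b t : R) := b * (b^-1 * lower1' (b^-1 * t)).

Lemma c11_lower b : exists C, c11 (lower b) (lower' b) C.
Proof.
have h := c11_D c11_id (c11_refl (c11_ramp (- 1) (ler01 : (0:R) <= 1))).
by eexists; exact: (c11_Z b (c11_scale b^-1 h)).
Qed.

Lemma lower1_props t : [/\ 1 <= t -> lower1 t = t, 0 < t < 1 -> t < lower1 t <= 1,
  2^-1 <= lower1 t & 0 <= lower1' t <= 1].
Proof.
rewrite /lower1 /lower1' /ramp_prim /ramp !posE.
have [a1|a1] := leP 0 (- t - - 1); have [a2|a2] := leP 0 (- t - - 1 - 1); split;
 try move=> /andP[h1 h2]; try move=> h; try (apply/andP; split); try lra; nra.
Qed.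

Lemma lower_props b t : 0 < b -> [/\ b <= t -> lower b t = t, 0 < t < b -> t < lower b t <= b,
  b / 2 <= lower b t & 0 <= lower' b t <= 1].
Proof.
move=> b0; have bn0 : b != 0 by rewrite gt_eqF.
have [h1 h2 h3 h4] := lower1_props (b^-1 * t).
have tE : b * (b^-1 * t) = t by rewrite mulrA divff// mul1r.
rewrite /lower /lower'; split.
- by move=> bt; rewrite h1 ?tE// ler_pdivlMl// mulr1.
- move=> /andP[t0 tb].
  have /andP[h5 h6] : b^-1 * t < lower1 (b^-1 * t) <= 1.
    by apply: h2; rewrite mulr_gt0 ?invr_gt0//= ltr_pdivrMl// mulr1.
  by rewrite -{1}tE ltr_pM2l// h5/= ler_piMr// ltW.
- by rewrite ler_pM2l.
- by rewrite mulrA divff// mul1r.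
Qed.

(* Equal to t^2 on [-M, M]: the product rule follows from the chain rule by
   polarization. *)
Definition sqr_cut (M t : R) := 2 * ramp_prim (- M) (2 * M) t + (- (2 * M)) * t + - M ^+ 2.
Definition sqr_cut' (M t : R) := 2 * ramp (- M) (2 * M) t + (- (2 * M)) * 1 + 0.

Lemma c11_sqr_cut M : 0 <= M -> exists C, c11 (sqr_cut M) (sqr_cut' M) C.
Proof.
move=> M0; have h := c11_ramp (- M) (mulr_ge0 (ler0n R 2) M0).
eexists; exact: (c11_D (c11_D (c11_Z 2 h) (c11_Z (- (2 * M)) c11_id)) (c11_cst (- M ^+ 2))).
Qed.

Lemma sqr_cutE M t : `|t| <= M -> sqr_cut M t = t ^+ 2 /\ sqr_cut' M t = 2 * t.
Proof.
rewrite ler_norml => /andP[h1 h2]; rewrite /sqr_cut /sqr_cut' /ramp_prim /ramp !posE.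
have [a1|a1] := leP 0 (t - - M); have [a2|a2] := leP 0 (t - - M - 2 * M); split; try lra; nra.
Qed.

End C11.

Section AE2.
Context {R : realType}.
Local Notation plane := (R * R)%type.
Local Notation mplane := (measurableTypeR R * measurableTypeR R)%type.
Local Notation mu2 := (@lebesgue2 R).
Implicit Types (P Q S : plane -> Prop).

Lemma ae2S P Q : (forall x, P x -> Q x) ->
  {ae mu2, forall x, P x} -> {ae mu2, forall x, Q x}.
Proof. exact: (@filterS mplane (almost_everywhere mu2) _ P Q). Qed.

Lemma ae2S2 P Q S : (forall x, P x -> Q x -> S x) ->
  {ae mu2, forall x, P x} -> {ae mu2, forall x, Q x} -> {ae mu2, forall x, S x}.
Proof. exact: (@filterS2 mplane (almost_everywhere mu2) _ P Q S). Qed.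

Lemma ae2S3 P Q S P3 : (forall x, P x -> Q x -> S x -> P3 x) ->
  {ae mu2, forall x, P x} -> {ae mu2, forall x, Q x} -> {ae mu2, forall x, S x} ->
  {ae mu2, forall x, P3 x}.
Proof. exact: (@filterS3 mplane (almost_everywhere mu2) _ P Q S P3). Qed.

End AE2.

Section Pairing.
Context d (T : measurableType d) (R : realType).
Variable mu : {measure set T -> \bar R}.
Variable D : set T.
Hypothesis mD : measurable D.
Local Notation intg f := (mu.-integrable D (EFin \o f)).
Local Notation I f := (\int[mu]_(x in D) f x).

Lemma cut_cvg0 (g : T -> R) : intg g -> I (fun x => pos (`|g x| - n%:R)) @[n --> \oo] --> 0.
Proof.
move=> gi; have mg := intg_meas gi.
have mp (n : nat) : measurable_fun D (fun x => pos (`|g x| - n%:R)).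
  apply: measurable_maxr => //; apply: measurable_funB => //.
  exact: measurableT_comp.
have := @Rint_dct _ _ _ mu D mD (fun n x => pos (`|g x| - n%:R)) (fun=> 0) (fun x => `|g x|) mp _ _ (intg_norm gi).
move=> [].
- by [].
- apply: aeW => x _; apply: (@cvg_near_cst).
  near=> n.
  have : `|g x| < n%:R by near: n; exact: nbhs_infty_gtr.
  by rewrite posE => h; case: ifP => //; rewrite subr_ge0 leNgt h.
- apply: aeW => x _ n; rewrite posE; case: ifP => h; last by rewrite normr0.
  by rewrite ger0_norm// gerBl.
move=> _; suff -> : I (fun=> 0) = 0 by [].
by rewrite /Rintegral integral0.
Unshelve. all: by end_near. Qed.

(** Cut g at height A: the excess over A is small in L^1 and meets the uniform bound C, while the
    rest is at most A and meets the L^1 convergence. This spares the extraction of an almost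
    everywhere convergent subsequence. *)
Lemma pairing_cvg0 (g : T -> R) (m_ : nat -> T -> R) (C : R) : 0 <= C -> intg g -> (forall n, intg (m_ n)) ->
  (forall n x, `|m_ n x| <= C) -> I (fun x => `|m_ n x|) @[n --> \oo] --> 0 ->
  I (fun x => g x * m_ n x) @[n --> \oo] --> 0.
Proof.
move=> C0 gi mi mC m0.
have mg := intg_meas gi.
have igm n : intg (fun x => g x * m_ n x).
  have := @intg_bndM _ _ _ mu D mD (m_ n) g C (intg_meas (mi n)) (aeW _ (fun x _ => mC n x)) gi.
  by apply: eq_integrable => // x _; rewrite /= mulrC.
apply/cvgrPdist_le => e e0.
have e1 : 0 < e / 2 / (C + 1) by rewrite !divr_gt0// ltr_wpDl.
have /cvgrPdist_le/(_ _ e1)[A _ HA] := cut_cvg0 gi.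
have := HA A (leqnn A); rewrite /= sub0r normrN => hA.
have e3 : 0 < e / 2 / (A%:R + 1) by rewrite !divr_gt0// ltr_wpDl.
move/cvgrPdist_le: m0 => /(_ _ e3) m0.
near=> n.
have hm : I (fun x => `|m_ n x|) <= e / 2 / (A%:R + 1).
  apply: (le_trans (ler_norm _)); rewrite -normrN -sub0r.
  by near: n.
have mp : measurable_fun D (fun x => pos (`|g x| - A%:R)).
  apply: measurable_maxr => //; apply: measurable_funB => //.
  exact: measurableT_comp.
have ip : intg (fun x => pos (`|g x| - A%:R)).
  apply: (intg_le mD mp _ (intg_norm gi)); apply: aeW => x _; rewrite posE; case: ifP => h; last by rewrite normr0.
  by rewrite ger0_norm// gerBl.
rewrite sub0r normrN; apply: (le_trans (Rint_norm_le mD (igm n))).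
apply: (@le_trans _ _ (I (fun x => C * pos (`|g x| - A%:R) + A%:R * `|m_ n x|))).
  apply: le_Rintegral => //.
  - exact: intg_norm.
  - by apply: intgD => //; apply: intgZ => //; exact: intg_norm.
  - move=> x _; rewrite normrM.
    have h1 := mC n x; have h2 := normr_ge0 (m_ n x); have h3 := normr_ge0 (g x).
    rewrite posE; case: ifP => h4.
      by have := ler_wpM2r h4 h1; nra.
    by rewrite mulr0 add0r ler_wpM2r//; lra.
rewrite RintD//; [|by apply: intgZ|by apply: intgZ => //; exact: intg_norm].
rewrite !RintZ//; last exact: intg_norm.
rewrite [e]splitr; apply: lerD.
  rewrite mulrC; apply: (@le_trans _ _ (e / 2 / (C + 1) * C)).
    by apply: ler_wpM2r => //; apply: (le_trans _ hA); exact: ler_norm.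
  rewrite mulrAC ler_pdivrMr ?ltr_wpDl//; apply: ler_wpM2l; first by rewrite divr_ge0// ltW.
  by rewrite lerDl.
rewrite mulrC; apply: (@le_trans _ _ (e / 2 / (A%:R + 1) * A%:R)).
  by apply: ler_wpM2r.
rewrite mulrAC ler_pdivrMr ?ltr_wpDl//; apply: ler_wpM2l; first by rewrite divr_ge0// ltW.
by rewrite lerDl.
Unshelve. all: by end_near. Qed.

End Pairing.

(** * Local mollification and the fundamental lemma of the calculus of variations *)

Section Weak.
Context {R : realType}.
Local Notation plane := (R * R)%type.
Local Notation mplane := (measurableTypeR R * measurableTypeR R)%type.
Local Notation mu2 := (@lebesgue2 R).
Variable Omega : set plane.
Hypothesis oO : open Omega.
Hypothesis bO : bounded_set Omega.
Implicit Types (f g h k u w phi : plane -> R).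
Local Notation intT f := (mu2.-integrable [set: mplane] (EFin \o f)).
Local Notation intO f := (mu2.-integrable (Omega : set mplane) (EFin \o f)).
Local Notation IO f := (\int[mu2]_(x in Omega) f x).

Lemma mO : measurable (Omega : set mplane). Proof. exact: open_measurable2. Qed.
Lemma finO : (mu2 Omega < +oo)%E. Proof. by apply: bounded_fin => //; exact: mO. Qed.

Lemma test_csupp phi : test_function Omega phi -> csupp phi.
Proof.
move=> [_ [K [cK _ H]]].
have [n _ Kn] := bounded_box (compact_bounded cK).
by exists n => x nx; apply: H; apply: contra_not nx; exact: Kn.
Qed.

Lemma test_bounded phi : test_function Omega phi -> exists2 M, 0 < M & forall x, `|phi x| <= M.
Proof. by move=> tp; apply: csupp_smooth_bounded; [case: tp|exact: test_csupp]. Qed.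

Lemma test_D phi v : test_function Omega phi -> test_function Omega ('D_v phi).
Proof.
move=> [sp [K [cK KO H]]]; split; first exact: smooth_D.
exists K; split => // x nK; apply: derive_near0.
have oC : open (~` K) by rewrite openC; exact: compact_closed2.
by apply: filterS (open_nbhs_nbhs (conj oC nK)) => y; exact: H.
Qed.

Lemma test_meas phi : test_function Omega phi -> measurable_fun (Omega : set mplane) phi.
Proof. by move=> [sp _]; apply: measurable_funTS; exact: smooth_measurable. Qed.

Lemma loc_zext f (K : set plane) : loc_integrable Omega f -> compact K -> K `<=` Omega ->
  intT (f \_ K).
Proof.
move=> [_ Hf] cK KO; have := Hf K cK KO.
have mK : measurable (K : set mplane) by exact: compact_measurable2.
move=> /(proj1 (@integrable_mkcond _ mplane R mu2 K (EFin \o f) mK)).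
by rewrite restrict_EFin.
Qed.

Lemma loc_mul f phi : loc_integrable Omega f -> test_function Omega phi -> intO (fun x => f x * phi x).
Proof.
move=> lf tp; have [M M0 HM] := test_bounded tp; have [sp [K [cK KO H]]] := tp.
have iT := loc_zext lf cK KO.
have := @intg_bndM _ mplane _ mu2 setT measurableT phi _ M (smooth_measurable sp) (aeW _ (fun z _ => HM _)) iT.
move=> /(@integrableS _ mplane R mu2 setT Omega _ measurableT mO (@subsetT _ _)).
apply: eq_integrable; first exact: mO.
move=> x /set_mem Ox /=; rewrite patchE; case: ifPn => xK; first by rewrite mulrC.
by rewrite H ?mulr0 ?mul0r// => Kx; move: xK; rewrite mem_set.
Qed.

Lemma int_zext f phi (K : set plane) : K `<=` Omega -> (forall x, ~ K x -> phi x = 0) ->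
  IO (fun x => f x * phi x) = \int[mu2]_x ((f \_ K) x * phi x).
Proof.
move=> KO H; rewrite Rintegral_mkcond; congr (Rintegral _ _ _); apply/funext => x.
rewrite !patchE; case: ifPn => xO; case: ifPn => xK //.
- by rewrite H ?mulr0// => Kx; move: xK; rewrite mem_set.
- by move: xO; rewrite mem_set//; apply: KO; exact: set_mem.
- by rewrite mul0r.
Qed.

Lemma L2_loc f : L2 Omega f -> loc_integrable Omega f.
Proof.
move=> [mf f2]; split => // K cK KO.
apply: (@integrableS _ mplane R mu2 Omega K _ mO (compact_measurable2 cK) KO).
apply: (@intg_le _ mplane R mu2 Omega mO _ (fun x => 1 + f x ^+ 2)) => //.
  by apply: aeW => x _; rewrite -(real_normK (num_real (f x))); have := sqr_ge0 (`|f x| - 1); have := normr_ge0 (f x); nra.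
by apply: (@intgD _ mplane R mu2 Omega mO) => //; apply: intg_cst; [exact: mO|exact: finO].
Qed.

Lemma int_loc f : intO f -> loc_integrable Omega f.
Proof.
move=> fi; split; first exact: (intg_meas fi).
by move=> K cK KO; exact: (@integrableS _ mplane R mu2 Omega K _ mO (compact_measurable2 cK) KO).
Qed.

(** These sets are compact and exhaust an open [Omega] as n grows and r shrinks to 0. *)
Definition core (n r : R) : set plane := box n `&` [set x | ball x r `<=` Omega].

Lemma core_compact n r : compact (core n r).
Proof.
apply: (@subclosed_compact _ _ (box n)); last exact: subIsetl.
  apply: closedI; first by apply: compact_closed2; exact: box_compact.
  rewrite -openC openE => x /= nx.
  have [y [bxy nOy]] : exists y, ball x r y /\ ~ Omega y.
    by apply: contrapT => h; apply: nx => y bxy; apply: contrapT => nOy; apply: h; exists y.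
  have oB : open (ball y r) by exact: ball_open.
  have nb : nbhs x (ball y r) by apply: open_nbhs_nbhs; split => //; exact: ball_sym.
  by apply: filterS nb => z byz /= bz; apply: nOy; apply: bz; exact: ball_sym.
exact: box_compact.
Qed.

Lemma core_sub n r : 0 < r -> core n r `<=` Omega.
Proof. by move=> r0 x [_ /(_ x)]; apply; exact: ballxx. Qed.

(** Leaves room around [K]: mollification at scale r at a point of [K] involves only values on the
    compact set [K'], where locally integrable functions are integrable. *)
Lemma compact_core (K : set plane) : compact K -> K `<=` Omega ->
  exists K' r, [/\ 0 < r, compact K', K' `<=` Omega & forall x, K x -> ball x r `<=` K'].
Proof.
move=> cK KO.
have nc : near_covering K by apply/compact_near_coveringP.
have [d /= d0 Hd] : \forall d \near (0:R)^'+, K `<=` [set x | ball x d `<=` Omega].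
  have := nc R (0:R)^'+ (fun d x => ball x d `<=` Omega) _.
  move=> H0; apply: H0.
  move=> x Kx.
  have /nbhs_ballP[e /= e0 He] : nbhs x Omega by apply: open_nbhs_nbhs; split => //; exact: KO.
  have e2 : 0 < e / 2 by rewrite divr_gt0.
  exists (ball x (e / 2), [set d | d < e / 2]); first split => /=.
  - exact: nbhsx_ballx.
  - exact: nbhs_right_lt.
  - move=> [y d] /= [bxy de] z byz; apply: He; rewrite (splitr e).
    apply: (ball_triangle bxy); apply: le_ball byz; exact: ltW.
have d2 : 0 < d / 2 by rewrite divr_gt0.
have {}Hd : K `<=` [set x | ball x (d / 2) `<=` Omega].
  apply: Hd => //=; rewrite ?sub0r ?normrN ?gtr0_norm//.
  by rewrite ltr_pdivrMr// ltr_pMr// ltr1n.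
have [N N0 KN] := bounded_box (compact_bounded cK).
pose r := d / 2 / 2; have r0 : 0 < r by rewrite divr_gt0.
exists (core (N + r) r), r; split => //; [exact: core_compact|exact: core_sub|].
move=> x Kx y bxy; split.
  have := KN x Kx; move: x y {Kx} bxy => [x1 x2] [y1 y2] [/= b1 b2] [/=].
  rewrite !in_itv/= => /andP[? ?] /andP[? ?].
  move: b1 b2; rewrite /ball/= !ltr_norml => /andP[? ?] /andP[? ?].
  by split; rewrite /= in_itv/=; apply/andP; split; lra.
move=> z byz; apply: (Hd x Kx) => /=; rewrite (splitr (d / 2)).
exact: (ball_triangle bxy).
Qed.

Lemma smooth_shift k (x : plane) : smooth k -> smooth (fun z => k (z - x)).
Proof.
move=> sk; apply: (@smooth_affine _ _ _ (fun z : plane => z - x) id) sk.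
  by move=> h v z; rewrite addrA.
by move=> z; apply: cvgB; [exact: cvg_id|exact: cvg_cst].
Qed.

Lemma derive_shiftx k (x v z : plane) : 'D_v (fun z => k (z - x)) z = 'D_v k (z - x).
Proof.
have A (h : R) (v0 z0 : plane) : (h *: v0 + z0) - x = h *: v0 + (z0 - x) by rewrite addrA.
by rewrite -[LHS]/('D_v (k \o (fun z => z - x)) z) (@derive_affine _ _ _ (fun z => z - x) id).
Qed.

Section localmoll.
Variables (K' : set plane) (r : R) (c : plane) (s : R) (k : plane -> R).
Hypothesis cK' : compact K'.
Hypothesis KO' : K' `<=` Omega.
Hypothesis kk : is_kernel c s k.
Hypothesis bb : ball c s `<=` ball (0 : plane) r.

Lemma shift_supp x : ball x r `<=` K' -> forall z, ~ K' z -> k (z - x) = 0.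
Proof.
move=> xK z nz; have [_ _ kb _] := kk; apply: kb => /bb b0; apply: nz; apply: xK.
case: x z b0 => x1 x2 [z1 z2] [/= b1 b2]; split; move: b1 b2; rewrite /ball/=.
  by rewrite sub0r normrN distrC.
by rewrite !sub0r !normrN [`|x2 - z2|]distrC.
Qed.

Lemma shift_test x : ball x r `<=` K' -> test_function Omega (fun z => k (z - x)).
Proof.
move=> xK; have [sk _ _ _] := kk; split; first exact: smooth_shift.
by exists K'; split => //; exact: shift_supp.
Qed.

Lemma moll_loc f x : ball x r `<=` K' -> moll k (f \_ K') x = IO (fun z => f z * k (z - x)).
Proof. by move=> xK; rewrite (int_zext _ KO' (shift_supp xK)). Qed.

(** The shifted kernel is itself a test function, so the definition of the weak derivative applies
    to it. *)
Lemma moll_wd v f g x : weak_derivative Omega v f g -> ball x r `<=` K' ->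
  'D_v (moll k (f \_ K')) x = moll k (g \_ K') x.
Proof.
move=> [lf lg W] xK; have [sk k0 kb k1] := kk; have ck := csupp_ball kb.
have iT := loc_zext lf cK' KO'.
have [_ ->] := moll_is_derive x v sk ck iT.
have tk := shift_test xK.
rewrite moll_loc//.
have := W _ tk; under [X in X = _ -> _]eq_Rintegral do rewrite derive_shiftx.
have H0 z : ~ K' z -> 'D_v k (z - x) = 0.
  move=> nz; rewrite -derive_shiftx; apply: derive_near0.
  have oC : open (~` K') by rewrite openC; exact: compact_closed2.
  by apply: filterS (open_nbhs_nbhs (conj oC nz)) => y; exact: shift_supp.
rewrite (int_zext _ KO' H0) => E.
rewrite /moll; under eq_Rintegral do rewrite mulrN.
rewrite RintN//; first by rewrite E opprK.
exact: (moll_int x (smooth_D v sk) (csupp_D v ck) iT).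
Qed.

End localmoll.

(** On a compact set the mollifications of [f] vanish, being integrals of [f] against test
    functions, and they converge to [f] in L^1. *)
Lemma fundamental_lemma f : loc_integrable Omega f ->
  (forall phi, test_function Omega phi -> IO (fun x => f x * phi x) = 0) ->
  {ae mu2, forall x, Omega x -> f x = 0}.
Proof.
move=> lf H.
have [k_ [kk k0]] := @exists_kseq R.
have HK (K : set plane) : compact K -> K `<=` Omega -> {ae mu2, forall x, K x -> f x = 0}.
  move=> cK KO; have [K' [r [r0 cK' KO' xK]]] := compact_core cK KO.
  have iT := loc_zext lf cK' KO'.
  have mK : measurable (K : set mplane) by exact: compact_measurable2.
  have := moll_cvg1 kk iT => cv.
  have KK' : K `<=` K' by move=> x Kx; apply: (xK x Kx); exact: ballxx.
  have iK : mu2.-integrable (K : set mplane) (EFin \o f) by case: lf => _; apply.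
  have : \int[mu2]_(x in K) `|f x| = 0.
    apply/eqP; rewrite eq_le; apply/andP; split; last by apply: Rintegral_ge0.
    apply/ler_addgt0Pr => e e0; rewrite add0r.
    have /cvgrPdist_le/(_ _ e0) := cv => cve.
    near \oo => n.
    have nr : n.+1%:R^-1 <= r by apply: ltW; near: n; exact: (near_infty_natSinv_lt (PosNum r0)).
    have : `|0 - \int[mu2]_x `|moll (k_ n) (f \_ K') x - (f \_ K') x| | <= e by near: n.
    rewrite sub0r normrN => le; apply: le_trans (le_trans (ler_norm _) le).
    have im : intT (fun x => `|moll (k_ n) (f \_ K') x - (f \_ K') x|).
      apply: (@intg_norm _ mplane R mu2 setT); apply: (@intgB _ mplane R mu2 setT measurableT) => //.
      exact: (moll_intT (k0 n)).
    have imK := @integrableS _ mplane R mu2 setT K _ measurableT mK (@subsetT _ _) im.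
    apply: (@le_trans _ _ (\int[mu2]_(x in K) `|moll (k_ n) (f \_ K') x - (f \_ K') x|)).
      rewrite le_eqVlt; apply/orP; left; apply/eqP; apply: eq_Rintegral => x /set_mem Kx.
      have bK : ball x (n.+1%:R^-1) `<=` K' by apply: subset_trans (xK x Kx); exact: le_ball.
      rewrite (moll_loc KO' (k0 n) (@subset_refl _ _) _ bK) H ?sub0r ?normrN ?patchE ?mem_set//.
        exact: KK'.
      exact: (shift_test cK' KO' (k0 n) (@subset_refl _ _) bK).
    rewrite /Rintegral; apply: fine_le.
    - exact: (integrable_fin_num mK imK).
    - exact: (integrable_fin_num measurableT im).
    - by apply: ge0_subset_integral => //; exact: (measurable_int mu2 im).
  move=> E0.
  have iN := intg_norm iK.
  have := Rint_EFin mK iN; rewrite E0 => E1.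
  have mfE : measurable_fun (K : set mplane) (EFin \o f) by exact: (measurable_int mu2 iK).
  have := proj1 (@ae_eq_integral_abs _ mplane R mu2 K mK (EFin \o f) mfE) E1.
  by apply: filterS => x H1 Kx; have := H1 Kx; case.
(* Countably many compact sets cover [Omega], so the exceptional null sets can be united. *)
have : {ae mu2, forall x, forall n, core n%:R (n.+1%:R^-1) x -> f x = 0}.
  apply/ae_foralln => n; apply: HK; first exact: core_compact.
  by apply: core_sub.
apply: ae2S => x Hx Ox.
have /nbhs_ballP[e /= e0 He] : nbhs x Omega by apply: open_nbhs_nbhs.
near \oo => n; apply: (Hx n); split.
  have n1 : `|x.1| < n%:R by near: n; exact: nbhs_infty_gtr.
  have n2 : `|x.2| < n%:R by near: n; exact: nbhs_infty_gtr.
  by split; rewrite /= in_itv/=; apply/andP; move: n1 n2; rewrite !ltr_norml => /andP[? ?] /andP[? ?]; split; exact: ltW.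
apply: subset_trans He; apply: le_ball.
by apply: ltW; near: n; exact: (near_infty_natSinv_lt (PosNum e0)).
Unshelve. all: by end_near. Qed.

End Weak.

(** Transfers directional derivatives to the line, where the chain rule for functions of one
    variable applies. *)
Lemma is_derive_line (R : realType) (V : normedModType R) (f : V -> R) (x v : V) (d : R) :
  is_derive (0:R) 1 (fun t : R => f (t *: v + x)) d <-> is_derive x v f d.
Proof.
have E : (fun h : R => h^-1 *: (f (h *: v + x) - f x)) =
         (fun h : R => h^-1 *: (f ((h *: (1:R) + 0) *: v + x) - f ((0:R) *: v + x))).
  by apply/funext => h; rewrite -[h *: (1:R)]/(h * 1) mulr1 addr0 scale0r add0r.
split => -[d1 d2]; apply: DeriveDef.
- by move: d1; rewrite /derivable /= E.
- by move: d2; rewrite /derive /= E.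
- by move: d1; rewrite /derivable /= E.
- by move: d2; rewrite /derive /= E.
Qed.

Lemma is_derive_mul (R : realType) (V : normedModType R) (f g : V -> R) (x v : V) (a b : R) :
  is_derive x v f a -> is_derive x v g b ->
  is_derive x v (fun y => f y * g y) (f x * b + a * g x).
Proof.
move=> [df Df] [dg Dg]; apply: DeriveDef; first exact: derivableM.
by rewrite deriveM// Df Dg -![_ *: _]/(_ * _) [g x * a]mulrC.
Qed.

Section ChainLimit.
Context d (T : measurableType d) (R : realType).
Variable mu : {measure set T -> \bar R}.
Variable D : set T.
Hypothesis mD : measurable D.
Hypothesis fD : (mu D < +oo)%E.
Local Notation intg f := (mu.-integrable D (EFin \o f)).
Local Notation I f := (\int[mu]_(x in D) f x).

Lemma Rint_cvg0_le (a_ b_ : nat -> T -> R) (k : R) : (forall n, measurable_fun D (a_ n)) ->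
  (forall n, intg (b_ n)) -> (forall n, {ae mu, forall x, D x -> `|a_ n x| <= k * b_ n x}) ->
  I (b_ n) @[n --> \oo] --> 0 ->
  (forall n, intg (a_ n)) /\ (I (fun x => `|a_ n x|) @[n --> \oo] --> 0) /\ (I (a_ n) @[n --> \oo] --> 0).
Proof.
move=> ma ib ab b0.
have ia n : intg (a_ n) by apply: (intg_le mD (ma n) (ab n)); exact: intgZ.
have c1 : I (fun x => `|a_ n x|) @[n --> \oo] --> 0.
  apply: (@squeeze_cvgr _ _ _ _ (fun=> 0) (fun n => k * I (b_ n))).
  - apply: nearW => n; apply/andP; split; first exact: Rintegral_ge0.
    rewrite -RintZ//; apply: Rint_le_ae => //; [exact: intg_norm|exact: intgZ].
  - exact: cvg_cst.
  - by rewrite -(mulr0 k); apply: cvgM => //; exact: cvg_cst.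
split => //; split => //; apply/cvgr0Pnorm_le => e e0.
move/cvgr0Pnorm_le: c1 => /(_ _ e0); apply: filterS => n; apply: le_trans.
by rewrite [X in _ <= X]ger0_norm ?Rintegral_ge0//; exact: Rint_norm_le.
Qed.

(** The error splits into F(u_n) - F(u), f(u_n) (g_n - g) and g (f(u_n) - f(u)). The Lipschitz
    bounds control the first two; in the last one g is unbounded, and [pairing_cvg0] is used. *)
Lemma chain_limit (F f : R -> R) (C M1 M2 : R) (u g psi phi : T -> R) (u_ g_ : nat -> T -> R) :
  c11 F f C -> intg u -> intg g -> (forall n, intg (u_ n)) -> (forall n, intg (g_ n)) ->
  I (fun x => `|u_ n x - u x|) @[n --> \oo] --> 0 ->
  I (fun x => `|g_ n x - g x|) @[n --> \oo] --> 0 ->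
  measurable_fun D psi -> measurable_fun D phi ->
  (forall x, `|psi x| <= M1) -> (forall x, `|phi x| <= M2) ->
  intg (fun x => F (u x) * psi x) /\ intg (fun x => f (u x) * g x * phi x) /\
  I (fun x => F (u_ n x) * psi x + f (u_ n x) * g_ n x * phi x) @[n --> \oo] -->
  I (fun x => F (u x) * psi x) + I (fun x => f (u x) * g x * phi x).
Proof.
move=> c iu ig iu_ ig_ cu cg mpsi mphi psiM phiM; have [C0 _ fB fL] := c; have lip := c11_lip c.
have mF : measurable_fun setT F by apply: continuous_measurable_fun; exact: c11_continuous c.
have mf : measurable_fun setT f by apply: continuous_measurable_fun; exact: c11_continuous_d c.
have mu' := intg_meas iu; have mu_ n := intg_meas (iu_ n).
have mg := intg_meas ig; have mg_ n := intg_meas (ig_ n).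
have iFu w : intg w -> intg (fun x => F (w x) * psi x).
  move=> iw; have mw := intg_meas iw.
  have iF : intg (fun x => F (w x)).
    apply: (@intg_le _ _ _ mu D mD _ (fun x => C * `|w x| + `|F 0|)); first exact: (measurableT_comp mF).
      apply: aeW => x _; have := lip 0 (w x); rewrite subr0 => h.
      by rewrite -[F _](subrK (F 0)) (le_trans (ler_normD _ _))// lerD2r.
    by apply: intgD => //; [apply: intgZ => //; exact: intg_norm|exact: intg_cst].
  have := intg_bndM mD mpsi (aeW _ (fun x _ => psiM x)) iF.
  by apply: eq_integrable => // x _; rewrite /= mulrC.
have ifg w k : intg w -> intg k -> intg (fun x => f (w x) * k x * phi x).
  move=> iw ik; have mw := intg_meas iw.
  have i1 : intg (fun x => f (w x) * k x).
    apply: (intg_bndM mD _ (aeW _ (fun x _ => fB (w x))) ik); exact: (measurableT_comp mf).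
  have := intg_bndM mD mphi (aeW _ (fun x _ => phiM x)) i1.
  by apply: eq_integrable => // x _; rewrite /= mulrC.
split; first exact: iFu.
split; first exact: ifg.
have iud n : intg (fun x => `|u_ n x - u x|) by apply: intg_norm => //; exact: intgB.
have igd n : intg (fun x => `|g_ n x - g x|) by apply: intg_norm => //; exact: intgB.
have [i1 [_ c1]] : (forall n, intg (fun x => (F (u_ n x) - F (u x)) * psi x)) /\
  (I (fun x => `|(F (u_ n x) - F (u x)) * psi x|) @[n --> \oo] --> 0) /\
  (I (fun x => (F (u_ n x) - F (u x)) * psi x) @[n --> \oo] --> 0).
  apply: (@Rint_cvg0_le _ (fun n x => `|u_ n x - u x|) (C * M1)) => //.
    move=> n; apply: measurable_funM => //; apply: measurable_funB; exact: (measurableT_comp mF).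
  move=> n; apply: aeW => x _; rewrite normrM mulrAC.
  by apply: ler_pM.
have [i2 [_ c2]] : (forall n, intg (fun x => f (u_ n x) * (g_ n x - g x) * phi x)) /\
  (I (fun x => `|f (u_ n x) * (g_ n x - g x) * phi x|) @[n --> \oo] --> 0) /\
  (I (fun x => f (u_ n x) * (g_ n x - g x) * phi x) @[n --> \oo] --> 0).
  apply: (@Rint_cvg0_le _ (fun n x => `|g_ n x - g x|) (C * M2)) => //.
    move=> n; apply: measurable_funM => //; apply: measurable_funM; last exact: measurable_funB.
    exact: (measurableT_comp mf).
  move=> n; apply: aeW => x _; rewrite !normrM mulrAC.
  by apply: ler_pM => //; apply: ler_pM.
have [i3 [c3 _]] : (forall n, intg (fun x => f (u_ n x) - f (u x))) /\
  (I (fun x => `|f (u_ n x) - f (u x)|) @[n --> \oo] --> 0) /\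
  (I (fun x => f (u_ n x) - f (u x)) @[n --> \oo] --> 0).
  apply: (@Rint_cvg0_le _ (fun n x => `|u_ n x - u x|) C) => //.
    by move=> n; apply: measurable_funB; exact: (measurableT_comp mf).
  by move=> n; apply: aeW => x _.
have igp : intg (fun x => g x * phi x).
  have := intg_bndM mD mphi (aeW _ (fun x _ => phiM x)) ig.
  by apply: eq_integrable => // x _; rewrite /= mulrC.
have fC2 n x : `|f (u_ n x) - f (u x)| <= C + C by rewrite (le_trans (ler_normB _ _))// lerD.
have c4 := pairing_cvg0 mD (addr_ge0 C0 C0) igp i3 fC2 c3.
have i4 n : intg (fun x => g x * phi x * (f (u_ n x) - f (u x))).
  have := intg_bndM mD (intg_meas (i3 n)) (aeW _ (fun x _ => fC2 n x)) igp.
  by apply: eq_integrable => // x _; rewrite /= mulrC.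
have -> : (fun n => I (fun x => F (u_ n x) * psi x + f (u_ n x) * g_ n x * phi x)) =
  (fun n => I (fun x => F (u x) * psi x) + I (fun x => f (u x) * g x * phi x) +
    (I (fun x => (F (u_ n x) - F (u x)) * psi x) + I (fun x => f (u_ n x) * (g_ n x - g x) * phi x)
     + I (fun x => g x * phi x * (f (u_ n x) - f (u x))))).
  apply/funext => n; rewrite -!RintD//; try by [exact: intgD|apply: iFu|apply: ifg]; last first.
  - by apply: intgD => //; exact: intgD.
  - by apply: intgD; [|exact: iFu|exact: ifg].
  by apply: eq_Rintegral => x _; ring.
rewrite -[X in _ --> X]addr0 -[X in _ --> _ + X]addr0 -[X in _ --> _ + (X + _)]addr0.
by apply: cvgD; [exact: cvg_cst|apply: cvgD => //; exact: cvgD].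
Qed.

End ChainLimit.

(** * The chain rule for weak derivatives *)

Section ChainRule.
Context {R : realType}.
Local Notation plane := (R * R)%type.
Local Notation mplane := (measurableTypeR R * measurableTypeR R)%type.
Local Notation mu2 := (@lebesgue2 R).

Lemma is_derive_c11 (V : normedModType R) (F f : R -> R) (C : R) (w : V -> R) (x v : V) :
  c11 F f C -> derivable w x v -> is_derive x v (fun y => F (w y)) (f (w x) * 'D_v w x).
Proof.
move=> c dw; have /is_derive_line dl : is_derive x v w ('D_v w x) by apply: DeriveDef.
apply/is_derive_line.
have dF := c11_is_derive (w ((0:R) *: v + x)) c.
have := is_derive1_comp dF dl; rewrite scale0r add0r; exact.
Qed.

Variable Omega : set plane.
Hypothesis oO : open Omega.
Hypothesis bO : bounded_set Omega.
Implicit Types (f g h k u w phi : plane -> R).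
Local Notation intT f := (mu2.-integrable [set: mplane] (EFin \o f)).
Local Notation intO f := (mu2.-integrable (Omega : set mplane) (EFin \o f)).
Local Notation IO f := (\int[mu2]_(x in Omega) f x).
Local Notation mO := (mO oO).

Lemma locD f g : loc_integrable Omega f -> loc_integrable Omega g ->
  loc_integrable Omega (fun x => f x + g x).
Proof.
move=> [mf Hf] [mg Hg]; split; first exact: measurable_funD.
move=> K cK KO; apply: (@intgD _ mplane R mu2 K (compact_measurable2 cK)); [exact: Hf|exact: Hg].
Qed.

Lemma locZ (c : R) f : loc_integrable Omega f -> loc_integrable Omega (fun x => c * f x).
Proof.
move=> [mf Hf]; split; first exact: measurable_funM.
by move=> K cK KO; apply: (@intgZ _ mplane R mu2 K (compact_measurable2 cK)); exact: Hf.
Qed.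

Lemma loc_bnd (M : R) f h : measurable_fun (Omega : set mplane) h -> 
  {ae mu2, forall x, Omega x -> `|h x| <= M} -> loc_integrable Omega f ->
  loc_integrable Omega (fun x => h x * f x).
Proof.
move=> mh hM [mf Hf]; split; first exact: measurable_funM.
move=> K cK KO; have mK : measurable (K : set mplane) by exact: compact_measurable2.
apply: (@intg_bndM _ mplane R mu2 K mK _ _ M); last exact: Hf.
  exact: measurable_funS mO KO mh.
by apply: ae2S hM => x H Kx; apply: H; exact: KO.
Qed.

Lemma loc_le f g : measurable_fun (Omega : set mplane) f ->
  {ae mu2, forall x, Omega x -> `|f x| <= g x} -> loc_integrable Omega g -> loc_integrable Omega f.
Proof.
move=> mf H [mg Hg]; split => // K cK KO; have mK : measurable (K : set mplane) by exact: compact_measurable2.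
apply: (@intg_le _ mplane R mu2 K mK _ g); [exact: measurable_funS mO KO mf| |exact: Hg].
by apply: ae2S H => x H Kx; apply: H; exact: KO.
Qed.

Lemma loc_ae f g : measurable_fun (Omega : set mplane) g ->
  {ae mu2, forall x, Omega x -> f x = g x} -> loc_integrable Omega f -> loc_integrable Omega g.
Proof.
move=> mg H lf; have [mf Hf] := lf; apply: (@loc_le _ (fun x => `|f x|)) => //.
  by apply: ae2S H => x H Kx; rewrite H.
split; first exact: measurableT_comp.
by move=> K cK KO; apply: (@intg_norm _ mplane R mu2 K); exact: Hf.
Qed.

Lemma loc_cst (c : R) : loc_integrable Omega (fun=> c).
Proof. by apply: int_loc => //; apply: intg_cst; [exact: mO|exact: finO]. Qed.

(** The function and its derivative are mollified from their values on a compact neighbourhood [K']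
    of the support of the test function. There the classical chain rule and integration by parts
    hold, and [chain_limit] passes to the limit. *)
Lemma wd_chain v u g (F f : R -> R) (C : R) : (v = e1 \/ v = e2) -> c11 F f C ->
  weak_derivative Omega v u g ->
  weak_derivative Omega v (fun x => F (u x)) (fun x => f (u x) * g x).
Proof.
move=> ve c wd; have [lu lg W] := wd; have [C0 _ fB fL] := c.
have mF : measurable_fun setT F by apply: continuous_measurable_fun; exact: c11_continuous c.
have mf : measurable_fun setT f by apply: continuous_measurable_fun; exact: c11_continuous_d c.
have lFu : loc_integrable Omega (fun x => F (u x)).
  apply: (@loc_le _ (fun x => C * `|u x| + `|F 0|)).
  - by apply: (measurableT_comp mF); case: lu.
  - apply: aeW => x _; have := c11_lip c 0 (u x); rewrite subr0 => h.
    by rewrite -[F _](subrK (F 0)) (le_trans (ler_normD _ _))// lerD2r.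
  - apply: locD; last exact: loc_cst.
    apply: locZ; have [mu' Hu] := lu; split; first exact: measurableT_comp.
    by move=> K cK KO; apply: (@intg_norm _ mplane R mu2 K); exact: Hu.
have lfg : loc_integrable Omega (fun x => f (u x) * g x).
  apply: (@loc_bnd C) => //; first by apply: (measurableT_comp mf); case: lu.
  by apply: aeW => x _; exact: fB.
split => // phi tp.
have [sp [K [cK KO pK]]] := tp.
have [K' [r [r0 cK' KO' xK]]] := compact_core oO cK KO.
have KK' : K `<=` K' by move=> x Kx; apply: (xK x Kx); exact: ballxx.
have oCK : open (~` K) by rewrite openC; exact: compact_closed2.
have DpK x : ~ K x -> 'D_v phi x = 0.
  by move=> nKx; apply: derive_near0; apply: filterS (open_nbhs_nbhs (conj oCK nKx)) => y; exact: pK.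
have pK' x : ~ K' x -> phi x = 0 by move=> h; apply: pK => /KK'.
have DpK' x : ~ K' x -> 'D_v phi x = 0 by move=> h; apply: DpK => /KK'.
have tDp := test_D v tp.
have [M M0 pM] := test_bounded tp; have [M1 M10 DpM] := test_bounded tDp.
have iu := loc_zext lu cK' KO'; have ig := loc_zext lg cK' KO'.
set uK := u \_ K' in iu; set gK := g \_ K' in ig.
have [k_ [kk k0]] := @exists_kseq R.
pose un n := moll (k_ n) uK; pose gn n := moll (k_ n) gK.
have sk n : smooth (k_ n) by case: (k0 n).
have ck n : csupp (k_ n) by case: (k0 n) => _ _ /csupp_ball.
have sun n : smooth (un n) := moll_smooth (sk n) (ck n) iu.
have sgn n : smooth (gn n) := moll_smooth (sk n) (ck n) ig.
have csp := test_csupp tp.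
(* On [K] the derivative of the mollified function is the mollified derivative; off [K] the test
   function removes the difference. *)
have ibp n : n.+1%:R^-1 <= r ->
    \int[mu2]_x (F (un n x) * 'D_v phi x + (f (un n x) * gn n x) * phi x) = 0.
  move=> nr.
  have dH (x : plane) : is_derive x v (fun x => F (un n x) * phi x)
      (F (un n x) * 'D_v phi x + f (un n x) * 'D_v (un n) x * phi x).
    have d1 : is_derive x v (fun x => F (un n x)) (f (un n x) * 'D_v (un n) x).
      by apply: is_derive_c11 c _; exact: smooth_derivable.
    have d2 : is_derive x v phi ('D_v phi x) by apply: DeriveDef => //; exact: smooth_derivable.
    exact: is_derive_mul d1 d2.
  have DH : 'D_v (fun x => F (un n x) * phi x) = 
      (fun x => F (un n x) * 'D_v phi x + f (un n x) * 'D_v (un n) x * phi x).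
    by apply/funext => x; have [] := dH x.
  have cF : continuous (fun x => F (un n x)).
    by move=> x; apply: continuous_comp; [exact: smooth_continuous|exact: c11_continuous c _].
  have cf : continuous (fun x => f (un n x)).
    by move=> x; apply: continuous_comp; [exact: smooth_continuous|exact: c11_continuous_d c _].
  have := Rint_derive0 (H := fun x => F (un n x) * phi x) ve.
  rewrite DH => IBP; rewrite -[RHS]IBP.
  - congr (Rintegral _ _ _); apply/funext => x; congr (_ + _).
    have [Kx|nKx] := pselect (K x); last by rewrite pK// !mulr0.
    congr (_ * _ * _); rewrite /gn /un; apply/esym.
    apply: (moll_wd cK' KO' (k0 n) (@subset_refl _ _) wd).
    by apply: subset_trans (xK x Kx); exact: le_ball.
  - by move=> x; have [] := dH x.
  - have c1 := smooth_continuous (smooth_D v sp); have c2 := smooth_continuous (smooth_D v (sun n)).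
    have c3 := smooth_continuous sp.
    move=> x; apply: cvgD; apply: cvgM; [exact: cF|exact: c1| |exact: c3].
    by apply: cvgM; [exact: cf|exact: c2].
  - by have [N HN] := csp; exists N => x /HN ->; rewrite mulr0.
have IOE h : (forall x, ~ K x -> h x = 0) -> \int[mu2]_x h x = IO h.
  move=> H; rewrite [in RHS]Rintegral_mkcond; congr (Rintegral _ _ _); apply/funext => x.
  rewrite patchE; case: ifPn => // xO; apply: H => /KO Ox.
  by move: xO; rewrite mem_set.
have iO h : intT h -> intO h by exact: (@integrableS _ mplane R mu2 setT Omega _ measurableT mO (@subsetT _ _)).
have cO (h_ : nat -> plane -> R) : (forall n, intT (h_ n)) ->
    \int[mu2]_x `|h_ n x| @[n --> \oo] --> 0 -> IO (fun x => `|h_ n x|) @[n --> \oo] --> 0.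
  move=> ih; apply: squeeze_cvgr; last exact: cvg_cst.
  apply: nearW => n; apply/andP; split; first exact: Rintegral_ge0.
  have im := @intg_norm _ mplane R mu2 setT _ (ih n).
  rewrite /Rintegral; apply: fine_le.
  - exact: (integrable_fin_num mO (iO _ im)).
  - exact: (integrable_fin_num measurableT im).
  - apply: ge0_subset_integral => //; first exact: mO.
    exact: (measurable_int mu2 im).
have iun n : intT (un n) by exact: (moll_intT (k0 n)).
have ign n : intT (gn n) by exact: (moll_intT (k0 n)).
have [iF [ifg cvL]] := @chain_limit _ mplane R mu2 Omega mO (finO oO bO) F f C M1 M uK gK ('D_v phi) phi
   un gn c (iO _ iu) (iO _ ig) (fun n => iO _ (iun n)) (fun n => iO _ (ign n))
   (cO _ (fun n => @intgB _ mplane R mu2 setT measurableT _ _ (iun n) iu) (moll_cvg1 kk iu))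
   (cO _ (fun n => @intgB _ mplane R mu2 setT measurableT _ _ (ign n) ig) (moll_cvg1 kk ig))
   (test_meas tDp) (test_meas tp) DpM pM.
have E0 : IO (fun x => F (uK x) * 'D_v phi x) + IO (fun x => f (uK x) * gK x * phi x) = 0.
  apply/esym; apply: (cvg_unique _ _ cvL) => //; apply: (@cvg_near_cst).
  near=> n; rewrite -IOE.
    by apply: ibp; apply: ltW; near: n; exact: (near_infty_natSinv_lt (PosNum r0)).
  by move=> x nK; rewrite pK// DpK// !mulr0 addr0.
transitivity (IO (fun x => F (uK x) * 'D_v phi x)).
  apply: eq_Rintegral => x _; rewrite /uK patchE; case: ifPn => // xK'.
  by rewrite DpK' ?mulr0// => Kx; move: xK'; rewrite mem_set.
move/eqP: E0; rewrite addr_eq0 => /eqP ->; congr (- _).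
apply: eq_Rintegral => x _; rewrite /uK /gK !patchE; case: ifPn => // xK'.
by rewrite pK' ?mulr0// => Kx; move: xK'; rewrite mem_set.
Unshelve. all: by end_near. Qed.

End ChainRule.

(** * Uniqueness, products and truncations of weakly differentiable functions *)

Section WeakCalculus.
Context {R : realType}.
Local Notation plane := (R * R)%type.
Local Notation mplane := (measurableTypeR R * measurableTypeR R)%type.
Local Notation mu2 := (@lebesgue2 R).
Variable Omega : set plane.
Hypothesis oO : open Omega.
Hypothesis bO : bounded_set Omega.
Implicit Types (f g h k u w phi : plane -> R).
Local Notation intT f := (mu2.-integrable [set: mplane] (EFin \o f)).
Local Notation intO f := (mu2.-integrable (Omega : set mplane) (EFin \o f)).
Local Notation IO f := (\int[mu2]_(x in Omega) f x).
Local Notation mO := (mO oO).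
Local Notation loc := (loc_integrable Omega).
Local Notation wd := (weak_derivative Omega).
Local Notation mfO := (measurable_fun (Omega : set mplane)).

Lemma int_test f phi : loc f -> test_function Omega phi -> intO (fun x => f x * phi x).
Proof. exact: loc_mul. Qed.

Lemma int_testD f phi v : loc f -> test_function Omega phi -> intO (fun x => f x * 'D_v phi x).
Proof. by move=> lf tp; apply: loc_mul => //; exact: test_D. Qed.

Lemma wd_ae v f f' g g' : mfO f' -> mfO g' ->
  {ae mu2, forall x, Omega x -> f x = f' x} -> {ae mu2, forall x, Omega x -> g x = g' x} ->
  wd v f g -> wd v f' g'.
Proof.
move=> mf' mg' ff gg [lf lg W].
have lf' := loc_ae oO mf' ff lf; have lg' := loc_ae oO mg' gg lg.
split => // phi tp; have E : forall h h' psi, test_function Omega psi -> loc h -> loc h' ->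
    {ae mu2, forall x, Omega x -> h x = h' x} -> IO (fun x => h' x * psi x) = IO (fun x => h x * psi x).
  move=> h h' psi tpsi lh lh' hh; apply: (@Rint_ae _ mplane R mu2 Omega mO).
  - exact: (intg_meas (int_test lh' tpsi)).
  - exact: (intg_meas (int_test lh tpsi)).
  - by apply: ae2S hh => x hh Ox; rewrite hh.
by rewrite (E f f' _ (test_D v tp) lf lf' ff) (E g g' _ tp lg lg' gg) W.
Qed.

Lemma wdD v f f' g g' : wd v f g -> wd v f' g' -> wd v (fun x => f x + f' x) (fun x => g x + g' x).
Proof.
move=> [lf lg W] [lf' lg' W']; split; [exact: locD|exact: locD|move=> phi tp].
have tD := test_D v tp.
under eq_Rintegral do rewrite mulrDl; under [in RHS]eq_Rintegral do rewrite mulrDl.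
rewrite (@RintD _ mplane R mu2 Omega mO _ _ (int_test lf tD) (int_test lf' tD)).
rewrite (@RintD _ mplane R mu2 Omega mO _ _ (int_test lg tp) (int_test lg' tp)).
by rewrite W// W'// opprD.
Qed.

Lemma wdZ v (c : R) f g : wd v f g -> wd v (fun x => c * f x) (fun x => c * g x).
Proof.
move=> [lf lg W]; split; [exact: locZ|exact: locZ|move=> phi tp].
have tD := test_D v tp.
under eq_Rintegral do rewrite -mulrA; under [in RHS]eq_Rintegral do rewrite -mulrA.
rewrite (@RintZ _ mplane R mu2 Omega mO _ _ (int_test lf tD)).
rewrite (@RintZ _ mplane R mu2 Omega mO _ _ (int_test lg tp)).
by rewrite W// mulrN.
Qed.

Lemma wd_uniq v f g g' : wd v f g -> wd v f g' -> {ae mu2, forall x, Omega x -> g x = g' x}.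
Proof.
move=> [lf lg W] [_ lg' W'].
have l0 : loc (fun x => g x + (-1) * g' x) by apply: locD => //; exact: locZ.
have := fundamental_lemma oO l0.
move=> /(_ _)/wrap[|H].
  move=> phi tp.
  under eq_Rintegral do rewrite mulrDl -mulrA.
  rewrite (@RintD _ mplane R mu2 Omega mO _ _ (int_test lg tp)); last first.
    by apply: (@intgZ _ mplane R mu2 Omega mO); exact: int_test.
  rewrite (@RintZ _ mplane R mu2 Omega mO _ _ (int_test lg' tp)).
  have := W phi tp; rewrite W'// => /oppr_inj ->; ring.
apply: ae2S H => x H Ox; have := H Ox; lra.
Qed.

Lemma weakD_wd v f g : wd v f g -> wd v f (weakD Omega v f).
Proof. by move=> H; rewrite /weakD; apply: (xgetPex (cst 0) (P := [set g | wd v f g])); exists g. Qed.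

Lemma weakD_ae v f g : wd v f g -> {ae mu2, forall x, Omega x -> weakD Omega v f x = g x}.
Proof. by move=> H; exact: wd_uniq (weakD_wd H) H. Qed.

Lemma int_outside h : (forall x, ~ Omega x -> h x = 0) -> \int[mu2]_x h x = IO h.
Proof.
move=> H; rewrite [in RHS]Rintegral_mkcond; congr (Rintegral _ _ _); apply/funext => x.
by rewrite patchE; case: ifPn => // xO; apply: H => Ox; move: xO; rewrite mem_set.
Qed.

Lemma test0 phi x : test_function Omega phi -> ~ Omega x -> phi x = 0.
Proof. by move=> [_ [K [_ KO H]]] nO; apply: H => /KO. Qed.

Lemma test_int phi v : (v = e1 \/ v = e2) -> test_function Omega phi -> IO ('D_v phi) = 0.
Proof.
move=> ve tp; rewrite -int_outside; last by move=> x; exact: (test0 (test_D v tp)).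
have [sp _] := tp; apply: Rint_derive0 => //.
- by move=> x; exact: smooth_derivable.
- by apply: smooth_continuous; exact: smooth_D.
- exact: (test_csupp tp).
Qed.

Lemma testM phi psi : smooth psi -> test_function Omega phi -> test_function Omega (fun x => psi x * phi x).
Proof.
move=> sps [sp [K [cK KO H]]]; split; first exact: smoothMf.
by exists K; split => // x nK; rewrite H// mulr0.
Qed.

Lemma smooth_loc psi : smooth psi -> loc psi.
Proof.
move=> sp; split; first by apply: measurable_funTS; exact: smooth_measurable.
move=> K cK KO; have cp := smooth_continuous sp.
have mK : measurable (K : set mplane) by exact: compact_measurable2.
have : compact (psi @` K) by apply: continuous_compact => //; exact: continuous_subspaceT.
move=> /compact_bounded[M [_ HM]].
apply: (@intg_le _ mplane R mu2 K mK _ (fun=> M + 1)).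
- by apply: measurable_funTS; exact: smooth_measurable.
- by apply: aeW => x Kx; apply: (HM (M + 1)); [rewrite ltrDl|exists x].
- by apply: intg_cst => //; exact: compact_fin.
Qed.

Lemma wd_smooth v psi : (v = e1 \/ v = e2) -> smooth psi -> wd v psi ('D_v psi).
Proof.
move=> ve sp; have sD := smooth_D v sp; split; [exact: smooth_loc|exact: smooth_loc|].
move=> phi tp; have [sph _] := tp; have := test_int ve (testM sp tp).
have E x : 'D_v (fun x => psi x * phi x) x = psi x * 'D_v phi x + 'D_v psi x * phi x.
  have d1 : is_derive x v psi ('D_v psi x) := DeriveDef (@smooth_derivable _ _ psi x v sp) erefl.
  have d2 : is_derive x v phi ('D_v phi x) := DeriveDef (@smooth_derivable _ _ phi x v sph) erefl.
  by have [] := is_derive_mul d1 d2.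
under eq_Rintegral do rewrite E.
rewrite (@RintD _ mplane R mu2 Omega mO _ _ (int_testD v (smooth_loc sp) tp) (int_test (smooth_loc sD) tp)).
by move=> /eqP; rewrite addr_eq0 => /eqP.
Qed.

Lemma wd_cst v (c : R) : (v = e1 \/ v = e2) -> wd v (fun=> c) (fun=> 0).
Proof.
move=> ve; apply: (wd_ae _ _ _ _ (wd_smooth ve (smooth_cst c))) => //.
- exact: aeW.
- by apply: aeW => x _; rewrite -[fun=> c]/(cst c) derive_cst.
Qed.

Lemma test_lim (f_ : nat -> plane -> R) f h phi : (forall n, mfO (f_ n)) -> mfO f -> loc h ->
  {ae mu2, forall x, Omega x -> f_ n x @[n --> \oo] --> f x} ->
  {ae mu2, forall x, Omega x -> forall n, `|f_ n x| <= h x} ->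
  test_function Omega phi ->
  IO (fun x => f_ n x * phi x) @[n --> \oo] --> IO (fun x => f x * phi x).
Proof.
move=> mf_ mf lh cf fh tp; have mp := test_meas tp.
have ih := @intg_norm _ mplane R mu2 Omega _ (int_test lh tp).
have := @Rint_dct _ mplane R mu2 Omega mO (fun n x => f_ n x * phi x) (fun x => f x * phi x) _
  (fun n => measurable_funM (mf_ n) mp) (measurable_funM mf mp) _ ih.
move=> [].
- apply: ae2S cf => x cf Ox; apply: cvgM; [exact: cf|exact: cvg_cst].
- apply: ae2S fh => x fh Ox n; rewrite !normrM ler_wpM2r//.
  by apply: (le_trans (fh Ox n)); exact: ler_norm.
by [].
Qed.

Lemma wd_lim v (f_ g_ : nat -> plane -> R) f g F G : (forall n, wd v (f_ n) (g_ n)) ->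
  mfO f -> mfO g -> loc F -> loc G ->
  {ae mu2, forall x, Omega x -> f_ n x @[n --> \oo] --> f x} ->
  {ae mu2, forall x, Omega x -> forall n, `|f_ n x| <= F x} ->
  {ae mu2, forall x, Omega x -> g_ n x @[n --> \oo] --> g x} ->
  {ae mu2, forall x, Omega x -> forall n, `|g_ n x| <= G x} -> wd v f g.
Proof.
move=> W mf mg lF lG cf fF cg gG.
have L (h_ : nat -> plane -> R) h H : mfO h -> loc H -> {ae mu2, forall x, Omega x -> h_ n x @[n --> \oo] --> h x} ->
  {ae mu2, forall x, Omega x -> forall n, `|h_ n x| <= H x} -> loc h.
  move=> mh lH ch hH; apply: (loc_le oO mh _ lH).
  apply: ae2S2 ch hH => x ch hH Ox.
  have cn : (fun n => `|h_ n x|) @ \oo --> `|h x| by apply: cvg_norm; exact: ch.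
  by apply: (cvgr_to_le cn); apply: nearW => n; exact: hH.
have mf_ n : mfO (f_ n) by have [[]] := W n.
have mg_ n : mfO (g_ n) by have [_ []] := W n.
split; [exact: L cf fF|exact: L cg gG|].
move=> phi tp.
have c1 := test_lim mf_ mf lF cf fF (test_D v tp).
have c2 := test_lim mg_ mg lG cg gG tp.
apply: (cvg_unique _ c1) => //.
rewrite (_ : (fun n => _) = (fun n => - IO (fun x => g_ n x * phi x))); last first.
  by apply/funext => n; have [_ _ ->] := W n.
exact: cvgN.
Qed.

Lemma wd_mul_bnd v u g w k (M : R) : (v = e1 \/ v = e2) -> (forall x, `|u x| <= M) -> (forall x, `|w x| <= M) ->
  wd v u g -> wd v w k -> wd v (fun x => u x * w x) (fun x => u x * k x + w x * g x).
Proof.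
move=> ve uM wM W1 W2.
have M0 : 0 <= M := le_trans (normr_ge0 _) (uM (0, 0)).
(* Both u + w and u - w take values in [-2M, 2M], where [sqr_cut] is the square. *)
have [C cs] := c11_sqr_cut (addr_ge0 M0 M0).
have W3 := wd_chain oO bO ve cs (wdD W1 W2).
have W4 := wd_chain oO bO ve cs (wdD W1 (wdZ (-1) W2)).
have := wdZ (4^-1) (wdD W3 (wdZ (-1) W4)).
have b1 x : `|u x + w x| <= M + M by rewrite (le_trans (ler_normD _ _))// lerD.
have b2 x : `|u x + -1 * w x| <= M + M by rewrite mulN1r (le_trans (ler_normB _ _))// lerD.
by congr (wd v _ _); apply/funext => x;
  have [h1 h2] := sqr_cutE (b1 x); have [h3 h4] := sqr_cutE (b2 x); rewrite ?h1 ?h2 ?h3 ?h4; field.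
Qed.

Lemma trunc_cvg (t : R) : trunc n%:R t @[n --> \oo] --> t /\ trunc' n%:R t @[n --> \oo] --> (1 : R).
Proof.
split; apply: cvg_near_cst; near=> n;
 (have h : `|t| <= n%:R by apply: ltW; near: n; exact: nbhs_infty_gtr);
 have [h1 h2] := trunc_id h; rewrite ?h1 ?h2.
Unshelve. all: by end_near. Qed.

Lemma trunc_norm (n : nat) (t : R) : [/\ `|trunc n%:R t| <= `|t|, `|trunc n%:R t| <= n%:R + 1 & `|trunc' n%:R t| <= 1].
Proof.
have [h1 h2 /andP[h3 h4]] := trunc_le t (ler0n R n); split => //.
by rewrite ger0_norm.
Qed.

Lemma trunc_wd (n : nat) v u g : (v = e1 \/ v = e2) -> wd v u g ->
  wd v (fun x => trunc n%:R (u x)) (fun x => trunc' n%:R (u x) * g x).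
Proof. by move=> ve W; have [C c] := c11_trunc (n%:R : R); exact: (wd_chain oO bO ve c W). Qed.

Lemma loc_norm f : loc f -> loc (fun x => `|f x|).
Proof.
move=> [mf Hf]; split; first exact: measurableT_comp.
by move=> K cK KO; apply: (@intg_norm _ mplane R mu2 K); exact: Hf.
Qed.

(** Both factors are truncated, and the three products assumed locally integrable dominate the
    passage to the limit. *)
Lemma wd_mul v u g w k : (v = e1 \/ v = e2) ->
  loc (fun x => u x * w x) -> loc (fun x => u x * k x) -> loc (fun x => w x * g x) ->
  wd v u g -> wd v w k -> wd v (fun x => u x * w x) (fun x => u x * k x + w x * g x).
Proof.
move=> ve l1 l2 l3 W1 W2.
apply: (@wd_lim v (fun n x => trunc n%:R (u x) * trunc n%:R (w x))
  (fun n x => trunc n%:R (u x) * (trunc' n%:R (w x) * k x) + trunc n%:R (w x) * (trunc' n%:R (u x) * g x))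
  _ _ (fun x => `|u x * w x|) (fun x => `|u x * k x| + `|w x * g x|)).
- move=> n; apply: (@wd_mul_bnd _ _ _ _ _ (n%:R + 1)) => //; try exact: trunc_wd.
  + by move=> x; have [] := trunc_norm n (u x).
  + by move=> x; have [] := trunc_norm n (w x).
- by case: l1.
- by case: l2; case: l3 => ? _ ? _; exact: measurable_funD.
- exact: loc_norm.
- by apply: locD => //; exact: loc_norm.
- apply: aeW => x _; have [c1 _] := trunc_cvg (u x); have [c2 _] := trunc_cvg (w x).
  exact: cvgM.
- apply: aeW => x _ n; rewrite !normrM.
  by have [? _ _] := trunc_norm n (u x); have [? _ _] := trunc_norm n (w x); apply: ler_pM.
- apply: aeW => x _; have [c1 c1'] := trunc_cvg (u x); have [c2 c2'] := trunc_cvg (w x).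
  apply: cvgD; apply: cvgM => //; rewrite -[X in _ --> X]mul1r; apply: cvgM => //; exact: cvg_cst.
- apply: aeW => x _ n; have [h1 _ h1'] := trunc_norm n (u x); have [h2 _ h2'] := trunc_norm n (w x).
  rewrite (le_trans (ler_normD _ _))// !normrM lerD//.
    by apply: ler_pM => //; rewrite ?mulr_ge0// ler_piMl.
  by apply: ler_pM => //; rewrite ?mulr_ge0// ler_piMl.
Qed.

Lemma H1_wd f v : (v = e1 \/ v = e2) -> H1 Omega f ->
  wd v f (weakD Omega v f) /\ L2 Omega (weakD Omega v f).
Proof.
move=> ve [_ /(_ v ve)[g W [mg lg]]].
have W' := weakD_wd W; split => //.
have mw : mfO (weakD Omega v f) by have [_ []] := W'.
split => //; apply: (@intg_ae _ mplane R mu2 Omega mO (fun x => g x ^+ 2)) => //.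
  exact: measurable_funX.
by apply: ae2S (weakD_ae W) => x H Ox; rewrite H.
Qed.

Lemma H1_intro f g1 g2 : L2 Omega f -> L2 Omega g1 -> L2 Omega g2 ->
  wd e1 f g1 -> wd e2 f g2 -> H1 Omega f.
Proof. by move=> Lf L1 L2 W1 W2; split => // v [->|->]; [exists g1|exists g2]. Qed.

Lemma L2D f g : L2 Omega f -> L2 Omega g -> L2 Omega (fun x => f x + g x).
Proof.
move=> [mf f2] [mg g2]; split; first exact: measurable_funD.
apply: (@intg_le _ mplane R mu2 Omega mO _ (fun x => 2 * f x ^+ 2 + 2 * g x ^+ 2)).
- by apply: measurable_funX; exact: measurable_funD.
- by apply: aeW => x _; rewrite ger0_norm ?sqr_ge0//; have := sqr_ge0 (f x - g x); nra.
- by apply: (@intgD _ mplane R mu2 Omega mO); apply: (@intgZ _ mplane R mu2 Omega mO).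
Qed.

Lemma L2Z (c : R) f : L2 Omega f -> L2 Omega (fun x => c * f x).
Proof.
move=> [mf f2]; split; first exact: measurable_funM.
have := @intgZ _ mplane R mu2 Omega mO (c ^+ 2) _ f2.
by apply: eq_integrable; [exact: mO|move=> x _; rewrite /= exprMn].
Qed.

Lemma L2_le f g (M : R) : mfO f -> {ae mu2, forall x, Omega x -> `|f x| <= M * `|g x|} ->
  L2 Omega g -> L2 Omega f.
Proof.
move=> mf fg [mg g2]; split => //.
apply: (@intg_le _ mplane R mu2 Omega mO _ (fun x => M ^+ 2 * g x ^+ 2)).
- exact: measurable_funX.
- apply: ae2S fg => x fg Ox; rewrite normrX -(real_normK (num_real (g x))) -exprMn lerXn2r ?nnegrE ?fg//.
  exact: le_trans (normr_ge0 _) (fg Ox).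
- by apply: (@intgZ _ mplane R mu2 Omega mO).
Qed.

Lemma L2_int f g : L2 Omega f -> L2 Omega g -> intO (fun x => f x * g x).
Proof. by move=> [mf f2] [mg g2]; exact: (@intg_sqrM _ mplane R mu2 Omega mO). Qed.

Lemma L2_cst (c : R) : L2 Omega (fun=> c).
Proof. by split => //; apply: intg_cst; [exact: mO|exact: finO]. Qed.

Lemma L2_bnd f (M : R) : mfO f -> {ae mu2, forall x, Omega x -> `|f x| <= M} -> L2 Omega f.
Proof. 
move=> mf H; apply: (@L2_le _ (fun=> 1) M) (L2_cst 1) => //.
by apply: ae2S H => x H Ox; rewrite normr1 mulr1 H.
Qed.

Lemma H1D f g : H1 Omega f -> H1 Omega g -> H1 Omega (fun x => f x + g x).
Proof.
move=> hf hg; have [W1 L1] := H1_wd (or_introl erefl) hf; have [W2 L2'] := H1_wd (or_intror erefl) hf.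
have [W3 L3] := H1_wd (or_introl erefl) hg; have [W4 L4] := H1_wd (or_intror erefl) hg.
apply: (H1_intro _ (L2D L1 L3) (L2D L2' L4) (wdD W1 W3) (wdD W2 W4)).
by apply: L2D; [case: hf|case: hg].
Qed.

Lemma H1Z (c : R) f : H1 Omega f -> H1 Omega (fun x => c * f x).
Proof.
move=> hf; have [W1 L1] := H1_wd (or_introl erefl) hf; have [W2 L2'] := H1_wd (or_intror erefl) hf.
apply: (H1_intro _ (L2Z c L1) (L2Z c L2') (wdZ c W1) (wdZ c W2)).
by apply: L2Z; case: hf.
Qed.

End WeakCalculus.

(** * The Sobolev embedding of H^1 into L^4 *)

Section SobolevTools.
Context {R : realType}.
Local Notation plane := (R * R)%type.
Local Notation mR := (measurableTypeR R).
Local Notation mplane := (measurableTypeR R * measurableTypeR R)%type.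
Local Notation mu2 := (@lebesgue2 R).
Local Notation leb := (@lebesgue_measure R).

(** Integration starts at 0 and runs to a point where F vanishes, so [D] has to be the derivative on
    one half-line only. Near the boundary this is the half of the line that stays in the domain. *)
Lemma FTC_half (F dF D : R -> R) (n : R) : continuous dF ->
  (forall t : R, is_derive t 1 F (dF t)) -> (forall t : R, n < `|t| -> F t = 0) ->
  measurable_fun [set: mR] (D : mR -> R) ->
  (forall t, 0 <= t -> dF t = D t) \/ (forall t, t <= 0 -> dF t = D t) ->
  (`|F 0|%:E <= \int[leb]_t `|D t|%:E)%E.
Proof.
move=> c dFF F0 mD.
pose m := `|n| + 1.
have nm : n < m by rewrite /m ltr_pwDr// ler_norm.
have m0 : 0 < m by rewrite /m ltr_wpDl.
have key (a b : R) : a < b -> `|F b - F a| = `|F 0| -> (forall t, t \in `[a, b] -> dF t = D t) ->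
  (`|F 0|%:E <= \int[leb]_t `|D t|%:E)%E.
  move=> ab E H; rewrite -E -(FTC_Rint ab c dFF).
  have mI : measurable (`[a, b]%classic : set mR) by exact: measurable_itv.
  have ci := cont_int_itv a b c.
  apply: (@le_trans _ _ (\int[leb]_(t in `[a, b]) `|dF t|)%:E).
    by rewrite lee_fin; apply: le_normr_Rintegral.
  rewrite -Rint_EFin//; last exact: integrable_norm.
  have -> : (\int[leb]_(x in `[a, b]) `|dF x|%:E = \int[leb]_(x in `[a, b]) `|D x|%:E)%E.
    by apply: eq_integral => x /set_mem /= xab; rewrite H.
  apply: ge0_subset_integral => //.
  by apply/measurable_EFinP; exact: measurableT_comp.
case=> H; [apply: (key 0 m)|apply: (key (- m) 0)] => //.
- by rewrite (F0 m) ?sub0r ?normrN// gtr0_norm.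
- by move=> t; rewrite in_itv/= => /andP[? _]; exact: H.
- by rewrite oppr_lt0.
- by rewrite (F0 (- m)) ?subr0// normrN gtr0_norm.
- by move=> t; rewrite in_itv/= => /andP[_ ?]; exact: H.
Qed.

Lemma is_derive_ray (V : normedModType R) (f : V -> R) (x v : V) (t : R) : derivable f (t *: v + x) v ->
  is_derive t 1 (fun t : R => f (t *: v + x)) ('D_v f (t *: v + x)).
Proof.
move=> df.
have A (s r u : R) : (s *: u + r) *: v + x = s *: (u *: v) + (r *: v + x).
  by rewrite scalerDl addrA scalerA.
apply: DeriveDef.
  have := @derivable_affine R R V (fun t : R => t *: v + x) _ A f t 1.
  by rewrite scale1r; apply.
by rewrite -[LHS]/('D_1 (f \o (fun t : R => t *: v + x)) t) (derive_affine A) scale1r.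
Qed.

(** [smooth] speaks of directional derivatives only, so linearity in the direction is proved: the
    increment is a step along [e1] followed by one along [e2], and the mean value theorem on the
    second step uses the continuity of ['D_e2 f]. *)
Lemma derive_lin2 (f : plane -> R) (x v : plane) : smooth f ->
  'D_v f x = v.1 * 'D_e1 f x + v.2 * 'D_e2 f x.
Proof.
move=> sf.
have c2 : continuous ('D_e2 f) by apply: smooth_continuous; exact: smooth_D.
have [d1 D1] := derive_homog v.1 (@smooth_derivable _ _ f x e1 sf).
have vE (h : R) : h *: v = h *: (v.1 *: (e1 : plane)) + (h * v.2) *: (e2 : plane).
  by apply: planeP; rewrite !(fstD, fstZ, sndD, sndZ) /=; ring.
apply/cvg_lim => //.
have q1 : (fun h : R => h^-1 *: (f (h *: (v.1 *: (e1 : plane)) + x) - f x)) @ 0^' --> v.1 * 'D_e1 f x.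
  by rewrite -D1; exact: d1.
have q2 : (fun h : R => h^-1 *: (f (h *: v + x) - f (h *: (v.1 *: (e1 : plane)) + x))) @ 0^' --> v.2 * 'D_e2 f x.
  apply/cvgrPdist_le => e e0.
  have ee : 0 < e / (`|v.2| + 1) by rewrite divr_gt0// ltr_wpDl.
  have /cvgrPdist_le/(_ _ ee) := c2 x.
  move=> /nbhs_ballP[d /= d0 Hd].
  (* With this bound on h every intermediate point lies within d of x; the added 1 avoids a division
     by zero. *)
  have dv : 0 < d / (`|v.1| + `|v.2| + 1) by rewrite divr_gt0// ltr_wpDl// addr_ge0.
  near=> h.
  have h0 : h != 0 by near: h; exact: nbhs_dnbhs_neq.
  have hd : `|h| < d / (`|v.1| + `|v.2| + 1) by near: h; exact: dnbhs0_lt.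
  pose y (t : R) : plane := t *: ((h * v.2) *: (e2 : plane)) + (h *: (v.1 *: (e1 : plane)) + x).
  have dy (t : R) : is_derive t 1 (fun t => f (y t)) (h * v.2 * 'D_e2 f (y t)).
    have [dh Dh] := derive_homog (h * v.2) (@smooth_derivable _ _ f (y t) e2 sf).
    by rewrite -Dh; exact: is_derive_ray dh.
  have cy : {within `[(0:R), 1], continuous (fun t => f (y t))}.
    apply: continuous_subspaceT => t; apply: differentiable_continuous; apply/derivable1_diffP.
    by have [] := dy t.
  have [c /andP[c0 c1] Hc] := @MVT _ (fun t => f (y t)) _ 0 1 ltr01 (fun t _ => dy t) cy.
  rewrite subr0 mulr1 /y scale1r scale0r add0r in Hc.
  rewrite vE [_ *: (v.1 *: _) + _]addrC -addrA Hc.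
  rewrite -[_ *: _]/(h^-1 * _) !mulrA mulVf// mul1r -mulrBr normrM.
  have := Hd (y c); rewrite /y => /(_ _)/wrap[|H].
    move: hd; rewrite ltr_pdivlMr ?ltr_wpDl ?addr_ge0// !mulrDr mulr1 => hd.
    have n0 := normr_ge0 h; have n1 := normr_ge0 v.1; have n2 := normr_ge0 v.2.
    rewrite !bnd_simp in c0 c1.
    split; rewrite /ball/= -![_ *: _]/(_ * _).
      by rewrite (_ : _ - _ = - (h * v.1)) ?normrN ?normrM; [nra|ring].
    rewrite (_ : _ - _ = - (c * (h * v.2))) ?normrN ?normrM ?[`|c|]ger0_norm; [|exact: ltW|ring].
    have p1 := mulr_ge0 n0 n1; have : c * (`|h| * `|v.2|) <= `|h| * `|v.2| by rewrite ler_piMl ?mulr_ge0// ltW.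
    lra.
  rewrite (le_trans (ler_wpM2l _ H))// mulrC mulrAC ler_pdivrMr ?ltr_wpDl//.
  by apply: ler_wpM2l; [exact: ltW|rewrite lerDl].
rewrite addrC; have := cvgD q2 q1 => /(_ _); apply: cvg_trans.
apply: near_eq_cvg; apply: nearW => h /=.
rewrite -[LHS]/(h^-1 *: (f (h *: v + x) - f (h *: (v.1 *: (e1 : plane)) + x)) + h^-1 *: (f (h *: (v.1 *: (e1 : plane)) + x) - f x)).
by rewrite -scalerDr addrA subrK.
Unshelve. all: by end_near. Qed.

Lemma Rint_fatou d (T : measurableType d) (mu : {measure set T -> \bar R}) (D : set T)
   (mD : measurable D) (f_ : nat -> T -> R) (f : T -> R) (B : R) :
  (forall n, mu.-integrable D (EFin \o f_ n)) -> measurable_fun D f ->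
  {ae mu, forall x, D x -> forall n, 0 <= f_ n x} ->
  {ae mu, forall x, D x -> f_ n x @[n --> \oo] --> f x} ->
  (forall n, \int[mu]_(x in D) f_ n x <= B) ->
  mu.-integrable D (EFin \o f) /\ \int[mu]_(x in D) f x <= B.
Proof.
move=> if_ mf f0 cf fB.
have mf_ n := intg_meas (if_ n).
have fle : (\int[mu]_(x in D) `|f x|%:E <= B%:E)%E.
  apply: (@le_trans _ _ (\int[mu]_(x in D) limn_einf (fun n => `|f_ n x|%:E))%E).
    apply: ae_ge0_le_integral => //.
    - by apply/measurable_EFinP; exact: measurableT_comp.
    - by move=> x Dx; rewrite limn_einf_lim; apply: lime_ge; [exact: is_cvg_einfs|]; apply: nearW => n; apply: le_ereal_inf_tmp => _ [m _ <-]; rewrite lee_fin.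
    - apply: measurableT_comp => //.
      by apply: measurable_fun_limn_esup => n; apply: measurableT_comp => //; apply/measurable_EFinP; exact: measurableT_comp.
    - apply: filterS cf => x cf Dx.
      have cn : (`|f_ n x|%:E)%E @[n --> \oo] --> (`|f x|%:E)%E.
        by apply: cvg_EFin; [exact: nearW|apply: cvg_norm; exact: cf].
      by have [-> _] := cvg_limn_einf_sup cn.
  apply: (le_trans (fatou _ mD _ _)) => //.
  - by move=> n; apply/measurable_EFinP; exact: measurableT_comp.
  rewrite limn_einf_lim; apply: lime_le; [exact: is_cvg_einfs|]; apply: nearW => n.
  apply: (@le_trans _ _ (\int[mu]_(x in D) `|f_ n x|%:E)%E).
    by apply: ereal_inf_lbound; exists n => /=.
  rewrite (_ : (\int[mu]_(x in D) `|f_ n x|%:E = \int[mu]_(x in D) (f_ n x)%:E)%E).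
    by rewrite (Rint_EFin mD)// lee_fin.
  apply: ae_eq_integral => //; try (by apply/measurable_EFinP => //; exact: measurableT_comp).
  by apply: filterS f0 => x f0 Dx; rewrite ger0_norm// f0.
have fi : mu.-integrable D (EFin \o f).
  by apply/intgP; split => //; exact: le_lt_trans fle (ltry _).
split => //; rewrite -lee_fin -(Rint_EFin mD fi); apply: le_trans fle.
apply: le_integral => //; first exact: intg_norm.
by move=> x _; rewrite lee_fin ler_norm.
Qed.

Lemma ge0_integral_shift1 (f : R -> \bar R) (h : R) : measurable_fun [set: mR] (f : mR -> \bar R) ->
  (forall x, 0 <= f x)%E -> (\int[leb]_x f (x + h)%R = \int[leb]_x f x)%E.
Proof.
move=> mf f0.
have mh : measurable_fun [set: mR] (fun x : mR => (x + h : mR)) by exact: measurable_funD.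
have := @ge0_integral_pushforward _ _ mR mR R (fun x : mR => (x + h : mR)) mh leb setT f measurableT mf (fun x _ => f0 x).
rewrite preimage_setT => <-.
apply: eq_measure_integral => A mA _; exact: lebesgue_measure_shift.
Qed.

(** Gagliardo's argument in two directions: H(x, y)^2 <= a(x) B(y - l x), where a is an integral
    along the vertical line and B along the oblique one. The shear (x, y) -> (x, y - l x) preserves
    the measure, so the integral of the right-hand side factors. *)
Lemma prod_bound (H m1 m2 : plane -> R) (l : R) :
  measurable_fun [set: mplane] H -> continuous m1 -> continuous m2 ->
  (forall x, 0 <= H x) ->
  (forall x, (H x)%:E <= \int[leb]_s `|m1 (x.1, s)|%:E)%E ->
  (forall x, (H x)%:E <= \int[leb]_t `|m2 (x.1 + t, x.2 + l * t)|%:E)%E ->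
  (\int[mu2]_x (H x ^+ 2)%:E <= L1norm mu2 m1 * L1norm mu2 m2)%E.
Proof.
move=> mH c1 c2 H0 H1 H2.
pose a (x : R) := (\int[leb]_s `|m1 (x, s)|%:E)%E.
pose B (q : R) := (\int[leb]_s `|m2 (s, q + l * s)|%:E)%E.
have a0 x : (0 <= a x)%E by apply: integral_ge0 => s _; rewrite lee_fin.
have B0 x : (0 <= B x)%E by apply: integral_ge0 => s _; rewrite lee_fin.
have mn1 : measurable_fun [set: mplane] (fun x : mplane => `|m1 x|%:E).
  by apply/measurable_EFinP; apply: measurableT_comp => //; exact: continuous_measurable2.
have cshear : continuous (fun x : plane => m2 (x.2, x.1 + l * x.2)).
  move=> x; apply: (@continuous_comp _ _ _ (fun x : plane => (x.2, x.1 + l * x.2)) m2); last exact: c2.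
  have c3 : continuous (fun x : plane => x.2) by move=> y; exact: cvg_snd.
  have c4 : continuous (fun x : plane => x.1 + l * x.2).
    by move=> y; apply: cvgD; [exact: cvg_fst|apply: cvgM; [exact: cvg_cst|exact: cvg_snd]].
  have c5 : continuous (fun x : plane => (x.2, x.1 + l * x.2) : plane).
    by move=> y; apply: (@cvg_pair _ _ _ _ (nbhs y.2) (nbhs (y.1 + l * y.2))); [exact: c3|exact: c4].
  exact: c5.
have mn2 : measurable_fun [set: mplane] (fun x : mplane => `|m2 (x.2, x.1 + l * x.2)|%:E).
  by apply/measurable_EFinP; apply: measurableT_comp => //; exact: continuous_measurable2.
have mn2' : measurable_fun [set: mplane] (fun x : mplane => `|m2 x|%:E).
  by apply/measurable_EFinP; apply: measurableT_comp => //; exact: continuous_measurable2.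
have ab0 (k : mplane -> R) x : (0 <= `|k x|%:E)%E by rewrite lee_fin.
have mH2 : measurable_fun [set: mplane] (fun x : mplane => (H x ^+ 2)%:E).
  by apply/measurable_EFinP; exact: measurable_funX.
have H20 (x : mplane) : (0 <= (H x ^+ 2)%:E)%E by rewrite lee_fin sqr_ge0.
have ma : measurable_fun [set: mR] a := @measurable_fun_fubini_tonelli_F _ _ mR mR R leb _ mn1 (ab0 _).
have mB : measurable_fun [set: mR] B := @measurable_fun_fubini_tonelli_F _ _ mR mR R leb _ mn2 (ab0 (fun x => m2 (x.2, x.1 + l * x.2))).
have Ia : (\int[leb]_x a x = L1norm mu2 m1)%E.
  by rewrite /L1norm /lebesgue2 (@fubini_tonelli1 _ _ mR mR R leb leb _ mn1 (ab0 _)).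
have IB : (\int[leb]_x B x = L1norm mu2 m2)%E.
  rewrite /B (@fubini_tonelli _ _ mR mR R leb leb _ mn2 (ab0 (fun x => m2 (x.2, x.1 + l * x.2))))/=.
  rewrite /L1norm /lebesgue2 (@fubini_tonelli1 _ _ mR mR R leb leb _ mn2' (ab0 _)).
  apply: eq_integral => s _; rewrite /fubini_F /=.
  by apply: (@ge0_integral_shift1 (fun y => `|m2 (s, y)|%:E)) => //; exact: (measurable_fun_pair2 s mn2').
(* The oblique line through (x, y) meets the second axis at y - l x, and [B] depends on this number
   only. *)
have HB x y : ((H (x, y) ^+ 2)%:E <= a x * B (y - l * x)%R)%E.
  have H0E : (0 <= (H (x, y))%:E)%E by rewrite lee_fin.
  rewrite expr2 EFinM; apply: (lee_pmul H0E H0E (H1 (x, y))).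
  apply: (le_trans (H2 (x, y))) => /=.
  rewrite /B -(@ge0_integral_shift1 (fun s => `|m2 (s, y - l * x + l * s)|%:E) x)//.
    rewrite le_eqVlt; apply/orP; left; apply/eqP/eq_integral => t _; congr (`|m2 (_, _)|%:E); ring.
  exact: (measurable_fun_pair2 (y - l * x) mn2).
rewrite /lebesgue2 (@fubini_tonelli1 _ _ mR mR R leb leb _ mH2 H20).
have mBs x : measurable_fun [set: mR] (fun y : mR => B (y - l * x)).
  by apply: (measurableT_comp mB); exact: measurable_funB.
rewrite -Ia -ge0_integralZr//; last by rewrite -IB; apply: integral_ge0.
apply: ge0_le_integral => //.
- by move=> x _; apply: integral_ge0 => y _.
- exact: (@measurable_fun_fubini_tonelli_F _ _ mR mR R leb _ mH2 H20).
- exact: emeasurable_funM.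
move=> x _; rewrite /fubini_F.
apply: (@le_trans _ _ (\int[leb]_y (a x * B (y - l * x)%R))%E).
  apply: ge0_le_integral => //.
  - exact: (measurable_fun_pair2 x mH2).
  - by apply: emeasurable_funM.
rewrite ge0_integralZl//.
by rewrite (@ge0_integral_shift1 B (- (l * x)) mB)// IB.
Qed.

End SobolevTools.

(** * The embedding of W^{1,1} into L^2 near a point of the closure *)

Section SobolevLocal.
Context {R : realType}.
Local Notation plane := (R * R)%type.
Local Notation mR := (measurableTypeR R).
Local Notation mplane := (measurableTypeR R * measurableTypeR R)%type.
Local Notation mu2 := (@lebesgue2 R).
Local Notation leb := (@lebesgue_measure R).

Lemma ge0_integral_swap (f : plane -> \bar R) : measurable_fun [set: mplane] (f : mplane -> \bar R) ->
  (forall x, 0 <= f x)%E -> (\int[mu2]_x f (x.2, x.1) = \int[mu2]_x f x)%E.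
Proof.
move=> mf f0.
have mh : measurable_fun [set: mplane] (fun x : mplane => (x.2, x.1) : mplane).
  exact: measurable_swap.
have := @ge0_integral_pushforward _ _ mplane mplane R (fun x : mplane => (x.2, x.1) : mplane) mh mu2 setT f measurableT mf (fun x _ => f0 x).
rewrite preimage_setT => <-.
apply: eq_measure_integral => A mA _; exact: lebesgue2_swap.
Qed.

Lemma continuous_swap (m : plane -> R) : continuous m -> continuous (fun x : plane => m (x.2, x.1)).
Proof.
move=> cm x; apply: (@continuous_comp _ _ _ (fun x : plane => (x.2, x.1) : plane) m); last exact: cm.
have c3 : continuous (fun x : plane => x.2) by move=> y; exact: cvg_snd.
have c4 : continuous (fun x : plane => x.1) by move=> y; exact: cvg_fst.
have c5 : continuous (fun x : plane => (x.2, x.1) : plane).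
  by move=> y; apply: (@cvg_pair _ _ _ _ (nbhs y.2) (nbhs y.1)); [exact: c3|exact: c4].
exact: c5.
Qed.

Lemma L1norm_swap (m : plane -> R) : continuous m -> L1norm mu2 (fun x => m (x.2, x.1)) = L1norm mu2 m.
Proof.
move=> cm; rewrite /L1norm (@ge0_integral_swap (fun x => `|m x|%:E))//.
by apply/measurable_EFinP; apply: measurableT_comp => //; exact: continuous_measurable2.
Qed.

(** [ray1] is the normal axis of a chart, and [ray2] has tangential component 1 and normal component
    l. In each case a coordinate equal to 1 measures the parameter along the ray. *)
Definition ray1 (s : bool) : plane := if s then e1 else e2.
Definition ray2 (s : bool) (l : R) : plane := if s then (l, 1) else (1, l).

(** Exchanging the coordinates preserves the measure and reduces the case [s = true] to the other
    one. *)
Lemma prod_bound_ray (s : bool) (l : R) (H m1 m2 : plane -> R) :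
  measurable_fun [set: mplane] H -> continuous m1 -> continuous m2 ->
  (forall x, 0 <= H x) ->
  (forall x, (H x)%:E <= \int[leb]_t `|m1 (t *: ray1 s + x)|%:E)%E ->
  (forall x, (H x)%:E <= \int[leb]_t `|m2 (t *: ray2 s l + x)|%:E)%E ->
  (\int[mu2]_x (H x ^+ 2)%:E <= L1norm mu2 m1 * L1norm mu2 m2)%E.
Proof.
have key (H' m1' m2' : plane -> R) :
  measurable_fun [set: mplane] H' -> continuous m1' -> continuous m2' ->
  (forall x, 0 <= H' x) ->
  (forall x, (H' x)%:E <= \int[leb]_t `|m1' (t *: ray1 false + x)|%:E)%E ->
  (forall x, (H' x)%:E <= \int[leb]_t `|m2' (t *: ray2 false l + x)|%:E)%E ->
  (\int[mu2]_x (H' x ^+ 2)%:E <= L1norm mu2 m1' * L1norm mu2 m2')%E.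
  move=> mH c1 c2 H0 H1 H2; apply: (@prod_bound R H' m1' m2' l) => // x.
    apply: (le_trans (H1 x)).
    rewrite -(@ge0_integral_shift1 _ (fun s => `|m1' (x.1, s)|%:E) x.2)//.
      rewrite le_eqVlt; apply/orP; left; apply/eqP/eq_integral => t _; by congr (`|m1' _|%:E); apply: planeP; rewrite !(fstD, fstZ, sndD, sndZ)/=; ring.
    apply: (measurable_fun_pair2 x.1 (f := fun x : mplane => `|m1' x|%:E)).
    by apply/measurable_EFinP; apply: measurableT_comp => //; exact: continuous_measurable2.
  apply: (le_trans (H2 x)); rewrite le_eqVlt; apply/orP; left; apply/eqP/eq_integral => t _; by congr (`|m2' _|%:E); apply: planeP; rewrite !(fstD, fstZ, sndD, sndZ)/=; ring.
case: s => mH c1 c2 H0 H1 H2; last exact: key.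
have mswap : measurable_fun [set: mplane] (fun x : mplane => (x.2, x.1) : mplane) by exact: measurable_swap.
rewrite -(L1norm_swap c1) -(L1norm_swap c2) -(@ge0_integral_swap (fun x => (H x ^+ 2)%:E)); last 2 first.
- by apply/measurable_EFinP; exact: measurable_funX.
- by move=> x; rewrite lee_fin sqr_ge0.
apply: (key (fun x => H (x.2, x.1))) => [| | |x|x|x].
- exact: (measurableT_comp mH mswap).
- exact: continuous_swap.
- exact: continuous_swap.
- exact: H0.
- apply: (le_trans (H1 (x.2, x.1))).
  rewrite le_eqVlt; apply/orP; left; apply/eqP/eq_integral => t _; by congr (`|m1 _|%:E); apply: planeP; rewrite !(fstD, fstZ, sndD, sndZ)/=; ring.
- apply: (le_trans (H2 (x.2, x.1))).
  rewrite le_eqVlt; apply/orP; left; apply/eqP/eq_integral => t _; by congr (`|m2 _|%:E); apply: planeP; rewrite !(fstD, fstZ, sndD, sndZ)/=; ring.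
Qed.

Variable Omega : set plane.
Hypothesis oO : open Omega.
Hypothesis bO : bounded_set Omega.
Implicit Types (f g h k u phi : plane -> R).
Local Notation intT f := (mu2.-integrable [set: mplane] (EFin \o f)).
Local Notation intO f := (mu2.-integrable (Omega : set mplane) (EFin \o f)).
Local Notation IO f := (\int[mu2]_(x in Omega) f x).
Local Notation mO := (mO oO).
Local Notation wd := (weak_derivative Omega).
Local Notation mfO := (measurable_fun (Omega : set mplane)).

(* Near p the domain is stable under translation by the cone C, which contains
   the rays along [sg *: ray1 s] and [ray2 s l]. The kernels are supported in C,
   so that mollification near p only uses values of w inside the domain. *)
Variables (w G1 G2 : plane -> R) (p : plane) (R0 : R) (s : bool) (l sg s0 : R) (C : set plane).
Hypothesis R0_gt0 : 0 < R0.
Hypothesis s0P : 0 < s0 <= 1.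
Hypothesis sgP : `|sg| = 1.
Hypothesis wi : intO w.
Hypothesis G1i : intO G1.
Hypothesis G2i : intO G2.
Hypothesis W1 : wd e1 w G1.
Hypothesis W2 : wd e2 w G2.
Hypothesis cone : forall x z, Omega x -> ball p R0 x -> C z -> ball p R0 (z + x) -> Omega (z + x).
Hypothesis coneray1 : forall t : R, 0 <= sg * t -> C (t *: ray1 s).
Hypothesis coneray2 : forall t : R, 0 <= t -> C (t *: ray2 s l).
Hypothesis coneball : forall (d : R) (z : plane), 0 < d -> `|z.1 - d * sg * (ray1 s).1| <= d * s0 ->
  `|z.2 - d * sg * (ray1 s).2| <= d * s0 -> C z.

Definition cutf := bump2 p (R0 / 4).
Definition loc_w x := cutf x * w x.
Definition loc_dw1 (e : plane) (G : plane -> R) x := cutf x * G x + w x * 'D_e cutf x.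
(** Weak derivatives are available along the two axes only, so the derivative of [loc_w] along an
    oblique v is assembled by linearity. *)
Definition loc_dw (v : plane) x := v.1 * loc_dw1 e1 G1 x + v.2 * loc_dw1 e2 G2 x.

Lemma scut : smooth cutf. Proof. exact: smooth_bump2. Qed.
Lemma cutf0 x : ~ ball p (R0 / 4) x -> cutf x = 0. Proof. exact: bump2_0. Qed.
Lemma ccut : csupp cutf. Proof. exact: csupp_ball cutf0. Qed.

Lemma smooth_bndO (k u : plane -> R) : smooth k -> csupp k -> intO u -> intO (fun x => k x * u x).
Proof.
move=> sk ck ui; have [M M0 HM] := csupp_smooth_bounded sk ck.
apply: (@intg_bndM _ mplane R mu2 Omega mO k u M) => //; last by apply: aeW => x _; exact: HM.
by apply: measurable_funTS; exact: smooth_measurable.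
Qed.

Lemma gci : intO loc_w. Proof. exact: smooth_bndO scut ccut wi. Qed.

Lemma gd1i (e : plane) (G : plane -> R) : intO G -> intO (loc_dw1 e G).
Proof.
move=> Gi; apply: (@intgD _ mplane R mu2 Omega mO); first exact: smooth_bndO scut ccut Gi.
have := smooth_bndO (smooth_D e scut) (csupp_D e ccut) wi.
by apply: eq_integrable; [exact: mO|move=> x _; rewrite /= mulrC].
Qed.

Lemma gdi v : intO (loc_dw v).
Proof.
by apply: (@intgD _ mplane R mu2 Omega mO); apply: (@intgZ _ mplane R mu2 Omega mO); exact: gd1i.
Qed.

Lemma Rint_lin2 (a b : R) (f1 f2 : plane -> R) : intO f1 -> intO f2 ->
  IO (fun x => a * f1 x + b * f2 x) = a * IO f1 + b * IO f2.
Proof.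
move=> i1 i2; rewrite (@RintD _ mplane R mu2 Omega mO).
- by rewrite (@RintZ _ mplane R mu2 Omega mO _ _ i1) (@RintZ _ mplane R mu2 Omega mO _ _ i2).
- exact: (@intgZ _ mplane R mu2 Omega mO).
- exact: (@intgZ _ mplane R mu2 Omega mO).
Qed.

Lemma gc_wd1 e G : (e = e1 \/ e = e2) -> intO G -> wd e w G -> wd e loc_w (loc_dw1 e G).
Proof.
move=> ee Gi W; apply: wd_mul => //.
- by apply: int_loc => //; exact: gci.
- by apply: int_loc => //; exact: smooth_bndO scut ccut Gi.
- apply: int_loc => //; have := smooth_bndO (smooth_D e scut) (csupp_D e ccut) wi.
  by apply: eq_integrable; [exact: mO|move=> x _; rewrite /= mulrC].
- by apply: wd_smooth => //; exact: scut.
Qed.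

Lemma alg1 (a b c d e : R) : a * (b * c + d * e) = b * (a * c) + d * (a * e).
Proof. ring. Qed.

Lemma alg2 (a b c d e : R) : (a * b + c * d) * e = a * (b * e) + c * (d * e).
Proof. ring. Qed.

Lemma gc_wd v phi : test_function Omega phi -> IO (fun x => loc_w x * 'D_v phi x) = - IO (fun x => loc_dw v x * phi x).
Proof.
move=> tp; have [sp _] := tp.
have [lg lg1 E1] := gc_wd1 (or_introl erefl) G1i W1.
have [_ lg2 E2] := gc_wd1 (or_intror erefl) G2i W2.
have iD1 := int_testD oO e1 lg tp; have iD2 := int_testD oO e2 lg tp.
have i1 := int_test oO lg1 tp; have i2 := int_test oO lg2 tp.
transitivity (IO (fun x => v.1 * (loc_w x * 'D_e1 phi x) + v.2 * (loc_w x * 'D_e2 phi x))).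
  by apply: eq_Rintegral => x _; rewrite (derive_lin2 x v sp); exact: alg1.
rewrite (Rint_lin2 _ _ iD1 iD2) (E1 _ tp) (E2 _ tp).
transitivity (- IO (fun x => v.1 * (loc_dw1 e1 G1 x * phi x) + v.2 * (loc_dw1 e2 G2 x * phi x))).
  by rewrite (Rint_lin2 _ _ i1 i2) !mulrN opprD.
congr (- _); apply: eq_Rintegral => x _; rewrite /loc_dw.
apply/esym; exact: alg2.
Qed.

Lemma int_ext h : intO h -> intT (h \_ Omega).
Proof.
move=> hi; have := proj1 (@integrable_mkcond _ mplane R mu2 Omega (EFin \o h) mO) hi.
by rewrite restrict_EFin.
Qed.

Section Fixk.
Variables (d : R) (k : plane -> R).
Hypothesis d0 : 0 < d.
Hypothesis dR : d * 2 <= R0 / 8.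
Hypothesis kk : is_kernel ((d * sg) *: ray1 s) (d * s0) k.

Let sk : smooth k. Proof. by case: kk. Qed.
Let ck : csupp k. Proof. by case: kk => _ _ /csupp_ball. Qed.
Let gE := loc_w \_ Omega.
Let gdE v := loc_dw v \_ Omega.
Let hk := moll k gE.
Let mk v := moll k (gdE v).
Let igE : intT gE. Proof. exact: int_ext gci. Qed.
Let igdE v : intT (gdE v). Proof. exact: int_ext (gdi v). Qed.

Lemma kball z : k z != 0 -> `|z.1| < R0 / 8 /\ `|z.2| < R0 / 8.
Proof.
have [_ _ kb _] := kk => kz.
have [bz|/kb kz0] := pselect (ball ((d * sg) *: ray1 s) (d * s0) z); last by rewrite kz0 eqxx in kz.
have /andP[s00 s01] := s0P.
have r1 : `|(ray1 s).1| <= 1 by rewrite /ray1; case: (s); rewrite /= ?normr1 ?normr0.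
have r2 : `|(ray1 s).2| <= 1 by rewrite /ray1; case: (s); rewrite /= ?normr1 ?normr0.
have ds : `|d * sg| = d by rewrite normrM sgP mulr1 gtr0_norm.
have ds0 : d * s0 <= d by rewrite ler_piMr// ltW.
have key (a b : R) : `|a| <= 1 -> `|d * sg * a - b| < d * s0 -> `|b| < R0 / 8.
  move=> a1 ab; have -> : b = d * sg * a - (d * sg * a - b) by ring.
  apply: (le_lt_trans (ler_normB _ _)); rewrite normrM ds.
  have : d * `|a| <= d by rewrite ler_piMr// ltW.
  move: ab dR; lra.
case: bz => /= b1 b2; split; [exact: key b1|exact: key b2].
Qed.

(** The radii grow with each operation: the cutoff vanishes outside R0/4, hence its derivatives
    outside R0/3. The kernel displaces points by less than R0/8, so the mollified function vanishes
    outside 11 R0/24, and its derivatives outside R0/2. *)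
Lemma gE0 z : ~ ball p (R0 / 3) z -> gE z = 0.
Proof.
move=> nb; rewrite /gE patchE; case: ifP => // _; rewrite /loc_w cutf0 ?mul0r// => bz.
by apply: nb; apply: le_ball bz; have := R0_gt0; lra.
Qed.

Lemma gd0 v z : ~ ball p (R0 / 3) z -> gdE v z = 0.
Proof.
move=> nb; rewrite /gdE patchE; case: ifP => // _; rewrite /loc_dw /loc_dw1.
have n0 : \forall y \near z, cutf y = 0.
  have r12 : 0 < R0 / 12 by rewrite divr_gt0.
  have nz : nbhs z (ball z (R0 / 12)) by exact: nbhsx_ballx.
  apply: filterS nz => y zy; apply: cutf0 => py; apply: nb.
  have := ball_triangle py (ball_sym zy); apply: le_ball; have := R0_gt0; lra.
have c0 : cutf z = 0 by exact: (nbhs_singleton n0).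
have d1' : 'D_e1 cutf z = 0 by exact: derive_near0.
have d2' : 'D_e2 cutf z = 0 by exact: derive_near0.
by rewrite c0 d1' d2'; ring.
Qed.

Lemma far_prod (x z : plane) (h : plane -> R) : ~ ball p (11 * R0 / 24) x -> 
  (forall z, ~ ball p (R0 / 3) z -> h z = 0) -> h z * k (z - x) = 0.
Proof.
move=> nb h0; have [kz|/kball[k1 k2]] := eqVneq (k (z - x)) 0; first by rewrite kz mulr0.
rewrite h0 ?mul0r// => -[b1 b2]; apply: nb; split; rewrite /ball/= in b1 b2 *.
  rewrite (_ : p.1 - x.1 = (p.1 - z.1) + (z - x).1); last by rewrite fstD/=; ring.
  by apply: (le_lt_trans (ler_normD _ _)); move: b1 k1; lra.
rewrite (_ : p.2 - x.2 = (p.2 - z.2) + (z - x).2); last by rewrite sndD/=; ring.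
by apply: (le_lt_trans (ler_normD _ _)); move: b2 k2; lra.
Qed.

Lemma far_h x : ~ ball p (11 * R0 / 24) x -> hk x = 0.
Proof.
move=> nb; rewrite /hk /moll /Rintegral integral0_eq// => z _; congr EFin.
by apply: far_prod => //; exact: gE0.
Qed.

Lemma far_m v x : ~ ball p (R0 / 2) x -> mk v x = 0.
Proof.
move=> nb; rewrite /mk /moll /Rintegral integral0_eq// => z _; congr EFin.
apply: far_prod; last exact: gd0.
by move=> bx; apply: nb; apply: le_ball bx; have := R0_gt0; lra.
Qed.

Lemma far_D v x : ~ ball p (R0 / 2) x -> 'D_v hk x = 0.
Proof.
move=> nb; apply: derive_near0.
have r12 : 0 < R0 / 24 by rewrite divr_gt0.
have nx : nbhs x (ball x (R0 / 24)) by exact: nbhsx_ballx.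
apply: filterS nx => y xy; apply: far_h => py; apply: nb.
have := ball_triangle py (ball_sym xy); apply: le_ball; have := R0_gt0; lra.
Qed.

(** The support of the shifted kernel is contained in a square x + K0 with K0 inside the cone [C],
    by [coneball], so [cone] keeps it in [Omega] even if x is arbitrarily close to the boundary. *)
Lemma near_test x : Omega x -> ball p (R0 / 2) x -> test_function Omega (fun z => k (z - x)).
Proof.
move=> Ox px; split; first exact: smooth_shift.
pose c1 := d * sg * (ray1 s).1; pose c2 := d * sg * (ray1 s).2; pose r := d * s0.
pose K : set plane := `[x.1 + c1 - r, x.1 + c1 + r]%classic `*` `[x.2 + c2 - r, x.2 + c2 + r]%classic.
have /andP[s00 s01] := s0P.
have dr : r <= d by rewrite /r ler_piMr// ltW.
have ds : `|d * sg| = d by rewrite normrM sgP mulr1 gtr0_norm.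
have r1 : `|(ray1 s).1| <= 1 by rewrite /ray1; case: (s); rewrite /= ?normr1 ?normr0.
have r2 : `|(ray1 s).2| <= 1 by rewrite /ray1; case: (s); rewrite /= ?normr1 ?normr0.
have cr1 : `|c1| <= d by rewrite /c1 normrM ds ler_piMr// ltW.
have cr2 : `|c2| <= d by rewrite /c2 normrM ds ler_piMr// ltW.
exists K; split.
- by apply: compact_setX; exact: segment_compact.
- move=> z [/=]; rewrite !in_itv/= => /andP[z1 z2] /andP[z3 z4].
  have -> : z = (z - x) + x by rewrite subrK.
  apply: cone => //.
  + by apply: le_ball px; have := R0_gt0; lra.
  + apply: (coneball d0); rewrite ?fstD ?sndD/= -/c1 -/c2 -/r ler_norml.
      by apply/andP; split; lra.
    by apply/andP; split; lra.
  + rewrite subrK; move: px => [/= p1 p2]; rewrite /ball/= in p1 p2.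
    move: cr1 cr2 p1 p2; rewrite !ler_norml !ltr_norml => /andP[? ?] /andP[? ?] /andP[? ?] /andP[? ?].
    by split; rewrite /ball/= ltr_norml; apply/andP; split; have := dR; have := R0_gt0; lra.
- move=> z nK; have [_ _ kb _] := kk; apply: kb => -[b1 b2]; apply: nK.
  have {}b1 : `|c1 - (z.1 - x.1)| < r := b1.
  have {}b2 : `|c2 - (z.2 - x.2)| < r := b2.
  move: b1 b2; rewrite !ltr_norml => /andP[? ?] /andP[? ?].
  by split; rewrite /= in_itv/=; apply/andP; split; lra.
Qed.

Lemma int_patch (h psi : plane -> R) : \int[mu2]_z ((h \_ Omega) z * psi z) = IO (fun z => h z * psi z).
Proof.
rewrite [RHS]Rintegral_mkcond; congr (Rintegral _ _ _); apply/funext => z.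
by rewrite !patchE; case: ifP => //; rewrite mul0r.
Qed.

Lemma near_D v x : Omega x -> ball p (R0 / 2) x -> 'D_v hk x = mk v x.
Proof.
move=> Ox px; have tk := near_test Ox px.
have [_ ->] := moll_is_derive x v sk ck igE.
rewrite /mk /moll !int_patch.
have := gc_wd v tk; under [X in X = _ -> _]eq_Rintegral do rewrite derive_shiftx.
move=> E; rewrite -[RHS]opprK -E -(@RintN _ mplane R mu2 Omega mO).
  by apply: eq_Rintegral => z _; rewrite mulrN.
have := int_testD oO v (int_loc oO gci) tk.
by apply: eq_integrable; [exact: mO|move=> z _; rewrite /= derive_shiftx].
Qed.

Let hO : plane -> R := (fun x => `|hk x|) \_ Omega.

(** Along a ray of the cone the derivative of [hk] is the mollified [loc_dw v]: within R0/2 of p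
    because the ray stays in [Omega], and farther away because both vanish. [FTC_half] then
    integrates along the ray. *)
Lemma ray_bound v : v.1 = 1 \/ v.2 = 1 ->
  (forall t : R, 0 <= t -> C (t *: v)) \/ (forall t : R, t <= 0 -> C (t *: v)) ->
  forall x, ((hO x)%:E <= \int[leb]_t `|mk v (t *: v + x)|%:E)%E.
Proof.
move=> v1 vC x; rewrite /hO patchE; case: ifPn => [/set_mem Ox|_]; last first.
  by apply: integral_ge0 => t _; rewrite lee_fin.
have [px|npx] := pselect (ball p (R0 / 2) x); last first.
  rewrite far_h ?normr0; first by apply: integral_ge0 => t _; rewrite lee_fin.
  by move=> bx; apply: npx; apply: le_ball bx; have := R0_gt0; lra.
have shk : smooth hk by exact: (moll_smooth sk ck igE).
have cray : continuous (fun t : R => t *: v + x).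
  by move=> t; apply: cvgD; [apply: cvgZr_tmp; exact: cvg_id|exact: cvg_cst].
have cmk : continuous (mk v) by exact: (moll_continuous sk ck (igdE v)).
have px' : ball p R0 x by apply: le_ball px; have := R0_gt0; lra.
have key t : C (t *: v) -> 'D_v hk (t *: v + x) = mk v (t *: v + x).
  move=> Ct; have [pt|npt] := pselect (ball p (R0 / 2) (t *: v + x)); last by rewrite far_D// far_m.
  apply: near_D => //; apply: cone => //.
  by apply: le_ball pt; have := R0_gt0; lra.
(* After this parameter the ray has left the support: one coordinate of v is 1, so the corresponding
   coordinate of the point moves at unit speed. *)
have := @FTC_half R (fun t => hk (t *: v + x)) (fun t => 'D_v hk (t *: v + x)) (fun t => mk v (t *: v + x))
   (`|p.1 - x.1| + `|p.2 - x.2| + R0).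
rewrite scale0r add0r; apply.
- have cD : continuous ('D_v hk) := smooth_continuous (smooth_D v shk).
  by move=> t; apply: (@continuous_comp _ _ _ (fun t : R => t *: v + x) ('D_v hk)); [exact: cray|exact: cD].
- by move=> t; apply: is_derive_ray; exact: smooth_derivable.
- move=> t tb; apply: far_h => -[b1 b2].
  have {}b1 : `|p.1 - (t * v.1 + x.1)| < 11 * R0 / 24 := b1.
  have {}b2 : `|p.2 - (t * v.2 + x.2)| < 11 * R0 / 24 := b2.
  have n1 := normr_ge0 (p.1 - x.1); have n2 := normr_ge0 (p.2 - x.2).
  have tri (a b : R) : `|t| <= `|a - b| + `|a - (t + b)|.
    by rewrite {1}(_ : t = (a - b) - (a - (t + b))) ?ler_normB//; ring.
  have := R0_gt0.
  case: v1 => v1.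
    by move: b1; rewrite v1 mulr1 => b1; have := tri p.1 x.1; move: b1 tb; lra.
  by move: b2; rewrite v1 mulr1 => b2; have := tri p.2 x.2; move: b2 tb; lra.
- apply: continuous_measurable_fun => t.
  by apply: (@continuous_comp _ _ _ (fun t : R => t *: v + x) (mk v)); [exact: cray|exact: cmk].
- by case: vC => vC; [left|right] => t /vC/key.
Qed.

(** The right-hand side does not involve the kernel, which makes the bound uniform along the
    mollification. *)
Lemma hk_bound : (\int[mu2]_(x in Omega) (hk x ^+ 2)%:E <=
  L1norm mu2 (gdE (ray1 s)) * L1norm mu2 (gdE (ray2 s l)))%E.
Proof.
have shk : smooth hk by exact: (moll_smooth sk ck igE).
have cmk v : continuous (mk v) by exact: (moll_continuous sk ck (igdE v)).
apply: (@le_trans _ _ (L1norm mu2 (mk (ray1 s)) * L1norm mu2 (mk (ray2 s l)))%E); last first.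
  by apply: lee_pmul; rewrite ?L1norm_ge0//; exact: (moll_L1norm kk).
have H x : 0 <= hO x by rewrite /hO patchE; case: ifP.
have mH : measurable_fun [set: mplane] hO.
  apply/(measurable_restrictT _ _).1; first exact: mO.
  by apply: measurable_funTS; apply: measurableT_comp => //; exact: smooth_measurable.
have E : (\int[mu2]_(x in Omega) (hk x ^+ 2)%:E = \int[mu2]_x (hO x ^+ 2)%:E)%E.
  rewrite integral_mkcond; apply: eq_integral => x _.
  by rewrite /hO !patchE; case: ifP => _; rewrite ?real_normK ?num_real ?expr0n.
rewrite E; apply: (@prod_bound_ray s l _ _ _ mH (cmk (ray1 s)) (cmk (ray2 s l)) H).
- apply: ray_bound; first by rewrite /ray1; case: (s); [left|right].
  have [s1|s1] := leP 0 sg; [left|right] => t t0; apply: coneray1.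
    by rewrite mulr_ge0.
  by rewrite nmulr_rge0.
- apply: ray_bound; first by rewrite /ray2; case: (s); [right|left].
  by left.
Qed.

End Fixk.

(** Used with a and b the truncations of |w| and |h| at height M, with c = |h| and D = |h - w|: the
    gap between a^2 and b^2 is at most D (a + b). *)
Lemma alg3 (a b c D M : R) : b <= c -> a - b <= D -> 0 <= a -> a <= M -> 0 <= b -> b <= M -> 0 <= D ->
  a ^+ 2 <= c ^+ 2 + 2 * M * D.
Proof.
move=> bc abD a0 aM b0 bM D0.
have p1 : 0 <= (D - (a - b)) * (a + b) by apply: mulr_ge0; lra.
have p2 : 0 <= D * (2 * M - a - b) by apply: mulr_ge0; lra.
have p3 : 0 <= (c - b) * (c + b) by apply: mulr_ge0; lra.
by nra.
Qed.

(** L^1 convergence of the mollifications h does not control squares, so |w| is first cut at height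
    M. The cut square exceeds h^2 by at most 2 M |h - w|, whose integral tends to 0; Fatou's lemma
    then lets M grow. *)
Lemma local_sobolev : intO (fun x => loc_w x ^+ 2).
Proof.
have /andP[s00 s01] := s0P.
(* The kernel lies within 2 [dl n] of the origin, hence inside the ball of radius 1/(n+1) required
   by [kseq]. *)
pose dl (n : nat) : R := n.+1%:R^-1 / 4.
have dl0 n : 0 < dl n by rewrite divr_gt0.
have kex n : exists k, is_kernel ((dl n * sg) *: ray1 s) (dl n * s0) k by apply: exists_kernel; rewrite mulr_gt0.
have [k_ kk] := choice kex.
have ks : kseq k_.
  move=> n; exists ((dl n * sg) *: ray1 s), (dl n * s0); split => // z [b1 b2].
  have {}b1 : `|dl n * sg * (ray1 s).1 - z.1| < dl n * s0 := b1.
  have {}b2 : `|dl n * sg * (ray1 s).2 - z.2| < dl n * s0 := b2.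
  have r1 : `|(ray1 s).1| <= 1 by rewrite /ray1; case: (s); rewrite /= ?normr1 ?normr0.
  have r2 : `|(ray1 s).2| <= 1 by rewrite /ray1; case: (s); rewrite /= ?normr1 ?normr0.
  have ds : `|dl n * sg| = dl n by rewrite normrM sgP mulr1 gtr0_norm.
  have ds0 : dl n * s0 <= dl n by rewrite ler_piMr// ltW.
  have key (a b : R) : `|a| <= 1 -> `|dl n * sg * a - b| < dl n * s0 -> `|0 - b| < n.+1%:R^-1.
    move=> a1 ab; rewrite sub0r normrN; have -> : b = dl n * sg * a - (dl n * sg * a - b) by ring.
    apply: (le_lt_trans (ler_normB _ _)); rewrite normrM ds.
    have : dl n * `|a| <= dl n by rewrite ler_piMr// ltW.
    have -> : n.+1%:R^-1 = dl n * 4 by rewrite /dl divfK.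
    by move: ab ds0 (dl0 n); lra.
  by split; [exact: key b1|exact: key b2].
pose gE := loc_w \_ Omega.
have igE : intT gE by exact: int_ext gci.
pose B := (L1norm mu2 (loc_dw (ray1 s) \_ Omega) * L1norm mu2 (loc_dw (ray2 s l) \_ Omega))%E.
have Bfin : B \is a fin_num.
  have fin v : L1norm mu2 (loc_dw v \_ Omega) \is a fin_num.
    by rewrite ge0_fin_numE ?L1norm_ge0//; have /intgP[_] := int_ext (gdi v).
  exact: fin_numM.
have [n0 n0R] : exists n0 : nat, forall n, (n0 <= n)%N -> dl n * 2 <= R0 / 8.
  have R8 : 0 < R0 / 8 by rewrite divr_gt0.
  have [n0 _ H] := near_infty_natSinv_lt (PosNum R8).
  exists n0 => n /H /=; have -> : n.+1%:R^-1 = dl n * 4 by rewrite /dl divfK.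
  by have := dl0 n; move: (dl n) => D; lra.
have mg : mfO loc_w by exact: (intg_meas gci).
pose sm (M t : R) := Num.min `|t| M.
have smM (M t : R) : 0 <= M -> 0 <= sm M t <= M by move=> M0; rewrite /sm le_min normr_ge0 M0 ge_min lexx orbT.
have ism (n : nat) : intO (fun x => sm n%:R (loc_w x) ^+ 2).
  apply: (@intg_le _ mplane R mu2 Omega mO _ (fun=> n%:R ^+ 2)).
  - by apply: measurable_funX; apply: measurable_minr => //; exact: measurableT_comp.
  - apply: aeW => x _; have /andP[h1 h2] := smM n%:R (loc_w x) (ler0n R n).
    by rewrite ger0_norm ?sqr_ge0// lerXn2r ?nnegrE.
  - by apply: intg_cst; [exact: mO|exact: finO].
have [] // := @Rint_fatou R _ mplane mu2 Omega mO (fun (n : nat) x => sm n%:R (loc_w x) ^+ 2) (fun x => loc_w x ^+ 2) (fine B) ism.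
- exact: measurable_funX.
- by apply: aeW => x _ n; exact: sqr_ge0.
- apply: aeW => x _; apply: cvg_near_cst; near=> n.
  have h : `|loc_w x| <= n%:R by apply: ltW; near: n; exact: nbhs_infty_gtr.
  by rewrite /sm min_l// real_normK// num_real.
move=> M; apply/ler_addgt0Pr => e e0.
have e1 : 0 < e / (2 * M%:R + 1) by rewrite divr_gt0// ltr_wpDl// mulr_ge0.
have /cvgrPdist_le/(_ _ e1)[n1 _ Hn] := moll_cvg1 ks igE.
pose n := maxn n0 n1.
have := Hn n (leq_maxr _ _); rewrite /= sub0r normrN => le1.
have kn := kk n; have [sk _ kb _] := kn; have ck := csupp_ball kb.
have hb := hk_bound (dl0 n) (n0R n (leq_maxl _ _)) kn.
pose h := moll (k_ n) gE.
have mh : mfO h by apply: measurable_funTS; apply: smooth_measurable; exact: (moll_smooth sk ck igE).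
have ih2 : intO (fun x => h x ^+ 2).
  apply/intgP; split; first exact: measurable_funX.
  have -> : (\int[mu2]_(x in Omega) `|h x ^+ 2|%:E = \int[mu2]_(x in Omega) (h x ^+ 2)%:E)%E.
    by apply: eq_integral => x _; rewrite ger0_norm// sqr_ge0.
  by apply: le_lt_trans hb _; rewrite ltey_eq Bfin.
have Ih2 : IO (fun x => h x ^+ 2) <= fine B.
  by rewrite -lee_fin -(Rint_EFin mO ih2) fineK.
have idT : intT (fun x => `|h x - gE x|).
  apply: (@intg_norm _ mplane R mu2 setT); apply: (@intgB _ mplane R mu2 setT measurableT) => //.
  exact: (moll_intT kn).
have idO := @integrableS _ mplane R mu2 setT Omega _ measurableT mO (@subsetT _ _) idT.
have idM : intO (fun x => 2 * M%:R * `|h x - gE x|) by exact: (@intgZ _ mplane R mu2 Omega mO).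
have Id : IO (fun x => `|h x - gE x|) <= e / (2 * M%:R + 1).
  apply: le_trans (le_trans (ler_norm _) le1).
  rewrite /Rintegral; apply: fine_le.
  - exact: (integrable_fin_num mO idO).
  - exact: (integrable_fin_num measurableT idT).
  - by apply: ge0_subset_integral => //; [exact: mO|exact: (measurable_int mu2 idT)].
apply: (@le_trans _ _ (IO (fun x => h x ^+ 2 + 2 * M%:R * `|h x - gE x|))).
  apply: (@Rint_le_ae _ mplane R mu2 Omega mO) => //.
    exact: (@intgD _ mplane R mu2 Omega mO).
  apply: aeW => x Ox; rewrite /gE patchE mem_set//.
  have /andP[g1 g2] := smM M%:R (loc_w x) (ler0n R M); have /andP[h1 h2] := smM M%:R (h x) (ler0n R M).
  have hh : sm M%:R (h x) <= `|h x| by rewrite /sm ge_min lexx.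
  have hd : sm M%:R (loc_w x) - sm M%:R (h x) <= `|h x - loc_w x|.
    rewrite /sm; have := ler_dist_dist (h x) (loc_w x); rewrite ler_norml => /andP[a1 a2].
    have a3 := normr_ge0 (h x - loc_w x).
    move: a1 a2 a3; move: `|loc_w x| `|h x| `|h x - loc_w x| => A1 A2 A3 ? ? ?.
    by rewrite !minEle; case: ifP => ?; case: ifP => ?; lra.
  rewrite -(real_normK (num_real (h x))); move: hh hd g1 g2 h1 h2 (normr_ge0 (h x - loc_w x)).
  exact: alg3.
rewrite (@RintD _ mplane R mu2 Omega mO _ _ ih2 idM); apply: lerD => //.
rewrite (@RintZ _ mplane R mu2 Omega mO _ _ idO).
apply: (@le_trans _ _ (2 * M%:R * (e / (2 * M%:R + 1)))).
  by apply: ler_wpM2l => //; rewrite mulr_ge0.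
rewrite mulrA ler_pdivrMr ?ltr_wpDl ?mulr_ge0// mulrC ler_wpM2l ?lerDl//; exact: ltW.
Unshelve. all: by end_near. Qed.

End SobolevLocal.

Section Sobolev.
Context {R : realType}.
Local Notation plane := (R * R)%type.
Local Notation mplane := (measurableTypeR R * measurableTypeR R)%type.
Local Notation mu2 := (@lebesgue2 R).

Lemma smooth_lip (g : R -> R) (q r : R) : smooth g ->
  exists2 L, 0 <= L & forall a b, `|a - q| <= r -> `|b - q| <= r -> `|g b - g a| <= L * `|b - a|.
Proof.
move=> sg; have cD : continuous ('D_1 g) := smooth_continuous (smooth_D (1 : R) sg).
have : compact (('D_1 g : R -> R) @` `[q - r, q + r]).
  apply: continuous_compact; last exact: segment_compact.
  exact: continuous_subspaceT.
move=> /compact_bounded[M0 [_ HM]].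
pose M := `|M0| + 1.
have M1 : M0 < M by rewrite /M ltr_pwDr// ler_norm.
exists M; first by rewrite /M addr_ge0.
have dg (t : R) : is_derive t 1 g ('D_1 g t) by apply: DeriveDef => //; exact: smooth_derivable.
have cg : continuous g := smooth_continuous sg.
have key a b : a < b -> `|a - q| <= r -> `|b - q| <= r -> `|g b - g a| <= M * `|b - a|.
  move=> ab aq bq.
  have [c cab ->] := @MVT R g ('D_1 g) a b ab (fun t _ => dg t) (continuous_subspaceT cg).
  rewrite normrM ler_wpM2r//; apply: (HM M M1); exists c => //=.
  move: cab aq bq; rewrite !in_itv/= !ler_norml => /andP[? ?] /andP[? ?] /andP[? ?].
  by apply/andP; split; lra.
move=> a b aq bq; have [ab|ba|->] := ltgtP a b; [exact: key| |by rewrite !subrr normr0 mulr0].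
by rewrite distrC [`|b - a|]distrC; exact: key.
Qed.

Variable Omega : set plane.
Hypothesis oO : open Omega.
Hypothesis bO : bounded_set Omega.
Hypothesis sO : smooth_boundary Omega.
Local Notation intO f := (mu2.-integrable (Omega : set mplane) (EFin \o f)).
Local Notation mO := (mO oO).

Lemma sqr_wd (f : plane -> R) v : (v = e1 \/ v = e2) -> H1 Omega f ->
  weak_derivative Omega v (fun x => f x ^+ 2) (fun x => f x * weakD Omega v f x + f x * weakD Omega v f x) /\
  intO (fun x => f x * weakD Omega v f x + f x * weakD Omega v f x).
Proof.
move=> ve hf; have [W L] := H1_wd oO ve hf; have [L0 _] := hf.
have i := L2_int oO L0 L.
split; last exact: (@intgD _ mplane R mu2 Omega mO).
apply: wd_mul => //; try by apply: int_loc.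
by apply: int_loc => //; case: L0 => _; apply: eq_integrable; [exact: mO|].
Qed.

(** [local_sobolev] is applied to f^2, whose gradient 2 f grad f is in L^1. In the interior every
    direction is admissible. At a boundary point the epigraph of an L-Lipschitz function is stable
    under the cone where the normal coordinate is at least L times the modulus of the tangential
    one. *)
Lemma L4_local (f : plane -> R) (p : plane) : H1 Omega f -> closure Omega p ->
  exists r h, [/\ 0 < r, intO h, forall x, 0 <= h x & forall x, Omega x -> ball p r x -> f x ^+ 4 <= h x].
Proof.
move=> hf cp.
suff [R0 R00 Hi] : exists2 R0, 0 < R0 & intO (fun x => loc_w (fun x => f x ^+ 2) p R0 x ^+ 2).
  have R8 : 0 < R0 / 4 / 2 by rewrite !divr_gt0.
  pose c : R := flat 1 (R0 / 4 / 2) ^+ 4.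
  have c0 : 0 < c by rewrite exprn_gt0// flat1_gt0.
  exists (R0 / 4 / 2), (fun x => (c ^+ 2)^-1 * loc_w (fun x => f x ^+ 2) p R0 x ^+ 2); split => //.
  - exact: (@intgZ _ mplane R mu2 Omega mO).
  - by move=> x; rewrite mulr_ge0 ?sqr_ge0// invr_ge0 sqr_ge0.
  - move=> x Ox bx; have := bump2_ge bx; rewrite -/c => cb.
    have -> : loc_w (fun x => f x ^+ 2) p R0 x ^+ 2 = bump2 p (R0 / 4) x ^+ 2 * f x ^+ 4.
      by rewrite /loc_w /cutf exprMn -exprM.
    rewrite mulrA; apply: ler_peMl; first exact: exprn_even_ge0.
    have cn : c ^+ 2 != 0 by rewrite expf_neq0// gt_eqF.
    apply: (@le_trans _ _ ((c ^+ 2)^-1 * c ^+ 2)); first by rewrite mulVf.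
    apply: ler_wpM2l; first by rewrite invr_ge0 sqr_ge0.
    by rewrite lerXn2r ?nnegrE ?(ltW c0)//; exact: le_trans (ltW c0) cb.
have [W1 G1] := sqr_wd (or_introl erefl) hf; have [W2 G2] := sqr_wd (or_intror erefl) hf.
have iw : intO (fun x => f x ^+ 2) by case: hf => -[].
have [Op|nOp] := pselect (Omega p).
  have /nbhs_ballP[R0 /= R00 HR] : nbhs p Omega by apply: open_nbhs_nbhs.
  exists R0 => //.
  apply: (@local_sobolev R Omega oO bO _ _ _ p R0 false 0 1 1 setT R00 _ _ iw G1 G2 W1 W2) => //.
  - by rewrite ltr01 lexx.
  - by rewrite normr1.
  - by move=> x z _ _ _ /HR.
have [r [gam [s [n [r0 sg chart]]]]] := sO cp nOp.
have [L L0 lip] := smooth_lip (axis_coords s n p).1 r sg.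
exists r => //.
pose sg0 : R := (-1) ^+ n.
have sg2 : sg0 * sg0 = 1 by rewrite /sg0 -signr_addb addbb expr0.
have L1 : 0 < L + 1 by rewrite ltr_wpDl.
(* The factor [sg0] undoes the orientation of the chart, so [ray2] runs along the edge of the cone.
   The radius d / (L + 1) fits the square at height d into the cone: there the tangential part is at
   most d / (L + 1) and the normal part at least d - d / (L + 1) = L d / (L + 1). *)
apply: (@local_sobolev R Omega oO bO _ _ _ p r s (sg0 * L) sg0 (L + 1)^-1
   [set z | L * `|(axis_coords s n z).1| <= (axis_coords s n z).2] r0 _ _ iw G1 G2 W1 W2).
- by rewrite invr_gt0 L1 invf_le1// lerDr.
- by rewrite /sg0 normrX normrN1 expr1n.
- move=> x z Ox bx Cz bzx; have {}Cz : L * `|(axis_coords s n z).1| <= (axis_coords s n z).2 := Cz; apply/(chart _ bzx); have /(chart _ bx) cx := Ox.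
  have E1 : (axis_coords s n (z + x)).1 = (axis_coords s n z).1 + (axis_coords s n x).1.
    by rewrite /axis_coords; case: (s).
  have E2 : (axis_coords s n (z + x)).2 = (axis_coords s n z).2 + (axis_coords s n x).2.
    by rewrite /axis_coords; case: (s) => /=; rewrite mulrDr.
  have bd y : ball p r y -> `|(axis_coords s n y).1 - (axis_coords s n p).1| <= r.
    by rewrite distrC /axis_coords; case: (s) => -[/= b1 b2]; exact: ltW.
  have := lip _ _ (bd _ bx) (bd _ bzx); rewrite E1 E2 addrK => h.
  by have := ler_norm (gam ((axis_coords s n z).1 + (axis_coords s n x).1) - gam (axis_coords s n x).1); lra.
- move=> t; rewrite -/sg0 => st /=; rewrite /axis_coords /ray1; case: (s) => /=; rewrite -/sg0 -![_ *: _]/(_ * _) mulr0 normr0 mulr0 mulr1//.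
- move=> t t0; have key : L * `|t * 1| <= sg0 * (t * (sg0 * L)).
    rewrite mulr1 ger0_norm// (_ : sg0 * (t * (sg0 * L)) = (sg0 * sg0) * (L * t)); last by ring.
    by rewrite sg2 mul1r.
  by rewrite /axis_coords /ray2 /=; case: (s); exact: key.
- move=> d z d0; rewrite /axis_coords /ray1 /=; set k := d / (L + 1).
  have kL : k * (L + 1) = d by rewrite /k divfK// gt_eqF.
  have k0 : 0 < k by rewrite divr_gt0.
  have key (a b : R) : `|a| <= k -> `|b - d * sg0| <= k -> L * `|a| <= sg0 * b.
    move=> ak bk; have La : L * `|a| <= L * k by exact: ler_wpM2l.
    have : `|sg0 * b - d| <= k.
      have -> : sg0 * b - d = sg0 * (b - d * sg0) by rewrite mulrBr [sg0 * (d * _)]mulrCA sg2 mulr1.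
      by rewrite normrM /sg0 normrX normrN1 expr1n mul1r.
    by rewrite ler_norml => /andP[h1 _]; move: La h1; rewrite -kL; lra.
  by case: (s) => /=; rewrite -/sg0 mulr0 subr0 mulr1 => h1 h2; exact: key.
Qed.

(** The closure is compact, so finitely many local bounds suffice, and their sum dominates f^4. *)
Lemma H1_L4 (f : plane -> R) : H1 Omega f -> intO (fun x => f x ^+ 4).
Proof.
move=> hf.
have ex p : exists rh : R * (plane -> R), [/\ 0 < rh.1, intO rh.2, forall x, 0 <= rh.2 x &
    closure Omega p -> forall x, Omega x -> ball p rh.1 x -> f x ^+ 4 <= rh.2 x].
  have [cp|ncp] := pselect (closure Omega p); last first.
    exists (1, fun=> 0); split => //=; apply: intg_cst; [exact: mO|exact: finO].
  by have [r [h [r0 ih h0 fh]]] := L4_local hf cp; exists (r, h).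
have [rh H] := choice ex.
have [N _ ON] := bounded_box bO.
have cc : compact (closure Omega).
  apply: (@subclosed_compact _ _ (box N)); [exact: closed_closure|exact: box_compact|].
  rewrite closureE => x; apply; split => //; apply: compact_closed2; exact: box_compact.
have nc : near_covering (closure Omega) by apply/compact_near_coveringP.
(* With the filter of finite families ordered by inclusion, [near_covering] yields a finite
   subcover. *)
pose F : set_system (seq plane) := [set S : set (seq plane) | exists s0 : seq plane, forall s : seq plane, {subset s0 <= s} -> S s].
have FF : Filter F.
  split; first by exists [::].
  - move=> P Q [s1 P1] [s2 Q2]; exists (s1 ++ s2) => s ss; split; [apply: P1|apply: Q2];
      by move=> x xs; apply: ss; rewrite mem_cat xs ?orbT.
  - by move=> P Q PQ [s0 P0]; exists s0 => s /P0/PQ.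
have [D' cov] : exists s : seq plane, closure Omega `<=` [set x | exists p, [/\ p \in s, closure Omega p & ball p (rh p).1 x]].
  have := nc (seq plane) F (fun s x => exists p, [/\ p \in s, closure Omega p & ball p (rh p).1 x]) FF.
  move=> /(_ _)/wrap[|[s0 Hs0]]; last by exists s0; exact: Hs0.
  move=> x cx; exists (ball x (rh x).1, [set s : seq plane | x \in s]); first split => /=.
  - by apply: nbhsx_ballx; case: (H x).
  - by exists [:: x] => s; apply; rewrite mem_seq1.
  - by move=> [y s] /= [bxy xs]; exists x.
have [mf _] : L2 Omega f by case: hf.
pose h x : R := \sum_(p <- D') (rh p).2 x.
have ih (s : seq plane) : intO (fun x => \sum_(p <- s) (rh p).2 x).
  elim: s => [|p s IH].
    by under eq_fun do rewrite big_nil; apply: intg_cst; [exact: mO|exact: finO].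
  under eq_fun do rewrite big_cons; apply: (@intgD _ mplane R mu2 Omega mO) => //.
  by case: (H p).
apply: (@intg_le _ mplane R mu2 Omega mO _ h) (ih D'); first exact: measurable_funX.
apply: aeW => x Ox; rewrite ger0_norm ?exprn_even_ge0//.
have [p [pD pc bx]] := cov x (subset_closure Ox).
have [_ _ h0 hp] := H p.
apply: (le_trans (hp pc x Ox bx)); rewrite /h (big_rem p)//= lerDl sumr_ge0// => q _.
by case: (H q).
Qed.

End Sobolev.

Lemma Rint_ae0 d (T : measurableType d) (R : realType) (mu : {measure set T -> \bar R}) (D : set T)
   (mD : measurable D) (f : T -> R) :
  mu.-integrable D (EFin \o f) -> {ae mu, forall x, D x -> 0 <= f x} ->
  \int[mu]_(x in D) f x <= 0 -> {ae mu, forall x, D x -> f x = 0}.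
Proof.
move=> fi f0 I0; have mf := intg_meas fi.
have E : \int[mu]_(x in D) `|f x| = 0.
  apply/eqP; rewrite eq_le Rintegral_ge0// andbT; apply: le_trans I0.
  rewrite (Rint_ae mD mf _ (g := fun x => `|f x|)) //; first exact: measurableT_comp.
  by apply: filterS f0 => x f0 Dx; rewrite ger0_norm// f0.
have := Rint_EFin mD (intg_norm fi); rewrite E => E1.
have mfE : measurable_fun D (EFin \o f) by exact/measurable_EFinP.
have := proj1 (@ae_eq_integral_abs _ T R mu D mD (EFin \o f) mfE) E1.
by apply: filterS => x H1 Dx; have := H1 Dx; case.
Qed.

(** * The minimizer rho *)

Section Rho.
Context {R : realType}.
Local Notation plane := (R * R)%type.
Local Notation mplane := (measurableTypeR R * measurableTypeR R)%type.
Local Notation mu2 := (@lebesgue2 R).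
Implicit Types f g h u v w : plane -> R.
Variable Omega : set plane.
Hypothesis oO : open Omega.
Hypothesis bO : bounded_set Omega.
Hypothesis sO : smooth_boundary Omega.
Local Notation intO f := (mu2.-integrable (Omega : set mplane) (EFin \o f)).
Local Notation IO f := (\int[mu2]_(x in Omega) f x).
Local Notation mO := (mO oO).
Local Notation wd := (weak_derivative Omega).
Local Notation mfO := (measurable_fun (Omega : set mplane)).

Lemma normc_sqr (z : R[i]) : ComplexField.Normc.normc z ^+ 2 = complex.Re z ^+ 2 + complex.Im z ^+ 2.
Proof. by case: z => x y /=; rewrite sqr_sqrtr// addr_ge0// sqr_ge0. Qed.

Lemma normc2E (x y : R) : ComplexField.Normc.normc (x +i* y)%C ^+ 2 = x ^+ 2 + y ^+ 2.
Proof. exact: normc_sqr. Qed.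

Lemma normcRE (x : R) : ComplexField.Normc.normc (x%:C)%C ^+ 2 = x ^+ 2.
Proof. by rewrite normc2E expr0n addr0. Qed.

Lemma ioD f g : intO f -> intO g -> intO (fun x => f x + g x).
Proof. exact: (@intgD _ mplane R mu2 Omega mO). Qed.

Lemma ioB f g : intO f -> intO g -> intO (fun x => f x - g x).
Proof. exact: (@intgB _ mplane R mu2 Omega mO). Qed.

Lemma ioZ (k : R) f : intO f -> intO (fun x => k * f x).
Proof. exact: (@intgZ _ mplane R mu2 Omega mO). Qed.

Lemma io_eq f g : (forall x, f x = g x) -> intO f -> intO g.
Proof. by move=> /funext ->. Qed.

Lemma io_bnd (M : R) f g : mfO f -> {ae mu2, forall x, Omega x -> `|f x| <= M} -> intO g ->
  intO (fun x => f x * g x).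
Proof. exact: (@intg_bndM _ mplane R mu2 Omega mO). Qed.

Lemma io_bndT (M : R) f g : mfO f -> (forall x, `|f x| <= M) -> intO g -> intO (fun x => f x * g x).
Proof. by move=> mf fM; apply: (@io_bnd M f g mf); apply: aeW => x _; exact: fM. Qed.

Lemma io_le f g : mfO f -> {ae mu2, forall x, Omega x -> `|f x| <= g x} -> intO g -> intO f.
Proof. exact: (@intg_le _ mplane R mu2 Omega mO). Qed.

Lemma io_cst (c : R) : intO (fun=> c).
Proof. by apply: intg_cst; [exact: mO|exact: finO]. Qed.

Lemma Iadd f g : intO f -> intO g -> IO (fun x => f x + g x) = IO f + IO g.
Proof. exact: (@RintD _ mplane R mu2 Omega mO). Qed.

Lemma Isub f g : intO f -> intO g -> IO (fun x => f x - g x) = IO f - IO g.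
Proof. exact: (@RintB _ mplane R mu2 Omega mO). Qed.

Lemma Iscale (k : R) f : intO f -> IO (fun x => k * f x) = k * IO f.
Proof. exact: (@RintZ _ mplane R mu2 Omega mO). Qed.

Lemma I_ae f g : intO f -> mfO g -> {ae mu2, forall x, Omega x -> f x = g x} -> intO g /\ IO g = IO f.
Proof.
move=> fi mg fg; split; first exact: (@intg_ae _ mplane R mu2 Omega mO f).
apply/esym; apply: (@Rint_ae _ mplane R mu2 Omega mO) => //; exact: intg_meas fi.
Qed.

Lemma Ile f g : intO f -> intO g -> {ae mu2, forall x, Omega x -> f x <= g x} -> IO f <= IO g.
Proof. exact: (@Rint_le_ae _ mplane R mu2 Omega mO). Qed.

Lemma int_of_L2 f : L2 Omega f -> intO f.
Proof.
move=> Lf; have := L2_int oO (L2_cst oO bO 1) Lf; apply: io_eq => x; exact: mul1r.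
Qed.

Lemma H1_cst (c : R) : H1 Omega (fun=> c).
Proof.
apply: (H1_intro (L2_cst oO bO c) (L2_cst oO bO 0) (L2_cst oO bO 0)); apply: wd_cst => //; [by left|by right].
Qed.

Lemma H1_comp (F f : R -> R) (C : R) (w : plane -> R) : c11 F f C -> H1 Omega w ->
  H1 Omega (fun x => F (w x)).
Proof.
move=> c hw; have [C0 _ fB _] := c.
have [W1 L1] := H1_wd oO (or_introl erefl) hw; have [W2 L2'] := H1_wd oO (or_intror erefl) hw.
have mF : measurable_fun setT F by apply: continuous_measurable_fun; exact: c11_continuous c.
have mf : measurable_fun setT f by apply: continuous_measurable_fun; exact: c11_continuous_d c.
have [[mw w2] _] := hw.
have key g : L2 Omega g -> L2 Omega (fun x => f (w x) * g x).
  move=> Lg; have [mg _] := Lg; apply: (@L2_le _ _ oO _ g C) => //.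
    by apply: measurable_funM => //; exact: (measurableT_comp mf).
  by apply: aeW => x _; rewrite normrM ler_wpM2r.
apply: (H1_intro _ (key _ L1) (key _ L2') (wd_chain oO bO (or_introl erefl) c W1) (wd_chain oO bO (or_intror erefl) c W2)).
apply: (@L2_le _ _ oO _ (fun x => C * `|w x| + `|F 0|) 1).
- exact: (measurableT_comp mF).
- apply: aeW => x _; have := c11_lip c 0 (w x); rewrite subr0 mul1r => h.
  rewrite [leRHS]ger0_norm; last by rewrite addr_ge0// mulr_ge0.
  by rewrite -[F _](subrK (F 0)) (le_trans (ler_normD _ _))// lerD2r.
- apply: L2D => //; last exact: L2_cst.
  apply: L2Z => //; apply: (@L2_le _ _ oO _ w 1) => //; first exact: measurableT_comp.
  by apply: aeW => x _; rewrite normr_id mul1r.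
Qed.

Variables (b eps : R) (a rho : plane -> R).
Hypothesis Hb : 0 < b < 1.
Hypothesis Heps : 0 < eps.
Hypothesis Hameas : mfO a.
Hypothesis Ha : {ae mu2, forall x, Omega x -> b <= a x <= 1}.
Hypothesis Hrho : positive_minimizer Omega eps a rho.

Definition dens (v g1 g2 : plane -> R) (x : plane) :=
  g1 x ^+ 2 + g2 x ^+ 2 + (a x - v x ^+ 2) ^+ 2 / (2 * eps ^+ 2).

Lemma pot_int v : H1 Omega v -> intO (fun x => (a x - v x ^+ 2) ^+ 2 / (2 * eps ^+ 2)).
Proof.
move=> hv; have i4 := H1_L4 oO bO sO hv; have [[mv _] _] := hv.
have e20 : 0 < (2 * eps ^+ 2)^-1 by rewrite invr_gt0 mulr_gt0// exprn_gt0.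
apply: (@io_le _ (fun x => (2 * eps ^+ 2)^-1 * (2 + 2 * v x ^+ 4))).
- by apply: measurable_funM => //; apply: measurable_funX; apply: measurable_funB => //; exact: measurable_funX.
- apply: ae2S Ha => x ax Ox; have /andP[a0 a1] := ax Ox; have /andP[b0 _] := Hb.
  rewrite ger0_norm; last by rewrite mulr_ge0 ?sqr_ge0// ltW.
  rewrite [leLHS]mulrC; apply: ler_wpM2l; first exact: ltW.
  have -> : v x ^+ 4 = (v x ^+ 2) ^+ 2 by rewrite -exprM.
  have := sqr_ge0 (a x + v x ^+ 2); nra.
- by apply: ioZ; apply: ioD; [exact: io_cst|exact: ioZ].
Qed.

Lemma dens_int v g1 g2 : H1 Omega v -> L2 Omega g1 -> L2 Omega g2 -> intO (dens v g1 g2).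
Proof. by move=> hv [_ i1] [_ i2]; apply: ioD; [exact: ioD|exact: pot_int]. Qed.

Lemma wd_L2 v g e : (e = e1 \/ e = e2) -> H1 Omega v -> wd e v g -> L2 Omega g.
Proof.
move=> ee hv W; have [W' [mw w2]] := H1_wd oO ee hv.
have mg : mfO g by have [_ []] := W.
split => //; apply: (@intg_ae _ mplane R mu2 Omega mO (fun x => weakD Omega e v x ^+ 2)) => //.
  exact: measurable_funX.
by apply: ae2S (weakD_ae oO W) => x H Ox; rewrite H.
Qed.

Lemma E_dens v g1 g2 : H1 Omega v -> wd e1 v g1 -> wd e2 v g2 ->
  E Omega eps a (fun x => (v x)%:C%C) = (2^-1 * IO (dens v g1 g2))%:E.
Proof.
move=> hv W1 W2; have [[mv _] _] := hv.
have L1 := wd_L2 (or_introl erefl) hv W1; have L2' := wd_L2 (or_intror erefl) hv W2.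
have [W1' [m1 _]] := H1_wd oO (or_introl erefl) hv; have [W2' [m2 _]] := H1_wd oO (or_intror erefl) hv.
(* [weakD] is a choice: even for the zero imaginary part it vanishes only almost everywhere. *)
have [Z1 [mz1 _]] := H1_wd oO (or_introl erefl) (H1_cst 0); have [Z2 [mz2 _]] := H1_wd oO (or_intror erefl) (H1_cst 0).
have z1 := wd_uniq oO Z1 (wd_cst oO 0 (or_introl erefl)); have z2 := wd_uniq oO Z2 (wd_cst oO 0 (or_intror erefl)).
have id := dens_int hv L1 L2'.
rewrite /E EFinM -(Rint_EFin mO id); congr (_ * _)%E.
pose h x := weakD Omega e1 v x ^+ 2 + weakD Omega e1 (fun=> 0) x ^+ 2 +
    (weakD Omega e2 v x ^+ 2 + weakD Omega e2 (fun=> 0) x ^+ 2) + (a x - v x ^+ 2) ^+ 2 / (2 * eps ^+ 2).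
have mh : mfO h.
  have gen (q1 q2 q3 q4 : plane -> R) : mfO q1 -> mfO q2 -> mfO q3 -> mfO q4 ->
      mfO (fun x => q1 x ^+ 2 + q2 x ^+ 2 + (q3 x ^+ 2 + q4 x ^+ 2) + (a x - v x ^+ 2) ^+ 2 / (2 * eps ^+ 2)).
    move=> n1 n2 n3 n4.
    apply: measurable_funD; first by apply: measurable_funD; apply: measurable_funD; exact: measurable_funX.
    by apply: measurable_funM => //; apply: measurable_funX; apply: measurable_funB => //; exact: measurable_funX.
  exact: (gen _ _ _ _ m1 mz1 m2 mz2).
transitivity (\int[mu2]_(x in Omega) (h x)%:E)%E.
  apply: eq_integral => x _; apply: (congr1 EFin); congr (_ + _ + _).
  - exact: normc2E.
  - exact: normc2E.
  - congr ((_ - _) ^+ 2 / _); exact: normcRE.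
apply: ae_eq_integral; first exact: mO.
- exact/measurable_EFinP.
- by apply/measurable_EFinP; exact: (intg_meas id).
have z12 := ae2S2 (fun x p q => conj p q) z1 z2.
have H : {ae mu2, forall x, Omega x -> (h x)%:E = (dens v g1 g2 x)%:E}.
  apply: ae2S3 z12 (weakD_ae oO W1) (weakD_ae oO W2) => x [h1 h2] h3 h4 Ox.
  by rewrite /h /= h1// h2// h3// h4// /dens expr0n /= !addr0.
exact: H.
Qed.

Lemma H1rho : H1 Omega rho. Proof. by case: Hrho => -[]. Qed.

Let r1 := weakD Omega e1 rho.
Let r2 := weakD Omega e2 rho.
Let Wr1 : wd e1 rho r1. Proof. by have [] := H1_wd oO (or_introl erefl) H1rho. Qed.
Let Wr2 : wd e2 rho r2. Proof. by have [] := H1_wd oO (or_intror erefl) H1rho. Qed.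
Let Lr1 : L2 Omega r1. Proof. by have [] := H1_wd oO (or_introl erefl) H1rho. Qed.
Let Lr2 : L2 Omega r2. Proof. by have [] := H1_wd oO (or_intror erefl) H1rho. Qed.

Lemma min_le v g1 g2 : H1 Omega v -> wd e1 v g1 -> wd e2 v g2 ->
  IO (dens rho r1 r2) <= IO (dens v g1 g2).
Proof.
move=> hv W1 W2; have [_ _ /(_ (fun x => (v x)%:C%C))] := Hrho.
move=> /(_ _)/wrap[|]; first by split => //; exact: H1_cst.
rewrite (E_dens H1rho Wr1 Wr2) (E_dens hv W1 W2) lee_fin.
by rewrite ler_pM2l// invr_gt0.
Qed.

(** The slope bound |f| <= 1 does not increase the gradient energy, so a pointwise smaller potential
    contradicts minimality unless it is equal almost everywhere. *)
Lemma rho_cmp (F f : R -> R) (C : R) : c11 F f C -> (forall t, `|f t| <= 1) ->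
  {ae mu2, forall x, Omega x -> (a x - F (rho x) ^+ 2) ^+ 2 <= (a x - rho x ^+ 2) ^+ 2} ->
  {ae mu2, forall x, Omega x -> (a x - F (rho x) ^+ 2) ^+ 2 = (a x - rho x ^+ 2) ^+ 2}.
Proof.
move=> c f1 le.
have hF := H1_comp c H1rho.
have W1 := wd_chain oO bO (or_introl erefl) c Wr1; have W2 := wd_chain oO bO (or_intror erefl) c Wr2.
have L1 := wd_L2 (or_introl erefl) hF W1; have L2' := wd_L2 (or_intror erefl) hF W2.
have m := min_le hF W1 W2.
have i1 := dens_int H1rho Lr1 Lr2; have i2 := dens_int hF L1 L2'.
have e20 : 0 < (2 * eps ^+ 2)^-1 by rewrite invr_gt0 mulr_gt0// exprn_gt0.
have sq x (t : R) : (f (rho x) * t) ^+ 2 <= t ^+ 2.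
  rewrite exprMn ler_piMl ?sqr_ge0//; have := f1 (rho x); rewrite ler_norml => /andP[h1 h2]; nra.
have := @Rint_ae0 _ mplane R mu2 Omega mO _ (ioB i1 i2).
move=> /(_ _)/wrap[|].
  apply: ae2S le => x le Ox; rewrite /dens subr_ge0; apply: lerD; first exact: lerD.
  by apply: ler_wpM2r; [exact: ltW|exact: le].
move=> /(_ _)/wrap[|]; first by rewrite Isub// subr_le0.
apply: ae2S2 le => x le h Ox; have {h} := h Ox; rewrite /dens.
have s1 := sq x (r1 x); have s2 := sq x (r2 x).
have s3 : (a x - F (rho x) ^+ 2) ^+ 2 / (2 * eps ^+ 2) <= (a x - rho x ^+ 2) ^+ 2 / (2 * eps ^+ 2).
  by apply: ler_wpM2r; [exact: ltW|exact: le].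
move=> h; apply: (@mulIf _ (2 * eps ^+ 2)^-1); first by rewrite gt_eqF.
by apply/eqP; rewrite eq_le s3/=; lra.
Qed.

Lemma pot_lt_above (A T r : R) : A <= 1 -> 1 <= T -> T < r -> (A - T ^+ 2) ^+ 2 < (A - r ^+ 2) ^+ 2.
Proof.
move=> A1 T1 Tr.
have p1 : 0 < r ^+ 2 - T ^+ 2 by nra.
have p2 : 0 < r ^+ 2 + T ^+ 2 - 2 * A by nra.
have := mulr_gt0 p1 p2; nra.
Qed.

Lemma pot_lt_below (A T r s : R) : s ^+ 2 <= A -> 0 < r -> r < T -> T <= s -> (A - T ^+ 2) ^+ 2 < (A - r ^+ 2) ^+ 2.
Proof.
move=> sA r0 rT Ts.
have p1 : 0 < T ^+ 2 - r ^+ 2 by nra.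
have p2 : 0 < 2 * A - r ^+ 2 - T ^+ 2 by nra.
have := mulr_gt0 p1 p2; nra.
Qed.

(** The competitors are [trunc 1] and [lower (Num.sqrt b)] composed with rho. Where rho > 1,
    respectively 0 < rho < sqrt b, they strictly decrease the potential because a takes values in
    [b, 1]; by [rho_cmp] this happens on a null set only. *)
Lemma rho_bounds : {ae mu2, forall x, Omega x -> Num.sqrt b <= rho x <= 1}.
Proof.
have /andP[b0 b1] := Hb.
have [_ rho0 _] := Hrho.
have [C c] := c11_trunc (1 : R).
have up : {ae mu2, forall x, Omega x -> rho x <= 1}.
  have tr (t : R) : 1 < t -> 1 <= trunc 1 t < t.
    by rewrite /trunc /ramp_prim !posE => t1; apply/andP; have [a1|a1] := leP 0 (t - 1 - 1); have [a2|a2] := leP 0 (t - 1);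
     have [a3|a3] := leP 0 (- t - 1); have [a4|a4] := leP 0 (- t - 1 - 1); split; try lra; nra.
  have := rho_cmp c => /(_ _)/wrap[|].
    by move=> t; have [_ _ /andP[h1 h2]] := trunc_le t (ler01 : 0 <= 1 :> R); rewrite ger0_norm.
  move=> /(_ _)/wrap[|H].
    apply: ae2S2 Ha rho0 => x ax r0 Ox; have /andP[a0 a1] := ax Ox; have {}r0 := r0 Ox.
    have [r1'|r1'] := leP (rho x) 1.
      have h : `|rho x| <= 1 by rewrite gtr0_norm.
      by have [-> _] := trunc_id h.
    by have /andP[t1 t2] := tr _ r1'; rewrite ltW// pot_lt_above.
  apply: ae2S3 Ha rho0 H => x ax r0 H Ox; have /andP[a0 a1] := ax Ox; have {}r0 := r0 Ox; have {}H := H Ox.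
  rewrite leNgt; apply/negP => r1'; have /andP[t1 t2] := tr _ r1'; by have := pot_lt_above a1 t1 t2; rewrite H ltxx.
have s0 : 0 < Num.sqrt b by rewrite sqrtr_gt0.
have sE : Num.sqrt b ^+ 2 = b by rewrite sqr_sqrtr// ltW.
have [C' c'] := c11_lower (Num.sqrt b).
have lo : {ae mu2, forall x, Omega x -> Num.sqrt b <= rho x}.
  have := rho_cmp c' => /(_ _)/wrap[|].
    by move=> t; have [_ _ _ /andP[h1 h2]] := lower_props t s0; rewrite ger0_norm.
  move=> /(_ _)/wrap[|H].
    apply: ae2S2 Ha rho0 => x ax r0 Ox; have /andP[a0 a1] := ax Ox; have {}r0 := r0 Ox.
    have [h1 h2 _ _] := lower_props (rho x) s0.
    have [sr|sr] := leP (Num.sqrt b) (rho x); first by rewrite h1.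
    have /andP[t1 t2] : rho x < lower (Num.sqrt b) (rho x) <= Num.sqrt b by apply: h2; rewrite r0.
    by rewrite ltW// (pot_lt_below _ r0 t1 t2)// sE.
  apply: ae2S3 Ha rho0 H => x ax r0 H Ox; have /andP[a0 a1] := ax Ox; have {}r0 := r0 Ox; have {}H := H Ox.
  have [h1 h2 _ _] := lower_props (rho x) s0.
  rewrite leNgt; apply/negP => sr.
  have /andP[t1 t2] : rho x < lower (Num.sqrt b) (rho x) <= Num.sqrt b by apply: h2; rewrite r0.
  by have := pot_lt_below (_ : Num.sqrt b ^+ 2 <= a x) r0 t1 t2; rewrite H ltxx sE => /(_ a0).
by apply: ae2S2 up lo => x h1 h2 Ox; rewrite h1// h2.
Qed.

(** The terms 6 M^2, 4 M^3 and M^4 bound those of order 2, 3 and 4 in w, by means of r <= 1, |A -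
    r^2| <= 1 and |t| <= 1. The energy along a variation thus stays below a quadratic polynomial in
    t. *)
Lemma pot_expand_le (A r w t M : R) : 0 <= r <= 1 -> `|A - r ^+ 2| <= 1 -> `|w| <= M -> `|t| <= 1 ->
  (A - (r + t * w) ^+ 2) ^+ 2 <= (A - r ^+ 2) ^+ 2 - 4 * t * ((A - r ^+ 2) * r * w)
    + t ^+ 2 * (6 * M ^+ 2 + 4 * M ^+ 3 + M ^+ 4).
Proof.
move=> /andP[r0 r1'] q1 wM t1; set q := A - r ^+ 2 in q1 *.
have -> : A - (r + t * w) ^+ 2 = q - 2 * t * r * w - t ^+ 2 * w ^+ 2 by rewrite /q; ring.
have M0 : 0 <= M := le_trans (normr_ge0 _) wM.
have w2 : w ^+ 2 <= M ^+ 2 by rewrite -(real_normK (num_real w)) lerXn2r ?nnegrE.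
have w20 := sqr_ge0 w; have t20 := sqr_ge0 t.
have h1 : 4 * r ^+ 2 * w ^+ 2 - 2 * q * w ^+ 2 <= 6 * M ^+ 2.
  move: q1; rewrite ler_norml => /andP[q2 q3]; have r2' : r ^+ 2 <= 1 by nra.
  have p1 : 0 <= (1 - r ^+ 2) * w ^+ 2 by rewrite mulr_ge0// subr_ge0.
  have p2 : 0 <= (1 + q) * w ^+ 2 by rewrite mulr_ge0//; lra.
  nra.
have h2 : t * r * w ^+ 3 <= M ^+ 3.
  apply: (le_trans (ler_norm _)); rewrite normrM normrX normrM.
  have : `|w| ^+ 3 <= M ^+ 3 by rewrite lerXn2r ?nnegrE.
  apply: le_trans; rewrite ler_piMl ?exprn_ge0// mulr_ile1 ?(ger0_norm r0)//.
have h3 : t ^+ 2 * w ^+ 4 <= M ^+ 4.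
  have -> : w ^+ 4 = (w ^+ 2) ^+ 2 by rewrite -exprM.
  have -> : M ^+ 4 = (M ^+ 2) ^+ 2 by rewrite -exprM.
  have t2 : t ^+ 2 <= 1 by rewrite -(real_normK (num_real t)) expr_le1.
  apply: (@le_trans _ _ ((w ^+ 2) ^+ 2)); first by rewrite ler_piMl ?sqr_ge0.
  by rewrite lerXn2r ?nnegrE ?sqr_ge0.
have -> : (q - 2 * t * r * w - t ^+ 2 * w ^+ 2) ^+ 2 = q ^+ 2 - 4 * t * (q * r * w) +
   t ^+ 2 * ((4 * r ^+ 2 * w ^+ 2 - 2 * q * w ^+ 2) + 4 * (t * r * w ^+ 3) + t ^+ 2 * w ^+ 4) by ring.
by rewrite lerD2l ler_wpM2l//; lra.
Qed.

(** The point t = - al / C with C = |B| + |al| + 1 lies in [-1, 1], and there the polynomial is at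
    most - al^2 / C. *)
Lemma quad_min0 (al B : R) : (forall t, `|t| <= 1 -> 0 <= 2 * t * al + t ^+ 2 * B) -> al = 0.
Proof.
move=> H; pose C := `|B| + `|al| + 1.
have C0 : 0 < C by rewrite ltr_wpDl// addr_ge0.
have CB : B <= C by rewrite /C; have := ler_norm B; have := normr_ge0 al; lra.
have t1 : `|- (al / C)| <= 1.
  rewrite normrN normrM normfV (gtr0_norm C0) ler_pdivrMr// mul1r /C.
  by have := normr_ge0 B; lra.
have := H _ t1.
have -> : 2 * - (al / C) * al + (- (al / C)) ^+ 2 * B = - (al ^+ 2 / C) * (2 - B / C).
  by field; rewrite gt_eqF.
have h1 : 1 <= 2 - B / C by have : B / C <= 1 by [rewrite ler_pdivrMr// mul1r]; lra.
have h2 : 0 <= al ^+ 2 / C by rewrite divr_ge0 ?sqr_ge0// ltW.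
move=> h3; have h4 : al ^+ 2 / C = 0 by nra.
move/eqP: h4; rewrite mulf_eq0 invr_eq0 (gt_eqF C0) orbF expf_eq0 /= => /eqP; exact.
Qed.

(** Here r = rho, A = a, p = psi, m = grad psi, s = grad rho and D = eps^-2; the bracket is the
    Euler-Lagrange density tested with rho psi^2. The cross terms are absorbed in the squares of p
    s_i + 2 r m_i. *)
Lemma rho_caccioppoli_ineq (r A p m1 m2 s1 s2 D : R) : 0 <= r -> r <= 1 -> `|A - r ^+ 2| <= 1 -> 0 <= D ->
  p ^+ 2 * (s1 ^+ 2 + s2 ^+ 2) <=
  2 * (s1 * (r * (p * m1 + p * m1) + (p * p) * s1) + s2 * (r * (p * m2 + p * m2) + (p * p) * s2)
     - D * ((A - r ^+ 2) * r * (r * (p * p)))) + (4 + 2 * D) * (p ^+ 2 + (m1 ^+ 2 + m2 ^+ 2)).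
Proof.
move=> r0 r1' q1 D0; set q := A - r ^+ 2 in q1 *.
have r2' : r ^+ 2 <= 1 by rewrite expr_le1.
move: q1; rewrite ler_norml => /andP[q1 q2].
have h1 := sqr_ge0 (p * s1 + 2 * r * m1); have h2 := sqr_ge0 (p * s2 + 2 * r * m2).
have h3 : 0 <= (1 - r ^+ 2) * m1 ^+ 2 by rewrite mulr_ge0 ?sqr_ge0// subr_ge0.
have h4 : 0 <= (1 - r ^+ 2) * m2 ^+ 2 by rewrite mulr_ge0 ?sqr_ge0// subr_ge0.
have h5 : 0 <= D * (p ^+ 2 * (1 - q * r ^+ 2)).
  rewrite mulr_ge0// mulr_ge0 ?sqr_ge0// subr_ge0.
  by apply: (le_trans (_ : _ <= 1 * 1)); rewrite ?mulr1//; have := sqr_ge0 r; nra.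
have h6 : 0 <= D * (m1 ^+ 2 + m2 ^+ 2) by rewrite mulr_ge0// addr_ge0 ?sqr_ge0.
have h7 := sqr_ge0 p.
rewrite -subr_ge0.
have -> : 2 * (s1 * (r * (p * m1 + p * m1) + p * p * s1) + s2 * (r * (p * m2 + p * m2) + p * p * s2) -
   D * (q * r * (r * (p * p)))) + (4 + 2 * D) * (p ^+ 2 + (m1 ^+ 2 + m2 ^+ 2)) - p ^+ 2 * (s1 ^+ 2 + s2 ^+ 2) =
   (p * s1 + 2 * r * m1) ^+ 2 + (p * s2 + 2 * r * m2) ^+ 2 + 4 * ((1 - r ^+ 2) * m1 ^+ 2) + 4 * ((1 - r ^+ 2) * m2 ^+ 2)
   + 2 * (D * (p ^+ 2 * (1 - q * r ^+ 2))) + 2 * (D * (m1 ^+ 2 + m2 ^+ 2)) + 4 * p ^+ 2 by ring.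
by lra.
Qed.

(** Minimality along rho + t w, where the bound of w controls the coefficient of t^2. The test
    function is arbitrary on the boundary, so the identity contains the natural Neumann
    condition. *)
Lemma rho_EL w k1 k2 (M : R) : H1 Omega w -> {ae mu2, forall x, Omega x -> `|w x| <= M} ->
  wd e1 w k1 -> wd e2 w k2 ->
  intO (fun x => r1 x * k1 x + r2 x * k2 x - (eps ^+ 2)^-1 * ((a x - rho x ^+ 2) * rho x * w x)) /\
  IO (fun x => r1 x * k1 x + r2 x * k2 x - (eps ^+ 2)^-1 * ((a x - rho x ^+ 2) * rho x * w x)) = 0.
Proof.
move=> hw wM W1 W2.
have L1 := wd_L2 (or_introl erefl) hw W1; have L2' := wd_L2 (or_intror erefl) hw W2.
have [[mw _] _] := hw; have [[mr _] _] := H1rho.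
have /andP[b0 b1] := Hb; have rb := rho_bounds.
have sb0 : 0 <= Num.sqrt b by exact: sqrtr_ge0.
have qr : {ae mu2, forall x, Omega x -> 0 <= rho x <= 1 /\ `|a x - rho x ^+ 2| <= 1}.
  apply: ae2S2 rb Ha => x rb ax Ox; have /andP[p1 p2] := rb Ox; have /andP[p3 p4] := ax Ox.
  have p5 : 0 <= rho x := le_trans sb0 p1.
  split; first by rewrite p5.
  by rewrite ler_norml; apply/andP; split; nra.
have iq : intO (fun x => (a x - rho x ^+ 2) * rho x * w x).
  apply: (@io_bnd 1); last by apply: int_of_L2; case: hw.
  - by apply: measurable_funM => //; apply: measurable_funB => //; exact: measurable_funX.
  - apply: ae2S qr => x qr Ox; have [/andP[p1 p2] p3] := qr Ox.
    by rewrite normrM mulr_ile1// ger0_norm.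
pose A x := r1 x * k1 x + r2 x * k2 x - (eps ^+ 2)^-1 * ((a x - rho x ^+ 2) * rho x * w x).
have iA : intO A.
  by apply: ioB; [apply: ioD; exact: (L2_int oO)|exact: ioZ].
split => //.
pose K := (2 * eps ^+ 2)^-1 * (6 * M ^+ 2 + 4 * M ^+ 3 + M ^+ 4).
have iB : intO (fun x => k1 x ^+ 2 + k2 x ^+ 2 + K).
  by apply: ioD; [apply: ioD; [case: L1|case: L2']|exact: io_cst].
apply: (@quad_min0 _ (IO (fun x => k1 x ^+ 2 + k2 x ^+ 2 + K))) => t t1.
have ht := H1D oO H1rho (H1Z oO t hw).
have Wt1 := wdD oO Wr1 (wdZ oO t W1); have Wt2 := wdD oO Wr2 (wdZ oO t W2).
have m := min_le ht Wt1 Wt2.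
have it := dens_int ht (L2D oO Lr1 (L2Z oO t L1)) (L2D oO Lr2 (L2Z oO t L2')).
have i0 := dens_int H1rho Lr1 Lr2.
have i1 : intO (fun x => 2 * t * A x + t ^+ 2 * (k1 x ^+ 2 + k2 x ^+ 2 + K)) by apply: ioD; exact: ioZ.
have : IO (fun x => dens rho r1 r2 x) <= IO (fun x => dens rho r1 r2 x + (2 * t * A x + t ^+ 2 * (k1 x ^+ 2 + k2 x ^+ 2 + K))).
  apply: (le_trans m); apply: Ile => //; first exact: ioD.
  apply: ae2S2 qr wM => x qr wM Ox; have [p1 p3] := qr Ox.
  have := pot_expand_le p1 p3 (wM Ox) t1; rewrite /dens /A /K => h.
  have e20 : 0 < (2 * eps ^+ 2)^-1 by rewrite invr_gt0 mulr_gt0// exprn_gt0.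
  have {}h := ler_wpM2r (ltW e20) h.
  have E2 : (eps ^+ 2)^-1 = 2 * (2 * eps ^+ 2)^-1 by field; rewrite gt_eqF.
  rewrite E2; move: h; move: ((2 * eps ^+ 2)^-1) => D h.
  rewrite -subr_ge0 in h; rewrite -subr_ge0; apply: (le_trans h); rewrite le_eqVlt; apply/orP; left; apply/eqP; ring.
by rewrite (Iadd i0 i1) (Iadd (ioZ _ iA) (ioZ _ iB)) (Iscale _ iA) (Iscale _ iB) lerDl.
Qed.

Definition grad_sqr : plane -> R := fun x => r1 x ^+ 2 + r2 x ^+ 2.

Lemma grad_int : intO grad_sqr.
Proof. by have [_ ir1] := Lr1; have [_ ir2] := Lr2; exact: (ioD ir1 ir2). Qed.

(** The test function rho psi^2 is admissible in [rho_EL] because both rho and psi are bounded;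
    [rho_caccioppoli_ineq] is then integrated. *)
Lemma rho_caccioppoli_bounded psi k1 k2 (M : R) : H1 Omega psi -> (forall x, `|psi x| <= M) ->
  wd e1 psi k1 -> wd e2 psi k2 ->
  intO (fun x => psi x ^+ 2 * grad_sqr x) /\
  IO (fun x => psi x ^+ 2 * grad_sqr x) <= (4 + 2 * (eps ^+ 2)^-1) * IO (fun x => psi x ^+ 2 + (k1 x ^+ 2 + k2 x ^+ 2)).
Proof.
move=> hp pM W1 W2.
have L1 := wd_L2 (or_introl erefl) hp W1; have L2' := wd_L2 (or_intror erefl) hp W2.
have [[mp ip] _] := hp; have [[mr ir] _] := H1rho; have lp : L2 Omega psi by case: hp.
have [mk1 ik1] := L1; have [mk2 ik2] := L2'; have [mr1 ir1] := Lr1; have [mr2 ir2] := Lr2.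
have M0 : 0 <= M := le_trans (normr_ge0 _) (pM (0, 0)).
have rb : {ae mu2, forall x, Omega x -> 0 <= rho x <= 1 /\ `|a x - rho x ^+ 2| <= 1}.
  apply: ae2S2 rho_bounds Ha => x rb ax Ox; have /andP[p1 p2] := rb Ox; have /andP[p3 p4] := ax Ox.
  have p5 : 0 <= rho x := le_trans (sqrtr_ge0 _) p1; have /andP[b0 b1] := Hb.
  by split; [rewrite p5|rewrite ler_norml; apply/andP; split; nra].
have rb1 : {ae mu2, forall x, Omega x -> `|rho x| <= 1}.
  by apply: ae2S rb => x rx Ox; have [/andP[p1 p2] _] := rx Ox; rewrite ger0_norm.
have p2M x : `|psi x ^+ 2| <= M ^+ 2 by rewrite normrX lerXn2r ?nnegrE.
have mp2 : mfO (fun x => psi x ^+ 2) by exact: measurable_funX.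
have ig : intO (fun x => psi x ^+ 2 * grad_sqr x).
  exact: (io_bndT mp2 p2M grad_int).
split => //.
have Lpk k : L2 Omega k -> L2 Omega (fun x => psi x * k x + psi x * k x).
  move=> Lk; have [mk _] := Lk; apply: L2D => //; apply: (@L2_le _ _ oO _ k M) => //; try exact: measurable_funM;
  by apply: aeW => x _; rewrite normrM ler_wpM2r.
have Wp e k : (e = e1 \/ e = e2) -> wd e psi k -> L2 Omega k -> wd e (fun x => psi x * psi x) (fun x => psi x * k x + psi x * k x).
  move=> ee W Lk; apply: wd_mul => //; apply: int_loc => //; exact: (L2_int oO).
have Ww e k r : (e = e1 \/ e = e2) -> wd e psi k -> L2 Omega k -> wd e rho r -> L2 Omega r ->
   wd e (fun x => rho x * (psi x * psi x)) (fun x => rho x * (psi x * k x + psi x * k x) + (psi x * psi x) * r x) /\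
   L2 Omega (fun x => rho x * (psi x * k x + psi x * k x) + (psi x * psi x) * r x).
  move=> ee W Lk Wr Lr; have [mk _] := Lk; have [mr0 _] := Lr; have l1 : L2 Omega (fun x => rho x * (psi x * k x + psi x * k x)).
    apply: (@L2_le _ _ oO _ (fun x => psi x * k x + psi x * k x) 1); last exact: Lpk.
      by apply: measurable_funM => //; apply: measurable_funD; exact: measurable_funM.
    by apply: ae2S rb1 => x rx Ox; rewrite normrM ler_wpM2r// rx.
  have l2 : L2 Omega (fun x => (psi x * psi x) * r x).
    apply: (@L2_le _ _ oO _ r (M ^+ 2)) => //.
      by apply: measurable_funM => //; exact: measurable_funM.
    by apply: aeW => x _; rewrite -expr2 normrM ler_wpM2r.
  split; last exact: L2D.
  apply: wd_mul => //; [| | |exact: Wp]; try by apply: int_loc => //; exact: int_of_L2.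
  apply: int_loc => //; apply: (@io_bnd 1) => //.
have [Ww1 Lw1] := Ww _ _ _ (or_introl erefl) W1 L1 Wr1 Lr1.
have [Ww2 Lw2] := Ww _ _ _ (or_intror erefl) W2 L2' Wr2 Lr2.
have Lw : L2 Omega (fun x => rho x * (psi x * psi x)).
  apply: (@L2_le _ _ oO _ psi M) => //; first by apply: measurable_funM => //; exact: measurable_funM.
  apply: ae2S rb1 => x rx Ox; rewrite !normrM mulrA ler_wpM2r//.
  by apply: (@le_trans _ _ (1 * `|psi x|)); [rewrite ler_wpM2r// rx|rewrite mul1r].
have hw := H1_intro Lw Lw1 Lw2 Ww1 Ww2.
have wM : {ae mu2, forall x, Omega x -> `|rho x * (psi x * psi x)| <= M ^+ 2}.
  apply: ae2S rb1 => x rx Ox; rewrite -expr2 normrM.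
  by apply: (@le_trans _ _ (1 * `|psi x ^+ 2|)); [rewrite ler_wpM2r// rx|rewrite mul1r].
have [iE E0] := rho_EL hw wM Ww1 Ww2.
have iS : intO (fun x => psi x ^+ 2 + (k1 x ^+ 2 + k2 x ^+ 2)) by exact: (ioD ip (ioD ik1 ik2)).
set EL := (fun x => _) in iE E0.
rewrite -(Iscale _ iS) -[leRHS]add0r -(mulr0 2) -E0 -(Iscale _ iE) -Iadd; [|exact: ioZ|exact: ioZ].
apply: Ile => //; first by apply: ioD; exact: ioZ.
apply: ae2S rb => x rx Ox; have [/andP[p1 p2] p3] := rx Ox.
rewrite /EL /grad_sqr.
have D0 : 0 <= (eps ^+ 2)^-1 by rewrite invr_ge0 sqr_ge0.
move: p1 p2 p3 D0; move: (rho x) (a x) (psi x) (k1 x) (k2 x) (r1 x) (r2 x) ((eps ^+ 2)^-1) => r A p m1 m2 s1 s2 D.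
exact: rho_caccioppoli_ineq.
Qed.

(* Passes from bounded to arbitrary H^1 functions by truncation and Fatou. *)
Lemma caccioppoli_limit (G : plane -> R) (K : R) : mfO G -> {ae mu2, forall x, Omega x -> 0 <= G x} -> 0 <= K ->
  (forall psi k1 k2 (M : R), H1 Omega psi -> (forall x, `|psi x| <= M) -> wd e1 psi k1 -> wd e2 psi k2 ->
    intO (fun x => psi x ^+ 2 * G x) /\
    IO (fun x => psi x ^+ 2 * G x) <= K * IO (fun x => psi x ^+ 2 + (k1 x ^+ 2 + k2 x ^+ 2))) ->
  forall f, H1 Omega f -> intO (fun x => f x ^+ 2 * G x).
Proof.
move=> mG G0 K0 H f hf.
have [W1 L1] := H1_wd oO (or_introl erefl) hf; have [W2 L2'] := H1_wd oO (or_intror erefl) hf.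
have [[mf f2] _] := hf; have [mg1 g12] := L1; have [mg2 g22] := L2'.
set g1 := weakD Omega e1 f in W1 L1 mg1 g12; set g2 := weakD Omega e2 f in W2 L2' mg2 g22.
have iS : intO (fun x => f x ^+ 2 + (g1 x ^+ 2 + g2 x ^+ 2)) by exact: (ioD f2 (ioD g12 g22)).
have tW (n : nat) := (trunc_wd oO bO n (or_introl erefl) W1, trunc_wd oO bO n (or_intror erefl) W2).
have hT (n : nat) : H1 Omega (fun x => trunc n%:R (f x)).
  by have [C c] := c11_trunc (n%:R : R); exact: H1_comp c hf.
have key (n : nat) := H _ _ _ (n%:R + 1) (hT n) (fun x => (let: And3 _ h _ := trunc_norm n (f x) in h)) (tW n).1 (tW n).2.
have [] // := @Rint_fatou R _ mplane mu2 Omega mO (fun (n : nat) x => trunc n%:R (f x) ^+ 2 * G x) (fun x => f x ^+ 2 * G x)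
   (K * IO (fun x => f x ^+ 2 + (g1 x ^+ 2 + g2 x ^+ 2))).
- by move=> n; have [] := key n.
- by apply: measurable_funM => //; exact: measurable_funX.
- by apply: ae2S G0 => x G0 Ox n; rewrite mulr_ge0 ?sqr_ge0// G0.
- apply: aeW => x _; have [c _] := trunc_cvg (f x).
  by apply: cvgM; [apply: (cvgM c c)|exact: cvg_cst].
move=> n; have [_ h] := key n; apply: (le_trans h); apply: ler_wpM2l => //.
have [[mt it] _] := hT n.
have Lt1 := wd_L2 (or_introl erefl) (hT n) (tW n).1; have Lt2 := wd_L2 (or_intror erefl) (hT n) (tW n).2.
apply: Ile => //; first by apply: ioD => //; apply: ioD; [case: Lt1|case: Lt2].
apply: aeW => x _; have [h1 _ h2] := trunc_norm n (f x).
have sq (s t : R) : `|s| <= `|t| -> s ^+ 2 <= t ^+ 2.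
  by move=> st; rewrite -(real_normK (num_real s)) -(real_normK (num_real t)) lerXn2r ?nnegrE.
apply: lerD; first exact: sq.
by apply: lerD; apply: sq; rewrite normrM ler_piMl.
Qed.

Lemma rho_caccioppoli f : H1 Omega f -> intO (fun x => f x ^+ 2 * grad_sqr x).
Proof.
apply: (@caccioppoli_limit grad_sqr (4 + 2 * (eps ^+ 2)^-1)).
- exact: (intg_meas grad_int).
- by apply: aeW => x _; rewrite addr_ge0 ?sqr_ge0.
- by rewrite addr_ge0// mulr_ge0// invr_ge0 sqr_ge0.
- by move=> psi k1 k2 M hp pM W1 W2; exact: (rho_caccioppoli_bounded hp pM W1 W2).
Qed.

End Rho.

(** * The potential xi *)

Section Excess.
Context {R : realType}.

(* Bounded, zero exactly on [0, 1], positive to the right and negative to the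
   left: testing the equation of xi with [excess xi] yields 0 <= xi <= 1. *)
Definition excess (t : R) := ramp_prim 1 1 t + (-1) * ramp_prim 2 1 t + (-1) * (ramp_prim 0 1 (- t) + (-1) * ramp_prim 1 1 (- t)).
Definition excess' (t : R) := ramp 1 1 t + (-1) * ramp 2 1 t + (-1) * (- ramp 0 1 (- t) + (-1) * (- ramp 1 1 (- t))).

Lemma c11_excess : exists C, c11 excess excess' C.
Proof.
have h a := c11_ramp a (ler01 : (0:R) <= 1).
eexists; exact: (c11_D (c11_D (h 1) (c11_Z (-1) (h 2))) (c11_Z (-1) (c11_D (c11_refl (h 0)) (c11_Z (-1) (c11_refl (h 1)))))).
Qed.

Lemma ramp_diff (a t : R) : [/\ t <= a -> ramp_prim a 1 t + (-1) * ramp_prim (a + 1) 1 t = 0,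
  a < t -> 0 < ramp_prim a 1 t + (-1) * ramp_prim (a + 1) 1 t,
  0 <= ramp_prim a 1 t + (-1) * ramp_prim (a + 1) 1 t <= 1 & 0 <= ramp a 1 t + (-1) * ramp (a + 1) 1 t].
Proof.
rewrite /ramp_prim /ramp !posE.
have [a1|a1] := leP 0 (t - a); have [a2|a2] := leP 0 (t - a - 1);
have [a3|a3] := leP 0 (t - (a + 1)); have [a4|a4] := leP 0 (t - (a + 1) - 1); split;
 try move=> h; try (apply/andP; split); try lra; nra.
Qed.

Lemma excess_props t : [/\ 1 < t -> 0 < excess t, t < 0 -> excess t < 0, `|excess t| <= 1, excess 0 = 0 & 0 <= excess' t].
Proof.
have b0 (t : R) := ramp_diff 1 t; have b1 (t : R) := ramp_diff 0 t.
rewrite (_ : (1 + 1 = 2 :> R)) // in b0; rewrite (_ : (0 + 1 = 1 :> R)) ?add0r // in b1.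
have [p1 p2 /andP[p3 p3'] p4] := b0 t; have [q1 q2 /andP[q3 q3'] q4] := b1 (- t).
have [u1 _ _ _] := b0 0; have [v1 _ _ _] := b1 (- 0).
rewrite /excess /excess'; split.
- by move=> t1; rewrite q1; [have := p2 t1; lra|lra].
- by move=> t0; rewrite p1; [have := q2 (ltac:(lra)); lra|lra].
- by rewrite ler_norml; apply/andP; split; lra.
- by rewrite u1// v1 ?oppr0//; ring.
- by lra.
Qed.

End Excess.

Section PairL2.
Context d (T : measurableType d) (R : realType).
Variable mu : {measure set T -> \bar R}.
Variable D : set T.
Hypothesis mD : measurable D.
Local Notation intg f := (mu.-integrable D (EFin \o f)).
Local Notation I f := (\int[mu]_(x in D) f x).

(** Young's inequality with a weight, |v g| <= l g^2 + l^-1 v^2, replaces the Cauchy-Schwarz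
    inequality. *)
Lemma pair2_cvg (u g : T -> R) (u_ : nat -> T -> R) : measurable_fun D g -> (forall n, measurable_fun D (u_ n)) ->
  measurable_fun D u -> intg (fun x => g x ^+ 2) -> (forall n, intg (fun x => (u_ n x - u x) ^+ 2)) ->
  I (fun x => (u_ n x - u x) ^+ 2) @[n --> \oo] --> 0 ->
  (forall n, intg (fun x => (u_ n x - u x) * g x)) /\
  (I (fun x => `|(u_ n x - u x) * g x|) @[n --> \oo] --> 0).
Proof.
move=> mg mu_ mu' ig iu cu.
have id n : intg (fun x => (u_ n x - u x) * g x).
  by apply: (@intg_sqrM _ T R mu D mD) => //; exact: measurable_funB.
split => //; apply/cvgrPdist_le => e e0.
have Ig0 : 0 <= I (fun x => g x ^+ 2) by apply: Rintegral_ge0 => x _; exact: sqr_ge0.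
pose G := I (fun x => g x ^+ 2) + 1; have G0 : 0 < G by rewrite /G ltr_wpDl.
(* Since the integral of g^2 is at most G, the first term is at most e/2; the second is too as soon
   as the squared distance is below l e / 2. *)
pose l := e / 2 / G; have l0 : 0 < l by rewrite /l !divr_gt0.
have le0 : 0 < l * (e / 2) by rewrite mulr_gt0// divr_gt0.
move/cvgrPdist_le: cu => /(_ _ le0); apply: filterS => n; rewrite !sub0r !normrN => h.
have {}h := le_trans (ler_norm _) h.
rewrite ger0_norm; last by apply: Rintegral_ge0.
apply: (@le_trans _ _ (I (fun x => l * g x ^+ 2 + l^-1 * (u_ n x - u x) ^+ 2))).
  apply: le_Rintegral => //; first exact: intg_norm.
    by apply: intgD => //; exact: intgZ.
  move=> x _; rewrite normrM.
  rewrite -(real_normK (num_real (g x))) -(real_normK (num_real (u_ n x - u x))).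
  have n1 := normr_ge0 (g x); have n2 := normr_ge0 (u_ n x - u x).
  rewrite -(ler_pM2l l0) mulrDr [l * (l^-1 * _)]mulrA mulfV ?gt_eqF// mul1r.
  move: n1 n2; move: `|g x| `|u_ n x - u x| => A B A0 B0.
  have := sqr_ge0 (l * A - B); have := mulr_ge0 (ltW l0) (mulr_ge0 A0 B0); nra.
rewrite RintD//; [|exact: intgZ|exact: intgZ].
rewrite !RintZ// [e]splitr; apply: lerD.
  rewrite /l -/G mulrAC ler_pdivrMr// ler_wpM2l ?divr_ge0 ?(ltW e0)//.
  by rewrite /G lerDl.
by rewrite -(ler_pM2l l0) mulrA mulfV ?gt_eqF// mul1r.
Qed.

Lemma cvg_of_L1 (u : T -> R) (u_ : nat -> T -> R) : intg u -> (forall n, intg (fun x => u_ n x - u x)) ->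
  I (fun x => `|u_ n x - u x|) @[n --> \oo] --> 0 ->
  (forall n, intg (u_ n)) /\ (I (u_ n) @[n --> \oo] --> I u).
Proof.
move=> iu id c.
have iun n : intg (u_ n).
  have := intgD mD (id n) iu; apply: eq_intg => // x _; exact: subrK.
split => //; apply/cvgrPdist_le => e e0.
move/cvgrPdist_le: c => /(_ _ e0); apply: filterS => n; rewrite sub0r normrN => h.
rewrite distrC -RintB//; apply: (le_trans (Rint_norm_le mD (id n))).
exact: le_trans (ler_norm _) h.
Qed.

End PairL2.

(** * Enlarging the class of test functions of a divergence equation *)

Section Xi.
Context {R : realType}.
Local Notation plane := (R * R)%type.
Local Notation mplane := (measurableTypeR R * measurableTypeR R)%type.
Local Notation mu2 := (@lebesgue2 R).
Implicit Types f g h u w phi : plane -> R.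
Variable Omega : set plane.
Hypothesis oO : open Omega.
Hypothesis bO : bounded_set Omega.
Local Notation intT f := (mu2.-integrable [set: mplane] (EFin \o f)).
Local Notation intO f := (mu2.-integrable (Omega : set mplane) (EFin \o f)).
Local Notation IO f := (\int[mu2]_(x in Omega) f x).
Local Notation mO := (mO oO).
Local Notation wd := (weak_derivative Omega).
Local Notation mfO := (measurable_fun (Omega : set mplane)).

Lemma test_L2 phi : test_function Omega phi -> L2 Omega phi.
Proof.
move=> tp; have [M M0 HM] := test_bounded tp.
by apply: (@L2_bnd _ _ oO bO _ M); [exact: test_meas|apply: aeW => x _; exact: HM].
Qed.

Lemma L2_test phi f : test_function Omega phi -> L2 Omega f -> L2 Omega (fun x => phi x * f x).
Proof.
move=> tp Lf; have [M M0 HM] := test_bounded tp; have [mf _] := Lf.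
apply: (@L2_le _ _ oO _ f M) => //; first by apply: measurable_funM => //; exact: test_meas.
by apply: aeW => x _; rewrite normrM ler_wpM2r.
Qed.

Lemma L2_ext f (K : set plane) : L2 Omega f -> compact K -> K `<=` Omega -> intT (f \_ K) /\ intT (fun x => (f \_ K) x ^+ 2).
Proof.
move=> Lf cK KO; have [mf f2] := Lf.
split; first exact: (loc_zext (L2_loc oO bO Lf) cK KO).
have l2 : loc_integrable Omega (fun x => f x ^+ 2) by apply: int_loc.
have := loc_zext l2 cK KO; apply: eq_integrable => // x _ /=.
by rewrite !patchE; case: ifP => //; rewrite expr0n.
Qed.

(** A mollified indicator of a compact neighbourhood of [K]. The scale is at most r/2, so the
    function equals 1 on a whole neighbourhood of [K], whence its derivatives vanish on [K]; it is
    at most r', which keeps the support in [K2]. *)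
Lemma exists_cutoff (K : set plane) : compact K -> K `<=` Omega ->
  exists chi, test_function Omega chi /\ forall x, K x -> chi x = 1 /\ forall v, 'D_v chi x = 0.
Proof.
move=> cK KO.
have [K1 [r [r0 cK1 K1O xK]]] := compact_core oO cK KO.
have [K2 [r' [r'0 cK2 K2O xK1]]] := compact_core oO cK1 K1O.
pose s := Num.min (r / 2) r'.
have s0 : 0 < s by rewrite /s lt_min r'0 divr_gt0.
have [k kk] := exists_kernel (0 : plane) s0; have [sk _ kb k1] := kk; have ck := csupp_ball kb.
pose one : plane -> R := fun=> 1.
have i1 : intT (one \_ K1) by exact: (loc_zext (loc_cst oO bO 1) cK1 K1O).
pose chi := moll k (one \_ K1).
have ss : smooth chi by exact: moll_smooth.
have chi1 y : ball y s `<=` K1 -> chi y = 1.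
  move=> yK; rewrite /chi /moll -k1.
  rewrite -(int_shift (- y) (f := k)); last by apply: csupp_integrable => //; exact: smooth_continuous.
  apply: eq_Rintegral => z _; rewrite patchE; case: ifPn => zK; first by rewrite mul1r.
  rewrite mul0r kb// => -[b1 b2]; move: zK; rewrite mem_set//; apply: yK; split.
    by move: b1; rewrite /ball/= sub0r normrN distrC.
  by move: b2; rewrite /ball/= sub0r normrN distrC.
exists chi; split.
  split => //; exists K2; split => // x nx.
  rewrite /chi /moll /Rintegral integral0_eq// => z _; congr EFin.
  rewrite patchE; case: ifPn => zK; last by rewrite mul0r.
  rewrite mul1r kb// => -[b1 b2]; apply: nx; apply: (xK1 z (set_mem zK)).
  have sr : s <= r' by rewrite /s ge_min lexx orbT.
  apply: (le_ball sr); split.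
    by move: b1; rewrite /ball/= sub0r normrN.
  by move: b2; rewrite /ball/= sub0r normrN.
move=> x Kx.
have r2 : 0 < r / 2 by rewrite divr_gt0.
have near1 : \forall y \near x, chi y = 1.
  have nx : nbhs x (ball x (r / 2)) by exact: nbhsx_ballx.
  apply: filterS nx => y xy; apply: chi1 => z yz; apply: (xK x Kx).
  rewrite (splitr r); apply: (ball_triangle xy); apply: le_ball yz.
  by rewrite /s ge_min lexx.
split; first exact: (nbhs_singleton near1).
move=> v; rewrite (@near_eq_derive _ _ _ chi (cst 1)) ?derive_cst//.
Qed.

Section DivMul.
Variables (q1 q2 s : plane -> R).
Hypothesis Lq1 : L2 Omega q1.
Hypothesis Lq2 : L2 Omega q2.
Hypothesis Ls : L2 Omega s.
Hypothesis divq : forall phi, test_function Omega phi ->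
  IO (fun x => q1 x * 'D_e1 phi x + q2 x * 'D_e2 phi x) = IO (fun x => s x * phi x).

(** Extends the equation from smooth test functions to phi eta with eta weakly differentiable. It is
    q and s that are mollified, not eta: on the support of phi the mollified field has a classical
    divergence, and its product with phi is a test function for the weak derivatives of eta. *)
Lemma div_mul phi eta g1 g2 : test_function Omega phi -> L2 Omega eta -> L2 Omega g1 -> L2 Omega g2 ->
  wd e1 eta g1 -> wd e2 eta g2 ->
  IO (fun x => q1 x * (phi x * g1 x + 'D_e1 phi x * eta x) + q2 x * (phi x * g2 x + 'D_e2 phi x * eta x)) =
  IO (fun x => s x * (phi x * eta x)).
Proof.
move=> tp Leta L1 L2' W1 W2.
have [sp [K [cK KO pK]]] := tp.
have [K' [r [r0 cK' KO' xK]]] := compact_core oO cK KO.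
have KK' : K `<=` K' by move=> x Kx; apply: (xK x Kx); exact: ballxx.
have [k_ [kk k0]] := @exists_kseq R.
have sk n : smooth (k_ n) by case: (k0 n).
have ck n : csupp (k_ n) by case: (k0 n) => _ _ /csupp_ball.
have [i1 i1'] := L2_ext Lq1 cK' KO'; have [i2 i2'] := L2_ext Lq2 cK' KO'; have [is_ is'] := L2_ext Ls cK' KO'.
pose Q1 n := moll (k_ n) (q1 \_ K'); pose Q2 n := moll (k_ n) (q2 \_ K'); pose S n := moll (k_ n) (s \_ K').
have sQ1 n : smooth (Q1 n) := moll_smooth (sk n) (ck n) i1.
have sQ2 n : smooth (Q2 n) := moll_smooth (sk n) (ck n) i2.
have sS n : smooth (S n) := moll_smooth (sk n) (ck n) is_.
have tD1 := test_D e1 tp; have tD2 := test_D e2 tp.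
pose G1 x := phi x * g1 x + 'D_e1 phi x * eta x; pose G2 x := phi x * g2 x + 'D_e2 phi x * eta x.
have LG1 : L2 Omega G1 by apply: L2D => //; exact: L2_test.
have LG2 : L2 Omega G2 by apply: L2D => //; exact: L2_test.
have LG0 : L2 Omega (fun x => phi x * eta x) by exact: L2_test.
have mQ f : smooth f -> mfO f by move=> sf; apply: measurable_funTS; exact: smooth_measurable.
have divQ n x : n.+1%:R^-1 <= r -> K x -> 'D_e1 (Q1 n) x + 'D_e2 (Q2 n) x = - S n x.
  move=> nr Kx; have bK : ball x (n.+1%:R^-1) `<=` K' by apply: subset_trans (xK x Kx); exact: le_ball.
  have [_ ->] := moll_is_derive x e1 (sk n) (ck n) i1; have [_ ->] := moll_is_derive x e2 (sk n) (ck n) i2.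
  have tk := shift_test cK' KO' (k0 n) (@subset_refl _ _) bK.
  rewrite /S (moll_loc KO' (k0 n) (@subset_refl _ _) _ bK) -(divq tk).
  have E v q : L2 Omega q -> moll (fun z => - 'D_v (k_ n) z) (q \_ K') x = - IO (fun z => q z * 'D_v (fun z => k_ n (z - x)) z).
    move=> Lq; have [iq _] := L2_ext Lq cK' KO'.
    have H0 z : ~ K' z -> 'D_v (fun z => k_ n (z - x)) z = 0.
      move=> nz; apply: derive_near0.
      have oC : open (~` K') by rewrite openC; exact: compact_closed2.
      by apply: filterS (open_nbhs_nbhs (conj oC nz)) => y; exact: (shift_supp (k0 n) (@subset_refl _ _) bK).
    rewrite (int_zext _ KO' H0) -(@RintN _ mplane R mu2 setT measurableT).
      by apply: eq_Rintegral => z _; rewrite derive_shiftx mulrN.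
    have := moll_int x (smooth_D v (sk n)) (csupp_D v (ck n)) iq.
    by apply: eq_integrable => // z _; rewrite /= derive_shiftx.
  rewrite (E _ _ Lq1) (E _ _ Lq2) -opprD; congr (- _).
  by apply/esym; apply: (Iadd oO); apply: (L2_int oO) => //; apply: test_L2; exact: test_D.
have ibp Q g e : smooth Q -> L2 Omega g -> wd e eta g ->
    IO (fun x => Q x * (phi x * g x + 'D_e phi x * eta x)) = - IO (fun x => eta x * ('D_e Q x * phi x)).
  move=> sQ Lg [_ _ W].
  have t1 := testM sQ tp; have t2 := testM (smooth_D e sQ) tp; have t3 := testM sQ (test_D e tp).
  have j1 := L2_int oO Lg (test_L2 t1); have j2 := L2_int oO Leta (test_L2 t2); have j3 := L2_int oO Leta (test_L2 t3).
  have := W _ t1.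
  transitivity (IO (fun x => g x * (Q x * phi x)) + IO (fun x => eta x * (Q x * 'D_e phi x))).
    rewrite -(Iadd oO j1 j3); apply: eq_Rintegral => x _.
    by move: (Q x) (phi x) (g x) ('D_e phi x) (eta x) => ? ? ? ? ?; ring.
  have {}H := W _ t1.
  have Dq x : 'D_e (fun x => Q x * phi x) x = Q x * 'D_e phi x + 'D_e Q x * phi x.
    have d1 : is_derive x e Q ('D_e Q x) := DeriveDef (@smooth_derivable _ _ Q x e sQ) erefl.
    have d2 : is_derive x e phi ('D_e phi x) := DeriveDef (@smooth_derivable _ _ phi x e sp) erefl.
    by have [] := is_derive_mul d1 d2.
  have H2 : IO (fun x => eta x * 'D_e (fun x => Q x * phi x) x) =
      IO (fun x => eta x * (Q x * 'D_e phi x)) + IO (fun x => eta x * ('D_e Q x * phi x)).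
    by rewrite -(Iadd oO j3 j2); apply: eq_Rintegral => x _; rewrite Dq mulrDr.
  have alg (X Y Z : R) : Y + Z = - X -> X + Y = - Z by move=> YZ; lra.
  by apply: alg; rewrite -H2.
have EQ n : n.+1%:R^-1 <= r ->
   IO (fun x => Q1 n x * G1 x) + IO (fun x => Q2 n x * G2 x) = IO (fun x => S n x * (phi x * eta x)).
  move=> nr; rewrite (ibp _ _ _ (sQ1 n) L1 W1) (ibp _ _ _ (sQ2 n) L2' W2) -opprD.
  have j1 := L2_int oO Leta (test_L2 (testM (smooth_D e1 (sQ1 n)) tp)).
  have j2 := L2_int oO Leta (test_L2 (testM (smooth_D e2 (sQ2 n)) tp)).
  rewrite -(Iadd oO j1 j2) -(@RintN _ mplane R mu2 Omega mO); last exact: (ioD oO j1 j2).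
  apply: eq_Rintegral => x _; have [Kx|nKx] := pselect (K x); last by rewrite (pK x nKx); ring.
  have := divQ n x nr Kx; move: ('D_e1 (Q1 n) x) ('D_e2 (Q2 n) x) (S n x) (phi x) (eta x) => A B C D F AB.
  have -> : A = - C - B by rewrite -AB addrK.
  by ring.
have lim (f G : plane -> R) : L2 Omega f -> L2 Omega G -> (forall x, ~ K' x -> G x = 0) ->
    IO (fun x => moll (k_ n) (f \_ K') x * G x) @[n --> \oo] --> IO (fun x => f x * G x).
  move=> Lf [mG iG] G0; have [jf jf2] := L2_ext Lf cK' KO'.
  have [id2 cd2] := moll_cvg2 kk jf jf2.
  have TO h : intT h -> intO h by exact: (@integrableS _ mplane R mu2 setT Omega _ measurableT mO (@subsetT _ _)).
  have cO : IO (fun x => (moll (k_ n) (f \_ K') x - (f \_ K') x) ^+ 2) @[n --> \oo] --> 0.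
    apply: squeeze_cvgr cd2; last exact: cvg_cst.
    apply: nearW => n; apply/andP; split; first by apply: Rintegral_ge0 => x _; exact: sqr_ge0.
    rewrite /Rintegral; apply: fine_le.
    - exact: (integrable_fin_num mO (TO _ (id2 n))).
    - exact: (integrable_fin_num measurableT (id2 n)).
    - apply: ge0_subset_integral => //; first exact: mO.
        exact: (measurable_int mu2 (id2 n)).
      by move=> x _; rewrite lee_fin sqr_ge0.
  have muf : mfO (f \_ K') by exact: (intg_meas (TO _ jf)).
  have mun n : mfO (moll (k_ n) (f \_ K')) by apply: mQ; exact: (moll_smooth (sk n) (ck n) jf).
  have [ip cp] := @pair2_cvg _ mplane R mu2 Omega mO _ _ _ mG mun muf iG (fun n => TO _ (id2 n)) cO.
  have if0 : intO (fun x => (f \_ K') x * G x).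
    by apply: (@intg_sqrM _ mplane R mu2 Omega mO) => //; exact: (TO _ jf2).
  have E0 : IO (fun x => (f \_ K') x * G x) = IO (fun x => f x * G x).
    apply: eq_Rintegral => x _; rewrite patchE; case: ifPn => // xK'.
    by rewrite G0 ?mulr0// => Kx; move: xK'; rewrite mem_set.
  rewrite -E0; have [] // := @cvg_of_L1 _ mplane R mu2 Omega mO (fun x => (f \_ K') x * G x)
    (fun n x => moll (k_ n) (f \_ K') x * G x) if0.
  - by move=> n; have := ip n; apply: (io_eq) => x; rewrite mulrBl.
  - by under eq_fun do under eq_Rintegral do rewrite -mulrBl.
have oCK : open (~` K) by rewrite openC; exact: compact_closed2.
have DpK v x : ~ K x -> 'D_v phi x = 0.
  by move=> nKx; apply: derive_near0; apply: filterS (open_nbhs_nbhs (conj oCK nKx)) => y; exact: pK.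
have z0 x : ~ K' x -> phi x * eta x = 0 by move=> nx; rewrite pK ?mul0r// => /KK'.
have z1 x : ~ K' x -> G1 x = 0 by move=> nx; rewrite /G1 pK ?DpK ?mul0r ?addr0// => /KK'.
have z2 x : ~ K' x -> G2 x = 0 by move=> nx; rewrite /G2 pK ?DpK ?mul0r ?addr0// => /KK'.
have c1 := lim _ _ Lq1 LG1 z1; have c2 := lim _ _ Lq2 LG2 z2; have c3 := lim _ _ Ls LG0 z0.
rewrite (Iadd oO (L2_int oO Lq1 LG1) (L2_int oO Lq2 LG2)).
apply: (cvg_unique _ (cvgD c1 c2)) => //; apply: cvg_trans c3; apply: near_eq_cvg.
near=> n; apply/esym; apply: EQ; apply: ltW; near: n; exact: (near_infty_natSinv_lt (PosNum r0)).
Unshelve. all: by end_near. Qed.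

End DivMul.

Section Comp.
Variables (q1 q2 s xi p1 p2 : plane -> R).
Hypothesis Lq1 : L2 Omega q1.
Hypothesis Lq2 : L2 Omega q2.
Hypothesis Ls : L2 Omega s.
Hypothesis divq : forall phi, test_function Omega phi ->
  IO (fun x => q1 x * 'D_e1 phi x + q2 x * 'D_e2 phi x) = IO (fun x => s x * phi x).
Hypothesis Lxi : L2 Omega xi.
Hypothesis Lp1 : L2 Omega p1.
Hypothesis Lp2 : L2 Omega p2.
Variable phi_ : nat -> plane -> R.
Hypothesis tphi : forall n, test_function Omega (phi_ n).
Hypothesis cphi : IO (fun x => (phi_ n x - xi x) ^+ 2) @[n --> \oo] --> 0.
Hypothesis cphi1 : IO (fun x => ('D_e1 (phi_ n) x - p1 x) ^+ 2) @[n --> \oo] --> 0.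
Hypothesis cphi2 : IO (fun x => ('D_e2 (phi_ n) x - p2 x) ^+ 2) @[n --> \oo] --> 0.

Lemma L2_mulM (M : R) h f : mfO h -> (forall x, `|h x| <= M) -> L2 Omega f -> L2 Omega (fun x => h x * f x).
Proof.
move=> mh hM Lf; have [mf _] := Lf.
apply: (@L2_le _ _ oO _ f M) => //; first exact: measurable_funM.
by apply: aeW => x _; rewrite normrM ler_wpM2r.
Qed.

(** F(phi) is not smooth, so it is attached to the weakly differentiable factor of [div_mul]. The
    smooth factor is a cutoff equal to 1 on the support of phi, and [F 0 = 0] confines everything to
    that support. *)
Lemma div_comp (F f : R -> R) (C : R) phi eta g1 g2 : c11 F f C -> F 0 = 0 -> test_function Omega phi ->
  L2 Omega eta -> L2 Omega g1 -> L2 Omega g2 -> wd e1 eta g1 -> wd e2 eta g2 ->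
  IO (fun x => (q1 x * g1 x + q2 x * g2 x) * F (phi x) +
               f (phi x) * (q1 x * 'D_e1 phi x + q2 x * 'D_e2 phi x) * eta x) =
  IO (fun x => s x * eta x * F (phi x)).
Proof.
move=> c F0 tp Leta L1 L2' W1 W2; have [C0 _ fB _] := c.
have [sp [K [cK KO pK]]] := tp.
have [chi [tc chi1]] := exists_cutoff cK KO.
have mF : measurable_fun setT F by apply: continuous_measurable_fun; exact: c11_continuous c.
have mf : measurable_fun setT f by apply: continuous_measurable_fun; exact: c11_continuous_d c.
have mp := test_meas tp.
have [M M0 pM] := test_bounded tp.
have mFp : mfO (fun x => F (phi x)) by exact: (measurableT_comp mF mp).
have FM x : `|F (phi x)| <= C * M.
  have := c11_lip c 0 (phi x); rewrite F0 !subr0 => h; apply: (le_trans h).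
  by apply: ler_wpM2l.
have key e g : (e = e1 \/ e = e2) -> L2 Omega g -> wd e eta g ->
    wd e (fun x => F (phi x) * eta x) (fun x => F (phi x) * g x + eta x * (f (phi x) * 'D_e phi x)) /\
    L2 Omega (fun x => F (phi x) * g x + eta x * (f (phi x) * 'D_e phi x)).
  move=> ee Lg W.
  have tD := test_D e tp; have [N N0 DN] := test_bounded tD.
  have l1 := L2_mulM mFp FM Lg.
  have l2 : L2 Omega (fun x => eta x * (f (phi x) * 'D_e phi x)).
    have mfD : mfO (fun x => f (phi x) * 'D_e phi x).
      by apply: measurable_funM; [exact: (measurableT_comp mf mp)|exact: test_meas].
    have fDN x : `|f (phi x) * 'D_e phi x| <= C * N by rewrite normrM; apply: ler_pM.
    have := L2_mulM mfD fDN Leta; by under eq_fun do rewrite mulrC.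
  split; last exact: L2D.
  apply: (wd_mul oO bO ee _ _ _ _ W).
  - by apply: L2_loc => //; exact: (L2_mulM mFp FM Leta).
  - exact: L2_loc.
  - exact: L2_loc.
  - by apply: wd_chain c _ => //; exact: wd_smooth.
have [V1 l1] := key _ _ (or_introl erefl) L1 W1; have [V2 l2] := key _ _ (or_intror erefl) L2' W2.
have l0 := L2_mulM mFp FM Leta.
have oCK : open (~` K) by rewrite openC; exact: compact_closed2.
have DpK v x : ~ K x -> 'D_v phi x = 0.
  by move=> nKx; apply: derive_near0; apply: filterS (open_nbhs_nbhs (conj oCK nKx)) => y; exact: pK.
have := div_mul Lq1 Lq2 Ls divq tc l0 l1 l2 V1 V2 => E.
transitivity (IO (fun x => s x * (chi x * (F (phi x) * eta x)))); last first.
  apply: eq_Rintegral => x _; have [Kx|nKx] := pselect (K x); last by rewrite (pK _ nKx) F0; ring.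
  by have [-> _] := chi1 x Kx; ring.
rewrite -E; apply: eq_Rintegral => x _.
have [Kx|nKx] := pselect (K x); last by rewrite !(DpK _ _ nKx) (pK _ nKx) F0; ring.
have [-> dc] := chi1 x Kx; rewrite !dc.
by move: ('D_e1 phi x) ('D_e2 phi x) (F (phi x)) (f (phi x)) => ? ? ? ?; ring.
Qed.

(** F(xi) inherits the zero trace of xi because [F 0 = 0], so eta is unrestricted on the boundary.
    In [div_comp] the test functions tend to xi: F(phi_n) converges in L^1 and stays bounded, which
    suffices against the L^1 function q . grad eta, and [chain_limit] handles the gradient term. *)
Lemma div_xi (F f : R -> R) (C B M : R) eta g1 g2 : c11 F f C -> F 0 = 0 -> (forall t, `|F t| <= B) ->
  (forall x, `|eta x| <= M) ->
  L2 Omega eta -> L2 Omega g1 -> L2 Omega g2 -> wd e1 eta g1 -> wd e2 eta g2 ->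
  [/\ intO (fun x => (q1 x * g1 x + q2 x * g2 x) * F (xi x)),
      intO (fun x => f (xi x) * (q1 x * p1 x + q2 x * p2 x) * eta x),
      intO (fun x => s x * eta x * F (xi x)) &
  IO (fun x => (q1 x * g1 x + q2 x * g2 x) * F (xi x)) +
  IO (fun x => f (xi x) * (q1 x * p1 x + q2 x * p2 x) * eta x) =
  IO (fun x => s x * eta x * F (xi x))].
Proof.
move=> c F0 FB eM Leta L1 L2' W1 W2; have [C0 _ fB _] := c.
have B0 : 0 <= B := le_trans (normr_ge0 _) (FB 0).
have mF : measurable_fun setT F by apply: continuous_measurable_fun; exact: c11_continuous c.
have mf : measurable_fun setT f by apply: continuous_measurable_fun; exact: c11_continuous_d c.
have [mxi ixi] := Lxi; have [mq1 iq1] := Lq1; have [mq2 iq2] := Lq2; have [mp1 ip1] := Lp1; have [mp2 ip2] := Lp2.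
have [me ie] := Leta.
have mphi n : mfO (phi_ n) by exact: test_meas.
have mD1 n : mfO ('D_e1 (phi_ n)) by apply: test_meas; exact: test_D.
have mD2 n : mfO ('D_e2 (phi_ n)) by apply: test_meas; exact: test_D.
have sqD h f' : L2 Omega h -> L2 Omega f' -> intO (fun x => (h x - f' x) ^+ 2).
  by move=> Lh Lf; have [_] := L2D oO Lh (L2Z oO (-1) Lf); apply: io_eq => x; rewrite mulN1r.
have LP n := test_L2 (tphi n); have LD1 n := test_L2 (test_D e1 (tphi n)); have LD2 n := test_L2 (test_D e2 (tphi n)).
have L1c : IO (fun x => `|phi_ n x - xi x|) @[n --> \oo] --> 0.
  have [_] := @pair2_cvg _ mplane R mu2 Omega mO xi (fun=> 1) phi_ (measurable_cst _) mphi mxi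
    (L2_cst oO bO 1).2 (fun n => sqD _ _ (LP n) Lxi) cphi.
  by under eq_fun do under eq_Rintegral do rewrite mulr1.
have iud n : intO (fun x => phi_ n x - xi x) by apply: (ioB oO); exact: (int_of_L2 oO bO).
have [i3 [c3 _]] : (forall n, intO (fun x => F (phi_ n x) - F (xi x))) /\
  (IO (fun x => `|F (phi_ n x) - F (xi x)|) @[n --> \oo] --> 0) /\
  (IO (fun x => F (phi_ n x) - F (xi x)) @[n --> \oo] --> 0).
  apply: (@Rint_cvg0_le _ mplane R mu2 Omega mO _ (fun n x => `|phi_ n x - xi x|) C) => //.
  - by move=> n; apply: measurable_funB; [exact: (measurableT_comp mF (mphi n))|exact: (measurableT_comp mF mxi)].
  - by move=> n; exact: (@intg_norm _ mplane R mu2 Omega).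
  - by move=> n; apply: aeW => x _; exact: (c11_lip c).
have FB2 n x : `|F (phi_ n x) - F (xi x)| <= B + B by rewrite (le_trans (ler_normB _ _))// lerD.
have mFp n : mfO (fun x => F (phi_ n x)) by exact: (measurableT_comp mF (mphi n)).
have mFx : mfO (fun x => F (xi x)) by exact: (measurableT_comp mF mxi).
have pairF g : intO g -> (forall n, intO (fun x => g x * F (phi_ n x))) /\ intO (fun x => g x * F (xi x)) /\
    (IO (fun x => g x * F (phi_ n x)) @[n --> \oo] --> IO (fun x => g x * F (xi x))).
  move=> ig.
  have j0 : intO (fun x => g x * F (xi x)) by have := io_bndT oO mFx (fun x => FB (xi x)) ig; apply: io_eq => x; exact: mulrC.
  have jn n : intO (fun x => g x * F (phi_ n x)) by have := io_bndT oO (mFp n) (fun x => FB (phi_ n x)) ig; apply: io_eq => x; exact: mulrC.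
  split => //; split => //.
  have := pairing_cvg0 mO (addr_ge0 B0 B0) ig i3 FB2 c3 => cc.
  rewrite -[X in _ --> X]add0r.
  have -> : (fun n => IO (fun x => g x * F (phi_ n x))) =
     (fun n => IO (fun x => g x * (F (phi_ n x) - F (xi x))) + IO (fun x => g x * F (xi x))).
    apply/funext => n; rewrite -(Iadd oO) //; last first.
      by have := ioB oO (jn n) j0; apply: io_eq => x; rewrite mulrBr.
    by apply: eq_Rintegral => x _; rewrite mulrBr subrK.
  by apply: cvgD => //; exact: cvg_cst.
have [a1 [a2 a3]] := pairF _ (ioD oO (L2_int oO Lq1 L1) (L2_int oO Lq2 L2')).
have [b1 [b2 b3]] := pairF _ (L2_int oO Ls Leta).
have dc1 := @pair2_cvg _ mplane R mu2 Omega mO p1 q1 (fun n => 'D_e1 (phi_ n)) mq1 mD1 mp1 iq1 (fun n => sqD _ _ (LD1 n) Lp1) cphi1.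
have dc2 := @pair2_cvg _ mplane R mu2 Omega mO p2 q2 (fun n => 'D_e2 (phi_ n)) mq2 mD2 mp2 iq2 (fun n => sqD _ _ (LD2 n) Lp2) cphi2.
have [d1i d1c] := dc1; have [d2i d2c] := dc2.
have ign n : intO (fun x => q1 x * 'D_e1 (phi_ n) x + q2 x * 'D_e2 (phi_ n) x) by apply: (ioD oO); exact: (L2_int oO).
have ig0 : intO (fun x => q1 x * p1 x + q2 x * p2 x) by apply: (ioD oO); exact: (L2_int oO).
have loc_w : IO (fun x => `|(q1 x * 'D_e1 (phi_ n) x + q2 x * 'D_e2 (phi_ n) x) - (q1 x * p1 x + q2 x * p2 x)|) @[n --> \oo] --> 0.
  have n1 n := @intg_norm _ mplane R mu2 Omega _ (d1i n); have n2 n := @intg_norm _ mplane R mu2 Omega _ (d2i n).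
  have cs : (fun n => IO (fun x => `|('D_e1 (phi_ n) x - p1 x) * q1 x|) + IO (fun x => `|('D_e2 (phi_ n) x - p2 x) * q2 x|)) @ \oo --> 0.
    by rewrite -(addr0 0); apply: cvgD.
  apply: squeeze_cvgr cs; last exact: cvg_cst.
  apply: nearW => n; apply/andP; split; first exact: Rintegral_ge0.
  rewrite -[leRHS](Iadd oO (n1 n) (n2 n)); apply: (Ile oO).
  - by apply: (@intg_norm _ mplane R mu2 Omega); exact: (ioB oO).
  - exact: (ioD oO).
  - apply: aeW => x _; rewrite (_ : _ - _ = ('D_e1 (phi_ n) x - p1 x) * q1 x + ('D_e2 (phi_ n) x - p2 x) * q2 x).
      exact: ler_normD.
    by move: ('D_e1 (phi_ n) x) ('D_e2 (phi_ n) x) => ? ?; ring.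
have ixi1 := int_of_L2 oO bO Lxi.
have [_ [h2 h3]] := @chain_limit _ mplane R mu2 Omega mO (finO oO bO) F f C 0 M xi (fun x => q1 x * p1 x + q2 x * p2 x) (fun=> 0) eta
  phi_ (fun n x => q1 x * 'D_e1 (phi_ n) x + q2 x * 'D_e2 (phi_ n) x) c ixi1 ig0 (fun n => int_of_L2 oO bO (LP n)) ign L1c loc_w
  (measurable_cst _) me (fun=> ltac:(by rewrite normr0)) eM.
have I0 : IO (fun x => F (xi x) * 0) = 0.
  by under eq_Rintegral do rewrite mulr0; rewrite /Rintegral integral0.
rewrite I0 add0r in h3.
have {}h3 : IO (fun x => f (phi_ n x) * (q1 x * 'D_e1 (phi_ n) x + q2 x * 'D_e2 (phi_ n) x) * eta x) @[n --> \oo] -->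
   IO (fun x => f (xi x) * (q1 x * p1 x + q2 x * p2 x) * eta x).
  apply: cvg_trans h3; apply: near_eq_cvg; apply: nearW => n.
  by apply: eq_Rintegral => x _; rewrite mulr0 add0r.
have jn n : intO (fun x => f (phi_ n x) * (q1 x * 'D_e1 (phi_ n) x + q2 x * 'D_e2 (phi_ n) x) * eta x).
  have k1 := io_bndT oO (measurableT_comp mf (mphi n)) (fun x => fB (phi_ n x)) (ign n).
  by have := io_bndT oO me eM k1; apply: io_eq => x; exact: mulrC.
split => //.
have cs : (fun n => IO (fun x => (q1 x * g1 x + q2 x * g2 x) * F (phi_ n x)) +
   IO (fun x => f (phi_ n x) * (q1 x * 'D_e1 (phi_ n) x + q2 x * 'D_e2 (phi_ n) x) * eta x)) @ \oo -->
   IO (fun x => (q1 x * g1 x + q2 x * g2 x) * F (xi x)) +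
   IO (fun x => f (xi x) * (q1 x * p1 x + q2 x * p2 x) * eta x) by apply: cvgD.
apply: (cvg_unique _ cs) => //; apply: cvg_trans b3; apply: near_eq_cvg; apply: nearW => n.
by rewrite -(Iadd oO (a1 n) (jn n)) (div_comp c F0 (tphi n) Leta L1 L2' W1 W2).
Qed.

End Comp.

End Xi.

(** The functions x / (x^2 + 1/(n+1)) are continuous and vanish at 0, in agreement with the
    convention that the inverse of 0 is 0. *)
Lemma measurable_invr (R : realType) : measurable_fun setT (fun x : measurableTypeR R => x^-1 : measurableTypeR R).
Proof.
apply: (measurable_fun_cvg (h := fun (n : nat) (x : measurableTypeR R) => (x : R) * ((x : R) ^+ 2 + n.+1%:R^-1)^-1)).
- move=> n; apply: continuous_measurable_fun => x; apply: cvgM; first exact: cvg_id.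
  apply: cvgV.
    by rewrite gt_eqF// ltr_wpDl ?sqr_ge0// invr_gt0.
  by apply: cvgD; [apply: cvgM; exact: cvg_id|exact: cvg_cst].
- move=> x _; have [->|x0] := eqVneq x 0.
    by rewrite invr0; apply: cvg_near_cst; apply: nearW => n; rewrite mul0r.
  have -> : x^-1 = x * (x ^+ 2 + 0)^-1 by rewrite addr0 expr2 invfM mulrA mulfV// mul1r.
  apply: cvgM; first exact: cvg_cst.
  apply: cvgV; first by rewrite addr0 expf_neq0.
  by apply: cvgD; [exact: cvg_cst|exact: cvg_harmonic].
Qed.

Lemma excess_01 (R : realType) (t : R) : 0 <= t <= 1 -> excess t = 0.
Proof.
move=> /andP[t0 t1]; have [p1 _ _ _] := ramp_diff 1 t; have [q1 _ _ _] := ramp_diff 0 (- t).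
have e2 : 1 + 1 = 2 :> R by [].
by rewrite e2 in p1; rewrite add0r in q1; rewrite /excess p1// q1 ?oppr_le0//; ring.
Qed.

(** The contribution of the zeroth-order term 1 - xi when the equation is tested with [excess xi]:
    outside [0, 1] the signs of 1 - t and [excess t] are opposite. *)
Lemma excess_neg (R : realType) (t : R) : 0 <= - ((1 - t) * 1 * excess t) /\
  (- ((1 - t) * 1 * excess t) = 0 -> 0 <= t <= 1).
Proof.
have [h1 h2 _ _ _] := excess_props t; rewrite mulr1.
have [t0|t0] := ltP t 0.
  have p : 0 < (1 - t) * - excess t by rewrite mulr_gt0 ?oppr_gt0 ?h2//; lra.
  by rewrite mulrN in p; split; [exact: ltW|move=> e; rewrite e ltxx in p].
have [t1|t1] := ltP 1 t.
  have p : 0 < (t - 1) * excess t by rewrite mulr_gt0 ?h1//; lra.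
  by rewrite -[t - 1]opprB mulNr in p; split; [exact: ltW|move=> e; rewrite e ltxx in p].
by split => //; rewrite excess_01 ?mulr0 ?oppr0// t0.
Qed.

Section XiSol.
Context {R : realType}.
Local Notation plane := (R * R)%type.
Local Notation mplane := (measurableTypeR R * measurableTypeR R)%type.
Local Notation mu2 := (@lebesgue2 R).
Implicit Types f g h u w phi : plane -> R.
Variable Omega : set plane.
Hypothesis oO : open Omega.
Hypothesis bO : bounded_set Omega.
Local Notation intO f := (mu2.-integrable (Omega : set mplane) (EFin \o f)).
Local Notation IO f := (\int[mu2]_(x in Omega) f x).
Local Notation mO := (mO oO).
Local Notation wd := (weak_derivative Omega).
Local Notation mfO := (measurable_fun (Omega : set mplane)).

(** Replaces the extended-valued norm of [H10] by three real integrals; the chosen weak derivatives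
    of phi_n - xi agree almost everywhere with the differences of the derivatives. *)
Lemma H10_approx xi : H10 Omega xi -> exists phi_ : nat -> plane -> R,
  [/\ forall n, test_function Omega (phi_ n),
   IO (fun x => (phi_ n x - xi x) ^+ 2) @[n --> \oo] --> 0,
   IO (fun x => ('D_e1 (phi_ n) x - weakD Omega e1 xi x) ^+ 2) @[n --> \oo] --> 0 &
   IO (fun x => ('D_e2 (phi_ n) x - weakD Omega e2 xi x) ^+ 2) @[n --> \oo] --> 0].
Proof.
move=> [hx [phi_ [tphi cphi]]]; exists phi_.
have [W1 L1] := H1_wd oO (or_introl erefl) hx; have [W2 L2'] := H1_wd oO (or_intror erefl) hx.
have Lxi : L2 Omega xi by case: hx.
set p1 := weakD Omega e1 xi in W1 L1 *; set p2 := weakD Omega e2 xi in W2 L2' *.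
have sub (V : plane -> R) (U : plane -> R) : L2 Omega V -> L2 Omega U -> L2 Omega (fun x => V x - U x).
  by move=> LV LU; have := L2D oO LV (L2Z oO (-1) LU); under eq_fun do rewrite mulN1r.
have LP n := sub _ _ (test_L2 oO bO (tphi n)) Lxi.
have LD1 n := sub _ _ (test_L2 oO bO (test_D e1 (tphi n))) L1.
have LD2 n := sub _ _ (test_L2 oO bO (test_D e2 (tphi n))) L2'.
have V1 n : wd e1 (fun x => phi_ n x - xi x) (fun x => 'D_e1 (phi_ n) x - p1 x).
  have [sp _] := tphi n; have := wdD oO (wd_smooth oO (or_introl erefl) sp) (wdZ oO (-1) W1).
  by under [X in wd _ X _ -> _]eq_fun do rewrite mulN1r; under [X in wd _ _ X -> _]eq_fun do rewrite mulN1r.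
have V2 n : wd e2 (fun x => phi_ n x - xi x) (fun x => 'D_e2 (phi_ n) x - p2 x).
  have [sp _] := tphi n; have := wdD oO (wd_smooth oO (or_intror erefl) sp) (wdZ oO (-1) W2).
  by under [X in wd _ X _ -> _]eq_fun do rewrite mulN1r; under [X in wd _ _ X -> _]eq_fun do rewrite mulN1r.
pose S n x := (phi_ n x - xi x) ^+ 2 + (('D_e1 (phi_ n) x - p1 x) ^+ 2 + ('D_e2 (phi_ n) x - p2 x) ^+ 2).
have iS n : intO (S n) by exact: (ioD oO (LP n).2 (ioD oO (LD1 n).2 (LD2 n).2)).
have E n : H1_sqnorm Omega (fun x => phi_ n x - xi x) = (IO (S n))%:E.
  rewrite -(Rint_EFin mO (iS n)) /H1_sqnorm.
  have hn := H1_intro (LP n) (LD1 n) (LD2 n) (V1 n) (V2 n).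
  have [_ [m1 _]] := H1_wd oO (or_introl erefl) hn; have [_ [m2 _]] := H1_wd oO (or_intror erefl) hn.
  have [mp _] := LP n.
  have gen (f0 f1 f2 : plane -> R) : mfO f0 -> mfO f1 -> mfO f2 -> mfO (fun x => f0 x ^+ 2 + (f1 x * f1 x + f2 x * f2 x)).
    move=> n0 n1 n2; apply: measurable_funD; first exact: measurable_funX.
    by apply: measurable_funD; exact: measurable_funM.
  have H : {ae mu2, forall x, Omega x -> ((phi_ n x - xi x) ^+ 2 + dot (wgrad Omega (fun x => phi_ n x - xi x) x) (wgrad Omega (fun x => phi_ n x - xi x) x))%:E = (S n x)%:E}.
    apply: ae2S2 (weakD_ae oO (V1 n)) (weakD_ae oO (V2 n)) => x h1 h2 Ox.
    by rewrite /dot /wgrad /= h1// h2// /S !expr2.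
  apply: ae_eq_integral => //; first exact: mO.
  - by apply/measurable_EFinP; exact: (gen _ _ _ mp m1 m2).
  - by apply/measurable_EFinP; exact: (intg_meas (iS n)).
have cS : IO (S n) @[n --> \oo] --> 0.
  have : (fun n => (IO (S n))%:E) @ \oo --> (0:R)%:E by under eq_fun do rewrite -E.
  by move=> /fine_cvg.
have sq (h_ : nat -> plane -> R) : (forall n, intO (fun x => h_ n x ^+ 2)) -> (forall n x, h_ n x ^+ 2 <= S n x) ->
    IO (fun x => h_ n x ^+ 2) @[n --> \oo] --> 0.
  move=> ih hS; apply: squeeze_cvgr cS; last exact: cvg_cst.
  apply: nearW => n; apply/andP; split; first by apply: Rintegral_ge0 => x _; exact: sqr_ge0.
  apply: (Ile oO) => //; apply: aeW => x _; exact: hS.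
split => //.
- apply: (sq (fun n x => phi_ n x - xi x)) => [n|n x]; first by case: (LP n).
  by rewrite /S lerDl addr_ge0// sqr_ge0.
- apply: (sq (fun n x => 'D_e1 (phi_ n) x - p1 x)) => [n|n x]; first by case: (LD1 n).
  by rewrite /S addrCA lerDl addr_ge0// sqr_ge0.
- apply: (sq (fun n x => 'D_e2 (phi_ n) x - p2 x)) => [n|n x]; first by case: (LD2 n).
  by rewrite /S addrA lerDr addr_ge0// sqr_ge0.
Qed.

Variables (b : R) (rho xi : plane -> R).
Hypothesis Hb : 0 < b < 1.
Hypothesis mrho : mfO rho.
Hypothesis rb : {ae mu2, forall x, Omega x -> Num.sqrt b <= rho x <= 1}.
Hypothesis Hxi : xi_solution Omega rho xi.

Let p1 := weakD Omega e1 xi.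
Let p2 := weakD Omega e2 xi.
Definition flux (e : plane) : plane -> R := fun x => weakD Omega e xi x / rho x ^+ 2.
Let q1 := flux e1.
Let q2 := flux e2.

Lemma H1xi : H1 Omega xi. Proof. by case: Hxi => -[]. Qed.
Let Lxi : L2 Omega xi. Proof. by case: H1xi. Qed.
Let Lp1 : L2 Omega p1. Proof. by have [] := H1_wd oO (or_introl erefl) H1xi. Qed.
Let Lp2 : L2 Omega p2. Proof. by have [] := H1_wd oO (or_intror erefl) H1xi. Qed.

Lemma rho_inv : {ae mu2, forall x, Omega x -> 1 <= (rho x ^+ 2)^-1 <= b^-1}.
Proof.
have /andP[b0 b1] := Hb.
apply: ae2S rb => x rx Ox; have /andP[r1 r2] := rx Ox.
have s0 : 0 < Num.sqrt b by rewrite sqrtr_gt0.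
have r0 : 0 < rho x by exact: lt_le_trans r1.
have bE : b = Num.sqrt b ^+ 2 by rewrite sqr_sqrtr// ltW.
have r20 : 0 < rho x ^+ 2 by rewrite exprn_gt0.
rewrite invf_ge1// expr_le1//= ?(ltW r0)// r2/=.
rewrite lef_pV2 ?posrE// {1}bE lerXn2r ?nnegrE//; exact: ltW.
Qed.

Lemma flux_L2 e : (e = e1 \/ e = e2) -> L2 Omega (flux e).
Proof.
move=> ee; have [_ Lp] := H1_wd oO ee H1xi; have [mp _] := Lp.
have /andP[b0 b1] := Hb.
apply: (@L2_le _ _ oO _ (weakD Omega e xi) b^-1) => //.
  apply: measurable_funM => //; apply: (measurableT_comp (@measurable_invr R)); exact: measurable_funX.
apply: ae2S rho_inv => x ri Ox; have /andP[r1 r2] := ri Ox.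
rewrite /flux normrM mulrC ler_wpM2r// ger0_norm//; exact: le_trans r1.
Qed.

Let Lq1 : L2 Omega q1. Proof. by apply: flux_L2; left. Qed.
Let Lq2 : L2 Omega q2. Proof. by apply: flux_L2; right. Qed.

Lemma one_sub_xi_L2 : L2 Omega (fun x => 1 - xi x).
Proof.
by have := L2D oO (L2_cst oO bO 1) (L2Z oO (-1) Lxi); under eq_fun do rewrite mulN1r.
Qed.

Lemma flux_div phi : test_function Omega phi ->
  IO (fun x => q1 x * 'D_e1 phi x + q2 x * 'D_e2 phi x) = IO (fun x => (1 - xi x) * phi x).
Proof.
move=> tp; have [_ /(_ _ tp) E] := Hxi.
have tL e := test_L2 oO bO (test_D e tp); have tL0 := test_L2 oO bO tp.
have i1 : intO (fun x => q1 x * 'D_e1 phi x + q2 x * 'D_e2 phi x) by apply: (ioD oO); exact: (L2_int oO).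
have i2 := L2_int oO Lxi tL0; have i3 := int_of_L2 oO bO tL0.
have {}E : IO (fun x => q1 x * 'D_e1 phi x + q2 x * 'D_e2 phi x) + IO (fun x => xi x * phi x) = IO phi.
  rewrite -E -(Iadd oO i1 i2); apply: eq_Rintegral => x _.
  rewrite /dot /wgrad /= /q1 /q2 /flux; move: (weakD Omega e1 xi x) (weakD Omega e2 xi x) ('D_e1 phi x) ('D_e2 phi x) => ? ? ? ?; ring.
have -> : IO (fun x => (1 - xi x) * phi x) = IO phi - IO (fun x => xi x * phi x).
  by rewrite -(Isub oO i3 i2); apply: eq_Rintegral => x _; rewrite mulrBl mul1r.
by rewrite -E addrK.
Qed.

Lemma flux_xi (F f : R -> R) (C B M : R) eta g1 g2 : c11 F f C -> F 0 = 0 -> (forall t, `|F t| <= B) ->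
  (forall x, `|eta x| <= M) ->
  L2 Omega eta -> L2 Omega g1 -> L2 Omega g2 -> wd e1 eta g1 -> wd e2 eta g2 ->
  [/\ intO (fun x => (q1 x * g1 x + q2 x * g2 x) * F (xi x)),
      intO (fun x => f (xi x) * (q1 x * p1 x + q2 x * p2 x) * eta x),
      intO (fun x => (1 - xi x) * eta x * F (xi x)) &
  IO (fun x => (q1 x * g1 x + q2 x * g2 x) * F (xi x)) +
  IO (fun x => f (xi x) * (q1 x * p1 x + q2 x * p2 x) * eta x) =
  IO (fun x => (1 - xi x) * eta x * F (xi x))].
Proof.
move=> c F0 FB eM Le L1 L2' W1 W2.
have [phi_ [tphi c0 c1 c2]] : exists phi_ : nat -> plane -> R,
  [/\ forall n, test_function Omega (phi_ n),
   IO (fun x => (phi_ n x - xi x) ^+ 2) @[n --> \oo] --> 0,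
   IO (fun x => ('D_e1 (phi_ n) x - p1 x) ^+ 2) @[n --> \oo] --> 0 &
   IO (fun x => ('D_e2 (phi_ n) x - p2 x) ^+ 2) @[n --> \oo] --> 0].
  by apply: H10_approx; case: Hxi.
exact: (@div_xi R Omega oO bO q1 q2 (fun x => 1 - xi x) xi p1 p2 Lq1 Lq2 one_sub_xi_L2 flux_div Lxi Lp1 Lp2 phi_ tphi c0 c1 c2
  F f C B M eta g1 g2).
Qed.

(** With eta = 1, the integral of excess'(xi) |grad xi|^2 / rho^2 is nonnegative and equals that of
    (1 - xi) excess(xi), whose integrand is nonpositive and therefore vanishes almost everywhere. *)
Lemma xi_bounds : {ae mu2, forall x, Omega x -> 0 <= xi x <= 1}.
Proof.
have [C c] := @c11_excess R.
have [_ _ _ z0 _] := @excess_props R 0.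
have zB t : `|excess t| <= 1 :> R by have [] := excess_props t.
have one (x : plane) : `|(fun=> 1 : R) x| <= 1 by rewrite normr1.
have [i1 i2 i3 E] := flux_xi c z0 zB one (L2_cst oO bO 1) (L2_cst oO bO 0) (L2_cst oO bO 0)
  (wd_cst oO 1 (or_introl erefl)) (wd_cst oO 1 (or_intror erefl)).
have qp0 : {ae mu2, forall x, Omega x -> 0 <= q1 x * p1 x + q2 x * p2 x}.
  apply: ae2S rho_inv => x ri Ox; have /andP[r1 _] := ri Ox.
  rewrite /q1 /q2 /flux -/p1 -/p2.
  have r0 : 0 <= (rho x ^+ 2)^-1 by exact: le_trans r1.
  have := mulr_ge0 r0 (addr_ge0 (sqr_ge0 (p1 x)) (sqr_ge0 (p2 x))).
  by congr (0 <= _); ring.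
have neg x : 0 <= - ((1 - xi x) * 1 * excess (xi x)) by have [] := excess_neg (xi x).
have ge : 0 <= IO (fun x => excess' (xi x) * (q1 x * p1 x + q2 x * p2 x) * 1).
  apply: (@Rint_ge0_ae _ mplane R mu2 Omega mO) => //.
  apply: ae2S qp0 => x h Ox; rewrite mulr1 mulr_ge0 ?h//.
  by have [] := excess_props (xi x).
have I0 : IO (fun x => (q1 x * 0 + q2 x * 0) * excess (xi x)) = 0.
  have zz (t1 t2 t3 : R) : (t1 * 0 + t2 * 0) * t3 = 0 by ring.
  transitivity (IO (fun=> 0)); last by rewrite /Rintegral integral0.
  apply: eq_Rintegral => x _; exact: zz.
rewrite I0 add0r in E; rewrite E in ge.
have iN := @intgN _ mplane R mu2 Omega mO _ i3.
have negae : {ae mu2, forall x : mplane, Omega x -> 0 <= - ((1 - xi x) * 1 * excess (xi x))}.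
  by apply: aeW => x _; exact: neg.
have := @Rint_ae0 _ mplane R mu2 Omega mO _ iN negae.
rewrite (@RintN _ mplane R mu2 Omega mO _ i3) oppr_le0 => /(_ ge).
by apply: ae2S => x H Ox; have [_] := excess_neg (xi x); apply; exact: H.
Qed.

(** Here x = xi, th = rho^-2, B = 1/b, p = psi, m = grad psi and s = grad xi; the bracket is the
    density of the equation of xi tested with xi psi^2. Cross terms are absorbed by completing
    squares, as for rho. *)
Lemma xi_caccioppoli_ineq (x th B p m1 m2 s1 s2 : R) : 0 <= x <= 1 -> 1 <= th <= B ->
  p ^+ 2 * (s1 ^+ 2 + s2 ^+ 2) <=
  2 * ((s1 * th * (p * m1 + p * m1) + s2 * th * (p * m2 + p * m2)) * x +
       1 * (s1 * th * s1 + s2 * th * s2) * (p * p) - (1 - x) * (p * p) * x)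
  + (4 * B + 2) * (p ^+ 2 + (m1 ^+ 2 + m2 ^+ 2)).
Proof.
move=> /andP[x0 x1] /andP[t1 tB].
have x2 : x ^+ 2 <= 1 by rewrite expr_le1.
have th0 : 0 <= th by exact: le_trans t1.
have B0 : 0 <= B by exact: le_trans tB.
have h1 : 0 <= th * (p * s1 + 2 * x * m1) ^+ 2 by rewrite mulr_ge0// sqr_ge0.
have h2 : 0 <= th * (p * s2 + 2 * x * m2) ^+ 2 by rewrite mulr_ge0// sqr_ge0.
have h3 : 0 <= (th - 1) * (p ^+ 2 * (s1 ^+ 2 + s2 ^+ 2)) by rewrite mulr_ge0 ?subr_ge0// mulr_ge0 ?addr_ge0 ?sqr_ge0.
have tx : th * x ^+ 2 <= B by apply: le_trans tB; rewrite ler_piMr.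
have h4 : 0 <= (B - th * x ^+ 2) * (m1 ^+ 2 + m2 ^+ 2) by rewrite mulr_ge0 ?subr_ge0// addr_ge0 ?sqr_ge0.
have h5 : 0 <= (1 - (1 - x) * x) * p ^+ 2 by rewrite mulr_ge0 ?sqr_ge0//; nra.
have h6 : 0 <= B * p ^+ 2 by rewrite mulr_ge0 ?sqr_ge0.
have h7 := sqr_ge0 m1; have h8 := sqr_ge0 m2.
rewrite -subr_ge0.
have -> : 2 * ((s1 * th * (p * m1 + p * m1) + s2 * th * (p * m2 + p * m2)) * x +
       1 * (s1 * th * s1 + s2 * th * s2) * (p * p) - (1 - x) * (p * p) * x)
  + (4 * B + 2) * (p ^+ 2 + (m1 ^+ 2 + m2 ^+ 2)) - p ^+ 2 * (s1 ^+ 2 + s2 ^+ 2) =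
  th * (p * s1 + 2 * x * m1) ^+ 2 + th * (p * s2 + 2 * x * m2) ^+ 2 + (th - 1) * (p ^+ 2 * (s1 ^+ 2 + s2 ^+ 2))
  + 4 * ((B - th * x ^+ 2) * (m1 ^+ 2 + m2 ^+ 2)) + 2 * ((1 - (1 - x) * x) * p ^+ 2) + 4 * (B * p ^+ 2) + 2 * m1 ^+ 2 + 2 * m2 ^+ 2 by ring.
by lra.
Qed.

Definition xgrad_sqr : plane -> R := fun x => p1 x ^+ 2 + p2 x ^+ 2.

Lemma xgrad_int : intO xgrad_sqr.
Proof. by have [_ i1] := Lp1; have [_ i2] := Lp2; exact: (ioD oO i1 i2). Qed.

Lemma xi_caccioppoli_bounded psi k1 k2 (M : R) : H1 Omega psi -> (forall x, `|psi x| <= M) ->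
  wd e1 psi k1 -> wd e2 psi k2 ->
  intO (fun x => psi x ^+ 2 * xgrad_sqr x) /\
  IO (fun x => psi x ^+ 2 * xgrad_sqr x) <= (4 * b^-1 + 2) * IO (fun x => psi x ^+ 2 + (k1 x ^+ 2 + k2 x ^+ 2)).
Proof.
move=> hp pM W1 W2.
have L1 := wd_L2 oO (or_introl erefl) hp W1; have L2' := wd_L2 oO (or_intror erefl) hp W2.
have lp : L2 Omega psi by case: hp.
have [mp ip] := lp; have [mk1 ik1] := L1; have [mk2 ik2] := L2'.
have M0 : 0 <= M := le_trans (normr_ge0 _) (pM (0, 0)).
have p2M x : `|psi x ^+ 2| <= M ^+ 2 by rewrite normrX lerXn2r ?nnegrE.
have ppM x : `|psi x * psi x| <= M ^+ 2 by exact: p2M.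
have mp2 : mfO (fun x => psi x ^+ 2) by exact: measurable_funX.
have ig : intO (fun x => psi x ^+ 2 * xgrad_sqr x) := io_bndT oO mp2 p2M xgrad_int.
split => //.
have Lpk k : L2 Omega k -> L2 Omega (fun x => psi x * k x + psi x * k x).
  by move=> Lk; have l1 := L2_mulM oO mp pM Lk; exact: (L2D oO l1 l1).
have Lpp := L2_mulM oO mp pM lp.
have Wp e k : (e = e1 \/ e = e2) -> wd e psi k -> L2 Omega k -> wd e (fun x => psi x * psi x) (fun x => psi x * k x + psi x * k x).
  move=> ee W Lk; have l1 := int_loc oO (L2_int oO lp Lk).
  exact: (wd_mul oO bO ee (int_loc oO (L2_int oO lp lp)) l1 l1 W W).
(* [flux_xi] asks for a bounded function of xi; [trunc 1] is bounded and is the identity on [0, 1],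
   where xi takes its values. *)
have [C c] := c11_trunc (1 : R).
have z0 : trunc 1 0 = 0 :> R by have [] // := @trunc_id R 1 0 (ltac:(by rewrite normr0)).
have zB (t : R) : `|trunc 1 t| <= 1 + 1 by have [] := trunc_le t (ler01 : 0 <= 1 :> R).
have [i1 i2 i3 E] := flux_xi c z0 zB ppM Lpp (Lpk _ L1) (Lpk _ L2') (Wp _ _ (or_introl erefl) W1 L1) (Wp _ _ (or_intror erefl) W2 L2').
have iS : intO (fun x => psi x ^+ 2 + (k1 x ^+ 2 + k2 x ^+ 2)) by exact: (ioD oO ip (ioD oO ik1 ik2)).
have i12 := ioD oO i1 i2; have iE := ioB oO i12 i3.
have E0 : IO (fun x => (q1 x * (psi x * k1 x + psi x * k1 x) + q2 x * (psi x * k2 x + psi x * k2 x)) * trunc 1 (xi x) +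
   trunc' 1 (xi x) * (q1 x * p1 x + q2 x * p2 x) * (psi x * psi x) - (1 - xi x) * (psi x * psi x) * trunc 1 (xi x)) = 0.
  by rewrite (Isub oO i12 i3) (Iadd oO i1 i2) E subrr.
rewrite -(Iscale oO _ iS) -[leRHS]add0r -(mulr0 2) -E0 -(Iscale oO _ iE) -(Iadd oO (ioZ oO _ iE) (ioZ oO _ iS)).
apply: (Ile oO) => //; first exact: (ioD oO (ioZ oO _ iE) (ioZ oO _ iS)).
apply: ae2S2 rho_inv xi_bounds => x ri xb Ox; have {}ri := ri Ox; have {}xb := xb Ox.
have /andP[x0 x1] := xb; have xn : `|xi x| <= 1 by rewrite ger0_norm.
have [-> ->] := trunc_id xn.
rewrite /xgrad_sqr /q1 /q2 /flux -/p1 -/p2.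
exact: xi_caccioppoli_ineq.
Qed.

Lemma xi_caccioppoli f : H1 Omega f -> intO (fun x => f x ^+ 2 * xgrad_sqr x).
Proof.
have /andP[b0 b1] := Hb.
apply: (@caccioppoli_limit R Omega oO bO xgrad_sqr (4 * b^-1 + 2)).
- exact: (intg_meas xgrad_int).
- by apply: aeW => x _; rewrite addr_ge0 ?sqr_ge0.
- by rewrite addr_ge0// mulr_ge0// invr_ge0 ltW.
- by move=> psi k1 k2 M hp pM W1 W2; exact: (xi_caccioppoli_bounded hp pM W1 W2).
Qed.

End XiSol.

(** * Curls, and division by rho *)

Section Curl.
Context {R : realType}.
Local Notation plane := (R * R)%type.
Local Notation mplane := (measurableTypeR R * measurableTypeR R)%type.
Local Notation mu2 := (@lebesgue2 R).
Implicit Types f g h u w phi : plane -> R.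
Variable Omega : set plane.
Hypothesis oO : open Omega.
Hypothesis bO : bounded_set Omega.
Local Notation intO f := (mu2.-integrable (Omega : set mplane) (EFin \o f)).
Local Notation IO f := (\int[mu2]_(x in Omega) f x).
Local Notation mO := (mO oO).
Local Notation wd := (weak_derivative Omega).
Local Notation mfO := (measurable_fun (Omega : set mplane)).

Lemma weak_curl_intro (B : plane -> plane) h : L2 Omega (fun x => (B x).1) -> L2 Omega (fun x => (B x).2) -> L2 Omega h ->
  (forall phi, test_function Omega phi ->
    IO (fun x => (B x).2 * 'D_e1 phi x) - IO (fun x => (B x).1 * 'D_e2 phi x) = - IO (fun x => h x * phi x)) ->
  weak_curl Omega B h.
Proof.
move=> L1 L2' Lh H; split; [exact: L2_loc|exact: L2_loc|exact: L2_loc|].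
move=> phi tp; rewrite -(H _ tp) -(Isub oO); last 2 first.
- by apply: (L2_int oO) => //; apply: test_L2 => //; exact: test_D.
- by apply: (L2_int oO) => //; apply: test_L2 => //; exact: test_D.
apply: eq_Rintegral => x _; rewrite /dot /perp /=.
by move: ('D_e1 phi x) ('D_e2 phi x) => ? ?; ring.
Qed.

Lemma weak_curl_test (B : plane -> plane) h phi : L2 Omega (fun x => (B x).1) -> L2 Omega (fun x => (B x).2) ->
  weak_curl Omega B h -> test_function Omega phi ->
    IO (fun x => (B x).2 * 'D_e1 phi x) - IO (fun x => (B x).1 * 'D_e2 phi x) = - IO (fun x => h x * phi x).
Proof.
move=> L1 L2' [_ _ _ H] tp; rewrite -(H _ tp) -(Isub oO); last 2 first.
- by apply: (L2_int oO) => //; apply: test_L2 => //; exact: test_D.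
- by apply: (L2_int oO) => //; apply: test_L2 => //; exact: test_D.
apply: eq_Rintegral => x _; rewrite /dot /perp /=.
by move: ('D_e1 phi x) ('D_e2 phi x) => ? ?; ring.
Qed.

Lemma curl_curl (B : plane -> plane) h : weak_curl Omega B h -> weak_curl Omega B (curl Omega B).
Proof. by move=> H; rewrite /curl; apply: (xgetPex (cst 0) (P := [set h | weak_curl Omega B h])); exists h. Qed.

Lemma curl_ae (B : plane -> plane) h : weak_curl Omega B h ->
  {ae mu2, forall x, Omega x -> curl Omega B x = h x}.
Proof.
move=> H; have [_ _ lc C1] := curl_curl H; have [_ _ lh C2] := H.
have l0 : loc_integrable Omega (fun x => curl Omega B x + (-1) * h x) by apply: locD => //; exact: locZ.
have := fundamental_lemma oO l0; move=> /(_ _)/wrap[|K].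
  move=> phi tp.
  have i1 := int_test oO lc tp; have i2 := int_test oO lh tp.
  transitivity (IO (fun x => curl Omega B x * phi x) - IO (fun x => h x * phi x)).
    rewrite -(Isub oO i1 i2); apply: eq_Rintegral => x _.
    by move: (curl Omega B x) => ?; ring.
  have := C1 _ tp; rewrite C2// => /oppr_inj ->; exact: subrr.
apply: ae2S K => x K Ox; have := K Ox; move: (curl Omega B x) (h x) => s t; lra.
Qed.

Lemma L2_ae f g : mfO g -> {ae mu2, forall x, Omega x -> g x = f x} -> L2 Omega f -> L2 Omega g.
Proof.
move=> mg fg Lf; apply: (@L2_le _ _ oO _ f 1) => //.
by apply: ae2S fg => x fg Ox; rewrite mul1r fg.
Qed.

Lemma curl_L2 (B : plane -> plane) h : weak_curl Omega B h -> L2 Omega h -> L2 Omega (curl Omega B).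
Proof.
move=> H Lh; apply: L2_ae (curl_ae H) Lh.
by have [_ _ [] ] := curl_curl H.
Qed.

Lemma H1V_curl (B : plane -> plane) : H1V Omega B ->
  weak_curl Omega B (fun x => weakD Omega e1 (fun y => (B y).2) x - weakD Omega e2 (fun y => (B y).1) x) /\
  L2 Omega (fun x => weakD Omega e1 (fun y => (B y).2) x - weakD Omega e2 (fun y => (B y).1) x).
Proof.
move=> [h1 h2].
have [[_ _ W1] L1] := H1_wd oO (or_introl erefl) h2; have [[_ _ W2] L2'] := H1_wd oO (or_intror erefl) h1.
have L : L2 Omega (fun x => weakD Omega e1 (fun y => (B y).2) x - weakD Omega e2 (fun y => (B y).1) x).
  by have := L2D oO L1 (L2Z oO (-1) L2'); under eq_fun do rewrite mulN1r.
split => //; apply: weak_curl_intro => //; [by case: h1|by case: h2|].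
move=> phi tp; rewrite (W1 _ tp) (W2 _ tp) -opprB opprK addrC.
have tl := test_L2 oO bO tp.
rewrite -(Isub oO (L2_int oO L1 tl) (L2_int oO L2' tl)); congr (- _).
by apply: eq_Rintegral => x _; rewrite mulrBl.
Qed.

(** Approximation of xi by test functions in H^1: only the distributional curl of the field occurs,
    and no boundary value of the field. *)
Lemma curl_xi_parts (B : plane -> plane) h xi : L2 Omega (fun x => (B x).1) -> L2 Omega (fun x => (B x).2) ->
  L2 Omega h -> weak_curl Omega B h -> H10 Omega xi ->
  IO (fun x => (B x).2 * weakD Omega e1 xi x) - IO (fun x => (B x).1 * weakD Omega e2 xi x) = - IO (fun x => h x * xi x).
Proof.
move=> L1 L2' Lh wc h10; have [phi_ [tphi c0 c1 c2]] := H10_approx oO bO h10.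
have [hx _] := h10; have Lxi : L2 Omega xi by case: hx.
have [_ Lp1] := H1_wd oO (or_introl erefl) hx; have [_ Lp2] := H1_wd oO (or_intror erefl) hx.
have lim (psi_ : nat -> plane -> R) psi g : (forall n, L2 Omega (psi_ n)) -> L2 Omega psi -> L2 Omega g ->
   IO (fun x => (psi_ n x - psi x) ^+ 2) @[n --> \oo] --> 0 ->
   IO (fun x => g x * psi_ n x) @[n --> \oo] --> IO (fun x => g x * psi x).
  move=> Ln Lp Lg c.
  have sqD n : intO (fun x => (psi_ n x - psi x) ^+ 2).
    by have [_] := L2D oO (Ln n) (L2Z oO (-1) Lp); apply: io_eq => x; rewrite mulN1r.
  have [mg ig] := Lg; have [mp _] := Lp.
  have [i1 c'] := @pair2_cvg _ mplane R mu2 Omega mO psi g psi_ mg (fun n => (Ln n).1) mp ig sqD c.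
  have [] // := @cvg_of_L1 _ mplane R mu2 Omega mO (fun x => g x * psi x) (fun n x => g x * psi_ n x) (L2_int oO Lg Lp).
  - by move=> n; have := i1 n; apply: io_eq => x; rewrite mulrBl mulrC [psi x * _]mulrC.
  - apply: cvg_trans c'; apply: near_eq_cvg; apply: nearW => n.
    by apply: eq_Rintegral => x _; rewrite mulrBl mulrC [psi x * _]mulrC.
have d1 := lim _ _ _ (fun n => test_L2 oO bO (test_D e1 (tphi n))) Lp1 L2' c1.
have d2 := lim _ _ _ (fun n => test_L2 oO bO (test_D e2 (tphi n))) Lp2 L1 c2.
have d0 := lim _ _ _ (fun n => test_L2 oO bO (tphi n)) Lxi Lh c0.
apply: (cvg_unique _ (cvgB d1 d2)) => //.
apply: cvg_trans (cvgN d0); apply: near_eq_cvg; apply: nearW => n /=.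
by apply/esym; exact: (weak_curl_test L1 L2' wc (tphi n)).
Qed.

End Curl.

(** * Division by rho, and the equation of rho tested with rho (|u|^2 - 1) *)

Section DivRho.
Context {R : realType}.
Local Notation plane := (R * R)%type.
Local Notation mplane := (measurableTypeR R * measurableTypeR R)%type.
Local Notation mu2 := (@lebesgue2 R).
Implicit Types f g h u w phi : plane -> R.
Variable Omega : set plane.
Hypothesis oO : open Omega.
Hypothesis bO : bounded_set Omega.
Hypothesis sO : smooth_boundary Omega.
Local Notation intO f := (mu2.-integrable (Omega : set mplane) (EFin \o f)).
Local Notation IO f := (\int[mu2]_(x in Omega) f x).
Local Notation mO := (mO oO).
Local Notation wd := (weak_derivative Omega).
Local Notation mfO := (measurable_fun (Omega : set mplane)).
Variables (b eps : R) (a rho : plane -> R).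
Hypothesis Hb : 0 < b < 1.
Hypothesis Heps : 0 < eps.
Hypothesis Hameas : mfO a.
Hypothesis Ha : {ae mu2, forall x, Omega x -> b <= a x <= 1}.
Hypothesis Hrho : positive_minimizer Omega eps a rho.

Let r1 := weakD Omega e1 rho.
Let r2 := weakD Omega e2 rho.
Let hrho := H1rho Hrho.
Let rb := rho_bounds oO bO sO Hb Heps Hameas Ha Hrho.
Let Wr e (ee : e = e1 \/ e = e2) : wd e rho (weakD Omega e rho). Proof. by have [] := H1_wd oO ee hrho. Qed.
Let Lr e (ee : e = e1 \/ e = e2) : L2 Omega (weakD Omega e rho). Proof. by have [] := H1_wd oO ee hrho. Qed.

Lemma mul_grad_rho_L2 f e : (e = e1 \/ e = e2) -> H1 Omega f -> L2 Omega (fun x => f x * weakD Omega e rho x).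
Proof.
move=> ee hf; have i := rho_caccioppoli oO bO sO Hb Heps Hameas Ha Hrho hf.
have [[mf _] _] := hf; have [mr _] := Lr ee.
have mfr : mfO (fun x => f x * weakD Omega e rho x) by exact: measurable_funM.
split => //; apply: (io_le oO) i; first exact: measurable_funX.
apply: aeW => x _; rewrite ger0_norm ?sqr_ge0// exprMn /grad_sqr.
apply: ler_wpM2l; first exact: sqr_ge0.
have sl (s t : R) : s ^+ 2 <= s ^+ 2 + t ^+ 2 by rewrite lerDl sqr_ge0.
have sr (s t : R) : t ^+ 2 <= s ^+ 2 + t ^+ 2 by rewrite lerDr sqr_ge0.
by case: ee => ->; [exact: sl|exact: sr].
Qed.

(** 1/rho is written S(rho) with S the inverse of [lower (Num.sqrt b)], which is C^{1,1} on the
    whole line and equals 1/t on the range of rho. The product rule for f S(rho) then needs f grad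
    rho in L^2, which is the Caccioppoli inequality. *)
Lemma div_rho_H1 f v : H1 Omega f -> mfO v -> {ae mu2, forall x, Omega x -> f x = rho x * v x} ->
  H1 Omega v /\ forall e, (e = e1 \/ e = e2) ->
  {ae mu2, forall x, Omega x -> weakD Omega e f x = rho x * weakD Omega e v x + v x * weakD Omega e rho x}.
Proof.
move=> hf mv fv.
have /andP[b0 b1] := Hb.
have s0 : 0 < Num.sqrt b by rewrite sqrtr_gt0.
have m0 : 0 < Num.sqrt b / 2 by rewrite divr_gt0.
have [C cl] := c11_lower (Num.sqrt b).
have lm t : Num.sqrt b / 2 <= lower (Num.sqrt b) t by have [] := lower_props t s0.
have [D ci] := c11_inv m0 lm cl.
set S := (fun x : R => (lower (Num.sqrt b) x)^-1) in ci; set S' := (fun x : R => - _) in ci.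
have [D0 _ SD _] := ci.
have mS : measurable_fun setT S by apply: continuous_measurable_fun; exact: c11_continuous ci.
have mS' : measurable_fun setT S' by apply: continuous_measurable_fun; exact: c11_continuous_d ci.
have [[mrho _] _] := hrho; have [Lf _] := hf.
have SM t : `|S t| <= (Num.sqrt b / 2)^-1.
  rewrite /S ger0_norm ?invr_ge0; last by apply: le_trans (lm t); exact: ltW.
  by rewrite lef_pV2 ?posrE//; exact: lt_le_trans (lm t).
have mSr : mfO (fun x => S (rho x)) by exact: (measurableT_comp mS mrho).
have mSr' : mfO (fun x => S' (rho x)) by exact: (measurableT_comp mS' mrho).
have vE : {ae mu2, forall x, Omega x -> f x * S (rho x) = v x}.
  apply: ae2S2 fv rb => x fv rx Ox; have /andP[h1 h2] := rx Ox.
  have [lE _ _ _] := lower_props (rho x) s0.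
  have r0 : rho x != 0 by rewrite gt_eqF//; exact: lt_le_trans h1.
  by rewrite /S lE// fv// mulrC mulrA mulVf// mul1r.
pose G e x := f x * (S' (rho x) * weakD Omega e rho x) + S (rho x) * weakD Omega e f x.
have LG e : (e = e1 \/ e = e2) -> L2 Omega (fun x => f x * (S' (rho x) * weakD Omega e rho x)) /\ L2 Omega (fun x => S (rho x) * weakD Omega e f x).
  move=> ee; have [_ Lg] := H1_wd oO ee hf.
  split; last exact: (L2_mulM oO mSr (fun x => SM (rho x)) Lg).
  have := L2_mulM oO mSr' (fun x => SD (rho x)) (mul_grad_rho_L2 ee hf).
  by under eq_fun do rewrite mulrCA.
have Lv0 : L2 Omega (fun x => f x * S (rho x)).
  by have := L2_mulM oO mSr (fun x => SM (rho x)) Lf; under eq_fun do rewrite mulrC.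
have WG e : (e = e1 \/ e = e2) -> wd e v (G e).
  move=> ee; have [Wf _] := H1_wd oO ee hf; have [g1 g2] := LG e ee.
  have W0 := wd_mul oO bO ee (L2_loc oO bO Lv0) (L2_loc oO bO g1) (L2_loc oO bO g2) Wf (wd_chain oO bO ee ci (Wr ee)).
  apply: (wd_ae oO mv _ vE _ W0); first by have [] := L2D oO g1 g2.
  by apply: aeW.
have hv : H1 Omega v.
  have Lv : L2 Omega v by apply: (L2_ae oO mv) Lv0; apply: ae2S vE => x h Ox; rewrite h.
  have [g1 g2] := LG _ (or_introl erefl); have [g3 g4] := LG _ (or_intror erefl).
  exact: (H1_intro Lv (L2D oO g1 g2) (L2D oO g3 g4) (WG _ (or_introl erefl)) (WG _ (or_intror erefl))).
split => // e ee.
(* Now that v is known to be in H^1, f = rho v is differentiated as a product, and uniqueness of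
   weak derivatives gives the formula. *)
have [Wv Lv] := H1_wd oO ee hv; have [Lv0' _] := hv; have Lrho : L2 Omega rho by case: hrho.
have W := wd_mul oO bO ee (int_loc oO (L2_int oO Lrho Lv0')) (int_loc oO (L2_int oO Lrho Lv))
  (int_loc oO (L2_int oO Lv0' (Lr ee))) (Wr ee) Wv.
have [Wf _] := H1_wd oO ee hf; have [mf _] := Lf.
have W' : wd e f (fun x => rho x * weakD Omega e v x + v x * weakD Omega e rho x).
  apply: (wd_ae oO mf _ _ _ W).
  - by have [_ []] := W.
  - by apply: ae2S fv => x h Ox; rewrite h.
  - exact: aeW.
exact: (wd_uniq oO Wf W').
Qed.

(* Integrand of the Euler-Lagrange equation of rho = r tested with
   r (t1^2 + t2^2 - 1), where A = a, E = eps^-2, s = grad rho and d_ij is the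
   j-th derivative of t_i. *)
Definition el_dens (r A E s1 s2 t1 t2 d11 d12 d21 d22 : R) :=
  s1 * (r * ((t1 * d11 + t1 * d11) + (t2 * d21 + t2 * d21)) + (t1 * t1 + t2 * t2 - 1) * s1) +
  s2 * (r * ((t1 * d12 + t1 * d12) + (t2 * d22 + t2 * d22)) + (t1 * t1 + t2 * t2 - 1) * s2) -
  E * ((A - r ^+ 2) * r * (r * (t1 * t1 + t2 * t2 - 1))).

(** Where the truncation is inactive, [trunc'] leaves factors 1 in front of the derivatives. *)
Lemma el_dens1 r A E s1 s2 t1 t2 d11 d12 d21 d22 :
  el_dens r A E s1 s2 t1 t2 (1 * d11) (1 * d12) (1 * d21) (1 * d22) = el_dens r A E s1 s2 t1 t2 d11 d12 d21 d22.
Proof. by rewrite !mul1r. Qed.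

Lemma cross_term_le (t s d v D : R) : `|t| <= `|v| -> `|d| <= `|D| -> `|2 * t * s * d| <= v ^+ 2 * s ^+ 2 + D ^+ 2.
Proof.
move=> tv dD; rewrite !normrM ger0_norm// -[v ^+ 2](real_normK (num_real v)) -[s ^+ 2](real_normK (num_real s)) -[D ^+ 2](real_normK (num_real D)).
have t0 := normr_ge0 t; have s0 := normr_ge0 s; have d0 := normr_ge0 d.
have h1 : `|t| * `|s| <= `|v| * `|s| by rewrite ler_wpM2r.
have h2 : (`|t| * `|s|) * `|d| <= (`|v| * `|s|) * `|D| by apply: ler_pM => //; rewrite mulr_ge0.
have := sqr_ge0 (`|v| * `|s| - `|D|); rewrite -exprMn; nra.
Qed.

(** Here t and d are the truncated u and its gradient, v and D the original ones. The bound is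
    independent of the truncation, and the Caccioppoli inequality for rho makes it integrable. *)
Lemma el_dens_le (r A E s1 s2 t1 t2 d11 d12 d21 d22 v1 v2 D11 D12 D21 D22 : R) :
  0 <= r <= 1 -> `|A - r ^+ 2| <= 1 -> 0 <= E ->
  `|t1| <= `|v1| -> `|t2| <= `|v2| ->
  `|d11| <= `|D11| -> `|d12| <= `|D12| -> `|d21| <= `|D21| -> `|d22| <= `|D22| ->
  `|el_dens r A E s1 s2 t1 t2 d11 d12 d21 d22| <=
   (v1 ^+ 2 * (s1 ^+ 2 + s2 ^+ 2) + v2 ^+ 2 * (s1 ^+ 2 + s2 ^+ 2) + (s1 ^+ 2 + s2 ^+ 2)) * 1 +
   (v1 ^+ 2 * (s1 ^+ 2 + s2 ^+ 2) + (D11 ^+ 2 + D12 ^+ 2)) + (v2 ^+ 2 * (s1 ^+ 2 + s2 ^+ 2) + (D21 ^+ 2 + D22 ^+ 2)) +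
   E * (v1 ^+ 2 + v2 ^+ 2 + 1).
Proof.
move=> /andP[r0 r1'] q1 E0 tv1 tv2 dD11 dD12 dD21 dD22.
have n1 := cross_term_le s1 tv1 dD11; have n2 := cross_term_le s2 tv1 dD12.
have n3 := cross_term_le s1 tv2 dD21; have n4 := cross_term_le s2 tv2 dD22.
have sq (s t : R) : `|s| <= `|t| -> s ^+ 2 <= t ^+ 2.
  by move=> st; rewrite -(real_normK (num_real s)) -(real_normK (num_real t)) lerXn2r ?nnegrE.
have t12 := sq _ _ tv1; have t22 := sq _ _ tv2.
set S := t1 ^+ 2 + t2 ^+ 2 - 1; set P := s1 ^+ 2 + s2 ^+ 2.
have SB : `|S| <= v1 ^+ 2 + v2 ^+ 2 + 1.
  by rewrite ler_norml; apply/andP; have := sqr_ge0 t1; have := sqr_ge0 t2; have := sqr_ge0 v1; have := sqr_ge0 v2; rewrite /S; split; lra.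
have P0 : 0 <= P by rewrite addr_ge0 ?sqr_ge0.
pose X := 2 * t1 * s1 * d11 + 2 * t2 * s1 * d21 + (2 * t1 * s2 * d12 + 2 * t2 * s2 * d22).
have -> : el_dens r A E s1 s2 t1 t2 d11 d12 d21 d22 = r * X + S * P - E * ((A - r ^+ 2) * r * r * S).
  by rewrite /el_dens /X /S /P; ring.
have XB : `|X| <= v1 ^+ 2 * s1 ^+ 2 + D11 ^+ 2 + (v2 ^+ 2 * s1 ^+ 2 + D21 ^+ 2) + (v1 ^+ 2 * s2 ^+ 2 + D12 ^+ 2 + (v2 ^+ 2 * s2 ^+ 2 + D22 ^+ 2)).
  rewrite /X; apply: (le_trans (ler_normD _ _)); apply: lerD; apply: (le_trans (ler_normD _ _)); exact: lerD.
have rX : `|r * X| <= `|X| by rewrite normrM ler_piMl// ger0_norm.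
have SP : `|S * P| <= (v1 ^+ 2 + v2 ^+ 2 + 1) * P by rewrite normrM (ger0_norm P0) ler_wpM2r.
have EB : `|E * ((A - r ^+ 2) * r * r * S)| <= E * (v1 ^+ 2 + v2 ^+ 2 + 1).
  rewrite normrM (ger0_norm E0) ler_wpM2l// !normrM (ger0_norm r0).
  apply: le_trans SB; rewrite ler_piMl//.
  by apply: mulr_ile1 => //; [rewrite mulr_ge0|apply: mulr_ile1].
apply: (le_trans (ler_normB _ _)); apply: (le_trans (lerD (ler_normD _ _) (lexx _))).
move: rX SP EB XB; rewrite /P.
move: (`|r * X|) (`|S * (s1 ^+ 2 + s2 ^+ 2)|) (`|E * ((A - r ^+ 2) * r * r * S)|) (`|X|) => a1 a2 a3 a4.
rewrite !mulrDr !mulrDl !mul1r !mulr1.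
lra.
Qed.

Lemma rho_EL_modulus v1 v2 : H1 Omega v1 -> H1 Omega v2 ->
  let el := fun x => el_dens (rho x) (a x) (eps ^+ 2)^-1 (r1 x) (r2 x) (v1 x) (v2 x)
     (weakD Omega e1 v1 x) (weakD Omega e2 v1 x) (weakD Omega e1 v2 x) (weakD Omega e2 v2 x) in
  intO el /\ IO el = 0.
Proof.
move=> h1 h2 el.
have Wv e v (ee : e = e1 \/ e = e2) (hv : H1 Omega v) := H1_wd oO ee hv.
have rn : {ae mu2, forall x, Omega x -> 0 <= rho x <= 1 /\ `|a x - rho x ^+ 2| <= 1}.
  apply: ae2S2 rb Ha => x rx ax Ox; have /andP[p1 p2] := rx Ox; have /andP[p3 p4] := ax Ox.
  have p5 : 0 <= rho x := le_trans (sqrtr_ge0 _) p1; have /andP[b0 b1] := Hb.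
  by split; [rewrite p5|rewrite ler_norml; apply/andP; split; nra].
have rb1 : {ae mu2, forall x, Omega x -> `|rho x| <= 1}.
  by apply: ae2S rn => x rx Ox; have [/andP[p1 p2] _] := rx Ox; rewrite ger0_norm.
have [[mrho _] _] := hrho.
have E0 : 0 <= (eps ^+ 2)^-1 by rewrite invr_ge0 sqr_ge0.
pose T (n : nat) (v : plane -> R) : plane -> R := fun x => trunc n%:R (v x).
pose T' (n : nat) (v : plane -> R) (e : plane) : plane -> R := fun x => trunc' n%:R (v x) * weakD Omega e v x.
have TB n v x : `|T n v x| <= n%:R + 1 by have [] := trunc_norm n (v x).
have hT n v : H1 Omega v -> H1 Omega (T n v).
  by move=> hv; have [C c] := c11_trunc (n%:R : R); exact: (H1_comp oO bO c hv).
have WT n v e : (e = e1 \/ e = e2) -> H1 Omega v -> wd e (T n v) (T' n v e) /\ L2 Omega (T' n v e).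
  move=> ee hv; have [W _] := Wv e v ee hv; have W' := trunc_wd oO bO n ee W.
  split => //; exact: (wd_L2 oO ee (hT n v hv) W').
have mT n v : H1 Omega v -> mfO (T n v) by move=> /(hT n v) [[]].
pose sq n v : plane -> R := fun x => T n v x * T n v x.
pose dsq n v e : plane -> R := fun x => T n v x * T' n v e x + T n v x * T' n v e x.
have sqP n v e : (e = e1 \/ e = e2) -> H1 Omega v -> [/\ wd e (sq n v) (dsq n v e), L2 Omega (sq n v) & L2 Omega (dsq n v e)].
  move=> ee hv; have [W L] := WT n v e ee hv; have LT : L2 Omega (T n v) by case: (hT n v hv).
  have l1 := L2_mulM oO (mT n v hv) (TB n v) L; have l0 := L2_mulM oO (mT n v hv) (TB n v) LT.
  split => //; last exact: (L2D oO l1 l1).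
  have j1 := L2_loc oO bO l1.
  exact: (wd_mul oO bO ee (L2_loc oO bO l0) j1 j1 W W).
(* The truncated |u|^2 - 1; in its gradient [ds] the summand 0 is the derivative of the constant -1,
   in the form produced by [wdD]. *)
pose s n : plane -> R := fun x => sq n v1 x + sq n v2 x + -1.
pose ds n e : plane -> R := fun x => dsq n v1 e x + dsq n v2 e x + 0.
have sB n x : `|s n x| <= (n%:R + 1) ^+ 2 + (n%:R + 1) ^+ 2 + 1.
  have q v : `|sq n v x| <= (n%:R + 1) ^+ 2 by rewrite /sq normrM expr2; apply: ler_pM.
  by rewrite /s (le_trans (ler_normD _ _))// normrN1 lerD2r (le_trans (ler_normD _ _))// lerD.
have sP n e : (e = e1 \/ e = e2) -> [/\ wd e (s n) (ds n e), L2 Omega (s n) & L2 Omega (ds n e)].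
  move=> ee; have [a1 a2 a3] := sqP n v1 e ee h1; have [b1 b2 b3] := sqP n v2 e ee h2.
  split.
  - exact: (wdD oO (wdD oO a1 b1) (wd_cst oO (-1) ee)).
  - exact: (L2D oO (L2D oO a2 b2) (L2_cst oO bO (-1))).
  - exact: (L2D oO (L2D oO a3 b3) (L2_cst oO bO 0)).
pose w n : plane -> R := fun x => rho x * s n x.
pose dw n e : plane -> R := fun x => rho x * ds n e x + s n x * weakD Omega e rho x.
have rhoL f : L2 Omega f -> L2 Omega (fun x => rho x * f x).
  move=> Lf; have [mf _] := Lf; apply: (@L2_le _ _ oO _ f 1) => //; first exact: measurable_funM.
  by apply: ae2S rb1 => x rx Ox; rewrite normrM ler_wpM2r// rx.
have wP n e : (e = e1 \/ e = e2) -> [/\ wd e (w n) (dw n e), L2 Omega (w n) & L2 Omega (dw n e)].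
  move=> ee; have [a1 a2 a3] := sP n e ee; have l1 := rhoL _ a2; have l2 := rhoL _ a3.
  have l3 := L2_mulM oO a2.1 (sB n) (Lr ee).
  split => //; last exact: (L2D oO l2 l3).
  exact: (wd_mul oO bO ee (L2_loc oO bO l1) (L2_loc oO bO l2) (L2_loc oO bO l3) (Wr ee) a1).
have key n : intO (fun x => r1 x * dw n e1 x + r2 x * dw n e2 x - (eps ^+ 2)^-1 * ((a x - rho x ^+ 2) * rho x * w n x)) /\
  IO (fun x => r1 x * dw n e1 x + r2 x * dw n e2 x - (eps ^+ 2)^-1 * ((a x - rho x ^+ 2) * rho x * w n x)) = 0.
  have [a1 a2 a3] := wP n e1 (or_introl erefl); have [b1 b2 b3] := wP n e2 (or_intror erefl).
  apply: (rho_EL oO bO sO Hb Heps Hameas Ha Hrho (M := (n%:R + 1) ^+ 2 + (n%:R + 1) ^+ 2 + 1) (H1_intro a2 a3 b3 a1 b1)) => //.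
  apply: ae2S rb1 => x rx Ox; rewrite /w normrM; apply: (@le_trans _ _ (1 * `|s n x|)); first by rewrite ler_wpM2r// rx.
  by rewrite mul1r.
have eln n x : r1 x * dw n e1 x + r2 x * dw n e2 x - (eps ^+ 2)^-1 * ((a x - rho x ^+ 2) * rho x * w n x) =
   el_dens (rho x) (a x) (eps ^+ 2)^-1 (r1 x) (r2 x) (T n v1 x) (T n v2 x) (T' n v1 e1 x) (T' n v1 e2 x) (T' n v2 e1 x) (T' n v2 e2 x).
  rewrite /dw /w /ds /s /sq /dsq /el_dens -/r1 -/r2.
  move: (T n v1 x) (T n v2 x) (T' n v1 e1 x) (T' n v1 e2 x) (T' n v2 e1 x) (T' n v2 e2 x) (r1 x) (r2 x) (rho x) (a x) ((eps ^+ 2)^-1).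
  by move=> x1 x2 x3 x4 x5 x6 x7 x8 x9 x10 x11; rewrite addr0 addr0.
have D11 := Wv _ _ (or_introl erefl) h1; have D12 := Wv _ _ (or_intror erefl) h1.
have D21 := Wv _ _ (or_introl erefl) h2; have D22 := Wv _ _ (or_intror erefl) h2.
have elfm (f1 f2 f3 f4 f5 f6 f7 f8 f9 f10 : plane -> R) : mfO f1 -> mfO f2 -> mfO f3 -> mfO f4 -> mfO f5 -> mfO f6 -> mfO f7 ->
   mfO f8 -> mfO f9 -> mfO f10 -> mfO (fun x => el_dens (f1 x) (f2 x) (eps ^+ 2)^-1 (f3 x) (f4 x) (f5 x) (f6 x) (f7 x) (f8 x) (f9 x) (f10 x)).
  move=> m1 m2 m3 m4 m5 m6 m7 m8 m9 m10; rewrite /el_dens.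
  have ms : mfO (fun x => f5 x * f5 x + f6 x * f6 x - 1).
    by apply: measurable_funB => //; apply: measurable_funD; exact: measurable_funM.
  apply: measurable_funB; first apply: measurable_funD.
  - apply: measurable_funM => //; apply: measurable_funD; last exact: measurable_funM.
    by apply: measurable_funM => //; apply: measurable_funD; apply: measurable_funD; exact: measurable_funM.
  - apply: measurable_funM => //; apply: measurable_funD; last exact: measurable_funM.
    by apply: measurable_funM => //; apply: measurable_funD; apply: measurable_funD; exact: measurable_funM.
  - apply: measurable_funM => //; apply: measurable_funM; last exact: measurable_funM.
    by apply: measurable_funM => //; apply: measurable_funB => //; exact: measurable_funX.
have mel : mfO el.
  have [[mv1 _] _] := h1; have [[mv2 _] _] := h2.
  exact: (elfm _ _ _ _ _ _ _ _ _ _ mrho Hameas (Lr (or_introl erefl)).1 (Lr (or_intror erefl)).1 mv1 mv2 D11.2.1 D12.2.1 D21.2.1 D22.2.1).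
have cc1 := rho_caccioppoli oO bO sO Hb Heps Hameas Ha Hrho h1; have cc2 := rho_caccioppoli oO bO sO Hb Heps Hameas Ha Hrho h2.
have gi := grad_int oO Hrho.
have i1 : intO (fun x => v1 x ^+ 2) by case: h1 => -[].
have i2 : intO (fun x => v2 x ^+ 2) by case: h2 => -[].
pose gs := grad_sqr Omega rho.
have iG : intO (fun x => (v1 x ^+ 2 * gs x + v2 x ^+ 2 * gs x + gs x) * 1 +
   (v1 x ^+ 2 * gs x + (weakD Omega e1 v1 x ^+ 2 + weakD Omega e2 v1 x ^+ 2)) +
   (v2 x ^+ 2 * gs x + (weakD Omega e1 v2 x ^+ 2 + weakD Omega e2 v2 x ^+ 2)) +
   (eps ^+ 2)^-1 * (v1 x ^+ 2 + v2 x ^+ 2 + 1)).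
  apply: (ioD oO); last exact: (ioZ oO _ (ioD oO (ioD oO i1 i2) (io_cst oO bO 1))).
  apply: (ioD oO); last exact: (ioD oO cc2 (ioD oO D21.2.2 D22.2.2)).
  apply: (ioD oO); last exact: (ioD oO cc1 (ioD oO D11.2.2 D12.2.2)).
  by have := ioD oO (ioD oO cc1 cc2) gi; apply: io_eq => x; rewrite mulr1.
have mfn n : mfO (fun x => r1 x * dw n e1 x + r2 x * dw n e2 x - (eps ^+ 2)^-1 * ((a x - rho x ^+ 2) * rho x * w n x)).
  by have [i _] := key n; exact: (intg_meas i).
have := @Rint_dct _ mplane R mu2 Omega mO _ el _ mfn mel _ iG.
move=> /(_ _ _)/wrap[].
- apply: aeW => x _; apply: cvg_near_cst; near=> n.
  have b1 : `|v1 x| <= n%:R by apply: ltW; near: n; exact: nbhs_infty_gtr.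
  have b2 : `|v2 x| <= n%:R by apply: ltW; near: n; exact: nbhs_infty_gtr.
  rewrite eln /el /T /T'; have [-> ->] := trunc_id b1; have [-> ->] := trunc_id b2.
  exact: el_dens1.
- apply: ae2S rn => x rx Ox n; have [p1 p2] := rx Ox; rewrite eln.
  have tn (v : plane -> R) e : `|T' n v e x| <= `|weakD Omega e v x|.
    by rewrite /T' normrM ler_piMl//; have [] := trunc_norm n (v x).
  have tn0 (v : plane -> R) : `|T n v x| <= `|v x| by have [] := trunc_norm n (v x).
  exact: el_dens_le.
move=> [iel cel]; split => //.
apply/esym; apply: (cvg_unique _ _ cel) => //; apply: cvg_near_cst; apply: nearW => n.
by have [_ ->] := key n.
Unshelve. all: by end_near. Qed.

End DivRho.

(** * The energy splitting *)

Section Assembly.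
Context {R : realType}.
Local Notation plane := (R * R)%type.
Local Notation mplane := (measurableTypeR R * measurableTypeR R)%type.
Local Notation mu2 := (@lebesgue2 R).
Implicit Types f g h w phi : plane -> R.
Variable Omega : set plane.
Hypothesis oO : open Omega.
Hypothesis bO : bounded_set Omega.
Hypothesis sO : smooth_boundary Omega.
Local Notation intO f := (mu2.-integrable (Omega : set mplane) (EFin \o f)).
Local Notation IO f := (\int[mu2]_(x in Omega) f x).
Local Notation mO := (mO oO).
Local Notation wd := (weak_derivative Omega).
Local Notation mfO := (measurable_fun (Omega : set mplane)).

Lemma ae2_and (P Q : plane -> Prop) : {ae mu2, forall x, P x} -> {ae mu2, forall x, Q x} ->
  {ae mu2, forall x, P x /\ Q x}.
Proof. by move=> p q; apply: ae2S2 p q => x p q. Qed.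

Lemma ae2_and3 (P Q S : plane -> Prop) : {ae mu2, forall x, P x} -> {ae mu2, forall x, Q x} -> {ae mu2, forall x, S x} ->
  {ae mu2, forall x, P x /\ (Q x /\ S x)}.
Proof. by move=> p q s; exact: ae2_and p (ae2_and q s). Qed.

Lemma subr_comb (c s1 s2 s3 s4 s5 s6 : R) : s1 - s2 = - s3 -> s4 - s5 = - s6 ->
  s1 + c * s4 - (s2 + c * s5) = - (s3 + c * s6).
Proof. by move=> h h'; rewrite opprD addrACA -mulrBr h h' mulrN -opprD. Qed.

(** [B''] is prescribed only almost everywhere, as [A] is by its defining relation. The curls are
    distributional because the summand [A0] is only in L^2. *)
Lemma weak_curl_comb (B B' B'' : plane -> plane) h h' (c : R) :
  L2 Omega (fun x => (B x).1) -> L2 Omega (fun x => (B x).2) -> L2 Omega h -> weak_curl Omega B h ->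
  L2 Omega (fun x => (B' x).1) -> L2 Omega (fun x => (B' x).2) -> L2 Omega h' -> weak_curl Omega B' h' ->
  mfO (fun x => (B'' x).1) -> mfO (fun x => (B'' x).2) ->
  {ae mu2, forall x, Omega x -> B'' x = B x + c *: B' x} ->
  [/\ L2 Omega (fun x => (B'' x).1), L2 Omega (fun x => (B'' x).2), L2 Omega (fun x => h x + c * h' x) &
  weak_curl Omega B'' (fun x => h x + c * h' x)].
Proof.
move=> L1 L2' Lh W L1' L2'' Lh' W' m1 m2 HB.
have M1 := L2D oO L1 (L2Z oO c L1'); have M2 := L2D oO L2' (L2Z oO c L2'').
have M3 := L2D oO Lh (L2Z oO c Lh').
have a1 : {ae mu2, forall x, Omega x -> (B'' x).1 = (B x).1 + c * (B' x).1} by apply: ae2S HB => x H Ox; rewrite H.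
have a2 : {ae mu2, forall x, Omega x -> (B'' x).2 = (B x).2 + c * (B' x).2} by apply: ae2S HB => x H Ox; rewrite H.
have L1norm := L2_ae oO m1 a1 M1; have N2 := L2_ae oO m2 a2 M2.
split => //; apply: (weak_curl_intro oO bO) => // phi tp.
have t0 := test_L2 oO bO tp; have t1 := test_L2 oO bO (test_D e1 tp); have t2 := test_L2 oO bO (test_D e2 tp).
have E := weak_curl_test oO bO L1 L2' W tp; have E' := weak_curl_test oO bO L1' L2'' W' tp.
have i1 := L2_int oO L1 t2; have i2 := L2_int oO L2' t1; have i3 := L2_int oO Lh t0.
have i1' := L2_int oO L1' t2; have i2' := L2_int oO L2'' t1; have i3' := L2_int oO Lh' t0.
have comb (f g k F : plane -> R) : mfO (fun x => F x * k x) -> intO (fun x => f x * k x) -> intO (fun x => g x * k x) ->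
    {ae mu2, forall x, Omega x -> F x = f x + c * g x} ->
    IO (fun x => F x * k x) = IO (fun x => f x * k x) + c * IO (fun x => g x * k x).
  move=> mF fk gk H; rewrite -(Iscale oO c gk) -(Iadd oO fk (ioZ oO c gk)).
  have [] // := I_ae oO (ioD oO fk (ioZ oO c gk)) mF.
  by apply: ae2S H => x H Ox; rewrite H// mulrDl mulrA.
rewrite (comb _ _ _ _ _ i2 i2' a2); last by apply: measurable_funM => //; case: t1.
rewrite (comb _ _ _ _ _ i1 i1' a1); last by apply: measurable_funM => //; case: t2.
rewrite (comb h h' phi (fun x => h x + c * h' x) _ i3 i3'); first last.
- exact: aeW.
- by apply: measurable_funM => //; [case: M3|case: t0].
exact: subr_comb.
Qed.

(** By the embedding into L^4; it serves for the products of the vector potential [bA] with the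
    components of bu and u. *)
Lemma L2_mul4 f g : H1 Omega f -> H1 Omega g -> L2 Omega (fun x => f x * g x).
Proof.
move=> hf hg; have i1 := H1_L4 oO bO sO hf; have i2 := H1_L4 oO bO sO hg.
have [[mf _] _] := hf; have [[mg _] _] := hg.
have m : mfO (fun x => f x * g x) by exact: measurable_funM.
split => //; apply: (io_le oO) (ioD oO i1 i2); first exact: measurable_funX.
apply: aeW => x _; rewrite ger0_norm ?sqr_ge0//.
have q (s t : R) : (s * t) ^+ 2 <= s ^+ 4 + t ^+ 4.
  have -> : s ^+ 4 = (s ^+ 2) ^+ 2 by rewrite -exprM.
  have -> : t ^+ 4 = (t ^+ 2) ^+ 2 by rewrite -exprM.
  have := sqr_ge0 (s ^+ 2); have := sqr_ge0 (t ^+ 2); have := sqr_ge0 (s ^+ 2 - t ^+ 2); rewrite exprMn; nra.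
exact: q.
Qed.

Lemma pot_le (A s t c : R) : `|A| <= 1 -> 0 <= c ->
  `|(A - (s ^+ 2 + t ^+ 2)) ^+ 2 * c| <= c * (2 + 4 * (s ^+ 4 + t ^+ 4)).
Proof.
rewrite ler_norml => /andP[A0 A1] c0; rewrite ger0_norm; last by rewrite mulr_ge0// sqr_ge0.
rewrite mulrC; apply: ler_wpM2l => //.
have -> : s ^+ 4 = (s ^+ 2) ^+ 2 by rewrite -exprM.
have -> : t ^+ 4 = (t ^+ 2) ^+ 2 by rewrite -exprM.
have := sqr_ge0 (A + (s ^+ 2 + t ^+ 2)); have := sqr_ge0 (s ^+ 2 - t ^+ 2); nra.
Qed.

Lemma pot_int2 (al : plane -> R) (eps : R) v w : mfO al -> {ae mu2, forall x, Omega x -> `|al x| <= 1} ->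
  H1 Omega v -> H1 Omega w -> intO (fun x => (al x - (v x ^+ 2 + w x ^+ 2)) ^+ 2 / (2 * eps ^+ 2)).
Proof.
move=> ma a1 hv hw; have i1 := H1_L4 oO bO sO hv; have i2 := H1_L4 oO bO sO hw.
have [[mv _] _] := hv; have [[mw _] _] := hw.
apply: (@io_le _ _ oO _ (fun x => (2 * eps ^+ 2)^-1 * (2 + 4 * (v x ^+ 4 + w x ^+ 4)))).
- apply: measurable_funM => //; apply: measurable_funX; apply: measurable_funB => //.
  by apply: measurable_funD; exact: measurable_funX.
- apply: ae2S a1 => x a1 Ox; apply: pot_le; first exact: a1.
  by rewrite invr_ge0 mulr_ge0// sqr_ge0.
- exact: (ioZ oO _ (ioD oO (io_cst oO bO 2) (ioZ oO 4 (ioD oO i1 i2)))).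
Qed.

Local Notation cRe u := (fun x => complex.Re (u x)).
Local Notation cIm u := (fun x => complex.Im (u x)).

(** Real and imaginary parts of a component of the covariant gradient: with real densities the
    pointwise identity becomes polynomial. *)
Definition cov_re (A : plane -> R) (u : plane -> R[i]) e x := weakD Omega e (cRe u) x + A x * complex.Im (u x).
Definition cov_im (A : plane -> R) (u : plane -> R[i]) e x := weakD Omega e (cIm u) x - A x * complex.Re (u x).

Definition cov_sqr (A : plane -> plane) u x :=
  cov_re (fun y => (A y).1) u e1 x ^+ 2 + cov_im (fun y => (A y).1) u e1 x ^+ 2 +
  (cov_re (fun y => (A y).2) u e2 x ^+ 2 + cov_im (fun y => (A y).2) u e2 x ^+ 2).

Definition pot (al : R) (eps : R) (z : R[i]) : R := (al - (complex.Re z ^+ 2 + complex.Im z ^+ 2)) ^+ 2 / (2 * eps ^+ 2).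

Lemma covE (g k t : R) (z : R[i]) :
  ((g +i* k) - 'i * t%:C * z = (g + t * complex.Im z) +i* (k - t * complex.Re z))%C.
Proof. by case: z => s r; apply/eqP; rewrite eq_complex /=; apply/andP; split; apply/eqP; ring. Qed.

Lemma cdotE (z w : R[i]) : cdot z w = complex.Re z * complex.Re w + complex.Im z * complex.Im w.
Proof.
case: z w => s t [s' t']; rewrite /cdot.
have -> : ((s +i* t) * (s' +i* t')^* + (s +i* t)^* * (s' +i* t') = ((s * s' + t * t') * 2)%:C)%C.
  by apply/eqP; rewrite eq_complex /=; apply/andP; split; apply/eqP; ring.
have -> : (((s * s' + t * t') * 2)%:C / 2%:R = (s * s' + t * t')%:C :> R[i])%C.
  by rewrite rmorphM rmorph_nat mulfK// pnatr_eq0.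
by [].
Qed.

Lemma currentE (g k t : R) (z : R[i]) : cdot ('i * z)%C ((g +i* k) - 'i * t%:C * z)%C =
  - complex.Im z * (g + t * complex.Im z) + complex.Re z * (k - t * complex.Re z).
Proof. by rewrite cdotE covE; case: z => s r /=; ring. Qed.

Lemma A0E rho xi x : A0 Omega rho xi x = (flux Omega rho xi e2 x, - flux Omega rho xi e1 x).
Proof.
rewrite /A0 /flux /wgrad /perp /=; move: (weakD _ _ _ _) (weakD _ _ _ _) (rho x ^+ 2) => s t V.
have -> : - (V^-1 *: ((- t, s) : plane)) = (- (V^-1 * - t), - (V^-1 * s)) by [].
by congr (_, _); ring.
Qed.

Lemma sqnorm_covgradE A (u : plane -> R[i]) x : sqnorm_covgrad Omega A u x = cov_sqr A u x.
Proof.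
have E (g k t : R) (z : R[i]) : (ComplexField.Normc.normc ((g +i* k) - 'i * t%:C * z) ^+ 2 = (g + t * complex.Im z) ^+ 2 + (k - t * complex.Re z) ^+ 2)%C.
  by rewrite covE normc2E.
by congr (_ + _); exact: E.
Qed.

Lemma cov_sqr_int A u : L2 Omega (cov_re (fun x => (A x).1) u e1) -> L2 Omega (cov_im (fun x => (A x).1) u e1) ->
  L2 Omega (cov_re (fun x => (A x).2) u e2) -> L2 Omega (cov_im (fun x => (A x).2) u e2) -> intO (cov_sqr A u).
Proof. by move=> [_ i1] [_ i2] [_ i3] [_ i4]; exact: (ioD oO (ioD oO i1 i2) (ioD oO i3 i4)). Qed.

Variables (b eps hex : R) (a rho xi : plane -> R).
Hypothesis Hb : 0 < b < 1.
Hypothesis Heps : 0 < eps.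
Hypothesis Hameas : mfO a.
Hypothesis Ha : {ae mu2, forall x, Omega x -> b <= a x <= 1}.
Hypothesis Hrho : positive_minimizer Omega eps a rho.
Hypothesis Hxi : xi_solution Omega rho xi.

Definition gl_dens A u x := cov_sqr A u x + pot (a x) eps (u x) + (curl Omega A x - hex) ^+ 2.
Definition f_dens A u x := rho x ^+ 2 * cov_sqr A u x + rho x ^+ 4 * pot 1 eps (u x) + curl Omega A x ^+ 2.
Definition vort_dens A u x :=
  (- complex.Im (u x) * cov_re (fun y => (A y).1) u e1 x + complex.Re (u x) * cov_im (fun y => (A y).1) u e1 x + (A x).1) * - weakD Omega e2 xi x +
  (- complex.Im (u x) * cov_re (fun y => (A y).2) u e2 x + complex.Re (u x) * cov_im (fun y => (A y).2) u e2 x + (A x).2) * weakD Omega e1 xi x.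
Definition r_dens (u : plane -> R[i]) x := (flux Omega rho xi e1 x * weakD Omega e1 xi x + flux Omega rho xi e2 x * weakD Omega e2 xi x) *
  (complex.Re (u x) ^+ 2 + complex.Im (u x) ^+ 2 - 1).

Lemma GL_dens u A : intO (gl_dens A u) -> GL Omega eps hex a u A = (2^-1 * IO (gl_dens A u))%:E.
Proof.
move=> i; rewrite /GL EFinM -(Rint_EFin mO i); congr (_ * _)%E.
apply: eq_integral => x _; apply: (congr1 EFin); congr (_ + _ + _).
- exact: sqnorm_covgradE.
- congr ((_ - _) ^+ 2 / _); exact: normc_sqr.
- exact: real_normK (num_real _).
Qed.

Lemma F_dens u A : intO (f_dens A u) -> F Omega eps rho u A = (2^-1 * IO (f_dens A u))%:E.
Proof.
move=> i; rewrite /F EFinM -(Rint_EFin mO i); congr (_ * _)%E.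
apply: eq_integral => x _; apply: (congr1 EFin); congr (_ * _ + _ * _ + _).
- exact: sqnorm_covgradE.
- congr ((_ - _) ^+ 2 / _); exact: normc_sqr.
- exact: real_normK (num_real _).
Qed.

Lemma vorticity_dens u A : intO (vort_dens A u) -> vorticity Omega u A xi = (- IO (vort_dens A u))%:E.
Proof.
move=> i; rewrite /vorticity EFinN -(Rint_EFin mO i); congr (- _)%E.
apply: eq_integral => x _; apply: (congr1 EFin); congr ((_ + _) * _ + (_ + _) * _).
- exact: currentE.
- exact: currentE.
Qed.

Lemma R0_dens u : intO (r_dens u) -> R0 Omega hex rho xi u = (hex ^+ 2 / 2 * IO (r_dens u))%:E.
Proof.
move=> i; rewrite /R0 (EFinM (hex ^+ 2 / 2)) -(Rint_EFin mO i); congr (_ * _)%E.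
apply: eq_integral => x _; apply: (congr1 EFin); congr (_ * _).
- rewrite /dot /flux /=; move: (weakD Omega e1 xi x) (weakD Omega e2 xi x) => s t; ring.
- congr (_ - _); exact: normc_sqr.
Qed.

(* Here r = rho, A = a, E = eps^-2, H = hex, s = grad rho, t = u, d_ij is the
   j-th derivative of t_i, p = grad xi, h = curl A and x = xi. *)
Lemma energy_density_split (r A E H s1 s2 t1 t2 d11 d12 d21 d22 a1 a2 q1 q2 p1 p2 h x : R) :
  p1 = r ^+ 2 * q1 -> p2 = r ^+ 2 * q2 ->
  let sq (v : R) := v ^+ 2 in
  (sq (r * d11 + t1 * s1 + (a1 + H * q2) * (r * t2)) + sq (r * d21 + t2 * s1 - (a1 + H * q2) * (r * t1)) +
   (sq (r * d12 + t1 * s2 + (a2 - H * q1) * (r * t2)) + sq (r * d22 + t2 * s2 - (a2 - H * q1) * (r * t1))) +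
   sq (A - (sq (r * t1) + sq (r * t2))) * (E / 2) + sq (h + H * (1 - x) - H)) -
  (sq (s1 + H * q2 * 0) + sq (0 - H * q2 * r) + (sq (s2 + (H * - q1) * 0) + sq (0 - (H * - q1) * r)) +
   sq (A - (sq r + sq 0)) * (E / 2) + sq (H * (1 - x) - H)) -
  (sq r * (sq (d11 + a1 * t2) + sq (d21 - a1 * t1) + (sq (d12 + a2 * t2) + sq (d22 - a2 * t1))) +
   r ^+ 4 * (sq (1 - (sq t1 + sq t2)) * (E / 2)) + sq h) -
  2 * H * ((- t2 * (d11 + a1 * t2) + t1 * (d21 - a1 * t1) + a1) * - p2 +
           (- t2 * (d12 + a2 * t2) + t1 * (d22 - a2 * t1) + a2) * p1) -
  sq H * ((q1 * p1 + q2 * p2) * (sq t1 + sq t2 - 1)) =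
  el_dens r A E s1 s2 t1 t2 d11 d12 d21 d22 - 2 * H * (h * x + (a2 * p1 - a1 * p2)).
Proof. by move=> -> -> sq; rewrite /sq /el_dens; field. Qed.

Lemma vort_dens_expand (c1 c2 c3 c4 s t a1 a2 p1 p2 : R) :
  c1 * (t * p2) - c2 * (s * p2) + (c4 * (s * p1) - c3 * (t * p1) + (a2 * p1 - a1 * p2)) =
  (- t * c1 + s * c2 + a1) * - p2 + (- t * c3 + s * c4 + a2) * p1.
Proof. ring. Qed.

Lemma r_dens_expand (q1 q2 p1 p2 s t : R) :
  q1 * s * (s * p1) + q2 * s * (s * p2) + (q1 * t * (t * p1) + q2 * t * (t * p2)) - (q1 * p1 + q2 * p2) =
  (q1 * p1 + q2 * p2) * (s ^+ 2 + t ^+ 2 - 1).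
Proof. ring. Qed.

Lemma flux_mul_le (p V f B : R) : 1 <= V <= B -> `|p * V * f| <= B * `|f * p|.
Proof.
move=> /andP[V1 VB]; have V0 : 0 <= V := le_trans ler01 V1.
have -> : p * V * f = V * (f * p) by ring.
by rewrite normrM ler_wpM2r// ger0_norm.
Qed.

Lemma energy_eq_of_sub (G G0 F V Q : R) : G - G0 - F - 2 * hex * V - hex ^+ 2 * Q = 0 ->
  2^-1 * G = 2^-1 * G0 + 2^-1 * F - hex * - V + hex ^+ 2 / 2 * Q.
Proof.
move=> H; have -> : G = (G - G0 - F - 2 * hex * V - hex ^+ 2 * Q) + (G0 + F + 2 * hex * V + hex ^+ 2 * Q) by ring.
by rewrite H; field.
Qed.

Lemma mul_sub_add (s c q f : R) : s * f = (s + c * q) * f + - c * (q * f).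
Proof. ring. Qed.

Lemma grad_xi_flux : {ae mu2, forall x, Omega x -> forall e, weakD Omega e xi x = rho x ^+ 2 * flux Omega rho xi e x}.
Proof.
have /andP[b0 b1] := Hb.
apply: ae2S (rho_bounds oO bO sO Hb Heps Hameas Ha Hrho) => x rx Ox e; have /andP[h1 h2] := rx Ox.
have r0 : rho x ^+ 2 != 0 by rewrite expf_neq0// gt_eqF//; apply: lt_le_trans h1; rewrite sqrtr_gt0.
by rewrite /flux mulrCA mulfV// mulr1.
Qed.

Lemma energy_split (bu u : plane -> R[i]) (bA A : plane -> plane) :
  H1C Omega bu -> H1V Omega bA -> mfO (cRe u) -> mfO (cIm u) ->
  mfO (fun x => (A x).1) -> mfO (fun x => (A x).2) ->
  {ae mu2, forall x, Omega x -> bu x = ((rho x)%:C * u x)%C} ->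
  {ae mu2, forall x, Omega x -> bA x = A x + hex *: A0 Omega rho xi x} ->
  GL Omega eps hex a bu bA =
  (GL Omega eps hex a (fun x => (rho x)%:C%C) (fun x => hex *: A0 Omega rho xi x)
   + F Omega eps rho u A
   - hex%:E * vorticity Omega u A xi
   + R0 Omega hex rho xi u)%E.
Proof.
move=> [hbR hbI] [hbA1 hbA2] mR mI mA1 mA2 Hu HA.
have rb := rho_bounds oO bO sO Hb Heps Hameas Ha Hrho.
have hrho := H1rho Hrho; have [[mrho _] _] := hrho.
have hxi := H1xi Hxi.
have al1 : {ae mu2, forall x, Omega x -> `|a x| <= 1}.
  have /andP[b0 b1] := Hb.
  by apply: ae2S Ha => x ax Ox; have /andP[a0 a1] := ax Ox; rewrite ger0_norm// (le_trans _ a0)// ltW.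
have rn : {ae mu2, forall x, Omega x -> `|rho x| <= 1}.
  by apply: ae2S rb => x rx Ox; have /andP[r0 r1] := rx Ox; rewrite ger0_norm// (le_trans _ r0)// sqrtr_ge0.
have rn2 : {ae mu2, forall x, Omega x -> `|rho x ^+ 2| <= 1}.
  by apply: ae2S rn => x rx Ox; rewrite normrX exprn_ile1 ?rx.
have rn4 : {ae mu2, forall x, Omega x -> `|rho x ^+ 4| <= 1}.
  by apply: ae2S rn => x rx Ox; rewrite normrX exprn_ile1 ?rx.
have E1 : {ae mu2, forall x, Omega x -> complex.Re (bu x) = rho x * complex.Re (u x)}.
  by apply: ae2S Hu => x H Ox; rewrite H//; case: (u x) => s t /=; rewrite mul0r subr0.
have E2 : {ae mu2, forall x, Omega x -> complex.Im (bu x) = rho x * complex.Im (u x)}.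
  by apply: ae2S Hu => x H Ox; rewrite H//; case: (u x) => s t /=; rewrite mul0r addr0.
have [huR DR] := div_rho_H1 oO bO sO Hb Heps Hameas Ha Hrho hbR mR E1.
have [huI DI] := div_rho_H1 oO bO sO Hb Heps Hameas Ha Hrho hbI mI E2.
pose q1 := flux Omega rho xi e1; pose q2 := flux Omega rho xi e2.
have Lq1 : L2 Omega q1 := flux_L2 oO Hb mrho rb Hxi (or_introl erefl).
have Lq2 : L2 Omega q2 := flux_L2 oO Hb mrho rb Hxi (or_intror erefl).
have LA01 : L2 Omega (fun x => (A0 Omega rho xi x).1).
  by have -> : (fun x => (A0 Omega rho xi x).1) = q2 by apply/funext => x; rewrite A0E.
have LA02 : L2 Omega (fun x => (A0 Omega rho xi x).2).
  have -> : (fun x => (A0 Omega rho xi x).2) = (fun x => (-1) * q1 x) by apply/funext => x; rewrite A0E mulN1r.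
  exact: (L2Z oO (-1) Lq1).
have wA0 : weak_curl Omega (A0 Omega rho xi) (fun x => 1 - xi x).
  apply: (weak_curl_intro oO bO LA01 LA02 (one_sub_xi_L2 oO bO Hxi)) => phi tp.
  have t1 := test_L2 oO bO (test_D e1 tp); have t2 := test_L2 oO bO (test_D e2 tp).
  rewrite -(flux_div oO bO Hb mrho rb Hxi tp) (Iadd oO (L2_int oO Lq1 t1) (L2_int oO Lq2 t2)) opprD; congr (_ - _).
  - transitivity (IO (fun x => (-1) * (q1 x * 'D_e1 phi x))); last by rewrite (Iscale oO _ (L2_int oO Lq1 t1)) mulN1r.
    by apply: eq_Rintegral => x _; rewrite A0E mulN1r mulNr.
  - by apply: eq_Rintegral => x _; rewrite A0E.
have LX := one_sub_xi_L2 oO bO Hxi.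
pose hA0 := (fun x => hex *: A0 Omega rho xi x) : plane -> plane.
(* hex A' is written A' + (hex - 1) A', where A' is [A0], so that [weak_curl_comb] also covers this
   multiple. *)
have [Lh1 Lh2 LhX whA0] := weak_curl_comb LA01 LA02 LX wA0 LA01 LA02 LX wA0 (B'' := hA0) (c := hex - 1)
  (measurable_funM (measurable_cst hex) LA01.1) (measurable_funM (measurable_cst hex) LA02.1)
  (ltac:(by apply: aeW => x _; rewrite /hA0 scalerBl scale1r addrC subrK)).
have [wB Lhb] := H1V_curl oO bO (conj hbA1 hbA2).
have LB1 : L2 Omega (fun x => (bA x).1) by case: hbA1.
have LB2 : L2 Omega (fun x => (bA x).2) by case: hbA2.
have [LA1 LA2 LhA wA] := weak_curl_comb LB1 LB2 Lhb wB LA01 LA02 LX wA0 (c := - hex) mA1 mA2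
  (ltac:(by apply: ae2S HA => x H Ox; rewrite H// scaleNr addrK)).
have cB := curl_ae oO wB; have cA := curl_ae oO wA; have cA0 := curl_ae oO whA0.
have LcB := curl_L2 oO wB Lhb; have LcA := curl_L2 oO wA LhA; have LcA0 := curl_L2 oO whA0 LhX.
set D21 := weakD Omega e1 _ in cB cA wB wA Lhb LhA; set D12 := weakD Omega e2 _ in cB cA wB wA Lhb LhA.
have LDe (f : plane -> R) e : (e = e1 \/ e = e2) -> H1 Omega f -> L2 Omega (weakD Omega e f).
  by move=> ee hf; have [] := H1_wd oO ee hf.
have ee1 : (e1 : plane) = e1 \/ (e1 : plane) = e2 by left.
have ee2 : (e2 : plane) = e1 \/ (e2 : plane) = e2 by right.
have LB (f g k : plane -> R) : L2 Omega f -> L2 Omega (fun x => g x * k x) -> L2 Omega (fun x => f x - g x * k x).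
  by move=> Lf Lgk; have := L2D oO Lf (L2Z oO (-1) Lgk); under eq_fun do rewrite mulN1r.
have L2sq (f : plane -> R) : L2 Omega f -> intO (fun x => f x ^+ 2) by case.
have up e f : (e = e1 \/ e = e2) -> H1 Omega f -> L2 Omega (fun x => f x * weakD Omega e xi x).
  move=> ee hf; have i := xi_caccioppoli oO bO Hb mrho rb Hxi hf; have [[mf _] _] := hf; have [mp _] := LDe _ _ ee hxi.
  have m : mfO (fun x => f x * weakD Omega e xi x) by exact: measurable_funM.
  split => //; apply: (io_le oO) i; first exact: measurable_funX.
  apply: aeW => x _; rewrite ger0_norm ?sqr_ge0// exprMn /xgrad_sqr.
  apply: ler_wpM2l; first exact: sqr_ge0.
  have sl (s t : R) : s ^+ 2 <= s ^+ 2 + t ^+ 2 by rewrite lerDl sqr_ge0.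
  have sr (s t : R) : t ^+ 2 <= s ^+ 2 + t ^+ 2 by rewrite lerDr sqr_ge0.
  by case: ee => ->; [exact: sl|exact: sr].
have ri := rho_inv Hb rb.
have uq e f : (e = e1 \/ e = e2) -> H1 Omega f -> L2 Omega (fun x => flux Omega rho xi e x * f x).
  move=> ee hf; have Lp := up e f ee hf; have [[mf _] _] := hf; have [mq _] := flux_L2 oO Hb mrho rb Hxi ee.
  apply: (@L2_le _ _ oO _ (fun x => f x * weakD Omega e xi x) b^-1) => //; first exact: measurable_funM.
  apply: ae2S ri => x ri Ox; exact: (flux_mul_le _ _ (ri Ox)).
(* [A] is bA - hex A' with A' = [A0]: the first part times f is in L^2 by the L^4 embedding, the
   second by the Caccioppoli inequality for xi. *)
have Au1 f : H1 Omega f -> L2 Omega (fun x => (A x).1 * f x).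
  move=> hf; have L := L2D oO (L2_mul4 hbA1 hf) (L2Z oO (- hex) (uq _ _ ee2 hf)); have [[mf _] _] := hf.
  apply: (L2_ae oO _ _ L); first exact: measurable_funM.
  apply: ae2S HA => x H Ox; rewrite H// A0E /= /GRing.scale /=.
  exact: mul_sub_add.
have Au2 f : H1 Omega f -> L2 Omega (fun x => (A x).2 * f x).
  move=> hf; have L := L2D oO (L2_mul4 hbA2 hf) (L2Z oO hex (uq _ _ ee1 hf)); have [[mf _] _] := hf.
  apply: (L2_ae oO _ _ L); first exact: measurable_funM.
  apply: ae2S HA => x H Ox; rewrite H// A0E /= /GRing.scale /=.
  rewrite mulrN -mulNr -{2}[hex]opprK; exact: mul_sub_add.
have Lrh (f : plane -> R) : L2 Omega f -> L2 Omega (fun x => f x * rho x).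
  move=> Lf; have [mf _] := Lf; apply: (@L2_le _ _ oO _ f 1) => //; first exact: measurable_funM.
  by apply: ae2S rn => x rx Ox; rewrite normrM mulrC ler_wpM2r// rx.
have L0 (f : plane -> R) : L2 Omega (fun x => f x * 0).
  have -> : (fun x => f x * 0) = (fun=> 0) by apply/funext => x; rewrite mulr0.
  exact: (L2_cst oO bO 0).
have iG : intO (gl_dens bA bu).
  have C := cov_sqr_int (L2D oO (LDe _ _ ee1 hbR) (L2_mul4 hbA1 hbI)) (LB _ _ _ (LDe _ _ ee1 hbI) (L2_mul4 hbA1 hbR))
    (L2D oO (LDe _ _ ee2 hbR) (L2_mul4 hbA2 hbI)) (LB _ _ _ (LDe _ _ ee2 hbI) (L2_mul4 hbA2 hbR)).
  exact: (ioD oO (ioD oO C (pot_int2 eps Hameas al1 hbR hbI)) (L2D oO LcB (L2_cst oO bO (- hex))).2).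
pose rC : plane -> R[i] := fun x => (rho x)%:C%C.
have hz := H1_cst oO bO 0.
have iG0 : intO (gl_dens hA0 rC).
  have C : intO (cov_sqr hA0 rC) := cov_sqr_int (A := hA0) (u := rC) (L2D oO (LDe _ _ ee1 hrho) (L0 _)) (LB _ _ _ (LDe _ _ ee1 hz) (Lrh _ Lh1))
    (L2D oO (LDe _ _ ee2 hrho) (L0 _)) (LB _ _ _ (LDe _ _ ee2 hz) (Lrh _ Lh2)).
  exact: (ioD oO (ioD oO C (pot_int2 eps Hameas al1 hrho hz)) (L2D oO LcA0 (L2_cst oO bO (- hex))).2).
have Lc1 := L2D oO (LDe _ _ ee1 huR) (Au1 _ huI); have Lc2 := LB _ _ _ (LDe _ _ ee1 huI) (Au1 _ huR).
have Lc3 := L2D oO (LDe _ _ ee2 huR) (Au2 _ huI); have Lc4 := LB _ _ _ (LDe _ _ ee2 huI) (Au2 _ huR).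
have iF : intO (f_dens A u).
  have C := cov_sqr_int (A := A) (u := u) Lc1 Lc2 Lc3 Lc4.
  have P : intO (fun x => pot 1 eps (u x)).
    apply: (pot_int2 (al := fun=> 1) eps _ _ huR huI); first exact: measurable_cst.
    by apply: aeW => x _; rewrite normr1.
  have B1 := io_bnd oO (measurable_funX 2 mrho) rn2 C; have B2 := io_bnd oO (measurable_funX 4 mrho) rn4 P.
  exact: (ioD oO (ioD oO B1 B2) LcA.2).
have Lp1 := LDe _ _ ee1 hxi; have Lp2 := LDe _ _ ee2 hxi.
(* u is grouped with grad xi rather than with the covariant derivative: u grad xi is in L^2 by the
   Caccioppoli inequality, so every term is a product of two L^2 functions. *)
have iV : intO (vort_dens A u).
  have i1 := ioB oO (L2_int oO Lc1 (up _ _ ee2 huI)) (L2_int oO Lc2 (up _ _ ee2 huR)).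
  have i2 := ioB oO (L2_int oO Lc4 (up _ _ ee1 huR)) (L2_int oO Lc3 (up _ _ ee1 huI)).
  have i3 := ioB oO (L2_int oO LA2 Lp1) (L2_int oO LA1 Lp2).
  have := ioD oO i1 (ioD oO i2 i3); apply: io_eq => x.
  rewrite /vort_dens /cov_re /cov_im; exact: vort_dens_expand.
have iR : intO (r_dens u).
  have i1 := ioD oO (L2_int oO (uq _ _ ee1 huR) (up _ _ ee1 huR)) (L2_int oO (uq _ _ ee2 huR) (up _ _ ee2 huR)).
  have i2 := ioD oO (L2_int oO (uq _ _ ee1 huI) (up _ _ ee1 huI)) (L2_int oO (uq _ _ ee2 huI) (up _ _ ee2 huI)).
  have i3 := ioD oO (L2_int oO Lq1 Lp1) (L2_int oO Lq2 Lp2).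
  have := ioB oO (ioD oO i1 i2) i3; apply: io_eq => x; exact: r_dens_expand.
have [iel Iel] := rho_EL_modulus oO bO sO Hb Heps Hameas Ha Hrho huR huI.
have [hxi0 _] := Hxi.
have Ix := curl_xi_parts oO bO LA1 LA2 LhA wA hxi0.
have Lxi : L2 Omega xi by case: hxi.
have j1 := L2_int oO LhA Lxi; have j2 := L2_int oO LA2 Lp1; have j3 := L2_int oO LA1 Lp2.
rewrite (GL_dens iG) (GL_dens iG0) (F_dens iF) (vorticity_dens iV) (R0_dens iR).
have iT := ioB oO iel (ioZ oO (2 * hex) (ioD oO j1 (ioB oO j2 j3))).
have iZ3 := ioB oO (ioB oO iG iG0) iF.
have iZ2 := ioB oO iZ3 (ioZ oO (2 * hex) iV).
have iZ := ioB oO iZ2 (ioZ oO (hex ^+ 2) iR).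
have Z0 : IO (gl_dens bA bu) - IO (gl_dens hA0 rC) - IO (f_dens A u) - 2 * hex * IO (vort_dens A u) - hex ^+ 2 * IO (r_dens u) = 0.
  rewrite -(Iscale oO (hex ^+ 2) iR) -(Iscale oO (2 * hex) iV) -(Isub oO iG iG0) -(Isub oO (ioB oO iG iG0) iF).
  rewrite -(Isub oO iZ3 (ioZ oO (2 * hex) iV)) -(Isub oO iZ2 (ioZ oO (hex ^+ 2) iR)).
  (* The combined integrand is replaced by an almost everywhere equal one, whose two parts integrate
     to zero by [rho_EL_modulus] and [curl_xi_parts]. *)
  have [|_ ->] := I_ae oO iT (intg_meas iZ); last first.
    rewrite (Isub oO iel (ioZ oO (2 * hex) (ioD oO j1 (ioB oO j2 j3)))) Iel (Iscale oO (2 * hex) (ioD oO j1 (ioB oO j2 j3))).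
    by rewrite (Iadd oO j1 (ioB oO j2 j3)) (Isub oO j2 j3) Ix subrr mulr0 subrr.
  have z0 e (ee : e = e1 \/ e = e2) := wd_uniq oO (H1_wd oO ee hz).1 (wd_cst oO 0 ee).
  have Q1 := ae2_and3 E1 E2 (ae2_and HA grad_xi_flux).
  have Q2 := ae2_and3 cA cB cA0.
  have Q3 := ae2_and (z0 _ ee1) (z0 _ ee2).
  have Q4 := ae2_and (DR _ ee1) (DR _ ee2).
  have Q5 := ae2_and (DI _ ee1) (DI _ ee2).
  have Q45 := ae2_and3 Q3 Q4 Q5.
  apply: ae2S3 Q1 Q2 Q45 => x [h0 [h1 [h2 h3]]] [k2 [k1 k3]] [[z1 z2] [[l1 l2] [m1 m2]]] Ox.
  have {}h0 := h0 Ox; have {}h1 := h1 Ox; have {}h2 := h2 Ox; have {}h3 := h3 Ox; have {}k1 := k1 Ox; have {}k2 := k2 Ox; have {}k3 := k3 Ox.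
  have {}z1 := z1 Ox; have {}z2 := z2 Ox; have {}l1 := l1 Ox; have {}l2 := l2 Ox; have {}m1 := m1 Ox; have {}m2 := m2 Ox.
  have eE : (2 * eps ^+ 2)^-1 = (eps ^+ 2)^-1 / 2 by rewrite invfM mulrC.
  have B1 : (bA x).1 = (A x).1 + hex * q2 x by rewrite h2 A0E.
  have B2 : (bA x).2 = (A x).2 - hex * q1 x by rewrite h2 A0E; congr (_ + _); exact: mulrN.
  set h := D21 x - D12 x + - hex * (1 - xi x) in k2 *.
  have kB : curl Omega bA x = h + hex * (1 - xi x) by rewrite k1 /h mulNr subrK.
  have k0 : curl Omega hA0 x = hex * (1 - xi x) by rewrite k3 mulrBl mul1r addrC subrK.
  (* The densities are brought literally into the shape of [energy_density_split], including the
     zeros that come from the imaginary part of rho. *)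
  have -> : gl_dens bA bu x = (rho x * weakD Omega e1 (cRe u) x + complex.Re (u x) * weakD Omega e1 rho x + ((A x).1 + hex * q2 x) * (rho x * complex.Im (u x))) ^+ 2 +
     (rho x * weakD Omega e1 (cIm u) x + complex.Im (u x) * weakD Omega e1 rho x - ((A x).1 + hex * q2 x) * (rho x * complex.Re (u x))) ^+ 2 +
     ((rho x * weakD Omega e2 (cRe u) x + complex.Re (u x) * weakD Omega e2 rho x + ((A x).2 - hex * q1 x) * (rho x * complex.Im (u x))) ^+ 2 +
     (rho x * weakD Omega e2 (cIm u) x + complex.Im (u x) * weakD Omega e2 rho x - ((A x).2 - hex * q1 x) * (rho x * complex.Re (u x))) ^+ 2) +
     (a x - ((rho x * complex.Re (u x)) ^+ 2 + (rho x * complex.Im (u x)) ^+ 2)) ^+ 2 * ((eps ^+ 2)^-1 / 2) + (h + hex * (1 - xi x) - hex) ^+ 2.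
    by rewrite /gl_dens /cov_sqr /cov_re /cov_im /pot kB B1 B2 h0 h1 l1 l2 m1 m2 eE.
  have -> : gl_dens hA0 rC x = (weakD Omega e1 rho x + hex * q2 x * 0) ^+ 2 + (0 - hex * q2 x * rho x) ^+ 2 +
     ((weakD Omega e2 rho x + (hex * - q1 x) * 0) ^+ 2 + (0 - (hex * - q1 x) * rho x) ^+ 2) +
     (a x - (rho x ^+ 2 + 0 ^+ 2)) ^+ 2 * ((eps ^+ 2)^-1 / 2) + (hex * (1 - xi x) - hex) ^+ 2.
    rewrite /gl_dens /cov_sqr /cov_re /cov_im /pot k0 eE.
    have -> : weakD Omega e1 (cIm rC) x = 0 := z1.
    have -> : weakD Omega e2 (cIm rC) x = 0 := z2.
    by rewrite /hA0 A0E.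
  have -> : f_dens A u x = rho x ^+ 2 * ((weakD Omega e1 (cRe u) x + (A x).1 * complex.Im (u x)) ^+ 2 + (weakD Omega e1 (cIm u) x - (A x).1 * complex.Re (u x)) ^+ 2 +
     ((weakD Omega e2 (cRe u) x + (A x).2 * complex.Im (u x)) ^+ 2 + (weakD Omega e2 (cIm u) x - (A x).2 * complex.Re (u x)) ^+ 2)) +
     rho x ^+ 4 * ((1 - (complex.Re (u x) ^+ 2 + complex.Im (u x) ^+ 2)) ^+ 2 * ((eps ^+ 2)^-1 / 2)) + h ^+ 2.
    by rewrite /f_dens /cov_sqr /cov_re /cov_im /pot k2 eE.
  have E := energy_density_split (a x) ((eps ^+ 2)^-1) hex (weakD Omega e1 rho x) (weakD Omega e2 rho x) (complex.Re (u x)) (complex.Im (u x))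
    (weakD Omega e1 (cRe u) x) (weakD Omega e2 (cRe u) x) (weakD Omega e1 (cIm u) x) (weakD Omega e2 (cIm u) x) (A x).1 (A x).2 h (xi x) (h3 e1) (h3 e2).
  exact/esym.
exact: (congr1 EFin (energy_eq_of_sub Z0)).
Qed.

End Assembly.

Unset Implicit Arguments.
Local Open Scope complex_scope.

Theorem proposition1p1 (R : realType) (Omega : set (R * R)%type)
  (b eps hex : R) (a rho xi : (R * R)%type -> R)
  (HOmega : smooth_bounded_simply_connected_domain Omega)
  (Hb : 0 < b < 1) (Heps : 0 < eps) (Hhex : 0 < hex)
  (Hameas : measurable_fun Omega a)
  (Ha : {ae lebesgue2, forall x, Omega x -> b <= a x <= 1})
  (Hrho : positive_minimizer Omega eps a rho)
  (Hxi : xi_solution Omega rho xi)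
  (bu u : (R * R)%type -> R[i]) (bA A : (R * R)%type -> (R * R)%type)
  (Hbu : H1C Omega bu) (HbA : H1V Omega bA)
  (Humeas : measurable_fun Omega (fun x => complex.Re (u x)) /\
            measurable_fun Omega (fun x => complex.Im (u x)))
  (HAmeas : measurable_fun Omega A)
  (Hu : {ae lebesgue2, forall x, Omega x -> bu x = (rho x)%:C * u x})
  (HA : {ae lebesgue2, forall x, Omega x ->
           bA x = A x + hex *: A0 Omega rho xi x}) :
  GL Omega eps hex a bu bA =
  (GL Omega eps hex a (fun x => (rho x)%:C)
                      (fun x => hex *: A0 Omega rho xi x)
   + F Omega eps rho u A
   - hex%:E * vorticity Omega u A xi
   + R0 Omega hex rho xi u)%E.
Proof.
case: HOmega => oO _ bO sO _; case: Humeas => mR mI.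
apply: (energy_split oO bO sO Hb Heps Hameas Ha Hrho Hxi Hbu HbA mR mI _ _ Hu HA).
- exact: (measurableT_comp measurable_fst HAmeas).
- exact: (measurableT_comp measurable_snd HAmeas).
Qed.
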